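(* Let $G=(V,E)$ be a simple undirected supply graph with edge capacities $c:E\rightarrow\mathbb{Z}_{\ge 0}$ and $H=(V,D)$ a simple undirected demand graph on the same vertex set, such that the graph $G+H=(V,E\cup D)$ is planar. Then there exist a feasible half-integral multicommodity flow of value $\Phi$ and a multicut of value $C$ such that $C\le 2\Phi$. Moreover, such a flow and multicut can be computed in polynomial time.
   Context: Each demand edge $\{s,t\}\in D$ defines a commodity with source $s$ and sink $t$. A multicommodity flow assigns to each demand edge $\{s,t\}\in D$ a collection of $s$–$t$ paths in $G$ with non-negative flow values; it is feasible if for every $e\in E$ the total flow on paths (over all commodities) using $e$ is at most $c_e$. Its value is the total flow over all paths of all commodities. It is half-integral if every path flow value is an integer multiple of $1/2$. A multicut is a set $M\subseteq E$ whose removal from $G$ disconnects the endpoints of every demand edge; its value is $\sum_{e\in M} c_e$. *)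

(* Defs.v *)
From Corelib Require Import BinNums.
From HB Require Import structures.
From mathcomp Require Import all_boot all_order all_algebra.
From mathcomp Require Import all_classical all_reals all_analysis.

Set Implicit Arguments.
Unset Strict Implicit.
Unset Printing Implicit Defensive.

Import Order.TTheory GRing.Theory Num.Theory.
Import numFieldNormedType.Exports.

Local Open Scope ring_scope.

(** A graph on the vertex set [V] is given by its edge set; the edge joining
    [x] and [y] is the unordered pair [[set x; y]]. *)

Definition simple_graph (V : finType) (E : {set {set V}}) : Prop :=
  forall e, e \in E -> #|e| = 2%N.

Definition adj (V : finType) (E : {set {set V}}) : rel V :=
  fun x y => [set x; y] \in E.

(** A drawing in the plane: vertices are distinct points, edges are Jordan arcs
    (injective continuous images of [0, 1]) joining the points of their two
    ends; arcs meet neither other arcs nor vertices, except at their ends. *)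
Definition planar (R : realType) (V : finType) (E : {set {set V}}) : Prop :=
  exists (pt : V -> R * R) (arc : {set V} -> R -> R * R),
    [/\ injective pt,
        forall e, e \in E ->
          {within `[0, 1], continuous (arc e)}%classic /\
          {in `[0, 1] &, injective (arc e)},
        forall e, e \in E ->
          [set arc e 0; arc e 1]%classic = (pt @` [set` e])%classic,
        forall e v t, e \in E -> t \in `]0, 1[ -> arc e t <> pt v
      & forall e e' t t', e \in E -> e' \in E -> e <> e' ->
          t \in `]0, 1[ -> t' \in `]0, 1[ -> arc e t <> arc e' t'].

(** A path is the sequence of its vertices, which are pairwise distinct. *)
Definition path_for (V : finType) (E : {set {set V}}) (d : {set V})
    (p : seq V) : bool :=
  if p is x :: p' then
    [&& path (adj E) x p', uniq p & d == [set x; last x p']]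
  else false.

Definition path_edges (V : finType) (p : seq V) : seq {set V} :=
  [seq [set u.1; u.2] | u <- zip p (behead p)].

(** [F d] lists the flow-carrying paths of the commodity [d], with their flow
    values; its value is irrelevant when [d] is not a demand edge. *)
Definition multiflow (V : finType) : Type := {set V} -> seq (seq V * rat).

Section FlowCut.
Variables (V : finType) (E D : {set {set V}}) (c : {set V} -> nat).

Definition flow_through (F : multiflow V) (e : {set V}) : rat :=
  \sum_(d in D) \sum_(pq <- F d | e \in path_edges pq.1) pq.2.

Definition flow_value (F : multiflow V) : rat :=
  \sum_(d in D) \sum_(pq <- F d) pq.2.

Definition is_multiflow (F : multiflow V) : Prop :=
  forall d, d \in D ->
    forall pq, pq \in F d -> path_for E d pq.1 /\ 0 <= pq.2.

Definition feasible (F : multiflow V) : Prop :=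
  is_multiflow F /\ forall e, e \in E -> flow_through F e <= (c e)%:R.

Definition half_integral (F : multiflow V) : Prop :=
  forall d, d \in D ->
    forall pq, pq \in F d -> exists k : int, pq.2 = k%:~R / 2%:R.

Definition is_multicut (M : {set {set V}}) : Prop :=
  M \subset E /\
  forall s t, [set s; t] \in D -> ~~ connect (adj (E :\: M)) s t.

Definition cut_value (M : {set {set V}}) : nat := (\sum_(e in M) c e)%N.

Definition flow_cut_pair (F : multiflow V) (M : {set {set V}}) : Prop :=
  [/\ feasible F, half_integral F, is_multicut M
    & (cut_value M)%:R <= 2%:R * flow_value F].

End FlowCut.

(** The machine model is the WHILE language over binary trees (N. D. Jones,
    Computability and Complexity from a Programming Perspective).  Evaluating an
    expression is charged for the full size of every tree it reads, and no
    result is larger than the charge, so that running time is polynomially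
    related to that of a Turing machine. *)

Local Open Scope nat_scope.

Inductive tree : Type := Leaf | Node of tree & tree.

Fixpoint tree_size (u : tree) : nat :=
  if u is Node u1 u2 then (tree_size u1 + tree_size u2).+1 else 1%N.

Inductive expr : Type :=
| EVar of nat
| ENil
| ECons of expr & expr
| EHd of expr
| ETl of expr.

Inductive cmd : Type :=
| Skip
| Assign of nat & expr
| Seq of cmd & cmd
| If of expr & cmd & cmd
| While of expr & cmd.

Definition store : Type := nat -> tree.

Definition upd (s : store) (x : nat) (u : tree) : store :=
  fun y => if y == x then u else s y.

Fixpoint eval_expr (s : store) (e : expr) : tree :=
  match e with
  | EVar x => s x
  | ENil => Leaf
  | ECons e1 e2 => Node (eval_expr s e1) (eval_expr s e2)
  | EHd e1 => if eval_expr s e1 is Node u _ then u else Leaf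
  | ETl e1 => if eval_expr s e1 is Node _ u then u else Leaf
  end.

Fixpoint cost (s : store) (e : expr) : nat :=
  match e with
  | EVar x => tree_size (s x)
  | ENil => 1
  | ECons e1 e2 => (cost s e1 + cost s e2).+1
  | EHd e1 | ETl e1 => (cost s e1).+1
  end.

(** In tests, [Leaf] is false and every other tree is true. *)
Definition truth (u : tree) : bool := if u is Leaf then false else true.

(** [exec p s s' t]: run from [s], the program [p] halts in [s'] in time [t]. *)
Inductive exec : cmd -> store -> store -> nat -> Prop :=
| ExecSkip s : exec Skip s s 1
| ExecAssign x e s : exec (Assign x e) s (upd s x (eval_expr s e)) (cost s e).+1
| ExecSeq p1 p2 s s1 s2 t1 t2 :
    exec p1 s s1 t1 -> exec p2 s1 s2 t2 -> exec (Seq p1 p2) s s2 (t1 + t2).+1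
| ExecIf e p1 p2 s s' t :
    exec (if truth (eval_expr s e) then p1 else p2) s s' t ->
    exec (If e p1 p2) s s' (cost s e + t).+1
| ExecWhileStop e p s :
    ~~ truth (eval_expr s e) -> exec (While e p) s s (cost s e).+1
| ExecWhileLoop e p s s1 s2 t1 t2 :
    truth (eval_expr s e) -> exec p s s1 t1 -> exec (While e p) s1 s2 t2 ->
    exec (While e p) s s2 (cost s e + t1 + t2).+1.

(** Input and output are both held in the variable 0. *)
Definition init (u : tree) : store := upd (fun=> Leaf) 0 u.

(** A single program, given any admissible input [x], outputs within polynomial
    time in the size of the encoding of [x] some [y] correct for [x]. *)
Definition poly_time_search (X : Type) (Y : X -> Type) (encX : X -> tree)
    (encY : forall x, Y x -> tree) (dom : X -> Prop)
    (correct : forall x, Y x -> Prop) : Prop :=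
  exists (p : cmd) (a k : nat),
    forall x, dom x ->
    exists (y : Y x) (s : store) (t : nat),
      [/\ exec p (init (encX x)) s t,
          s 0%N = encY x y,
          correct x y
        & (t <= a * tree_size (encX x) ^ k)%N].

(** Numbers are encoded in binary (least significant bit first), graphs by
    adjacency matrices *)

Definition enc_bool (b : bool) : tree := if b then Node Leaf Leaf else Leaf.

Fixpoint enc_pos (p : positive) : tree :=
  match p with
  | xH => Node (enc_bool true) Leaf
  | xO p' => Node (enc_bool false) (enc_pos p')
  | xI p' => Node (enc_bool true) (enc_pos p')
  end.

Definition enc_nat (n : nat) : tree :=
  if bin_of_nat n is Npos p then enc_pos p else Leaf.

Definition enc_int (z : int) : tree := Node (enc_bool (z < 0)%R) (enc_nat (absz z)).

Definition enc_rat (q : rat) : tree :=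
  Node (enc_int (numq q)) (enc_int (denq q)).

Definition enc_seq (T : Type) (enc : T -> tree) (s : seq T) : tree :=
  foldr (fun x u => Node (enc x) u) Leaf s.

Definition enc_matrix (n : nat) (entry : 'I_n -> 'I_n -> tree) : tree :=
  enc_seq (fun i => enc_seq (entry i) (enum 'I_n)) (enum 'I_n).

Record instance : Type := Instance {
  num_vertices : nat;
  supply : {set {set 'I_num_vertices}};
  demand : {set {set 'I_num_vertices}};
  capacity : {set 'I_num_vertices} -> nat }.

Arguments capacity : clear implicits.

(** Entry (i, j): the capacity of the supply edge ij, or [Leaf] if there is no
    such edge, together with a bit telling whether ij is a demand edge. *)
Definition enc_instance (I : instance) : tree :=
  enc_matrix (fun i j : 'I_(num_vertices I) =>
    Node (if [set i; j] \in supply I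
          then Node Leaf (enc_nat (capacity I [set i; j])) else Leaf)
         (enc_bool ([set i; j] \in demand I))).

Definition enc_multiflow (n : nat) (F : multiflow 'I_n) : tree :=
  enc_matrix (fun i j : 'I_n =>
    enc_seq (fun pq : seq 'I_n * rat =>
        Node (enc_seq (fun v : 'I_n => enc_nat v) pq.1) (enc_rat pq.2))
      (F [set i; j])).

Definition enc_edge_set (n : nat) (M : {set {set 'I_n}}) : tree :=
  enc_matrix (fun i j : 'I_n => enc_bool ([set i; j] \in M)).

Definition candidate (I : instance) : Type :=
  (multiflow 'I_(num_vertices I) * {set {set 'I_(num_vertices I)}})%type.

Definition enc_solution (I : instance) (y : candidate I) : tree :=
  Node (enc_multiflow y.1) (enc_edge_set y.2).

(* Main.v *)
(* Subdivide every edge of G + H. A drawing assigns to each half-edge its winding number mod 2 around the other nodes, and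
   these numbers satisfy van Kampen's crossing relations. They force a 2-colouring of the back edges of a depth-first search
   tree into left and right ones, hence a word in which every tree edge and back edge occurs twice and back edges do not
   cross. The gaps of this word, glued along the back edges, are the faces: the edge sets that meet every vertex cut evenly
   are exactly the boundaries of sets of faces. A supply edge of capacity c becomes a link of cost 2c between two faces, and a
   demand edge separates its two sides by a further dual edge. A set of faces cutting a single demand is then a path of that
   commodity, and a multicut is a set of links cutting all these sets. Growing the minimal uncovered sets at equal speed,
   followed by reverse deletion, costs at most twice the dual solution; keeping the slacks of one parity makes the dual
   integral, and halving it gives a half-integral flow. *)

(** Planarity is used once, in [Topo.planar_van_kampen]; all that follows is finite and mod 2, and
    does not go through the Jordan curve theorem. The bridge is the left-right planarity criterion:
    winding numbers show that its constraints are solvable, and the algorithm, which never sees the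
    drawing, solves the same constraints itself. Costs are doubled because a link growing from both
    ends loses slack at rate two, so that the next event comes at an integral time only if the slack
    is even. Slacks start even, each link end carries a parity bit, and an end that becomes active
    out of phase with the global clock forfeits one unit. These forfeited units endanger the factor
    two; the potentials in [Wpot.budget] pay for them. That inequality is carried backwards in time,
    since reverse deletion decides in this order which links survive, and the survivors then form a
    tree that gains one link at a time. Running times are bounded for every matrix, planar or not;
    hence no size bound may rest on the correctness of the algorithm. *)

Set Implicit Arguments.
Unset Strict Implicit.
Unset Printing Implicit Defensive.

(** * Reflection for linear equations mod 2 *)

Module Xor.
From mathcomp Require Import all_boot.

Inductive xexpr := XVar of nat | XAdd of xexpr & xexpr | XNot of xexpr | XCst of bool.

Fixpoint xeval (env : seq bool) (e : xexpr) : bool :=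
  match e with
  | XVar i => nth false env i
  | XAdd e1 e2 => xeval env e1 (+) xeval env e2
  | XNot e1 => ~~ xeval env e1
  | XCst b => b
  end.

Fixpoint xcoef (e : xexpr) (i : nat) : bool :=
  match e with
  | XVar j => i == j
  | XAdd e1 e2 => xcoef e1 i (+) xcoef e2 i
  | XNot e1 => xcoef e1 i
  | XCst b => false
  end.

Fixpoint xcst (e : xexpr) : bool :=
  match e with
  | XVar _ => false
  | XAdd e1 e2 => xcst e1 (+) xcst e2
  | XNot e1 => ~~ xcst e1
  | XCst b => b
  end.

Lemma xevalE env e : xeval env e =
  xcst e (+) \big[addb/false]_(i < size env) (xcoef e i && nth false env i).
Proof.
elim: e => /= [j|e1 -> e2 ->|e1 ->|b].
- case: (ltnP j (size env)) => js.
    rewrite (bigD1 (Ordinal js)) //= eqxx /= big1 ?addbF // => i /eqP ij.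
    by case: eqP => // e; case: ij; apply: val_inj.
  rewrite nth_default // big1 // => i _; case: eqP => // e.
  by move: (ltn_ord i); rewrite e ltnNge js.
- rewrite addbACA -big_split; congr addb; apply: eq_bigr => i _ /=.
  by rewrite andb_addl.
- by rewrite addNb.
- by rewrite big1 ?addbF.
Qed.

(** An affine form over GF(2) whose constant and coefficients all vanish is zero under every
    valuation. Both hypotheses are decided by computation on the syntax, with the atoms left
    opaque. *)
Lemma xor_reflect env e : xcst e = false -> all (fun i => ~~ xcoef e i) (iota 0 (size env)) ->
  xeval env e = false.
Proof.
move=> e0 /allP e1; rewrite xevalE e0 big1 // => i _.
by have := e1 i; rewrite mem_iota leq0n ltn_ord => /(_ isT) /negbTE ->.
Qed.

Lemma addb_eqF (a b : bool) : (a (+) b = false) -> a = b.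
Proof. by case: a; case: b. Qed.

Ltac xor_same x y := first [constr_eq x y | unify x y].
(** The inner [match goal with] runs the test while a term is being computed; when [xor_same] fails,
    the outer one moves on to the next atom. *)
Ltac xor_mem x l :=
  lazymatch l with
  | nil => constr:(false)
  | cons ?y ?l' =>
    match goal with
    | _ => let _ := match goal with _ => xor_same x y end in constr:(true)
    | _ => xor_mem x l'
    end
  end.
Ltac xor_env l e :=
  lazymatch e with
  | addb ?a ?b => let l1 := xor_env l a in xor_env l1 b
  | negb ?a => xor_env l a
  | true => l
  | false => l
  | _ => let b := xor_mem e l in
         lazymatch b with true => l | false => constr:(cons e l) end
  end.
Ltac xor_idx x l :=
  lazymatch l with
  | cons ?y ?l' =>
    match goal with
    | _ => let _ := match goal with _ => xor_same x y end in constr:(0)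
    | _ => let i := xor_idx x l' in constr:(S i)
    end
  end.
Ltac xor_quote l e :=
  lazymatch e with
  | addb ?a ?b => let a1 := xor_quote l a in let b1 := xor_quote l b in constr:(XAdd a1 b1)
  | negb ?a => let a1 := xor_quote l a in constr:(XNot a1)
  | true => constr:(XCst true)
  | false => constr:(XCst false)
  | _ => let i := xor_idx e l in constr:(XVar i)
  end.

Ltac xor_close :=
  lazymatch goal with
  | |- ?e = false =>
    let l := xor_env (@nil bool) e in
    let q := xor_quote l e in
    exact (@xor_reflect l q (erefl _) (erefl _))
  end.

Lemma addb_hyp (a b c : bool) : a = b -> c (+) (a (+) b) = false -> c = false.
Proof. by move=> ->; rewrite addbb addbF. Qed.

Ltac xor_hyps :=
  lazymatch goal with
  | |- @eq bool _ _ -> @eq bool _ _ -> _ => let H := fresh in move=> H; xor_hyps; apply: (addb_hyp H)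
  | |- @eq bool _ _ -> _ => let H := fresh in move=> H; apply: addb_eqF; apply: (addb_hyp H)
  | |- _ => apply: addb_eqF
  end.

(* Proves an equation between sums mod 2 from the sum of the equations in front of it. *)
Ltac xor := xor_hyps; xor_close.
End Xor.

(** * The van Kampen relations along paths and cycles *)

Module Kampen.
From mathcomp Require Import all_boot.
Import Xor.

Section VanKampen.
Variable P : eqType.
Variables (dom : pred P) (adj : rel P) (lt : rel P) (n : P -> P -> P -> bool).

(* The mod 2 van Kampen condition: [n c a b] says how [ab] winds around [c], and
   the right-hand side counts crossings of the chords [ab], [cd] of a convex curve
   through the points in the order [lt]. *)
Definition van_kampen : Prop :=
  [/\ forall x y, dom x -> dom y -> x <> y -> lt x y = ~~ lt y x,
      forall c a b, n c a b = n c b a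
    & forall a b c d, adj a b -> adj c d -> a <> c -> a <> d -> b <> c -> b <> d ->
      n c a b (+) n d a b (+) n a c d (+) n b c d =
      lt a c (+) lt a d (+) lt b c (+) lt b d].

Fixpoint wind (c : P) (p : seq P) : bool :=
  if p is a :: q then if q is b :: _ then n c a b (+) wind c q else false else false.

Lemma wind_cons2 c a b p : wind c [:: a, b & p] = n c a b (+) wind c (b :: p).
Proof. by []. Qed.

Lemma wind1 c a : wind c [:: a] = false.
Proof. by []. Qed.

Arguments wind : simpl never.

Lemma wind_cat c a p q :
  wind c ((a :: p) ++ q) = wind c (a :: p) (+) wind c (last a p :: q).
Proof.
elim: p a => [|b p IH] a //; rewrite [_ ++ _]/= !wind_cons2.
by rewrite -cat_cons IH addbA.
Qed.

Hypothesis vk : van_kampen.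

Lemma wind_rcons c a p b : wind c (rcons (a :: p) b) = wind c (a :: p) (+) n c (last a p) b.
Proof. by rewrite -cats1 wind_cat wind_cons2 wind1 addbF. Qed.

Lemma wind_rev c p : wind c (rev p) = wind c p.
Proof.
case: vk => _ sym _; elim: p => // a [//|b p] IH.
rewrite rev_cons wind_cons2 -IH; case: (lastP p) IH => [|q z] IH.
  by rewrite /= !wind_cons2 !wind1 sym.
rewrite -rcons_cons rev_rcons rcons_cons wind_rcons.
by rewrite rev_cons last_rcons addbC sym.
Qed.

Definition apart (p q : seq P) := ~~ has (mem q) p.

Lemma apartC p q : apart p q = apart q p.
Proof. by rewrite /apart has_sym. Qed.

Lemma apart_cons a p q : apart (a :: p) q = (a \notin q) && apart p q.
Proof. by rewrite /apart /= negb_or. Qed.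

(** Sum of the relations over all pairs of steps of the two paths: an inner point contributes its
    winding number and its comparisons twice, so that only the ends survive. [edge] treats a single
    step of the first path. *)
Lemma wind_paths a p c q : path adj a p -> path adj c q -> apart (a :: p) (c :: q) ->
  wind c (a :: p) (+) wind (last c q) (a :: p) (+) wind a (c :: q) (+) wind (last a p) (c :: q) =
  lt a c (+) lt a (last c q) (+) lt (last a p) c (+) lt (last a p) (last c q).
Proof.
case: vk => _ _ vkE.
have edge a' b' c' q' : adj a' b' -> path adj c' q' -> a' \notin c' :: q' -> b' \notin c' :: q' ->
  n c' a' b' (+) n (last c' q') a' b' (+) wind a' (c' :: q') (+) wind b' (c' :: q') =
  lt a' c' (+) lt a' (last c' q') (+) lt b' c' (+) lt b' (last c' q').
  move=> ab; elim: q' c' => [|d q' IH] c'; first by move=> *; rewrite !wind1 /=; xor.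
  rewrite !wind_cons2 /= => /andP[cd dq]; rewrite !inE !negb_or => /and3P[ac ad aq] /and3P[bc bd bq].
  have := IH d dq; rewrite !inE !negb_or => /(_ (introT andP (conj ad aq)) (introT andP (conj bd bq))).
  have := vkE _ _ _ _ ab cd; move=> /(_ (elimN eqP ac) (elimN eqP ad) (elimN eqP bc) (elimN eqP bd)).
  by xor.
move=> + cq; elim: p a => [|b p IH] a; first by move=> _ _; rewrite !wind1 /=; xor.
move=> /andP[ab bp]; rewrite apart_cons => /andP[ac bpc].
have bc : b \notin c :: q by move: bpc; rewrite apart_cons => /andP[].
have := IH b bp bpc.
have := edge _ _ _ _ ab cq ac bc; rewrite !wind_cons2 [last a _]/=.
by xor.
Qed.

Section Chords.
(** The cycle consists of [p12], [p23], [p34], [p14]. Each chord is cut at a marked point, [t]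
    between [v1] and [v3], [w] between [v2] and [v4], because a whole chord touches all four sides
    while each half of it avoids two of them. *)
Variables (v1 v2 v3 v4 : P) (p12 p23 p34 p14 p24 s13 r13 s24 r24 : seq P).
Let t := last v1 s13.
Let w := last v2 s24.
Hypotheses (e12 : path adj v1 p12 /\ last v1 p12 = v2)
  (e23 : path adj v2 p23 /\ last v2 p23 = v3)
  (e34 : path adj v3 p34 /\ last v3 p34 = v4)
  (e14 : path adj v1 p14 /\ last v1 p14 = v4)
  (e13 : path adj v1 (s13 ++ r13) /\ last t r13 = v3)
  (e24 : path adj v2 (s24 ++ r24) /\ last w r24 = v4).
Hypotheses (d1 : apart (v1 :: p12) (v3 :: p34)) (d2 : apart (v1 :: p14) (v2 :: p23))
  (d3 : apart (v1 :: s13 ++ r13) (v2 :: s24 ++ r24))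
  (d4 : apart (v1 :: s13) (v2 :: p23)) (d5 : apart (v1 :: s13) (v3 :: p34))
  (d6 : apart (t :: r13) (v1 :: p12)) (d7 : apart (t :: r13) (v1 :: p14))
  (d8 : apart (v2 :: s24) (v3 :: p34)) (d9 : apart (v2 :: s24) (v1 :: p14))
  (d10 : apart (w :: r24) (v1 :: p12)) (d11 : apart (w :: r24) (v2 :: p23)).
Hypotheses (dom2 : dom v2) (dom3 : dom v3) (dom4 : dom v4).

(* Two overlapping chords of the cycle v1 v2 v3 v4 lie on different sides of it. *)
Lemma overlapping_chords :
  wind t (v1 :: p12) (+) wind t (v2 :: p23) (+) wind t (v3 :: p34) (+) wind t (v1 :: p14)
  (+) (wind w (v1 :: p12) (+) wind w (v2 :: p23) (+) wind w (v3 :: p34) (+) wind w (v1 :: p14)) = true.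
Proof.
have [tot _ _] := vk.
have ml x y q r : apart (x :: q) (y :: r) -> last x q \notin y :: r.
  by move=> /hasPn; apply; exact: mem_last.
have sub1 (x : P) q q' y r : apart (x :: q ++ q') (y :: r) -> apart (x :: q) (y :: r).
  by rewrite /apart -cat_cons has_cat negb_or => /andP[].
have sub2 (x : P) q q' y r : apart (x :: q ++ q') (y :: r) -> apart (last x q :: q') (y :: r).
  rewrite /apart -cat_cons has_cat negb_or => /andP[h1 h2] /=; rewrite negb_or h2 andbT.
  exact: ml h1.
have [] := (e12, e13); have [] := (e23, e24); have [] := (e34, e14).
move=> [a34 l34] [a14 l14] [a23 l23] [] + l24 [a12 l12] [] + l13.
rewrite !cat_path -/t -/w => /andP[as24 ar24] /andP[as13 ar13].
have d3' : apart (v2 :: s24 ++ r24) (v1 :: s13 ++ r13) by rewrite apartC.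
have x1 : apart (v1 :: s13) (v2 :: s24 ++ r24) := sub1 _ _ _ _ _ d3.
have x2 : apart (t :: r13) (v2 :: s24 ++ r24) := sub2 _ _ _ _ _ d3.
have x3 : apart (v2 :: s24) (v1 :: s13 ++ r13) := sub1 _ _ _ _ _ d3'.
have x4 : apart (w :: r24) (v1 :: s13 ++ r13) := sub2 _ _ _ _ _ d3'.
have a24 : path adj v2 (s24 ++ r24) by rewrite cat_path as24.
have a13 : path adj v1 (s13 ++ r13) by rewrite cat_path as13.
(* Each half chord against the two sides that it avoids and against the other chord, then the two
   pairs of opposite sides and the two chords: fifteen relations without constant term. The [true]
   on the right comes from the three negations that antisymmetry of the order contributes below. *)
have := wind_paths as13 a23 d4; have := wind_paths as13 a34 d5; have := wind_paths as13 a24 x1.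
have := wind_paths ar13 a12 d6; have := wind_paths ar13 a14 d7; have := wind_paths ar13 a24 x2.
have := wind_paths as24 a34 d8; have := wind_paths as24 a14 d9; have := wind_paths as24 a13 x3.
have := wind_paths ar24 a12 d10; have := wind_paths ar24 a23 d11; have := wind_paths ar24 a13 x4.
have := wind_paths a12 a34 d1; have := wind_paths a14 a23 d2; have := wind_paths a13 a24 d3.
rewrite !last_cat -/t -/w l12 l23 l34 l14 l13 l24 -!cat_cons !wind_cat -/t -/w.
have ne x y q r z : apart q r -> x \in q -> y \in r -> z = lt x y -> dom x -> dom y -> lt y x = ~~ z.
  move=> /hasPn qr xq yr -> dx dy; apply: tot => // e.
  by have := qr x xq; rewrite /= -e yr.
have ml' (x y : P) q : last x q = y -> y \in x :: q by move=> <-; exact: mem_last.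
have l13' : last v1 (s13 ++ r13) = v3 by rewrite last_cat.
have := ne v2 v4 _ _ _ d1 (ml' _ _ _ l12) (ml' _ _ _ l34) erefl dom2 dom4.
have := ne v3 v2 _ _ _ d3 (ml' _ _ _ l13') (mem_head _ _) erefl dom3 dom2.
have := ne v4 v3 _ _ _ d2 (ml' _ _ _ l14) (ml' _ _ _ l23) erefl dom4 dom3.
by xor.
Qed.
End Chords.

End VanKampen.
Arguments wind {P} n c p : simpl never.
End Kampen.

(** * Winding numbers mod 2 of the arcs of a drawing *)

Module Topo.
Require Import Defs.
From mathcomp Require Import all_boot all_order all_algebra.
From mathcomp Require Import all_classical all_reals all_analysis.
From mathcomp Require Import lra.
Import Order.TTheory GRing.Theory Num.Theory.
Import numFieldNormedType.Exports.
Local Open Scope ring_scope.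

Section Curves.
Variable R : realType.
Implicit Types (u v : R * R) (a b : R -> R * R).

(** A half-plane with half of its boundary line, so that exactly one of [u] and [- u] is upper when
    [u] is nonzero. Applied to differences, it also orders the points of the drawing. *)
Definition upper u := (0 < u.2) || ((u.2 == 0) && (0 < u.1)).
(** Meant for two vectors in a common [half_plane], where it detects that the segment between them
    crosses the negative half of the first axis. *)
Definition crosses u v := (upper u != upper v) && (u.1 < 0).

Lemma upperN u : u != 0 -> upper (- u) = ~~ upper u.
Proof.
case: u => x y; rewrite /upper /= !oppr_gt0 oppr_eq0 => nz.
have {nz} : (x != 0) || (y != 0).
  by move: nz; rewrite -negb_and; apply: contra => /andP[/eqP -> /eqP ->].
by case: (ltgtP y 0) => //=; case: (ltgtP x 0).
Qed.

Lemma upper_pos u : 0 < u.2 -> upper u = true.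
Proof. by rewrite /upper => ->. Qed.

Lemma upper_neg u : u.2 < 0 -> upper u = false.
Proof. by move=> u0; rewrite /upper ltNge (ltW u0) (lt_eqF u0). Qed.

(* One of the four open half planes bounded by a coordinate axis. *)
Definition half_plane (k : 'I_4) u : bool :=
  match val k with
  | 0%N => 0 < u.1 | 1%N => u.1 < 0 | 2%N => 0 < u.2 | _ => u.2 < 0
  end.

(** Negation exchanges the two rays of the first axis, and a change of [upper] is a crossing of
    exactly one of them. *)
Lemma half_planeN k u v : half_plane k u -> half_plane k v ->
  crosses (- u) (- v) = crosses u v (+) (upper u != upper v).
Proof.
move=> hu hv; have [nu nv] : u != 0 /\ v != 0.
  by split; apply/eqP => e; move: hu hv; rewrite e; case: k => -[|[|[|[|]]]] //= ?;
     rewrite /half_plane /= ltxx.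
rewrite /crosses !upperN //.
have -> : (~~ upper u != ~~ upper v) = (upper u != upper v).
  by case: (upper u); case: (upper v).
have e1 : (- u).1 = - u.1 by case: (u).
rewrite e1 oppr_lt0.
move: hu hv; rewrite /half_plane /upper.
case: k => -[|[|[|[|//]]]] /= _ hu hv.
- by rewrite hu [u.1 < 0]ltNge ltW //= andbF andbT addFb.
- by rewrite hu [0 < u.1]ltNge ltW //= andbF andbT addbb.
- by rewrite -!/(upper _) !upper_pos.
- by rewrite -!/(upper _) !upper_neg.
Qed.

(** All corners lie in one half-plane that misses the origin, so the boundary of the cell does not
    wind around it. *)
Lemma half_plane_cell k p q r s :
  half_plane k p -> half_plane k q -> half_plane k r -> half_plane k s ->
  crosses p q (+) crosses q s = crosses p r (+) crosses r s.
Proof.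
rewrite /crosses /half_plane /upper.
case: k => -[|[|[|[|//]]]] /= _ hp hq hr hs.
- by rewrite ![_ < 0]ltNge !ltW //= !andbF.
- rewrite hp hq hr !andbT.
  by move: ((0 < p.2) || _) ((0 < q.2) || _) ((0 < r.2) || _) ((0 < s.2) || _) => [] [] [] [].
- by rewrite -!/(upper _) !upper_pos.
- by rewrite -!/(upper _) !upper_neg.
Qed.

Definition grid (N i : nat) : R := i%:R / N%:R.

(* The parity of the number of times the polygon inscribed in [a], seen from
   [p], crosses the negative half-axis. *)
Definition turns (N : nat) a p : bool :=
  \big[addb/false]_(i < N) crosses (a (grid N i) - p) (a (grid N i.+1) - p).

Definition fine_for a b (N : nat) :=
  forall i j, (i < N)%N -> (j < N)%N -> exists k, forall i' j',
    (i <= i' <= i.+1)%N -> (j <= j' <= j.+1)%N ->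
    half_plane k (a (grid N i') - b (grid N j')).

(** A discrete homotopy. No cell of the grid of differences [F] winds around the origin, hence
    neither does the boundary of the whole square. Two of its sides are [a] seen from the ends of
    [b]; the other two are, up to sign, [b] seen from the ends of [a], and the sign costs changes of
    [upper] that telescope to the corners. *)
Lemma turns_grid a b N : (0 < N)%N -> fine_for a b N ->
  turns N a (b 0) (+) turns N a (b 1) (+) turns N b (a 0) (+) turns N b (a 1) =
  upper (b 0 - a 0) (+) upper (b 0 - a 1) (+) upper (b 1 - a 0) (+) upper (b 1 - a 1).
Proof.
move=> N0 fine; pose F i j := a (grid N i) - b (grid N j).
pose H j := \big[addb/false]_(i < N) crosses (F i j) (F i.+1 j).
pose V i := \big[addb/false]_(j < N) crosses (F i j) (F i j.+1).
have g0 : grid N 0 = 0 by rewrite /grid mul0r.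
have g1 : grid N N = 1 by rewrite /grid divff // pnatr_eq0 -lt0n.
have row (j : nat) : (j < N)%N -> H j (+) H j.+1 = crosses (F 0 j) (F 0 j.+1) (+) crosses (F N j) (F N j.+1).
  move=> jN; suff rw m : (m <= N)%N ->
    \big[addb/false]_(i < m) crosses (F i j) (F i.+1 j) (+)
    \big[addb/false]_(i < m) crosses (F i j.+1) (F i.+1 j.+1) =
    crosses (F 0 j) (F 0 j.+1) (+) crosses (F m j) (F m j.+1) by exact: rw.
  elim: m => [|m IH] mN; first by rewrite !big_ord0 !addbb.
  rewrite !big_ord_recr /=; have [k fk] := fine m j mN jN.
  have := @half_plane_cell k (F m j) (F m.+1 j) (F m j.+1) (F m.+1 j.+1).
  rewrite !fk ?leqnn ?leqnSn // => /(_ isT isT isT isT).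
  move: (IH (ltnW mN)).
  set A := \big[_/_]_(_ < m) _; set B := \big[_/_]_(_ < m) _.
  by do 5![case: (crosses _ _)]; case: A; case: B.
have HV : H 0 (+) H N = V 0 (+) V N.
  suff rw m : (m <= N)%N -> H 0 (+) H m =
    \big[addb/false]_(j < m) crosses (F 0 j) (F 0 j.+1) (+)
    \big[addb/false]_(j < m) crosses (F N j) (F N j.+1) by exact: rw.
  elim: m => [|m IH] mN; first by rewrite !big_ord0 !addbb.
  rewrite !big_ord_recr /=; move: (IH (ltnW mN)) (row m mN).
  set A := \big[_/_]_(_ < m) _; set B := \big[_/_]_(_ < m) _.
  by case: (H 0); case: (H m); case: (H m.+1); case: A; case: B; do 2![case: crosses].
have tH j : H j = turns N a (b (grid N j)) by [].
have tV i : (i = 0 \/ i = N)%N -> turns N b (a (grid N i)) =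
    V i (+) upper (b (grid N 0) - a (grid N i)) (+) upper (b (grid N N) - a (grid N i)).
  move=> iN.
  suff rw m : (m <= N)%N ->
    \big[addb/false]_(j < m) crosses (b (grid N j) - a (grid N i)) (b (grid N j.+1) - a (grid N i)) =
    \big[addb/false]_(j < m) crosses (F i j) (F i j.+1) (+)
    upper (b (grid N 0) - a (grid N i)) (+) upper (b (grid N m) - a (grid N i)) by exact: rw.
  elim: m => [|m IH] mN; first by rewrite !big_ord0 addFb addbb.
  rewrite !big_ord_recr.
  rewrite (IH (ltnW mN)).
  rewrite [val _]/= -/(F i m) -/(F i m.+1).
  set A := \big[_/_]_(_ < m) _.
  (* Consecutive points of an outer column of the grid are corners of a common cell; for the last
     column this is the cell with index [N.-1]. *)
  have [k fk] : exists k, half_plane k (F i m) /\ half_plane k (F i m.+1).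
    case: iN => ->.
      have [k fk] := fine 0%N m N0 mN; exists k; split; apply: fk; rewrite ?leqnn ?leqnSn //.
    have N1 : (N.-1 < N)%N by rewrite prednK.
    have [k fk] := fine N.-1 m N1 mN; exists k; split; apply: fk; rewrite ?prednK ?leqnn ?leq_pred ?leqnSn //.
  case: fk => f1 f2; have := half_planeN f1 f2.
  rewrite /F !opprB => ->.
  have nz p : half_plane k p -> p != 0.
    move=> hp; apply/eqP => e; move: hp; rewrite e /half_plane.
    by case: (val k) => [|[|[|?]]] /=; rewrite ltxx.
  rewrite -(opprB (b (grid N m))) -(opprB (b (grid N m.+1))) !upperN; first last.
  - by rewrite -oppr_eq0 opprB nz.
  - by rewrite -oppr_eq0 opprB nz.
  by move: (upper _) (upper _) (upper _) (crosses _ _) A => [] [] [] [] [].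
have := tV 0%N (or_introl erefl); have := tV N (or_intror erefl).
have := tH 0%N; have := tH N; rewrite !g0 !g1 => <- <- -> ->.
move: HV; move: (H 0%N) (H N) (V 0%N) (V N) => h1 h2 v1 v2.
move: (upper _) (upper _) (upper _) (upper _) => u1 u2 u3 u4.
by move: h1 h2 v1 v2 u1 u2 u3 u4 => [] [] [] [] [] [] [] [].
Qed.

Definition continuous01 a := forall s, 0 <= s <= 1 -> forall e, 0 < e ->
  exists2 d, 0 < d & forall s', 0 <= s' <= 1 -> `|s' - s| < d -> `|a s' - a s| < e.

Lemma within_continuous01 a : {within `[0, 1], continuous a}%classic -> continuous01 a.
Proof.
move=> /subspace_continuousP ca s s01 e e0.
have := ca s; rewrite /= in_itv /= => /(_ s01) /cvgrPdist_lt /(_ e e0).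
rewrite near_withinE => /nbhs_ballP[d /= d0 H]; exists d => // s' s'01 ss'.
by rewrite distrC; apply: H; rewrite //= ?in_itv //= /ball /= distrC.
Qed.

Lemma half_plane_open u : u != 0 -> exists k, exists2 e, 0 < e &
  forall v, `|v - u| < e -> half_plane k v.
Proof.
move=> u0; have n1 v : `|v.1 - u.1| <= `|v - u| by case: v => x y; rewrite /= le_max lexx.
have n2 v : `|v.2 - u.2| <= `|v - u| by case: v => x y; rewrite /= le_max lexx orbT.
have [/eqP x0|] := boolP (u.1 == 0); last first.
  rewrite neq_lt => /orP[] x0.
    exists (@Ordinal 4 1 isT), (- u.1); first lra.
    move=> v /(le_lt_trans (n1 v)); rewrite /half_plane /= ltr_norml => /andP[]; lra.
  exists (@Ordinal 4 0 isT), u.1 => // v /(le_lt_trans (n1 v)).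
  rewrite /half_plane /= ltr_norml => /andP[]; lra.
have : u.2 != 0.
  by apply: contraNneq u0 => y0; rewrite [u]surjective_pairing x0 y0.
rewrite neq_lt => /orP[] y0.
  exists (@Ordinal 4 3 isT), (- u.2); first lra.
  move=> v /(le_lt_trans (n2 v)); rewrite /half_plane /= ltr_norml => /andP[]; lra.
exists (@Ordinal 4 2 isT), u.2 => // v /(le_lt_trans (n2 v)).
rewrite /half_plane /= ltr_norml => /andP[]; lra.
Qed.

(** Near each pair of parameters the nonzero difference stays in one open coordinate half-plane.
    Compactness of the unit square makes the mesh uniform. *)
Lemma fine_eventually a b : continuous01 a -> continuous01 b ->
  (forall s t, 0 <= s <= 1 -> 0 <= t <= 1 -> a s <> b t) ->
  exists N0, forall N, (N0 <= N)%N -> fine_for a b N.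
Proof.
move=> ca cb ab.
pose good (N : nat) (x : R * R) := exists k, forall s t, 0 <= s <= 1 -> 0 <= t <= 1 ->
  `|s - x.1| <= N.+1%:R^-1 -> `|t - x.2| <= N.+1%:R^-1 -> half_plane k (a s - b t).
have cK : compact ((`[0, 1] : set R) `*` (`[0, 1] : set R))%classic.
  by apply: compact_setX; exact: segment_compact.
move/compact_near_coveringP : cK => /(_ nat eventually good _) [].
  move=> [s t] [/=]; rewrite !in_itv /= => s01 t01.
  have nz : a s - b t != 0 by rewrite subr_eq0; apply/eqP/ab.
  have [k [e e0 He]] := half_plane_open nz.
  have e20 : 0 < e / 2 by lra.
  have [d1 d10 H1] := ca s s01 _ e20.
  have [d2 d20 H2] := cb t t01 _ e20.
  near=> x N; exists k => s' t' s'01 t'01 sx tx.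
  apply: He; have -> : a s' - b t' - (a s - b t) = (a s' - a s) - (b t' - b t).
    by rewrite !opprB addrACA [RHS]addrACA [- b t' - _]addrC.
  apply: le_lt_trans (ler_normB _ _) _; rewrite [e]splitr.
  have [xs xt] : `|x.1 - s| < d1 / 2 /\ `|x.2 - t| < d2 / 2.
    near: x; apply/nbhs_ballP; exists (Num.min (d1 / 2) (d2 / 2)) => /=.
      by rewrite lt_min !divr_gt0.
    move=> x [/= b1 b2]; split; rewrite distrC.
      by apply: lt_le_trans b1 _; rewrite ge_min lexx.
    by apply: lt_le_trans b2 _; rewrite ge_min lexx orbT.
  have [N1 N2] : N.+1%:R^-1 < d1 / 2 /\ N.+1%:R^-1 < d2 / 2.
    split; near: N.
      exact: (near_infty_natSinv_lt (PosNum (divr_gt0 d10 (ltr0n _ 2)))).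
    exact: (near_infty_natSinv_lt (PosNum (divr_gt0 d20 (ltr0n _ 2)))).
  apply: ltrD.
    apply: H1 => //; rewrite -(subrK x.1 s') -addrA (splitr d1).
    apply: le_lt_trans (ler_normD _ _) _; apply: ltrD => //; exact: le_lt_trans N1.
  apply: H2 => //; rewrite -(subrK x.2 t') -addrA (splitr d2).
  apply: le_lt_trans (ler_normD _ _) _; apply: ltrD => //; exact: le_lt_trans N2.
(* [good] speaks of the mesh [N.+1], hence the shifted threshold. *)
move=> N0 _ HN; exists N0.+1 => N N0N i j iN jN.
have Npos : 0 < N%:R :> R by rewrite ltr0n (leq_ltn_trans _ N0N).
have N1 : (N0 <= N.-1)%N by rewrite -ltnS prednK // (leq_ltn_trans _ N0N).
have g01 m n : (n < N)%N -> (m <= n.+1)%N -> 0 <= grid N m <= 1.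
  move=> nN mn; rewrite divr_ge0 ?ler0n //= ler_pdivrMr // mul1r ler_nat.
  exact: leq_trans nN.
have [|k kP] := HN N.-1 N1 (grid N i, grid N j).
  by split; rewrite /= in_itv /=; [apply: g01 iN _ | apply: g01 jN _].
exists k => i' j' ii' jj'.
have gd m n : (m <= n <= m.+1)%N -> `|grid N n - grid N m| <= N%:R^-1.
  move=> /andP[mn nm]; rewrite /grid -mulrBl -natrB // normrM [`|N%:R^-1|]ger0_norm ?invr_ge0 ?(ltW Npos) //.
  rewrite ger0_norm ?ler0n //; apply: ler_piMl; first by rewrite invr_ge0 ltW.
  by rewrite lern1 leq_subLR addn1.
case/andP: (ii') => _ i'i; case/andP: (jj') => _ j'j.
by apply: kP; rewrite /= ?prednK ?(leq_ltn_trans _ N0N) //; [exact: g01 i'i|exact: g01 j'j|exact: gd|exact: gd].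
Unshelve. all: end_near. Qed.

End Curves.

(** [inl v] is a vertex and [inr e] the node that subdivides the edge [e]; adjacency is
    incidence. *)
Definition sub_adj (V : finType) (U : {set {set V}}) (p q : V + {set V}) : bool :=
  match p, q with
  | inl v, inr e | inr e, inl v => (e \in U) && (v \in e)
  | _, _ => false
  end.

Definition sub_dom (V : finType) (U : {set {set V}}) (p : V + {set V}) : bool :=
  if p is inr e then e \in U else true.

Lemma eventually_fin (T : finType) (Q : T -> nat -> Prop) :
  (forall x, exists N0, forall N, (N0 <= N)%N -> Q x N) ->
  exists N0, forall N, (N0 <= N)%N -> forall x, Q x N.
Proof.
move=> /choice[f fP]; exists (\max_x f x)%N => N le x.
by apply: fP; apply: leq_trans le; apply: leq_bigmax.
Qed.

(** Two half-edges at different vertices and of different edges are disjoint curves, as [turns_grid]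
    requires. There are finitely many pairs of them, so one mesh serves all and the winding numbers
    are defined independently of the pair. *)
Lemma planar_van_kampen (R : realType) (V : finType) (U : {set {set V}}) : planar R U ->
  exists lt n, Kampen.van_kampen (sub_dom U) (sub_adj U) lt n.
Proof.
case=> pt [arc [inj_pt arcU arc_end arc_pt arc_arc]].
pose pos (p : V + {set V}) := match p with inl v => pt v | inr e => arc e (2^-1) end.
(* The half of the arc that starts at [pt v], whichever end of the arc this is. *)
pose half (v : V) e (t : R) := if arc e 0 == pt v then arc e (t / 2) else arc e (1 - t / 2).
have half01 (t : R) : 0 <= t <= 1 -> 0 <= t / 2 <= 1 /\ 0 <= 1 - t / 2 <= 1.
  by move=> /andP[? ?]; split; apply/andP; split; lra.
have half0 v e : e \in U -> v \in e -> half v e 0 = pt v.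
  move=> eU ve; rewrite /half mul0r subr0; case: eqP => // n0.
  have : ([set arc e 0; arc e 1] (pt v))%classic by rewrite arc_end //; exists v.
  by case=> [/esym|/esym].
have half1 v e : half v e 1 = arc e (2^-1).
  by rewrite /half mul1r; case: ifP => // _; congr (arc e _); lra.
have half_in v e (t : R) : e \in U -> v \in e -> 0 <= t <= 1 -> half v e t = pt v \/
    exists2 s : R, s \in `]0, 1[ & half v e t = arc e s.
  move=> eU ve /andP[t0 t1]; have [->|tn] := eqVneq t 0; first by left; exact: half0.
  have {}t0 : 0 < t by rewrite lt_neqAle eq_sym tn.
  by right; rewrite /half; case: ifP => _;
    [exists (t / 2) | exists (1 - t / 2)]; rewrite ?in_itv //=; lra.
have half_cont v e : e \in U -> continuous01 (half v e).
  move=> eU s s01 eps eps0; have [ce _] := arcU e eU.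
  have ce' := within_continuous01 ce; have [h1 h2] := half01 s s01.
  rewrite /half; case: ifP => _.
    have [d d0 H] := ce' _ h1 _ eps0; exists d => // s' s'01 ss'.
    have [? _] := half01 s' s'01; apply: H => //; rewrite -mulrBl normrM.
    by rewrite [`|2^-1|]ger0_norm ?invr_ge0 //; move: (normr_ge0 (s' - s)) ss'; set x := `|_|; lra.
  have [d d0 H] := ce' _ h2 _ eps0; exists d => // s' s'01 ss'.
  have [_ ?] := half01 s' s'01; apply: H => //.
  have -> : 1 - s' / 2 - (1 - s / 2) = - ((s' - s) / 2) by lra.
  rewrite normrN normrM.
  by rewrite [`|2^-1|]ger0_norm ?invr_ge0 //; move: (normr_ge0 (s' - s)) ss'; set x := `|_|; lra.
have half_disj v e v' e' : e \in U -> v \in e -> e' \in U -> v' \in e' -> v <> v' -> e <> e' ->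
    forall s t : R, 0 <= s <= 1 -> 0 <= t <= 1 -> half v e s <> half v' e' t.
  move=> eU ve e'U v'e' vv' ee' s t s01 t01.
  have [->|[s1 s1i ->]] := half_in v e s eU ve s01; have [->|[t1 t1i ->]] := half_in v' e' t e'U v'e' t01.
  - by move/inj_pt.
  - by apply/nesym/arc_pt.
  - exact: arc_pt.
  - exact: arc_arc.
have [N0 fineN] : exists N0, forall N, (N0 <= N)%N -> forall x : V * {set V} * (V * {set V}),
    x.1.2 \in U -> x.1.1 \in x.1.2 -> x.2.2 \in U -> x.2.1 \in x.2.2 ->
    x.1.1 <> x.2.1 -> x.1.2 <> x.2.2 -> fine_for (half x.1.1 x.1.2) (half x.2.1 x.2.2) N.
  apply: eventually_fin => -[[v e] [v' e']] /=.
  have [H|nH] := pselect [/\ e \in U, v \in e & e' \in U /\ [/\ v' \in e', v <> v' & e <> e']].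
    case: H => eU ve [e'U [v'e' vv' ee']].
    have [N0 HN] := fine_eventually (half_cont v e eU) (half_cont v' e' e'U)
      (half_disj _ _ _ _ eU ve e'U v'e' vv' ee').
    by exists N0 => N /HN.
  by exists 0%N => N _ *; case: nH.
pose lt p q := upper (pos q - pos p).
pose w p v e := turns N0.+1 (half v e) (pos p).
pose n c a b := match a, b with
  | inl v, inr e | inr e, inl v => w c v e | _, _ => false end.
exists lt, n; split.
- move=> x y dx dy xy; rewrite /lt -opprB upperN // subr_eq0; apply/eqP => exy.
  case: x y dx dy xy exy => [v|e] [v'|e'] /= dx dy xy exy.
  + by apply: xy; congr inl; apply: inj_pt.
  + by apply: (arc_pt e' v 2^-1) => //; rewrite in_itv /=; lra.
  + by apply: (arc_pt e v' 2^-1) => //; rewrite in_itv /=; lra.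
  + have i2 : (2^-1 : R) \in `]0, 1[ by rewrite in_itv /=; lra.
    by apply: (arc_arc e e' _ _ dx dy _ i2 i2 exy) => ee'; apply: xy; rewrite ee'.
- by move=> c [v|e] [v'|e'].
have main v e v' e' : e \in U -> v \in e -> e' \in U -> v' \in e' -> v <> v' -> e <> e' ->
    w (inl v') v e (+) w (inr e') v e (+) w (inl v) v' e' (+) w (inr e) v' e' =
    lt (inl v) (inl v') (+) lt (inr e) (inl v') (+) lt (inl v) (inr e') (+) lt (inr e) (inr e').
  move=> eU ve e'U v'e' vv' ee'.
  have f := fineN N0.+1 (leqnSn _) ((v, e), (v', e')) eU ve e'U v'e' vv' ee'.
  by have := turns_grid (ltn0Sn _) f; rewrite /= !half0 // !half1.
move=> [v|e] [v'|e'] [v1|e1] [v1'|e1'] //=.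
- move=> /andP[eU ve] /andP[e1U ve1] vv _ _ ee.
  rewrite main //; first by do 4![case: (lt _ _)].
  + by move=> h; apply: vv; congr inl.
  + by move=> h; apply: ee; congr inr.
- move=> /andP[eU ve] /andP[e1U ve1] _ vv ee _.
  have := main v e' v1' e1 eU ve e1U ve1.
  rewrite [X in X -> _]/= => H; have {}H := H (fun h => vv (f_equal inl h)) (fun h => ee (f_equal inr h)).
  by move: H; case: (lt _ _); case: (lt _ _); case: (lt _ _); case: (lt _ _); do 4![case: (w _ _ _)].
- move=> /andP[eU ve] /andP[e1U ve1] _ ee vv _.
  have H := main v' e v1 e1' eU ve e1U ve1 (fun h => vv (f_equal inl h)) (fun h => ee (f_equal inr h)).
  by move: H; case: (lt _ _); case: (lt _ _); case: (lt _ _); case: (lt _ _); do 4![case: (w _ _ _)].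
- move=> /andP[eU ve] /andP[e1U ve1] ee _ _ vv.
  have H := main v' e v1' e1 eU ve e1U ve1 (fun h => vv (f_equal inl h)) (fun h => ee (f_equal inr h)).
  by move: H; case: (lt _ _); case: (lt _ _); case: (lt _ _); case: (lt _ _); do 4![case: (w _ _ _)].
Qed.
End Topo.

(** * Depth-first trees and solvability of the left-right constraints *)

Module Palm.
From mathcomp Require Import all_boot zify.
Import Xor Kampen.

Section Tree.
Variable par : nat -> nat.
Hypothesis par_lt : forall k, 0 < k -> par k < k.

(** The ancestors of [k] up to the root 0. Parents have smaller numbers, so [k.+1] is enough
    fuel. *)
Fixpoint climb (fuel k : nat) : seq nat :=
  if fuel is f.+1 then k :: (if k == 0 then [::] else climb f (par k)) else [::].

Definition chain k := climb k.+1 k.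

Lemma climb_fuel f k : k < f -> climb f k = chain k.
Proof.
suff H f1 f2 j : j < f1 -> j < f2 -> climb f1 j = climb f2 j by move=> kf; apply: H.
elim: f1 f2 j => [|f1 IH] [|f2] j //= jf1 jf2; case: eqP => // /eqP j0.
by rewrite (IH f2) //; have := par_lt (k := j); lia.
Qed.

Lemma chain0 : chain 0 = [:: 0]. Proof. by []. Qed.

Lemma chainE k : 0 < k -> chain k = k :: chain (par k).
Proof. by case: k => // k k0; rewrite -(climb_fuel (par_lt k0)). Qed.

Definition anc x y := x \in chain y.

Lemma anc0 x : anc x 0 = (x == 0).
Proof. by rewrite /anc chain0 inE. Qed.

Lemma ancE x y : 0 < y -> anc x y = (x == y) || anc x (par y).
Proof. by move=> y0; rewrite /anc chainE // inE. Qed.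

Lemma anc_refl x : anc x x.
Proof.
by have [->|x0] := posnP x; [rewrite anc0 | rewrite ancE // eqxx].
Qed.

Lemma anc_leq x y : anc x y -> x <= y.
Proof.
elim/ltn_ind: y => y IH; have [->|y0] := posnP y; first by rewrite anc0 => /eqP ->.
rewrite ancE // => /orP[/eqP -> //|/(IH _ (par_lt y0))]; have := par_lt y0; lia.
Qed.

Lemma anc_par x y : 0 < y -> anc x (par y) = anc x y && (x != y).
Proof.
move=> y0; rewrite [anc x y]ancE //; case: eqP => [->|_]; last by rewrite andbT.
by rewrite andbF; apply/negP => /anc_leq; have := par_lt y0; lia.
Qed.

Lemma anc_trans y x z : anc x y -> anc y z -> anc x z.
Proof.
move=> xy; elim/ltn_ind: z => z IH; have [->|z0] := posnP z.
  by rewrite anc0 => /eqP <-.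
rewrite ancE // => /orP[/eqP <-//|yz]; rewrite ancE //.
by rewrite IH ?orbT //; exact: par_lt.
Qed.

Lemma anc_total x x' y : anc x y -> anc x' y -> x <= x' -> anc x x'.
Proof.
elim/ltn_ind: y => y IH; have [->|y0] := posnP y.
  by rewrite !anc0 => /eqP -> /eqP ->; rewrite anc_refl.
move=> xy; rewrite ancE // => /orP[/eqP -> //|x'y]; move: xy.
rewrite ancE // => /orP[/eqP ->|xy]; last exact: IH (par_lt y0) xy x'y.
by move: (anc_leq x'y) (par_lt y0); lia.
Qed.

Lemma anc_root x : anc 0 x.
Proof.
elim/ltn_ind: x => x IH; have [->|x0] := posnP x; first by rewrite anc0.
by rewrite ancE // IH ?orbT //; exact: par_lt.
Qed.

Lemma anc_child x y : anc x y -> x != y -> exists c, [/\ 0 < c, par c = x & anc c y].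
Proof.
elim/ltn_ind: y => y IH; have [->|y0] := posnP y; first by rewrite anc0 => ->.
move=> xy nxy; have xp : anc x (par y) by rewrite anc_par // xy.
have [->|nx] := eqVneq x (par y); first by exists y; rewrite anc_refl.
have [c [c0 cx cy]] := IH (par y) (par_lt y0) xp nx.
by exists c; split=> //; rewrite ancE // cy orbT.
Qed.

Lemma meet_exists y y' : exists z, [/\ anc z y, anc z y' & forall w, anc w y -> anc w y' -> anc w z].
Proof.
elim/ltn_ind: y => y IH.
have [yy'|nyy] := boolP (anc y y'); first by exists y; rewrite anc_refl.
have [y00|y0] := posnP y; first by rewrite y00 anc_root in nyy.
have [z [zy zy' zmax]] := IH (par y) (par_lt y0).
exists z; split=> // [|w]; first by rewrite ancE // zy orbT.
by rewrite ancE // => /orP[/eqP ->|wy wy']; [rewrite (negbTE nyy) | exact: zmax].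
Qed.

Lemma sibling_apart c c' x : 0 < c -> 0 < c' -> par c = par c' -> c <> c' -> anc c x -> anc c' x -> False.
Proof.
wlog cc' : c c' / c <= c' => [H c0 c'0 pc nc cx c'x|c0 c'0 pc nc cx c'x].
  case/orP: (leq_total c c') => h; first exact: (H c c').
  by apply: (H c' c) => //; apply: nesym.
have := anc_total cx c'x cc'; rewrite ancE // => /orP[/eqP //|].
by rewrite -pc => /anc_leq; have := par_lt c0; lia.
Qed.

Local Opaque wind chain.

Section Completeness.
(** [B] lists the back edges by their lower ends, [tgt] gives their upper ends, and [E] marks the
    subdividing nodes. The root 0 is not a point of the drawing, hence the guards [0 < par k]. *)
Variables (B : seq nat) (tgt : nat -> nat) (E : pred nat).
Variables (dom : pred nat) (adj lt : rel nat) (n : nat -> nat -> nat -> bool).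
Hypothesis vk : van_kampen dom adj lt n.
Hypothesis adj_par : forall k, 0 < par k -> adj k (par k).
Hypothesis adj_sym : forall k l, adj k l = adj l k.
Hypothesis adj_tgt : forall b, b \in B -> adj b (tgt b).
Hypothesis E_par : forall k, 0 < par k -> E k = ~~ E (par k).
Hypothesis leafB : forall b k, b \in B -> 0 < k -> par k <> b.
Hypothesis tgtP : forall b, b \in B -> [/\ 0 < tgt b, tgt b < par b & anc (tgt b) b].
Hypothesis E_tgt : forall b, b \in B -> E (tgt b) = false.
Hypothesis E_fork : forall c c', 0 < c -> 0 < c' -> par c = par c' -> c <> c' -> 0 < par c -> E (par c) = false.
Hypothesis dom_anc : forall b x, b \in B -> anc x b -> 0 < x -> dom x.

(** The return edges of the tree edge above [c], in the language of left-right planarity. *)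
Definition ret c b := [&& b \in B, anc c b, 0 < c & tgt b < par c].

Lemma B_gt0 b : b \in B -> 0 < b.
Proof. by case: b => // /tgtP[]; rewrite anc0 => + _ /eqP t0; rewrite t0. Qed.

Lemma climb_path y x : 0 < x -> anc x y -> exists p, [/\ path adj y p, last y p = x,
   forall z, (z \in y :: p) = anc x z && anc z y &
   forall c, wind n c (y :: p) = wind n c (chain y) (+) wind n c (chain x)].
Proof.
move=> x0; elim/ltn_ind: y => y IH xy; have [e|nxy] := eqVneq x y.
  exists [::]; rewrite e; split=> // [z|c]; last by rewrite wind1 addbb.
  rewrite inE; apply/eqP/andP => [->|[yz zy]]; first by rewrite anc_refl.
  by move: (anc_leq yz) (anc_leq zy); lia.
have y0 : 0 < y by have := anc_leq xy; lia.
have xp : anc x (par y) by rewrite anc_par // xy.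
have p0 : 0 < par y by apply: leq_trans x0 (anc_leq xp).
have [p [pp lp mp wp]] := IH _ (par_lt y0) xp.
exists (par y :: p); split=> //=; first by rewrite adj_par.
  move=> z; rewrite inE mp [anc z y]ancE //; case: (eqVneq z y) => [->|] //=.
  by rewrite xy.
move=> c; have cy : chain y = [:: y, par y & chain (par (par y))] by rewrite (chainE y0) (chainE p0).
rewrite wind_cons2 wp cy wind_cons2 (chainE p0); xor.
Qed.

Lemma rev_path_exists x p : path adj x p -> exists q, [/\ path adj (last x p) q,
   last (last x p) q = x, last x p :: q =i x :: p & forall c, wind n c (last x p :: q) = wind n c (x :: p)].
Proof.
move=> pp; have e : rev (x :: p) = last x p :: rev (belast x p) by rewrite lastI rev_rcons.
exists (rev (belast x p)); split.
- rewrite rev_path -(eq_path (e := adj)) // => a b; exact: adj_sym.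
- by case: p {pp e} => //= y q; rewrite rev_cons last_rcons.
- by move=> z; rewrite -e mem_rev.
- by move=> c; rewrite -e (wind_rev vk).
Qed.

Lemma descend_path y x : 0 < x -> anc x y -> exists p, [/\ path adj x p, last x p = y,
   forall z, (z \in x :: p) = anc x z && anc z y &
   forall c, wind n c (x :: p) = wind n c (chain y) (+) wind n c (chain x)].
Proof.
move=> x0 xy; have [p [pp lp mp wp]] := climb_path x0 xy.
have [q] := rev_path_exists pp; rewrite lp => -[qq lq mq wq].
by exists q; split=> // [z|c]; rewrite ?mq ?wq.
Qed.

(* [turn c b] is formally the winding number mod 2 around [c] of the fundamental
   cycle of [b]; the chains to the root cancel whenever two cycles are added. *)
Definition turn c b := wind n c (chain b) (+) n c b (tgt b) (+) wind n c (chain (tgt b)).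

(** In the sum of the two fundamental cycles their common tree path cancels. What remains is the
    part below the meet of [b1] and [b2], the tree path between the targets, and the back edges
    themselves. A walk outside the subtree of [c] that never enters the interval between the targets
    avoids all of this. *)
Lemma two_cycles_const b1 b2 c x q : ret c b1 -> ret c b2 -> path adj x q ->
  (forall z, z \in x :: q -> ~~ anc c z /\ (z < tgt b1 /\ z < tgt b2 \/ tgt b1 < z /\ tgt b2 < z)) ->
  turn x b1 (+) turn x b2 = turn (last x q) b1 (+) turn (last x q) b2.
Proof.
wlog le12 : b1 b2 / tgt b1 <= tgt b2 => [H r1 r2 xq h|].
  case/orP: (leq_total (tgt b1) (tgt b2)) => le; first exact: H.
  rewrite addbC [RHS]addbC; apply: H => // z /h [-> [[]|[]]]; split=> //; [left|right]; split=> //.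
move=> /and4P[b1B cb1 c0 t1] /and4P[b2B cb2 _ t2] xq h.
have [z [zb1 zb2 zmax]] := meet_exists b1 b2.
have cz := zmax _ cb1 cb2; have z0 : 0 < z := leq_trans c0 (anc_leq cz).
have [tb1 _ tab1] := tgtP b1B; have [tb2 _ tab2] := tgtP b2B.
have [p1 [pp1 l1 m1 w1]] := climb_path z0 zb1.
have [p2 [pp2 l2 m2 w2]] := climb_path z0 zb2.
have tac1 : anc (tgt b1) c by apply: anc_total tab1 cb1 _; apply: ltnW (ltn_trans t1 (par_lt c0)).
have tac2 : anc (tgt b2) c by apply: anc_total tab2 cb2 _; apply: ltnW (ltn_trans t2 (par_lt c0)).
have t12 := anc_total tac1 tac2 le12.
have [p3 [pp3 l3 m3 w3]] := climb_path tb1 t12.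
have ap (y : nat) r : (forall w, w \in y :: r -> [\/ anc c w, w = tgt b1, w = tgt b2 | tgt b1 <= w <= tgt b2]) ->
    apart (y :: r) (x :: q).
  move=> H; apply/hasPn => w /H hw; apply/negP => /h [/negP ncw]; move: le12; case: hw => //; clear; lia.
have a1 : apart (b1 :: p1) (x :: q).
  by apply: ap => w; rewrite m1 => /andP[zw _]; constructor 1; exact: anc_trans zw.
have a2 : apart (b2 :: p2) (x :: q).
  by apply: ap => w; rewrite m2 => /andP[zw _]; constructor 1; exact: anc_trans zw.
have a3 : apart (tgt b2 :: p3) (x :: q).
  by apply: ap => w; rewrite m3 => /andP[/anc_leq ? /anc_leq ?]; constructor 4; apply/andP.
have a4 : apart [:: b1; tgt b1] (x :: q).
  by apply: ap => w; rewrite !inE => /orP[/eqP ->|/eqP ->]; [constructor 1|constructor 2].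
have a5 : apart [:: b2; tgt b2] (x :: q).
  by apply: ap => w; rewrite !inE => /orP[/eqP ->|/eqP ->]; [constructor 1|constructor 3].
have e4 : path adj b1 [:: tgt b1] by rewrite /= adj_tgt.
have e5 : path adj b2 [:: tgt b2] by rewrite /= adj_tgt.
have := wind_paths vk pp1 xq a1; have := wind_paths vk pp2 xq a2; have := wind_paths vk pp3 xq a3.
have := wind_paths vk e4 xq a4; have := wind_paths vk e5 xq a5.
rewrite l1 l2 l3 /= !wind_cons2 !wind1 !w1 !w2 !w3 /turn; xor.
Qed.

(** The increment from [par c] to [c] does not depend on the return edge, by [two_cycles_const] for
    the single step from [par c] to its parent. So [o] can be built downwards, with an arbitrary
    admissible edge [b0] as witness. *)
Lemma orientation_exists : exists o : nat -> bool, forall c b, ret c b -> ret (par c) b ->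
  o c = o (par c) (+) turn (par (par c)) b (+) turn (par c) b.
Proof.
suff H k : exists o : nat -> bool, forall c b, c < k -> ret c b -> ret (par c) b ->
    o c = o (par c) (+) turn (par (par c)) b (+) turn (par c) b.
  have [o oP] := H (\max_(x <- B) x).+1; exists o => c b rc; apply: oP => //.
  by case/and4P: rc => bB /anc_leq cb _ _; rewrite ltnS (leq_trans cb) // leq_bigmax_seq.
elim: k => [|k [o oP]]; first by exists (fun=> false).
pose bs := [seq b <- B | ret k b && ret (par k) b].
pose b0 := nth 0 bs 0.
exists (fun c => if c == k then o (par k) (+) turn (par (par k)) b0 (+) turn (par k) b0 else o c).
move=> c b ck rc rpc; have c0 : 0 < c by case/and4P: rc.
have pc := par_lt c0; have pck : (par c == k) = false by apply/eqP; move: ck pc; clear; lia.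
rewrite pck; case: eqP => [e|nck]; last by apply: oP => //; move: ck nck; clear; lia.
move: rc rpc; rewrite e => rk rpk; case/and4P: (rk) => bB _ _ _.
have bbs : b \in bs by rewrite mem_filter rk rpk.
have : b0 \in bs by apply: mem_nth; case: (bs) bbs.
rewrite mem_filter => /andP[/andP[rk0 rpk0] _].
have ppk : 0 < par (par k).
  by case/and4P: rpk0 => b0B _ _; apply: leq_trans.
have k0 : 0 < k by rewrite -e.
have pk0 : 0 < par k by case/and4P: rpk0.
have := @two_cycles_const b b0 k (par k) [:: par (par k)] rk rk0.
rewrite /= adj_par // => /(_ isT) H.
have {H} : turn (par k) b (+) turn (par k) b0 = turn (par (par k)) b (+) turn (par (par k)) b0.
  apply: H => z zi; split.
    apply/negP => /anc_leq; move: zi (par_lt k0) (par_lt pk0); rewrite !inE.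
    by move=> /orP[/eqP ->|/eqP ->]; clear; lia.
  right; case/and4P: rpk rpk0 (par_lt pk0) => _ _ _ t1 /and4P[_ _ _ t2] pp.
  by move: zi; rewrite !inE => /orP[/eqP ->|/eqP ->] //; move: t1 t2 pp; clear; lia.
by xor.
Qed.

(** Thanks to [o] the right-hand side is the same at every [c] of which [b] is a return edge, and it
    can be evaluated at [b] itself. *)
Lemma sides_exist : exists (o lam : nat -> bool), forall c b, ret c b -> lam b = turn (par c) b (+) o c.
Proof.
have [o oP] := orientation_exists.
exists o, (fun b => turn (par b) b (+) o b) => c b rc.
case/and4P: (rc) => bB cb c0 tc.
suff H d : anc c d -> anc d b -> turn (par d) b (+) o d = turn (par c) b (+) o c by apply: H; rewrite ?anc_refl.
elim/ltn_ind: d => d IH cd db; have [->//|ncd] := eqVneq c d.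
have d0 : 0 < d := leq_trans c0 (anc_leq cd).
have cpd : anc c (par d) by rewrite anc_par // cd.
have pdb : anc (par d) b by apply: anc_trans db; rewrite ancE // anc_refl orbT.
rewrite -(IH _ (par_lt d0) cpd pdb).
have pd0 : 0 < par d := leq_trans c0 (anc_leq cpd).
have cmono x : anc c x -> par c <= par x.
  move=> cx; have [<-//|nx] := eqVneq c x.
  have x0 : 0 < x := leq_trans c0 (anc_leq cx).
  by have := anc_leq (y := par x) (x := c); rewrite anc_par // cx nx => /(_ isT); have := par_lt c0; clear; lia.
have rd : ret d b by rewrite /ret bB db d0 (leq_trans tc) ?cmono.
have rpd : ret (par d) b by rewrite /ret bB pdb pd0 (leq_trans tc) ?cmono.
have := oP d b rd rpd; xor.
Qed.

Definition top b := head 0 [seq c <- chain b | (0 < c) && (par c == 0)].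

Lemma topP b : 0 < b -> [/\ 0 < top b, par (top b) = 0 & anc (top b) b].
Proof.
move=> b0; have [|r [r0 pr rb]] := anc_child (anc_root b); first by rewrite eq_sym -lt0n.
suff : top b \in [seq c <- chain b | (0 < c) && (par c == 0)].
  by rewrite mem_filter => /andP[/andP[-> /eqP ->]].
have : r \in [seq c <- chain b | (0 < c) && (par c == 0)] by rewrite mem_filter r0 pr eqxx.
by rewrite /top; case: filter => //= x l _; rewrite mem_head.
Qed.

Lemma top_uniq b r : 0 < b -> 0 < r -> par r = 0 -> anc r b -> r = top b.
Proof.
move=> b0 r0 pr rb; have [t0 pt tb] := topP b0; apply/eqP/negPn/negP => /eqP ne.
by apply: sibling_apart ne rb tb; rewrite ?pr ?pt.
Qed.

Lemma top_leq b x : 0 < b -> 0 < x -> anc x b -> anc (top b) x.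
Proof.
move=> b0 x0 xb; have [t0 pt tx] := topP x0.
by rewrite -(top_uniq b0 t0 pt (anc_trans tx xb)).
Qed.

(* In the fork at [par c = par c'], the cycles of two back edges below [c] that
   stay below the target of one below [c'] are on the same side. *)
Definition same_rule (lam : nat -> bool) := forall c c' b1 b2 b0, par c = par c' -> c <> c' ->
  ret c b1 -> ret c b2 -> ret c' b0 -> tgt b0 < tgt b1 -> tgt b0 < tgt b2 -> lam b1 = lam b2.

Definition differ_rule (lam : nat -> bool) := forall c c' b b' b0 b0', par c = par c' -> c <> c' ->
  ret c b -> ret c' b' -> ret c b0 -> ret c' b0' -> tgt b0' < tgt b -> tgt b0 < tgt b' ->
  lam b = ~~ lam b'.

Definition align_rule (lam : nat -> bool) := forall u b1 b2, b1 \in B -> b2 \in B ->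
  anc u b1 -> anc u b2 -> tgt b1 = tgt b2 -> tgt b1 < u ->
  (forall b, b \in B -> anc u b -> tgt b1 <= tgt b) -> lam b1 = lam b2.

(** The walk from the fork down to [b0], along this back edge and up to [top b0] avoids the curve
    formed by [b1] and [b2], because [b0] starts in a sibling branch and ends nearer to the root
    than both targets. Hence the fork and the top of the component see the same winding; adding
    [turn (top b) b] measures sides relative to that top. *)
Lemma same_side : exists o lam, (forall c b, ret c b -> lam b = turn (par c) b (+) o c) /\
  same_rule (fun b => lam b (+) turn (top b) b).
Proof.
have [o [lam lamP]] := sides_exist; exists o, lam; split=> //.
move=> c c' b1 b2 b0 pc nc r1 r2 r0 t1 t2.
case/and4P: (r1) => b1B cb1 c0 t1c; case/and4P: (r2) => b2B cb2 _ t2c.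
case/and4P: (r0) => b0B c'b0 c'0 t0c'.
have [t00 _ ta0] := tgtP b0B.
set u := par c in pc t1c t2c.
have u0 : 0 < u by apply: leq_trans t1c.
have uc : anc u c by rewrite ancE // anc_refl orbT.
have uc' : anc u c' by rewrite pc ancE // anc_refl orbT.
have ub0 := anc_trans uc' c'b0.
have [p [pp lp mp _]] := descend_path u0 ub0.
have b00 := B_gt0 b0B; have [r0' pr0 rb0] := topP b00.
have rt : anc (top b0) (tgt b0) by apply: top_leq.
have [q [pq lq mq _]] := climb_path r0' rt.
have tb0 : top b0 = top b1.
  apply: top_uniq (B_gt0 b1B) r0' pr0 _; apply: anc_trans (anc_trans _ uc) cb1.
  exact: top_leq.
have tb2 : top b0 = top b2.
  apply: top_uniq (B_gt0 b2B) r0' pr0 _; apply: anc_trans (anc_trans _ uc) cb2.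
  exact: top_leq.
have pth : path adj u (p ++ tgt b0 :: q) by rewrite cat_path pp /= lp adj_tgt.
have := @two_cycles_const b1 b2 c u (p ++ tgt b0 :: q) r1 r2 pth.
rewrite last_cat /= lq => H.
rewrite (lamP c b1 r1) (lamP c b2 r2) -tb2 -tb0 -/u.
suff H2 : turn u b1 (+) turn u b2 = turn (top b0) b1 (+) turn (top b0) b2 by move: H2; clear; xor.
apply: H => z; rewrite -cat_cons mem_cat mp mq.
have uc_lt : u < c by apply: par_lt.
move=> /orP[/andP[uz zb0]|/andP[_ ztb0]]; last first.
  have := anc_leq ztb0 => zt; split; last by left; move: zt t1 t2; clear; lia.
  by apply/negP => /anc_leq cz; move: zt t1 t1c uc_lt cz; clear; lia.
split; last by right; move: (anc_leq uz) t1c t2c; clear; lia.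
apply/negP => cz; apply: (sibling_apart c0 c'0 _ nc (anc_trans cz zb0) c'b0).
exact: pc.
Qed.

Section Fork.
Variables c c' : nat.
Hypotheses (pcc' : par c = par c') (ncc' : c <> c') (c0 : 0 < c) (c'0 : 0 < c').
Let u := par c.

(* Around the fork [u] a vertex is located by its number, for a vertex of the
   trunk above [u], or by the branch [c] or [c'] it belongs to. *)
Definition located (S : pred nat) (x y : bool) w :=
  [|| (w <= u) && S w, x && anc c w | y && anc c' w].

Lemma located_apart S1 x1 y1 S2 x2 y2 p q :
  (forall w, w \in p -> located S1 x1 y1 w) -> (forall w, w \in q -> located S2 x2 y2 w) ->
  (forall w, S1 w -> S2 w -> w <= u -> False) -> ~~ (x1 && x2) -> ~~ (y1 && y2) -> apart p q.
Proof.
move=> pp qq S12 x12 y12; apply/hasPn => w /pp wp; apply/negP => /qq wq.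
have lc x : par x = u -> 0 < x -> anc x w -> (w <= u) = false.
  by move=> px x0 /anc_leq xw; apply/negbTE; rewrite -ltnNge -px (leq_trans (par_lt x0)).
have nu x : par x = u -> 0 < x -> anc x w -> w <= u -> False.
  by move=> px x0 /anc_leq xw; rewrite leqNgt -px (leq_trans (par_lt x0)).
have sib := sibling_apart c0 c'0 pcc' ncc'.
case/or3P: wp => /andP[h1 h2]; case/or3P: wq => /andP[h3 h4].
- exact: (S12 w).
- exact: (nu c).
- exact: (nu c').
- exact: (nu c).
- by rewrite h1 h3 in x12.
- exact: (sib w).
- exact: (nu c').
- exact: (sib w).
- by rewrite h1 h3 in y12.
Qed.

Lemma descend_branch x y : (x == c) || (x == c') -> 0 < u -> anc x y ->
  exists p, [/\ path adj u p, last u p = y,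
    forall w, w \in u :: p -> w = u \/ anc x w &
    forall d, wind n d (u :: p) = wind n d (chain y) (+) wind n d (chain u)].
Proof.
move=> xc u0 xy; have [x0 px] : 0 < x /\ par x = u by case/orP: xc => /eqP ->.
have [p [pp lp mp wp]] := descend_path x0 xy.
exists (x :: p); split=> //=; first by rewrite pp andbT adj_sym -px adj_par // px.
  by move=> w; rewrite inE mp => /orP[/eqP ->|/andP[]]; [left|right].
move=> d; have cx : chain x = [:: x, u & chain (par u)] by rewrite (chainE x0) px (chainE u0).
case: vk => _ sym _.
rewrite wind_cons2 wp cx wind_cons2 (chainE u0) (sym d u x); xor.
Qed.

Lemma located_ret_target b x : (x == c) || (x == c') -> ret x b -> [/\ anc (tgt b) u, 0 < tgt b & tgt b < u].
Proof.
move=> xc /and4P[bB xb x0 tx]; have [t0 _ tb] := tgtP bB.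
have px : par x = u by case/orP: xc => /eqP ->.
have ux : anc u x by rewrite ancE // px anc_refl orbT.
by split=> //; [apply: anc_total tb (anc_trans ux xb) _; rewrite -px ltnW | rewrite -px].
Qed.

(** Branching happens at vertices only, so [par u] is a subdividing node, whereas targets are
    vertices. The strict inequality makes [par u] an inner point of the chord from [u] up to the
    target. *)
Lemma fork_parent b x : (x == c) || (x == c') -> ret x b ->
  [/\ 0 < par u, tgt b < par u, E (par u) & ret u b].
Proof.
move=> xc rx; have [ta t0 tu] := located_ret_target xc rx.
have u0 : 0 < u := leq_trans t0 (ltnW tu).
have tp : anc (tgt b) (par u) by rewrite anc_par // ta neq_ltn tu.
have pu0 : 0 < par u := leq_trans t0 (anc_leq tp).
have Eu : E u = false by apply: (E_fork c0 c'0).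
case/and4P: rx => bB xb x0 tx.
have Epu : E (par u) by have := E_par pu0; rewrite Eu => /esym/negbFE.
have tpu : tgt b < par u.
  rewrite ltn_neqAle anc_leq // andbT; apply/eqP => e.
  by move: Epu; rewrite -e E_tgt.
split=> //; rewrite /ret bB u0 tpu /= andbT; apply: (anc_trans _ xb).
have px : par x = u by case/orP: xc => /eqP ->.
by rewrite ancE // px anc_refl orbT.
Qed.

Lemma located_up lo hi w : anc lo w -> anc w hi -> hi <= u -> located (fun x => lo <= x <= hi) false false w.
Proof.
by move=> /anc_leq h1 /anc_leq h2 h3; rewrite /located h1 h2 (leq_trans h2 h3).
Qed.

(** [overlapping_chords] for the sum of the two fundamental cycles, with corners [u], [tgt b],
    [tgt b'] and the meet [z] of [b'] and [b0']. One chord is the tree path from [u] through [par u]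
    to [tgt b']; the other climbs from [tgt b] to [tgt b0'] and goes back along [b0'] to [z]. The
    tree path above [tgt b0'] avoids the cycle, so this marked point sees it as the top does. *)
Lemma opposite_lt b b' b0' : ret c b -> ret c' b' -> ret c' b0' -> tgt b < tgt b' -> tgt b0' < tgt b ->
  turn (par u) b (+) turn (par u) b' (+) (turn (top b) b (+) turn (top b) b') = true.
Proof.
move=> rb rb' rb0 tbb' tb0b.
have cc : (c == c) || (c == c') by rewrite eqxx.
have cc1 : (c' == c) || (c' == c') by rewrite eqxx orbT.
have [ta t0 tu] := located_ret_target cc rb.
have [ta' t0' tu'] := located_ret_target cc1 rb'.
have [ta0 t00 tu0] := located_ret_target cc1 rb0.
have [pu0 tpu' _ _] := fork_parent cc1 rb'.
have [bB cb _ _] := and4P rb; have [b'B cb' _ _] := and4P rb'; have [b0B cb0 _ _] := and4P rb0.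
have u0 : 0 < u := leq_trans t0 (ltnW tu).
have uc : anc u c by rewrite ancE // anc_refl orbT.
have uc' : anc u c' by rewrite /u pcc' ancE // anc_refl orbT.
have [z [zb' zb0 zmax]] := meet_exists b' b0'.
have cz := zmax _ cb' cb0; have z0 : 0 < z := leq_trans c'0 (anc_leq cz).
have [p12 [P12 L12 M12 W12]] := descend_branch cc u0 cb.
have aa' : anc (tgt b) (tgt b') by apply: anc_total ta ta' (ltnW tbb').
have a0a : anc (tgt b0') (tgt b) by apply: anc_total ta0 ta (ltnW tb0b).
have [p23 [P23 L23 M23 W23]] := descend_path t0 aa'.
have [p34 [P34 L34 M34 W34]] := climb_path z0 zb'.
have [p14 [P14 L14 M14 W14]] := descend_branch cc1 u0 cz.
have a'p : anc (tgt b') (par u) by rewrite anc_par // ta' neq_ltn tu'.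
have [r13 [R13 LR13 MR13 _]] := climb_path t0' a'p.
have [s24 [S24 LS24 MS24 _]] := climb_path t00 a0a.
have [r24 [R24 LR24 MR24 _]] := climb_path z0 zb0.
have [rr0 prr rrb] := topP (B_gt0 bB).
have rt : anc (top b) (tgt b0').
  by apply: top_leq (B_gt0 bB) t00 _; apply: anc_trans (anc_trans ta0 uc) cb.
have [q [PQ LQ MQ _]] := climb_path rr0 rt.
have l12 : forall w, w \in u :: rcons p12 (tgt b) -> located (fun x => (x == u) || (x == tgt b)) true false w.
  move=> w; rewrite -rcons_cons mem_rcons inE => /orP[/eqP ->|/M12[->|cw]].
  - by rewrite /located eqxx orbT ltnW.
  - by rewrite /located leqnn eqxx.
  - by rewrite /located cw orbT.
have l23 : forall w, w \in tgt b :: p23 -> located (fun x => tgt b <= x <= tgt b') false false w.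
  by move=> w; rewrite M23 => /andP[? ?]; apply: located_up => //; exact: ltnW.
have l34 : forall w, w \in tgt b' :: b' :: p34 -> located (pred1 (tgt b')) false true w.
  move=> w; rewrite inE M34 => /orP[/eqP ->|/andP[zw _]].
    by rewrite /located /= eqxx ltnW.
  by rewrite /located (anc_trans cz zw) !orbT.
have l14 : forall w, w \in u :: p14 -> located (pred1 u) false true w.
  by move=> w /M14[->|cw]; rewrite /located /= ?leqnn ?eqxx // cw !orbT.
have uu : anc (par u) u by rewrite ancE // anc_refl orbT.
have l13 : forall w, w \in u :: par u :: r13 -> located (fun x => tgt b' <= x <= u) false false w.
  move=> w; rewrite inE MR13 => /orP[/eqP ->|/andP[h1 h2]].
    by rewrite /located leqnn ltnW.
  by apply: located_up => //; exact: anc_trans uu.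
have l13s : forall w, w \in [:: u; par u] -> located (fun x => (x == u) || (x == par u)) false false w.
  by move=> w; rewrite !inE => h; rewrite /located h andbT; case/orP: h => /eqP ->; rewrite ?leqnn // ltnW // par_lt.
have l13r : forall w, w \in par u :: r13 -> located (fun x => tgt b' <= x <= par u) false false w.
  by move=> w; rewrite MR13 => /andP[? ?]; apply: located_up => //; rewrite ltnW // par_lt.
have l24 : forall w, w \in tgt b :: s24 ++ b0' :: r24 -> located (fun x => tgt b0' <= x <= tgt b) false true w.
  move=> w; rewrite -cat_cons mem_cat MS24 MR24 => /orP[/andP[h1 h2]|/andP[zw _]].
    have := located_up h1 h2 (ltnW tu); rewrite /located => /orP[->//|]; by rewrite orbF.
  by rewrite /located (anc_trans cz zw) !orbT.
have l24s : forall w, w \in tgt b :: s24 -> located (fun x => tgt b0' <= x <= tgt b) false false w.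
  by move=> w; rewrite MS24 => /andP[? ?]; apply: located_up => //; exact: ltnW.
have l24r : forall w, w \in tgt b0' :: b0' :: r24 -> located (pred1 (tgt b0')) false true w.
  move=> w; rewrite inE MR24 => /orP[/eqP ->|/andP[zw _]].
    by rewrite /located /= eqxx ltnW.
  by rewrite /located (anc_trans cz zw) !orbT.
have lq : forall w, w \in tgt b0' :: q -> located (fun x => x <= tgt b0') false false w.
  move=> w; rewrite MQ => /andP[_ /anc_leq h]; rewrite /located h (leq_trans h) // ltnW //.
have pu := par_lt u0.
have sym : forall x y, adj x y = adj y x by exact: adj_sym.
have e12 : path adj u (rcons p12 (tgt b)) /\ last u (rcons p12 (tgt b)) = tgt b.
  by rewrite rcons_path P12 L12 last_rcons adj_tgt.
have e34 : path adj (tgt b') (b' :: p34) /\ last (tgt b') (b' :: p34) = z.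
  by rewrite /= P34 sym adj_tgt.
have e13 : path adj u ([:: par u] ++ r13) /\ last (last u [:: par u]) r13 = tgt b'.
  by rewrite /= adj_par.
have e24 : path adj (tgt b) (s24 ++ b0' :: r24) /\ last (last (tgt b) s24) (b0' :: r24) = z.
  by rewrite cat_path /= S24 LS24 R24 LR24 sym adj_tgt.
have dm x y : y \in B -> anc x y -> 0 < x -> dom x := @dom_anc y x.
(* Within the trunk, apartness is a comparison of numbers; [num] supplies [lia] with the chain of
   inequalities from [tgt b0'] up to [u]. *)
have num S1 S2 : (forall w : nat, S1 w -> S2 w -> w <= u -> tgt b0' < tgt b -> tgt b < tgt b' -> tgt b' < par u ->
    par u < u -> False) -> forall w, S1 w -> S2 w -> w <= u -> False.
  by move=> H w s1 s2 wu; apply: (H w).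
Ltac fork_apart num la lb := apply: (located_apart la lb) => //; apply: num; clear => /=; lia.
have t13 : last u [:: par u] = par u by [].
have := @overlapping_chords _ dom adj lt n vk u (tgt b) (tgt b') z (rcons p12 (tgt b)) p23 (b' :: p34) p14
  [:: par u] r13 s24 (b0' :: r24) e12 (conj P23 L23) e34 (conj P14 L14) e13 e24.
rewrite LS24 t13 => /(_ ltac:(fork_apart num l12 l34) ltac:(fork_apart num l14 l23)
  ltac:(fork_apart num l13 l24) ltac:(fork_apart num l13s l23) ltac:(fork_apart num l13s l34)
  ltac:(fork_apart num l13r l12) ltac:(fork_apart num l13r l14) ltac:(fork_apart num l24s l34)
  ltac:(fork_apart num l24s l14) ltac:(fork_apart num l24r l12) ltac:(fork_apart num l24r l23)).
have ub : anc u b := anc_trans uc cb.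
move=> /(_ (dm _ _ bB (anc_trans ta ub) t0) (dm _ _ bB (anc_trans ta' ub) t0') (dm _ _ b'B zb' z0)).
have Q1 : apart (u :: rcons p12 (tgt b)) (tgt b0' :: q) by fork_apart num l12 lq.
have Q2 : apart (tgt b :: p23) (tgt b0' :: q) by fork_apart num l23 lq.
have Q3 : apart (tgt b' :: b' :: p34) (tgt b0' :: q) by fork_apart num l34 lq.
have Q4 : apart (u :: p14) (tgt b0' :: q) by fork_apart num l14 lq.
have := wind_paths vk e12.1 PQ Q1; have := wind_paths vk P23 PQ Q2.
have := wind_paths vk e34.1 PQ Q3; have := wind_paths vk P14 PQ Q4.
case: vk => _ nsym _.
rewrite LQ L23 L14 e12.2 e34.2 -!rcons_cons !wind_rcons L12 !wind_cons2 !W12 !W23 !W34 !W14 /turn.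
rewrite !(nsym _ (tgt b') b'); xor.
Qed.
(** With a common target the corners become [u], the meet [y] of [b] and [b0], the target, and the
    meet [z] of [b'] and [b0']. The second chord follows [b0], the trunk between the targets of [b0]
    and [b0'], and then [b0'] backwards. *)
Lemma opposite_eq b b' b0 b0' : ret c b -> ret c' b' -> ret c b0 -> ret c' b0' ->
  tgt b = tgt b' -> tgt b0 < tgt b -> tgt b0' < tgt b ->
  turn (par u) b (+) turn (par u) b' (+) (turn (top b) b (+) turn (top b) b') = true.
Proof.
move=> rb rb' rb0 rb0' tbb' tb0b tb0b'.
have cc : (c == c) || (c == c') by rewrite eqxx.
have cc1 : (c' == c) || (c' == c') by rewrite eqxx orbT.
have [ta t0 tu] := located_ret_target cc rb.
have [ta0 t00 tu0] := located_ret_target cc rb0.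
have [ta0' t00' tu0'] := located_ret_target cc1 rb0'.
have [pu0 tpu _ _] := fork_parent cc rb.
have [bB cb _ _] := and4P rb; have [b'B cb' _ _] := and4P rb'.
have [b0B cb0 _ _] := and4P rb0; have [b0'B cb0' _ _] := and4P rb0'.
have u0 : 0 < u := leq_trans t0 (ltnW tu).
have uc : anc u c by rewrite ancE // anc_refl orbT.
have [z [zb' zb0' zmax]] := meet_exists b' b0'.
have cz := zmax _ cb' cb0'; have z0 : 0 < z := leq_trans c'0 (anc_leq cz).
have [y [yb yb0 ymax]] := meet_exists b b0.
have cy := ymax _ cb cb0; have y0 : 0 < y := leq_trans c0 (anc_leq cy).
have [p12 [P12 L12 M12 W12]] := descend_branch cc u0 cy.
have [p23 [P23 L23 M23 W23]] := descend_path y0 yb.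
have [p34 [P34 L34 M34 W34]] := climb_path z0 zb'.
have [p14 [P14 L14 M14 W14]] := descend_branch cc1 u0 cz.
have ap : anc (tgt b) (par u) by rewrite anc_par // ta neq_ltn tu.
have [r13 [R13 LR13 MR13 _]] := climb_path t0 ap.
have [s24 [S24 LS24 MS24 _]] := descend_path y0 yb0.
have [m24 [m24P m24L m24M]] : exists m, [/\ path adj (tgt b0) m, last (tgt b0) m = tgt b0' &
    forall w, w \in tgt b0 :: m -> w < tgt b].
  case/orP: (leq_total (tgt b0) (tgt b0')) => le.
    have [m [mP mL mM _]] := descend_path t00 (anc_total ta0 ta0' le).
    by exists m; split=> // w; rewrite mM => /andP[_ /anc_leq h]; apply: leq_ltn_trans h _.
  have [m [mP mL mM _]] := climb_path t00' (anc_total ta0' ta0 le).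
  by exists m; split=> // w; rewrite mM => /andP[_ /anc_leq h]; apply: leq_ltn_trans h _.
have [r24 [R24 LR24 MR24 _]] := climb_path z0 zb0'.
have [rr0 prr rrb] := topP (B_gt0 bB).
have rt : anc (top b) (tgt b0).
  by apply: top_leq (B_gt0 bB) t00 _; apply: anc_trans (anc_trans ta0 uc) cb.
have [q [PQ LQ MQ _]] := climb_path rr0 rt.
have l12 : forall w, w \in u :: p12 -> located (pred1 u) true false w.
  by move=> w /M12[->|cw]; rewrite /located /= ?leqnn ?eqxx // cw !orbT.
have l23 : forall w, w \in y :: rcons p23 (tgt b) -> located (pred1 (tgt b)) true false w.
  move=> w; rewrite -rcons_cons mem_rcons inE M23 => /orP[/eqP ->|/andP[yw _]].
    by rewrite /located /= eqxx ltnW.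
  by rewrite /located (anc_trans cy yw) !orbT.
have l34 : forall w, w \in tgt b :: b' :: p34 -> located (pred1 (tgt b)) false true w.
  move=> w; rewrite inE M34 => /orP[/eqP ->|/andP[zw _]].
    by rewrite /located /= eqxx ltnW.
  by rewrite /located (anc_trans cz zw) !orbT.
have l14 : forall w, w \in u :: p14 -> located (pred1 u) false true w.
  by move=> w /M14[->|cw]; rewrite /located /= ?leqnn ?eqxx // cw !orbT.
have pu := par_lt u0.
have uu : anc (par u) u by rewrite ancE // anc_refl orbT.
have l13 : forall w, w \in u :: par u :: r13 -> located (fun x => tgt b <= x <= u) false false w.
  move=> w; rewrite inE MR13 => /orP[/eqP ->|/andP[h1 h2]].
    by rewrite /located leqnn ltnW.
  by apply: located_up => //; exact: anc_trans uu.
have l13s : forall w, w \in [:: u; par u] -> located (fun x => (x == u) || (x == par u)) false false w.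
  by move=> w; rewrite !inE => h; rewrite /located h andbT; case/orP: h => /eqP ->; rewrite ?leqnn // ltnW // par_lt.
have l13r : forall w, w \in par u :: r13 -> located (fun x => tgt b <= x <= par u) false false w.
  by move=> w; rewrite MR13 => /andP[? ?]; apply: located_up => //; rewrite ltnW // par_lt.
have l24s : forall w, w \in y :: rcons s24 (tgt b0) -> located (pred1 (tgt b0)) true false w.
  move=> w; rewrite -rcons_cons mem_rcons inE MS24 => /orP[/eqP ->|/andP[yw _]].
    by rewrite /located /= eqxx ltnW.
  by rewrite /located (anc_trans cy yw) !orbT.
have l24r : forall w, w \in tgt b0 :: m24 ++ b0' :: r24 -> located (fun x => x < tgt b) false true w.
  move=> w; rewrite -cat_cons mem_cat MR24 => /orP[/m24M h|/andP[zw _]].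
    by rewrite /located h ltnW // (ltn_trans h).
  by rewrite /located (anc_trans cz zw) !orbT.
have l24 : forall w, w \in y :: rcons s24 (tgt b0) ++ m24 ++ b0' :: r24 -> located (fun x => x < tgt b) true true w.
  move=> w; rewrite -cat_cons mem_cat => /orP[/l24s|h].
    rewrite /located /= => /or3P[/andP[_ /eqP ->]|->|//]; rewrite ?orbT //.
    by rewrite ltnW //= tb0b.
  have := l24r w; rewrite inE h orbT => /(_ isT); rewrite /located => /or3P[->//|//|->].
  by rewrite !orbT.
have lq : forall w, w \in tgt b0 :: q -> located (fun x => x <= tgt b0) false false w.
  by move=> w; rewrite MQ => /andP[_ /anc_leq h]; rewrite /located h (leq_trans h) // ltnW.
have sym : forall x y, adj x y = adj y x by exact: adj_sym.
have e23 : path adj y (rcons p23 (tgt b)) /\ last y (rcons p23 (tgt b)) = tgt b.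
  by rewrite rcons_path P23 L23 last_rcons adj_tgt.
have e34 : path adj (tgt b) (b' :: p34) /\ last (tgt b) (b' :: p34) = z.
  by rewrite /= P34 sym tbb' adj_tgt.
have e13 : path adj u ([:: par u] ++ r13) /\ last (last u [:: par u]) r13 = tgt b.
  by rewrite /= adj_par.
have e24 : path adj y (rcons s24 (tgt b0) ++ m24 ++ b0' :: r24) /\
    last (last y (rcons s24 (tgt b0))) (m24 ++ b0' :: r24) = z.
  rewrite last_rcons !cat_path last_cat rcons_path last_rcons /= S24 LS24 m24P m24L R24 LR24.
  by rewrite adj_tgt // sym adj_tgt.
have dm x w : w \in B -> anc x w -> 0 < x -> dom x := @dom_anc w x.
have num S1 S2 : (forall w : nat, S1 w -> S2 w -> w <= u -> tgt b0' < tgt b -> tgt b0 < tgt b -> tgt b < par u ->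
    par u < u -> False) -> forall w, S1 w -> S2 w -> w <= u -> False.
  by move=> H w s1 s2 wu; apply: (H w).
have t13 : last u [:: par u] = par u by [].
have t24 : last y (rcons s24 (tgt b0)) = tgt b0 by rewrite last_rcons.
have := @overlapping_chords _ dom adj lt n vk u y (tgt b) z p12 (rcons p23 (tgt b)) (b' :: p34) p14
  [:: par u] r13 (rcons s24 (tgt b0)) (m24 ++ b0' :: r24) (conj P12 L12) e23 e34 (conj P14 L14) e13 e24.
rewrite t24 t13 => /(_ ltac:(fork_apart num l12 l34) ltac:(fork_apart num l14 l23)
  ltac:(fork_apart num l13 l24) ltac:(fork_apart num l13s l23) ltac:(fork_apart num l13s l34)
  ltac:(fork_apart num l13r l12) ltac:(fork_apart num l13r l14) ltac:(fork_apart num l24s l34)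
  ltac:(fork_apart num l24s l14) ltac:(fork_apart num l24r l12) ltac:(fork_apart num l24r l23)).
have ub : anc u b := anc_trans uc cb.
move=> /(_ (dm _ _ bB yb y0) (dm _ _ bB (anc_trans ta ub) t0) (dm _ _ b'B zb' z0)).
have Q1 : apart (u :: p12) (tgt b0 :: q) by fork_apart num l12 lq.
have Q2 : apart (y :: rcons p23 (tgt b)) (tgt b0 :: q) by fork_apart num l23 lq.
have Q3 : apart (tgt b :: b' :: p34) (tgt b0 :: q) by fork_apart num l34 lq.
have Q4 : apart (u :: p14) (tgt b0 :: q) by fork_apart num l14 lq.
have := wind_paths vk P12 PQ Q1; have := wind_paths vk e23.1 PQ Q2.
have := wind_paths vk e34.1 PQ Q3; have := wind_paths vk P14 PQ Q4.
case: vk => _ nsym _.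
rewrite LQ L12 L14 e23.2 e34.2 -!rcons_cons !wind_rcons L23 !wind_cons2 !W12 !W23 !W34 !W14 /turn -tbb'.
rewrite !(nsym _ (tgt b) b'); xor.
Qed.
End Fork.

(** The order of the two targets selects the chord: [b0'] if [tgt b] is smaller, [b0] with the
    branches exchanged if it is larger, both in case of equality. *)
Lemma opposite_sides o lam : (forall c b, ret c b -> lam b = turn (par c) b (+) o c) ->
  differ_rule (fun b => lam b (+) turn (top b) b).
Proof.
move=> lamP c c' b b' b0 b0' pcc' ncc' rb rb' rb0 rb0' h1 h2.
have [c0 c'0] : 0 < c /\ 0 < c' by case/and4P: rb; case/and4P: rb'.
have cc : (c == c) || (c == c') by rewrite eqxx.
have cc1 : (c' == c) || (c' == c') by rewrite eqxx orbT.
have [pu0 _ _ ub] := fork_parent pcc' ncc' c0 c'0 cc rb.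
have [_ _ _ ub'] := fork_parent pcc' ncc' c0 c'0 cc1 rb'.
have tt : top b = top b'.
  case/and4P: rb => bB _ _ _; case/and4P: rb' => b'B _ _ _; case/and4P: ub => _ uab u0 _.
  case/and4P: ub' => _ uab' _ _; have [t0 pt tb] := topP (B_gt0 bB).
  by apply: (top_uniq (B_gt0 b'B) t0 pt); apply: anc_trans uab'; apply: top_leq (B_gt0 bB) u0 uab.
have := lamP _ _ ub; have := lamP _ _ ub'; rewrite -tt.
case: (ltngtP (tgt b) (tgt b')) => [lt'|lt'|e].
- by have := opposite_lt pcc' ncc' c0 c'0 rb rb' rb0' lt' h1; xor.
- have := opposite_lt (esym pcc') (nesym ncc') c'0 c0 rb' rb rb0 lt' h2.
  by rewrite -pcc' -tt; xor.
- by rewrite -e in h2; have := opposite_eq pcc' ncc' c0 c'0 rb rb' rb0 rb0' e h2 h1; xor.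
Qed.

Definition lower_sibling c b c' b0 :=
  [&& par c == par c', c != c', ret c b, ret c' b0 & tgt b0 < tgt b].

(** The back edges on which [same_rule] or [differ_rule] imposes something; the side of any other is
    a free choice. *)
Definition constrained b :=
  has (fun b0 => has (fun c => has (fun c' => lower_sibling c b c' b0) (iota 0 b0.+1)) (iota 0 b.+1)) B.

Lemma constrainedP b : reflect (exists c c' b0, lower_sibling c b c' b0) (constrained b).
Proof.
apply: (iffP hasP) => [[b0 _ /hasP[c _ /hasP[c' _ h]]]|[c [c' [b0 h]]]]; first by exists c, c', b0.
case/and5P: (h) => _ _ /and4P[_ cb _ _] /and4P[b0B c'b0 _ _] _.
exists b0 => //; apply/hasP; exists c; first by rewrite mem_iota /= add0n ltnS anc_leq.
by apply/hasP; exists c'; rewrite // mem_iota /= add0n ltnS anc_leq.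
Qed.

(** Free edges all get the side [false], so alignment can fail only if [b1] or [b2] is constrained.
    The branch [c] that constrains one of them contains [u]: otherwise the sibling edge would start
    below [u] and end nearer to the root than [tgt b1]. Hence [c] contains both edges, and
    [same_rule] applies. *)
Theorem lr_sides_exist : exists lam, [/\ same_rule lam, differ_rule lam & align_rule lam].
Proof.
have [o [lam0 [lamP same]]] := same_side; have diff := opposite_sides lamP.
pose lam b := lam0 b (+) turn (top b) b.
have conI c c' b b0 : par c = par c' -> c <> c' -> ret c b -> ret c' b0 -> tgt b0 < tgt b -> constrained b.
  move=> pc /eqP nc rb rb0 lt0; apply/constrainedP; exists c, c', b0.
  by rewrite /lower_sibling pc eqxx nc rb rb0.
exists (fun b => constrained b && lam b); split.
- move=> c c' b1 b2 b0 pc nc r1 r2 r0 t1 t2.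
  rewrite (conI _ _ _ _ pc nc r1 r0 t1) (conI _ _ _ _ pc nc r2 r0 t2).
  exact: (same c c' b1 b2 b0 pc nc).
- move=> c c' b b' b0 b0' pc nc r1 r2 r0 r0' t1 t2.
  rewrite (conI _ _ _ _ pc nc r1 r0' t1) (conI _ _ _ _ (esym pc) (nesym nc) r2 r0 t2).
  exact: (diff c c' b b' b0 b0').
have half u b1 b2 : b1 \in B -> b2 \in B -> anc u b1 -> anc u b2 -> tgt b1 = tgt b2 -> tgt b1 < u ->
  (forall b, b \in B -> anc u b -> tgt b1 <= tgt b) -> constrained b1 -> constrained b2 && (lam b1 == lam b2).
  move=> b1B b2B u1 u2 te tu tmin /constrainedP[c [c' [b0 /and5P[/eqP pc /eqP nc r1 r0 t0]]]].
  case/and4P: (r1) => _ cb1 c0 tc; case/and4P: (r0) => b0B c'b0 c'0 _.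
  have cu : anc c u.
    case/orP: (leq_total c u) => le; first exact: anc_total cb1 u1 le.
    have [<-|nuc] := eqVneq u c; first exact: anc_refl.
    have uc' : anc u c' by rewrite ancE // -pc anc_par // (anc_total u1 cb1 le) nuc orbT.
    by have := tmin b0 b0B (anc_trans uc' c'b0); rewrite leqNgt t0.
  have r2 : ret c b2 by rewrite /ret b2B (anc_trans cu u2) c0 -te.
  rewrite (conI _ _ _ _ pc nc r2 r0) -?te //=; apply/eqP.
  by apply: (same c c' b1 b2 b0 pc nc r1 r2 r0) => //; rewrite -te.
move=> u b1 b2 b1B b2B u1 u2 te tu tmin.
have [c1|n1] := boolP (constrained b1).
  by case/andP: (half u b1 b2 b1B b2B u1 u2 te tu tmin c1) => -> /eqP ->.
have [c2|//] := boolP (constrained b2).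
have := half u b2 b1 b2B b1B u2 u1 (esym te); rewrite -te => /(_ tu tmin c2).
by rewrite (negbTE n1).
Qed.

End Completeness.
End Tree.
End Palm.

(** * The contour word of the ordered tree *)

Module Word.
From mathcomp Require Import all_boot zify.
Import Xor Kampen Palm.

Section Word.
Variables (par : nat -> nat) (m : nat) (B : seq nat) (tgt : nat -> nat) (lam : nat -> bool).

Local Notation ret := (Palm.ret par B tgt).
Local Notation anc := (Palm.anc par).

Definition returns c := [seq b <- B | ret c b].
Definition low c := foldl minn m (map tgt (returns c)).
Definition high c := foldl maxn 0 (map tgt (returns c)).
Definition side c := has (fun b => lam b && (tgt b == high c)) (returns c).
(** Nesting depth of left-right planarity: branches are compared by their lowest target, and on a
    tie a branch with several targets comes after one with a single target. *)
Definition nest c := (low c).*2 + (low c < high c).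
(** Signed nesting depth, shifted to stay in [nat]. Left branches precede right ones, and on either
    side the branches that return soonest are outermost, since they must be closed before the
    others. *)
Definition key c := if side c then m.*2.+2 + nest c else m.*2.+2 - nest c.
Definition kids v := [seq c <- iota 1 m | par c == v].
(** Bucket sort by [key], whose range is given by [key_bound]. *)
Definition sorted_kids v :=
  flatten [seq [seq c <- kids v | key c == k] | k <- iota 0 (4 * m).+4].

(** The closing letters at [v]. The order is mirrored, so that back edges closed together on one
    side nest instead of crossing. *)
Definition attached (w : seq (bool * nat)) v s :=
  [seq l <- rev w | [&& l.1, tgt l.2 == v & lam l.2 == s]].
Definition block (w : nat -> seq (bool * nat)) v c :=
  attached (w c) v false ++ (false, c) :: w c ++ (false, c) :: attached (w c) v true.
Definition step_word (w : nat -> seq (bool * nat)) v :=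
  (if v \in B then [:: (true, v)] else [::]) ++ flatten [seq block w v c | c <- sorted_kids v].

(* The words of the last [k] vertices, the truncation being harmless. *)
Fixpoint words k : seq (seq (bool * nat)) :=
  if k is k'.+1 then
    take (4 * m).+4 (step_word (fun c => nth [::] (words k') (c - (m - k').+1)) (m - k')) :: words k'
  else [::].
Definition word v := nth [::] (words m.+1) v.

Hypothesis par_lt : forall k, 0 < k -> par k < k.
Hypothesis B_in : forall b, b \in B -> 0 < b <= m.
Hypothesis B_uniq : uniq B.
Hypothesis leafB : forall b k, b \in B -> 0 < k <= m -> par k <> b.
Hypothesis tgtP : forall b, b \in B -> [/\ 0 < tgt b, tgt b < par b & anc (tgt b) b].
Hypothesis same : same_rule par B tgt lam.
Hypothesis differ : differ_rule par B tgt lam.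
Hypothesis align : align_rule par B tgt lam.

Lemma low_le c b : ret c b -> low c <= tgt b.
Proof.
move=> rb; have : tgt b \in map tgt (returns c).
  by apply: map_f; rewrite mem_filter rb; case/and4P: rb.
rewrite /low; move: (map _ _) => s; elim/last_ind: s => // s x IH.
rewrite mem_rcons inE -cats1 foldl_cat /= geq_min => /orP[/eqP ->|/IH ->//].
by rewrite leqnn orbT.
Qed.

Lemma high_ge c b : ret c b -> tgt b <= high c.
Proof.
move=> rb; have : tgt b \in map tgt (returns c).
  by apply: map_f; rewrite mem_filter rb; case/and4P: rb.
rewrite /high; move: (map _ _) => s; elim/last_ind: s => // s x IH.
rewrite mem_rcons inE -cats1 foldl_cat /= leq_max => /orP[/eqP ->|/IH ->//].
by rewrite leqnn orbT.
Qed.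

Lemma tgt_lt_m b : b \in B -> tgt b < m.
Proof.
move=> bB; have [_ t _] := tgtP bB; have /andP[b0 bm] := B_in bB.
by apply: leq_trans bm; apply: ltn_trans t (par_lt b0).
Qed.

Lemma low_attained c b : ret c b -> exists2 b1, ret c b1 & tgt b1 = low c.
Proof.
move=> rb; suff : low c \in map tgt (returns c).
  by case/mapP => b1; rewrite mem_filter => /andP[r1 _] ->; exists b1.
have : tgt b \in map tgt (returns c).
  by apply: map_f; rewrite mem_filter rb; case/and4P: rb.
have : {in map tgt (returns c), forall x, x < m}.
  by move=> x /mapP[b1]; rewrite mem_filter => /andP[_ b1B] ->; exact: tgt_lt_m.
rewrite /low; move: (map _ _) => s sm ts.
suff : foldl minn m s \in m :: s.
  rewrite inE => /orP[/eqP e|//]; have := sm _ ts.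
  suff : foldl minn m s <= tgt b by rewrite e leqNgt => /negbTE ->.
  elim/last_ind: s ts {sm e} => // s x IH.
  rewrite mem_rcons inE -cats1 foldl_cat /= geq_min => /orP[/eqP ->|/IH ->//].
  by rewrite leqnn orbT.
elim/last_ind: s {sm ts} => [|s x IH]; first exact: mem_head.
rewrite -cats1 foldl_cat /= /minn; case: ifP => _; last by rewrite inE mem_cat !inE eqxx !orbT.
by move: IH; rewrite !inE mem_cat => /orP[->//|->]; rewrite orbT.
Qed.

Lemma high_attained c b : ret c b -> exists2 b1, ret c b1 & tgt b1 = high c.
Proof.
move=> rb; suff : high c \in map tgt (returns c).
  by case/mapP => b1; rewrite mem_filter => /andP[r1 _] ->; exists b1.
have : tgt b \in map tgt (returns c).
  by apply: map_f; rewrite mem_filter rb; case/and4P: rb.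
have : 0 < tgt b by case/and4P: rb => /tgtP[].
rewrite /high; move: (map _ _) => s t0 ts.
suff : foldl maxn 0 s \in 0 :: s.
  rewrite inE => /orP[/eqP e|//].
  suff : tgt b <= foldl maxn 0 s by rewrite e leqNgt t0.
  elim/last_ind: s ts {e} => // s x IH.
  rewrite mem_rcons inE -cats1 foldl_cat /= leq_max => /orP[/eqP ->|/IH ->//].
  by rewrite leqnn orbT.
elim/last_ind: s {ts} => [|s x IH]; first exact: mem_head.
rewrite -cats1 foldl_cat /= /maxn; case: ifP => _; first by rewrite inE mem_cat !inE eqxx !orbT.
by move: IH; rewrite !inE mem_cat => /orP[->//|->]; rewrite orbT.
Qed.

(* A return edge above the lowest point of a sibling lies on the side of its branch. *)
Lemma side_of c c' b b' : par c = par c' -> c <> c' -> ret c b -> ret c' b' -> low c' < tgt b ->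
  lam b = side c.
Proof.
move=> pc nc rb rb' lb.
have [b0 r0 t0] := low_attained rb'.
have sameb b1 : ret c b1 -> low c' < tgt b1 -> lam b1 = lam b.
  by move=> r1 l1; apply: (same pc nc r1 rb r0); rewrite t0.
rewrite /side; apply/idP/hasP => [lamb|[b1]].
  have [b1 r1 t1] := high_attained rb; exists b1; first by rewrite mem_filter r1; case/and4P: r1.
  by rewrite t1 eqxx andbT (sameb b1 r1) // t1 (leq_trans lb) // high_ge.
rewrite mem_filter => /andP[r1 _] /andP[l1 /eqP t1].
by rewrite -(sameb b1 r1) // t1 (leq_trans lb) // high_ge.
Qed.

Lemma opposite_of c c' b b' : par c = par c' -> c <> c' -> ret c b -> ret c' b' ->
  low c' < tgt b -> low c < tgt b' -> lam b = ~~ lam b'.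
Proof.
move=> pc nc rb rb' l1 l2; have [b0 r0 t0] := low_attained rb; have [b0' r0' t0'] := low_attained rb'.
by apply: (differ pc nc rb rb' r0 r0'); rewrite ?t0 ?t0'.
Qed.

(** If nothing below the fork returns lower than the common lowest target, [align] applies at the
    fork. Otherwise a third branch returns lower, and [side_of] against this branch puts each edge
    on the side of its own branch. *)
Lemma tie_aligned c c' b b' : par c = par c' -> c <> c' -> ret c b -> ret c' b' ->
  tgt b = low c -> tgt b' = low c' -> low c = low c' -> lam b = lam b' \/ (lam b = side c /\ lam b' = side c').
Proof.
move=> pc nc rb rb' tb tb' ll; set u := par c.
case/and4P: (rb) => bB cb c0 tu; case/and4P: (rb') => b'B cb' c'0 _.
have uc : anc u c by rewrite ancE // anc_refl // orbT.
have uc' : anc u c' by rewrite ancE // -pc anc_refl // orbT.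
have [/hasP[b'' b''B /andP[ub'' lt'']]|/hasPn nb] := boolP (has (fun b1 => anc u b1 && (tgt b1 < tgt b)) B).
  right; have nu : u != b''.
    apply/eqP => e; apply: (leafB b''B _ e); rewrite c0 /=.
    by have /andP[_] := B_in bB; apply: leq_trans; apply: anc_leq cb.
  have [c'' [c''0 pc'' cb'']] := anc_child par_lt ub'' nu.
  have r'' : ret c'' b'' by rewrite /Palm.ret b''B cb'' c''0 pc'' (ltn_trans lt'').
  have l'' : low c'' < tgt b by apply: leq_ltn_trans (low_le r'') lt''.
  have n1 : c <> c'' by move=> e; move: l''; rewrite -e -tb ltnn.
  have n2 : c' <> c'' by move=> e; move: l''; rewrite -e tb ll ltnn.
  split; first by apply: (side_of _ n1 rb r'').
  by apply: (side_of _ n2 rb' r''); rewrite ?pc'' -?pc // tb' -ll -tb.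
left; apply: (align (u := u)) => //.
- exact: anc_trans cb.
- exact: anc_trans cb'.
- by rewrite tb ll.
by move=> b1 b1B ub1; have := nb b1 b1B; rewrite negb_and ub1 /= -leqNgt.
Qed.

(** Conditions for [b], met first in the word, and [b'], met later, not to cross: the edge that
    closes first does so on its own outer side, and edges closing together do not close towards each
    other. *)
Definition fits b b' := [/\ tgt b' < tgt b -> lam b = false, tgt b < tgt b' -> lam b' = true
  & tgt b = tgt b' -> lam b -> lam b'].

Lemma low_high c b : ret c b -> low c <= high c.
Proof. by move=> rb; apply: leq_trans (high_ge rb); apply: low_le. Qed.

Lemma nest_le c b : ret c b -> nest c <= m.*2.+1.
Proof.
move=> rb; have [b1 /and4P[b1B _ _ _] t1] := low_attained rb; rewrite /nest.
have := tgt_lt_m b1B; rewrite t1; case: (low c < high c); clear; lia.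
Qed.

Lemma nest_gt0 c b : ret c b -> 0 < nest c.
Proof.
move=> rb; have [b1 /and4P[b1B _ _ _] t1] := low_attained rb; rewrite /nest -t1.
by have [t0 _ _] := tgtP b1B; rewrite addn_gt0 double_gt0 t0.
Qed.

(** Branches on the same side cannot interleave: if some return edge of each went above the lowest
    target of the other, [opposite_of] would separate the two edges while [side_of] puts them on one
    side. Exact ties are left to [tie_aligned]. *)
Lemma key_fits c c' b b' : par c = par c' -> c <> c' -> ret c b -> ret c' b' -> key c <= key c' ->
  fits b b'.
Proof.
move=> pc nc rb rb' kk.
have n0 := nest_gt0 rb; have nl := nest_le rb; have nl' := nest_le rb'.
have lb := low_le rb; have hb := high_ge rb; have lb' := low_le rb'; have hb' := high_ge rb'.
have S1 := side_of pc nc rb rb'; have S2 := side_of (esym pc) (nesym nc) rb' rb.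
have D := opposite_of pc nc rb rb'.
have [bh rh th] := high_attained rb; have [bh' rh' th'] := high_attained rb'.
have D1 := opposite_of pc nc rh rb'; have D2 := opposite_of pc nc rb rh'.
have S1h := side_of pc nc rh rb'; have S2h := side_of (esym pc) (nesym nc) rh' rb.
have T := tie_aligned pc nc rb rb'.
have nestlt : (if side c then true else false) = side c by case: (side c).
rewrite th in D1 S1h; rewrite th' in D2 S2h.
(* The keys leave three cases: a left branch before a right one, two left ones of non-increasing
   depth, two right ones of non-decreasing depth. *)
have K : [\/ side c = false /\ side c' = true, [/\ side c = false, side c' = false & nest c' <= nest c]
    | [/\ side c = true, side c' = true & nest c <= nest c']].
  move: kk; rewrite /key; case: (side c); case: (side c') => kk.
  - by constructor 3; split=> //; move: kk; clear; lia.
  - by have [] : False; move: kk n0 nl nl'; clear; lia.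
  - by constructor 1.
  - by constructor 2; split=> //; move: kk nl nl'; clear; lia.
have nestE x : nest x = (low x).*2 + (low x < high x) by [].
case: K => [[s1 s2]|[s1 s2 nn]|[s1 s2 nn]];
  [|move: (nn); rewrite !nestE => {}nn|move: (nn); rewrite !nestE => {}nn];
  rewrite ?s1 in S1 S1h T; rewrite ?s2 in S2 S2h T.
- split=> [lt|lt|e].
  + case: (leqP (tgt b) (low c')) => h; last exact: S1.
    by move: lt lb' h; clear; lia.
  + case: (leqP (tgt b') (low c)) => h; last exact: S2.
    by move: lt lb h; clear; lia.
  + case: (leqP (tgt b) (low c')) => h; last by rewrite S1.
    case: (leqP (tgt b') (low c)) => h'; last by rewrite S2.
    have [t1 t2 t3] : [/\ tgt b = low c, tgt b' = low c' & low c = low c'].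
      by move: e lb lb' h h'; clear; split; lia.
    by case: (T t1 t2 t3) => [->|[_ ->]].
- have up : low c < tgt b' -> lam b' = true.
    move=> h; have hl : low c' < high c.
      move: nn (low_high rb) (low_high rb') h hb'; clear; case: ltnP; case: ltnP; lia.
    by have := D1 hl h; rewrite S1h //; case: (lam b').
  split=> [lt|lt|e].
  + by apply: S1; apply: leq_ltn_trans lt.
  + by apply: up; apply: leq_ltn_trans lt.
  + case: (leqP (tgt b) (low c')) => h; last by rewrite S1.
    case: (leqP (tgt b') (low c)) => h'; last by rewrite up.
    have [t1 t2 t3] : [/\ tgt b = low c, tgt b' = low c' & low c = low c'].
      by move: e lb lb' h h'; clear; split; lia.
    by case: (T t1 t2 t3) => [->|[-> _]].
- have up : low c' < tgt b -> lam b = false.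
    move=> h; have hl : low c < high c'.
      move: nn (low_high rb) (low_high rb') h hb; clear; case: ltnP; case: ltnP; lia.
    by have := D2 h hl; rewrite S2h.
  split=> [lt|lt|e].
  + by apply: up; apply: leq_ltn_trans lt.
  + by apply: S2; apply: leq_ltn_trans lt.
  + case: (leqP (tgt b) (low c')) => h; last by rewrite up.
    case: (leqP (tgt b') (low c)) => h'; last by rewrite S2.
    have [t1 t2 t3] : [/\ tgt b = low c, tgt b' = low c' & low c = low c'].
      by move: e lb lb' h h'; clear; split; lia.
    by case: (T t1 t2 t3) => [->|[_ ->]].
Qed.

Lemma mem_kids v c : (c \in kids v) = (0 < c <= m) && (par c == v).
Proof. by rewrite mem_filter mem_iota /= add1n ltnS andbC. Qed.

Lemma key_bound c : key c < (4 * m).+4.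
Proof.
have lowm : low c <= m.
  rewrite /low; elim/last_ind: (map _ _) => // s x IH.
  by rewrite -cats1 foldl_cat /= geq_min IH.
by rewrite /key /nest; case: side; case: (low c < high c); move: lowm; clear; lia.
Qed.

Lemma mem_sorted_kids v : sorted_kids v =i kids v.
Proof.
move=> c; apply/flattenP/idP => [[s /mapP[k _ ->]]|cv]; first by rewrite mem_filter => /andP[].
exists [seq c' <- kids v | key c' == key c]; last by rewrite mem_filter eqxx.
by apply/mapP; exists (key c); rewrite // mem_iota /= add0n key_bound.
Qed.

Lemma flatten_keys_sorted v ks : sorted ltn ks ->
  uniq (flatten [seq [seq c <- kids v | key c == k] | k <- ks]) &&
  pairwise (fun c c' => key c <= key c') (flatten [seq [seq c <- kids v | key c == k] | k <- ks]).
Proof.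
elim: ks => //= k ks IH; rewrite (path_sortedE ltn_trans) => /andP[/allP kks /IH/andP[U S]].
rewrite cat_uniq U filter_uniq ?filter_uniq ?iota_uniq //= pairwise_cat S !andbT.
have inks c : c \in flatten [seq [seq c <- kids v | key c == k] | k <- ks] -> k < key c.
  by move=> /flattenP[s /mapP[k' /kks kk' ->]]; rewrite mem_filter => /andP[/eqP ->].
apply/and3P; split.
- apply/hasPn => c /inks kc; rewrite mem_filter negb_and; apply/orP; left.
  by rewrite neq_ltn kc orbT.
- apply/allrelP => c c'; rewrite mem_filter => /andP[/eqP -> _] /inks; exact: ltnW.
- apply/(pairwiseP 0) => i j ii jj ij.
  have nthk x : x < size [seq c <- kids v | key c == k] -> key (nth 0 [seq c <- kids v | key c == k] x) = k.
    by move=> /(mem_nth 0); rewrite mem_filter => /andP[/eqP].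
  by rewrite !nthk.
Qed.

Lemma sorted_kids_uniq v : uniq (sorted_kids v).
Proof. by case/andP: (flatten_keys_sorted v (iota_ltn_sorted 0 (4 * m).+4)). Qed.

Lemma sorted_kids_pairwise v : pairwise (fun c c' => key c <= key c') (sorted_kids v).
Proof. by case/andP: (flatten_keys_sorted v (iota_ltn_sorted 0 (4 * m).+4)). Qed.

(** In the word of [v] a back edge whose target lies strictly above [v] is still open and occurs
    once; closed ones occur twice. This is [(tgt b >= v).+1]. *)
Definition spec v (w : seq (bool * nat)) :=
  (forall b, count_mem (true, b) w = if (b \in B) && anc v b then (tgt b >= v).+1 else 0) /\
  (forall c, count_mem (false, c) w = if [&& 0 < c <= m, anc v c & v != c] then 2 else 0).

Lemma tgt_above c b : b \in B -> anc c b -> 0 < c -> tgt b < c -> tgt b <= par c.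
Proof.
move=> bB cb c0 tc; have [_ _ tb] := tgtP bB.
have := anc_total par_lt tb cb (ltnW tc); rewrite ancE // => /orP[/eqP e|/(anc_leq par_lt)//].
by rewrite e ltnn in tc.
Qed.

Lemma block_spec (w : nat -> seq (bool * nat)) v c : c \in kids v -> spec c (w c) ->
  (forall b, count_mem (true, b) (block w v c) = if (b \in B) && anc c b then (tgt b >= v).+1 else 0) /\
  (forall x, count_mem (false, x) (block w v c) = if (0 < x <= m) && anc c x then 2 else 0).
Proof.
rewrite mem_kids => /andP[/andP[c0 cm] /eqP pc] [wb wc].
have vc : v < c by rewrite -pc; exact: par_lt.
have att s l : count_mem l (attached (w c) v s) = if [&& l.1, tgt l.2 == v & lam l.2 == s] then count_mem l (w c) else 0.
  rewrite /attached count_filter -(count_rev _ (w c)); case: ifP => h.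
    by apply: eq_count => x /=; case: eqP => // ->.
  by apply/eqP; rewrite -leqn0 leqNgt -has_count; apply/hasPn => x _ /=; case: eqP => // ->; rewrite h.
split=> [b|x]; rewrite /block count_cat /= count_cat /= !att /=.
  rewrite wb; case: (boolP ((b \in B) && anc c b)) => [/andP[bB cb]|_]; last by rewrite !if_same.
  have [tv|tv] := eqVneq (tgt b) v.
    have -> : (c <= tgt b) = false by rewrite tv leqNgt vc.
    by rewrite tv leqnn; case: (lam b).
  suff -> : (c <= tgt b) = (v <= tgt b) by rewrite /= !add0n !addn0.
  case: (ltnP (tgt b) c) => h; last by rewrite (leq_trans (ltnW vc)).
  have := tgt_above bB cb c0 h; rewrite pc; move: tv; clear; lia.
rewrite wc; have [<-|ncx] := eqVneq c x; first by rewrite eqxx !andbF anc_refl // c0 cm.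
have -> : ((false, c) == (false, x)) = false by apply/eqP => -[e]; rewrite e eqxx in ncx.
by rewrite !andbT !add0n addn0.
Qed.

Lemma kid_unique v c c' x : c \in kids v -> c' \in kids v -> anc c x -> anc c' x -> c = c'.
Proof.
rewrite !mem_kids => /andP[/andP[c0 _] /eqP pc] /andP[/andP[c'0 _] /eqP pc'] cx c'x.
by apply/eqP/negPn/negP => /eqP ne; apply: (sibling_apart par_lt c0 c'0 _ ne cx c'x); rewrite pc pc'.
Qed.

Lemma kid_exists v x : 0 < x <= m -> anc v x -> v != x -> exists2 c, c \in kids v & anc c x.
Proof.
move=> /andP[x0 xm] vx nvx; have [c [c0 pc cx]] := anc_child par_lt vx nvx.
by exists c; rewrite // mem_kids pc eqxx c0 (leq_trans (anc_leq par_lt cx)).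
Qed.

Lemma sum_kids v (f : nat -> nat) c : c \in kids v -> (forall c', c' \in kids v -> c' != c -> f c' = 0) ->
  sumn (map f (sorted_kids v)) = f c.
Proof.
move=> cv f0; rewrite sumnE big_map (bigD1_seq c) ?sorted_kids_uniq ?mem_sorted_kids //=.
by rewrite big_seq_cond big1 ?addn0 // => c' /andP[]; rewrite mem_sorted_kids; exact: f0.
Qed.

Lemma sum_kids0 v (f : nat -> nat) : (forall c', c' \in kids v -> f c' = 0) ->
  sumn (map f (sorted_kids v)) = 0.
Proof.
by move=> f0; rewrite sumnE big_map big_seq big1 // => c'; rewrite mem_sorted_kids; exact: f0.
Qed.

Lemma step_word_spec (w : nat -> seq (bool * nat)) v : v <= m ->
  (forall c, c \in kids v -> spec c (w c)) -> spec v (step_word w v).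
Proof.
move=> vm wP; have bl c cv := block_spec cv (wP c cv).
have own a : count_mem a (if v \in B then [:: (true, v)] else [::]) = ((v \in B) && (a == (true, v))).
  by case: ifP => //= _; rewrite eq_sym addn0.
split=> [b|x]; rewrite /step_word count_cat own count_flatten -map_comp.
  have [<-|nvb] := eqVneq v b.
    rewrite eqxx anc_refl // !andbT sum_kids0 => [|c cv] /=.
      case: ifP => // bB; have [_ t _] := tgtP bB; rewrite addn0.
      by rewrite leqNgt (ltn_trans t) //; apply: par_lt; have /andP[] := B_in bB.
    rewrite (proj1 (bl c cv)) [anc c v]negbTE ?andbF //; apply/negP => cb.
    move: cv; rewrite mem_kids => /andP[/andP[c0 _] /eqP pc].
    by have := par_lt c0; rewrite pc ltnNge (anc_leq par_lt cb).
  have -> : ((true, b) == (true, v)) = false by apply/eqP => -[e]; rewrite e eqxx in nvb.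
  rewrite andbF add0n; case: (boolP ((b \in B) && anc v b)) => [/andP[bB vb]|nb].
    have [c cv cb] := kid_exists (B_in bB) vb nvb.
    rewrite (sum_kids cv) => [|c' c'v nc] /=; first by rewrite (proj1 (bl c cv)) bB cb.
    rewrite (proj1 (bl c' c'v)); case: ifP => // /andP[_ c'b].
    by rewrite (kid_unique c'v cv c'b cb) eqxx in nc.
  rewrite sum_kids0 // => c cv /=; rewrite (proj1 (bl c cv)); case: ifP => // /andP[bB cb].
  move: nb; rewrite bB /=; case/negP; apply: anc_trans cb; rewrite //.
  by move: cv; rewrite mem_kids => /andP[/andP[c0 _] /eqP <-]; rewrite ancE // anc_refl // orbT.
have -> : ((false, x) == (true, v)) = false by [].
rewrite andbF add0n; case: ifP => [/and3P[x0 vx nvx]|nx].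
  have [c cv cx] := kid_exists x0 vx nvx.
  rewrite (sum_kids cv) => [|c' c'v nc] /=; first by rewrite (proj2 (bl c cv)) x0 cx.
  rewrite (proj2 (bl c' c'v)); case: ifP => // /andP[_ c'x].
  by rewrite (kid_unique c'v cv c'x cx) eqxx in nc.
rewrite sum_kids0 // => c cv /=; rewrite (proj2 (bl c cv)); case: ifP => // /andP[x0 cx].
move: cv nx; rewrite mem_kids x0 /= => /andP[/andP[c0 _] /eqP <-].
have pcc : anc (par c) c by rewrite ancE // anc_refl // orbT.
rewrite (anc_trans par_lt pcc cx) /= => /negbFE/eqP e.
by have := par_lt c0; rewrite e ltnNge (anc_leq par_lt cx).
Qed.

Lemma count_mem_le (T : eqType) (L w : seq T) k : (forall x, count_mem x w <= k) ->
  {subset w <= L} -> size w <= size L * k.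
Proof.
move=> wk wL; have -> : size w = count (mem L) w by apply/esym/eqP; rewrite -all_count; apply/allP.
elim: L {wL} => [|a L IH]; first by rewrite (@eq_count _ _ pred0) ?count_pred0.
rewrite /= mulSn; apply: leq_trans (leq_add (wk a) IH).
rewrite -count_predUI; apply: leq_trans (leq_addr _ _).
by apply: sub_count => x; rewrite /= inE.
Qed.

Lemma spec_size v w : spec v w -> size w <= (4 * m).+4.
Proof.
case=> wb wc; pose L := [seq (t, x) | t <- [:: true; false], x <- iota 0 m.+1].
have -> : (4 * m).+4 = size L * 2 by rewrite size_allpairs /= size_iota; lia.
apply: count_mem_le.
- by case=> [[] x]; rewrite ?wb ?wc; case: ifP => // _; case: (v <= tgt x).
- case=> t x; rewrite -has_pred1 has_count => h; apply/allpairsP; exists (t, x) => /=; split=> //.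
    by case: t {h}; rewrite !inE.
  rewrite inE mem_iota add1n ltnS; apply/orP; right; case: t h; rewrite ?wb ?wc; case: ifP => //.
    by move=> /andP[/B_in].
  by move=> /and3P[].
Qed.

Lemma drop_words k j : j <= k -> drop j (words k) = words (k - j).
Proof.
elim: j k => [|j IH] k jk; first by rewrite drop0 subn0.
by case: k jk => // k jk; rewrite /= IH.
Qed.

(** [words k] starts with the word of [m.+1 - k] and continues with those of the later vertices.
    Children have larger numbers, so the shifted index inside the recursion finds their words. *)
Lemma nth_words v : v <= m -> word v = take (4 * m).+4 (step_word word v).
Proof.
move=> vm; have e1 : words (m - v).+1 = drop v (words m.+1) by rewrite drop_words ?leqW // subSn.
have e2 : words (m - v) = drop v.+1 (words m.+1) by rewrite drop_words // subSS.
have -> : word v = head [::] (words (m - v).+1) by rewrite e1 -nth0 nth_drop addn0.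
rewrite [words _.+1]/= subKn // [LHS]/=; congr take; rewrite /step_word; congr cat; congr flatten.
apply/eq_in_map => c; rewrite mem_sorted_kids mem_kids => /andP[/andP[c0 cm] /eqP pc].
have vc : v < c by rewrite -pc; exact: par_lt.
by rewrite /block e2 nth_drop subnKC.
Qed.

Lemma word_spec v : v <= m -> spec v (word v) /\ word v = step_word word v.
Proof.
move: v; suff H k v : m - v < k -> v <= m -> spec v (word v) /\ word v = step_word word v.
  by move=> v; exact: (H (m - v).+1).
elim: k v => // k IH v; rewrite ltnS => kv vm.
have sp : spec v (step_word word v).
  apply: step_word_spec => // c; rewrite mem_kids => /andP[/andP[c0 cm] /eqP pc].
  have vc : v < c by rewrite -pc; exact: par_lt.
  have mc : m - c < k by apply: leq_trans kv; rewrite ltn_sub2l // (leq_trans vc).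
  by have [] := IH c mc cm.
have e : word v = step_word word v by rewrite nth_words // take_oversize // (spec_size sp).
by rewrite e.
Qed.

Section Pair.
Variables b b' : nat.
Hypotheses (bB : b \in B) (b'B : b' \in B) (bb' : b <> b').

(* The subword of the letters of [b] (true) and [b'] (false). *)
Definition proj (w : seq (bool * nat)) :=
  [seq l.2 == b | l <- w & (l == (true, b)) || (l == (true, b'))].

Lemma proj_cat s t : proj (s ++ t) = proj s ++ proj t.
Proof. by rewrite /proj filter_cat map_cat. Qed.

Lemma proj_cons l s : proj (l :: s) =
  (if (l == (true, b)) || (l == (true, b')) then [:: l.2 == b] else [::]) ++ proj s.
Proof. by rewrite /proj /=; case: ifP. Qed.

Lemma count_proj w : count_mem true (proj w) = count_mem (true, b) w.
Proof.
rewrite /proj count_map count_filter; apply: eq_count => -[t x] /=.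
rewrite !xpair_eqE eqb_id; case: t => //=; first by case: eqP => //= ->; rewrite eqxx.
by rewrite andbF.
Qed.

Lemma count_proj' w : count_mem false (proj w) = count_mem (true, b') w.
Proof.
rewrite /proj count_map count_filter; apply: eq_count => -[t x] /=.
rewrite !xpair_eqE; case: t => //=; last by rewrite !andbF.
by case: (x =P b) => [->|_] //=; apply/esym/eqP.
Qed.

Lemma proj_attached (w : seq (bool * nat)) v s : proj (attached w v s) =
  [seq x <- rev (proj w) | (tgt (if x then b else b') == v) && (lam (if x then b else b') == s)].
Proof.
elim: w => // -[t x] w IH; rewrite /attached rev_cons -cats1 filter_cat proj_cat -/(attached w v s) IH.
rewrite proj_cons rev_cat filter_cat; congr cat; rewrite /= !xpair_eqE.
have b'b : (b' == b) = false by apply/eqP => e; case: bb'.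
have p1 : proj [:: (true, b)] = [:: true] by rewrite /proj /= eqxx /= eqxx.
have p2 : proj [:: (true, b')] = [:: false] by rewrite /proj /= eqxx orbT /= b'b.
case: t => //=; case: (x =P b) => [->|nb] /=; first by case: ifP.
case: (x =P b') => [->|nb'] /=; first by case: ifP.
by case: ifP => // h; rewrite /proj /= !xpair_eqE /= (introF eqP nb) (introF eqP nb').
Qed.

Lemma proj_nil (w : seq (bool * nat)) : count_mem (true, b) w = 0 -> count_mem (true, b') w = 0 -> proj w = [::].
Proof.
rewrite -count_proj -count_proj'; case: (proj w) => //= -[] s //=.
Qed.

Lemma proj_left (w : seq (bool * nat)) : count_mem (true, b') w = 0 -> proj w = nseq (count_mem (true, b) w) true.
Proof. by rewrite -count_proj -count_proj'; elim: (proj w) => //= -[] s IH //= /IH <-. Qed.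

Lemma proj_right (w : seq (bool * nat)) : count_mem (true, b) w = 0 -> proj w = nseq (count_mem (true, b') w) false.
Proof. by rewrite -count_proj -count_proj'; elim: (proj w) => //= -[] s IH //= /IH <-. Qed.

Lemma kid_word_spec v c : c \in kids v -> spec c (word c).
Proof. by rewrite mem_kids => /andP[/andP[_ cm] _]; have [] := word_spec cm. Qed.

Lemma count_block v c a : c \in kids v -> count_mem (true, a) (block word v c) =
  if (a \in B) && anc c a then (v <= tgt a).+1 else 0.
Proof. by move=> cv; rewrite (proj1 (block_spec cv (kid_word_spec cv))). Qed.

Lemma proj_flatten v s : proj (flatten [seq block word v c | c <- s]) =
  flatten [seq proj (block word v c) | c <- s].
Proof. by elim: s => //= c s IH; rewrite proj_cat IH. Qed.

Lemma proj_block_nil v c : c \in kids v -> ~~ anc c b -> ~~ anc c b' -> proj (block word v c) = [::].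
Proof. by move=> cv /negbTE n /negbTE n'; apply: proj_nil; rewrite count_block // ?n ?n' andbF. Qed.

Lemma proj_word v c : v <= m -> c \in kids v ->
  proj (word v) = flatten [seq proj (block word v c) | c <- sorted_kids v].
Proof.
move=> vm cv; have [_ ->] := word_spec vm; rewrite /step_word proj_cat proj_flatten.
case: ifP => // vB; move: cv; rewrite mem_kids => /andP[cc /eqP pc].
by case: (leafB vB cc).
Qed.

Lemma proj_relevant v : flatten [seq proj (block word v c) | c <- sorted_kids v] =
  flatten [seq proj (block word v c) | c <- sorted_kids v & (c \in kids v) && (anc c b || anc c b')].
Proof.
have e : [seq c <- sorted_kids v | c \in kids v] = sorted_kids v.
  by apply/all_filterP/allP => c; rewrite mem_sorted_kids.
rewrite -{1}e.
elim: (sorted_kids v) => {e} //= c s IH; case: (boolP (c \in kids v)) => //= cv; rewrite IH.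
by case: ifPn => //=; rewrite negb_or => /andP[n n']; rewrite proj_block_nil.
Qed.

(* Both edges below the same child: the word of the child, closed at [v]. *)
Lemma proj_step v c : c \in kids v -> anc c b -> anc c b' -> proj (word v) =
  proj (attached (word c) v false) ++ proj (word c) ++ proj (attached (word c) v true).
Proof.
move=> cv cb cb'; have := cv; rewrite mem_kids => /andP[/andP[c0 cm] /eqP pc].
have vm : v <= m by rewrite -pc (leq_trans _ cm) // ltnW // par_lt.
rewrite (proj_word vm cv) (@proj_relevant v) //.
have -> : [seq x <- sorted_kids v | (x \in kids v) && (anc x b || anc x b')] = [:: c].
  apply: perm_small_eq => //; apply: uniq_perm; rewrite ?filter_uniq ?sorted_kids_uniq // => x.
  rewrite mem_filter mem_sorted_kids inE; apply/andP/eqP => [[/andP[_ /orP[h|h]] xv]|->].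
  - exact: kid_unique xv cv h cb.
  - exact: kid_unique xv cv h cb'.
  - by rewrite cv cb.
by rewrite /= cats0 /block !proj_cat !proj_cons !proj_cat proj_cons.
Qed.

(** The two edges live in different blocks, and blocks are ordered by key; all other blocks contain
    neither letter. *)
Lemma proj_fork v c c' : c \in kids v -> c' \in kids v -> c <> c' -> anc c b -> anc c' b' ->
  exists2 h : bool, (if h then key c <= key c' else key c' <= key c) & proj (word v) =
   let p := nseq (v <= tgt b).+1 true in let q := nseq (v <= tgt b').+1 false in
   if h then p ++ q else q ++ p.
Proof.
move=> cv c'v cc' cb c'b'; have := cv; rewrite mem_kids => /andP[/andP[c0 cm] /eqP pc].
have vm : v <= m by rewrite -pc (leq_trans _ cm) // ltnW // par_lt.
have ncb' : anc c b' = false by apply/negP => h; apply: cc'; exact: kid_unique cv c'v h c'b'.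
have nc'b : anc c' b = false by apply/negP => h; apply: cc'; exact: kid_unique cv c'v cb h.
have pb : proj (block word v c) = nseq (v <= tgt b).+1 true.
  by rewrite proj_left !count_block // ?bB ?cb // ncb' andbF.
have pb' : proj (block word v c') = nseq (v <= tgt b').+1 false.
  by rewrite proj_right !count_block // ?b'B ?c'b' // nc'b andbF.
pose t := [seq x <- sorted_kids v | (x \in kids v) && (anc x b || anc x b')].
have pt : perm_eq t [:: c; c'].
  apply: uniq_perm; rewrite ?filter_uniq ?sorted_kids_uniq //= ?inE ?andbT; first exact/eqP.
  move=> x; rewrite mem_filter mem_sorted_kids !inE; apply/andP/orP => [[/andP[_ /orP[h|h]] xv]|].
  - by left; apply/eqP; exact: kid_unique xv cv h cb.
  - by right; apply/eqP; exact: kid_unique xv c'v h c'b'.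
  - by case=> /eqP ->; rewrite ?cv ?c'v ?cb ?c'b' ?orbT.
have st : pairwise (fun c c' => key c <= key c') t.
  by apply: subseq_pairwise (sorted_kids_pairwise v); exact: filter_subseq.
rewrite (proj_word vm cv) proj_relevant -/t.
have := perm_size pt; have := perm_mem pt; have := perm_uniq pt.
case: t st {pt} => [|x [|y [|? ?]]] //= /andP[/andP[xy _] _] + mt _.
have := mt x; have := mt y; rewrite !inE !eqxx ?orbT /= => /esym/orP yc /esym/orP xc.
rewrite !andbT (introF eqP cc') /= => xny.
case: xc yc => /eqP ex [] /eqP ey; move: xy xny; rewrite ex ey ?eqxx // cats0 pb pb' => xy _.
- by exists true.
- by exists false.
Qed.

Definition nested (s : seq bool) :=
  s \in [:: [:: true; true; false; false]; [:: true; false; false; true];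
            [:: false; true; true; false]; [:: false; false; true; true]].

(** Induction on the way up from the fork. Both letters now lie in one child word, and each step
    only adds the closing letters on the sides allowed by [fits]. The three shapes record which of
    the two edges are closed. *)
Lemma nested_above u c c' v : c \in kids u -> c' \in kids u -> c <> c' -> anc c b -> anc c' b' ->
  key c <= key c' ->
  proj (word u) = nseq (u <= tgt b).+1 true ++ nseq (u <= tgt b').+1 false -> anc v u ->
  if v <= tgt b then if v <= tgt b' then nested (proj (word v)) else proj (word v) == [:: true; true; false]
  else proj (word v) == true :: nseq (v <= tgt b').+1 false.
Proof.
move=> cu c'u cc' cb cb' kk pu.
have := cu; have := c'u; rewrite !mem_kids => /andP[/andP[c'0 c'm] /eqP pc'] /andP[/andP[c0 cm] /eqP pc].
have uc : anc u c by rewrite ancE // pc anc_refl // orbT.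
have uc' : anc u c' by rewrite ancE // pc' anc_refl // orbT.
have um : u <= m by rewrite -pc (leq_trans _ cm) // ltnW // par_lt.
have F : tgt b < u -> tgt b' < u -> fits b b'.
  move=> t1 t2; apply: (@key_fits c c') => //; rewrite ?pc ?pc' // /Palm.ret.
    by rewrite bB cb c0 pc.
  by rewrite b'B cb' c'0 pc'.
move: {2}(u - v) (leqnn (u - v)) => k; elim: k v => [|k IH] v uv vu.
  have -> : v = u by have := anc_leq par_lt vu; move: uv; clear; lia.
  by rewrite pu; case: (u <= tgt b); case: (u <= tgt b').
have [->|nvu] := eqVneq v u.
  by rewrite pu; case: (u <= tgt b); case: (u <= tgt b').
have [d [d0 pd du]] := anc_child par_lt vu nvu.
have vd : v < d by rewrite -pd par_lt.
have dm : d <= m := leq_trans (anc_leq par_lt du) um.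
have dv : d \in kids v by rewrite mem_kids d0 dm pd eqxx.
have db := anc_trans par_lt (anc_trans par_lt du uc) cb.
have db' := anc_trans par_lt (anc_trans par_lt du uc') cb'.
have := IH d _ du; rewrite (proj_step dv db db') !proj_attached.
have -> : u - d <= k by move: uv vd; clear; lia.
move=> /(_ isT) S.
have tt x : x \in B -> anc d x -> tgt x < d -> (v <= tgt x) = (tgt x == v).
  by move=> xB dx tx; have := tgt_above xB dx d0 tx; rewrite pd eqn_leq => ->.
have tn x : d <= tgt x -> (tgt x == v) = false /\ v <= tgt x.
  move=> tx; split; last by apply: leq_trans tx; exact: ltnW.
  by apply/eqP => e; move: tx; rewrite e leqNgt vd.
have ud := anc_leq par_lt du.
move: S; case: (leqP d (tgt b)) => tb; case: (leqP d (tgt b')) => tb'.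
- have [n1 l1] := tn b tb; have [n2 l2] := tn b' tb'; rewrite l1 l2 => S.
  have nof s s' : [seq x <- s | (tgt (if x then b else b') == v) && (lam (if x then b else b') == s')] = [::].
    by rewrite (@eq_filter _ _ pred0) ?filter_pred0 // => -[] /=; rewrite ?n1 ?n2.
  by rewrite !nof cats0.
- move=> /eqP ->; have [n1 l1] := tn b tb; rewrite l1 (tt b') //= n1 /=.
  by case: (tgt b' == v); case: (lam b').
- move=> /eqP ->; have [n2 l2] := tn b' tb'; rewrite l2 (tt b) //= n2 /=.
  by case: (tgt b == v); case: (lam b).
- move=> /eqP ->; rewrite (tt b) // (tt b') //=.
  have [F1 F2 F3] := F (leq_trans tb ud) (leq_trans tb' ud).
  have [e1|n1] := eqVneq (tgt b) v; have [e2|n2] := eqVneq (tgt b') v; rewrite /= ?eqxx //.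
  + by move: F3; rewrite e1 e2 => /(_ erefl); case: (lam b) => [->//|_]; case: (lam b').
  + rewrite F1 // e1 ltn_neqAle n2 /=.
    by have := tgt_above b'B db' d0 tb'; rewrite pd.
  + rewrite F2 // e2 ltn_neqAle n1 /=.
    by have := tgt_above bB db d0 tb; rewrite pd.
Qed.

End Pair.

Lemma proj_swap b b' w : b <> b' -> proj b' b w = map negb (proj b b' w).
Proof.
move=> bb'; rewrite /proj -map_comp; elim: w => //= -[t x] w IH.
rewrite orbC; case: ifP => //= h; rewrite IH; congr cons.
move: h; rewrite !xpair_eqE; case: t => //=.
by case: (x =P b) => [->|_]; case: (_ =P b').
Qed.

Lemma proj_nested b b' : b \in B -> b' \in B -> b <> b' -> nested (proj b b' (word 0)).
Proof.
move=> bB b'B bb'.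
have [u [ub ub' umax]] := meet_exists par_lt b b'.
have nu x y : x \in B -> y \in B -> x <> y -> anc u x -> anc u y -> u != x.
  move=> xB yB xy ux uy; apply/eqP => e; move: uy; rewrite e => uy.
  have [|c [c0 pc cy]] := anc_child par_lt uy; first exact/eqP.
  apply: (leafB xB _ pc); rewrite c0; have /andP[_ ym] := B_in yB.
  exact: leq_trans (anc_leq par_lt cy) ym.
have [c cu cb] := kid_exists (B_in bB) ub (nu _ _ bB b'B bb' ub ub').
have [c' c'u cb'] := kid_exists (B_in b'B) ub' (nu _ _ b'B bB (nesym bb') ub' ub).
have cc' : c <> c'.
  move=> e; have := umax c cb; rewrite {1}e => /(_ cb') /(anc_leq par_lt).
  by move: cu; rewrite mem_kids => /andP[/andP[c0 _] /eqP <-]; rewrite leqNgt par_lt.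
have [h] := proj_fork bB b'B bb' cu c'u cc' cb cb'.
have root := anc_root par_lt u.
case: h => kk pu.
  by have := nested_above bB b'B bb' cu c'u cc' cb cb' kk pu root.
have pu' : proj b' b (word u) = nseq (u <= tgt b').+1 true ++ nseq (u <= tgt b).+1 false.
  by rewrite proj_swap // pu map_cat !map_nseq.
have := nested_above b'B bB (nesym bb') c'u cu (nesym cc') cb' cb kk pu' root.
by rewrite /= proj_swap // /nested; case: (proj b b' _) => [|[] [|[] [|[] [|[] [|? ?]]]]].
Qed.

Lemma word0_noncrossing b b' X Y Z : b \in B -> b' \in B -> b <> b' ->
  word 0 = X ++ (true, b) :: Y ++ (true, b) :: Z -> ~~ odd (count_mem (true, b') Y).
Proof.
move=> bB b'B bb' e; have := proj_nested bB b'B bb'.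
have c2 : count_mem true (proj b b' (word 0)) = 2.
  by rewrite count_proj // (word_spec (leq0n m)).1.1 bB (anc_root par_lt).
move: c2; rewrite e proj_cat proj_cons proj_cat proj_cons eqxx /= !eqxx /=.
rewrite -(count_proj' bb'); move: (proj b b' X) (proj b b' Y) (proj b b' Z) => x y z.
rewrite !count_cat /= count_cat /= => c2.
have ar i j k : i + (1 + (j + (1 + k))) = 2 -> i = 0 /\ j = 0 by clear; lia.
have [x0 y0] := ar _ _ _ c2.
have nf t : count_mem true t = 0 -> t = nseq (size t) false.
  by elim: t => //= -[] t IH //= /IH <-.
rewrite (nf x x0) (nf y y0); move: (size x) (size y) => i j.
rewrite /nested; case: i => [|[|[|i]]]; case: j => [|[|[|j]]]; rewrite //= ?inE //=.
all: by case: z {c2} => [|[] [|[] z]].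
Qed.

Lemma word_factor v c : 0 < c <= m -> anc v c -> v != c ->
  exists X Z, word v = X ++ (false, c) :: word c ++ (false, c) :: Z.
Proof.
move=> cc vc nvc; have [d [d0 pd dc]] := anc_child par_lt vc nvc.
move: {2}(c - v) (leqnn (c - v)) => k; elim: k v vc nvc d d0 pd dc => [|k IH] v vc nvc d d0 pd dc.
  by have := anc_leq par_lt vc; move: nvc; clear; move=> ? ? ?; lia.
move=> cv; have vd : v < d by rewrite -pd par_lt.
have [/andP[c0 cm]] := (cc, tt).1; have dm : d <= m := leq_trans (anc_leq par_lt dc) cm.
have vm : v <= m := ltnW (leq_trans vd dm).
have dk : d \in sorted_kids v by rewrite mem_sorted_kids mem_kids d0 dm pd eqxx.
have [_ ->] := word_spec vm; rewrite /step_word; case/path.splitPr: dk => s t.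
rewrite map_cat flatten_cat /= /block.
have [->|ndc] := eqVneq d c.
  eexists (_ ++ _ ++ attached (word c) v false), (attached (word c) v true ++ _).
  by rewrite -!catA /= -!catA.
have [e [e0 pe ec]] := anc_child par_lt dc ndc.
have [|X [Z E]] := IH d dc ndc e e0 pe ec; first by move: cv vd; clear; lia.
set A := (if _ then _ else _); set Fs := flatten _; set Ft := flatten _.
set al := attached (word d) v false; set ar := attached (word d) v true; rewrite E.
exists (A ++ Fs ++ al ++ (false, d) :: X), (Z ++ (false, d) :: ar ++ Ft).
by rewrite -!catA /= -!catA /= -!catA /= -!catA.
Qed.

(** The word of [c] stands between the two marks, and the letters of odd multiplicity in it are the
    back edges still open there. *)
Lemma word0_mark c : 0 < c <= m -> exists X Y Z, word 0 = X ++ (false, c) :: Y ++ (false, c) :: Z /\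
  forall b, b \in B -> odd (count_mem (true, b) Y) = anc c b && (tgt b < c).
Proof.
move=> cc; have [/andP[c0 cm]] := (cc, tt).1.
have [|X [Z e]] := @word_factor 0 c cc (anc_root par_lt c); first by rewrite eq_sym -lt0n.
exists X, (word c), Z; split=> // b bB; rewrite (word_spec cm).1.1 bB /=.
by case: (anc c b) => //=; rewrite ltnNge; case: (c <= tgt b).
Qed.

End Word.
End Word.

(** * Minimal violated sets and uncrossing *)

Module Wgmv.
From mathcomp Require Import all_boot zify.

Section Merge.
Variable N : nat.
Implicit Types (es : seq (nat * nat)) (lab : seq nat) (S T : pred nat).

Definition merge_step lab (e : nat * nat) :=
  [seq if l == nth 0 lab e.2 then nth 0 lab e.1 else l | l <- lab].
Definition merge es := foldl merge_step (iota 0 N) es.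

Definition cut S (e : nat * nat) := S e.1 != S e.2.
Definition closed es S := all (fun e => ~~ cut S e) es.
Definition inrange es := all (fun e => (e.1 < N) && (e.2 < N)) es.

Lemma size_merge es : size (merge es) = N.
Proof.
rewrite /merge -{2}(size_iota 0 N); elim: es (iota 0 N) => //= e es IH lab.
by rewrite IH size_map.
Qed.

Lemma merge_edge es e : inrange es -> e \in es -> nth 0 (merge es) e.1 = nth 0 (merge es) e.2.
Proof.
rewrite /merge; move: (size_iota 0 N).
have keep lab x y f : size lab = N -> x < N -> y < N -> nth 0 lab x = nth 0 lab y ->
    nth 0 (merge_step lab f) x = nth 0 (merge_step lab f) y.
  by move=> sl xN yN h; rewrite !(nth_map 0) ?sl // h.
have keeps fs lab x y : size lab = N -> x < N -> y < N -> nth 0 lab x = nth 0 lab y ->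
    nth 0 (foldl merge_step lab fs) x = nth 0 (foldl merge_step lab fs) y.
  elim: fs lab => //= f fs IH lab sl xN yN h.
  by apply: IH; rewrite ?size_map //; exact: keep.
elim: es (iota 0 N) => //= f es IH lab sl /andP[/andP[f1 f2] rs].
rewrite inE => /orP[/eqP ->|]; last by apply: IH; rewrite ?size_map.
apply: keeps; rewrite ?size_map // !(nth_map 0) ?sl // eqxx.
by case: ifP.
Qed.

Lemma merge_closed es S x y : inrange es -> closed es S -> x < N -> y < N ->
  nth 0 (merge es) x = nth 0 (merge es) y -> S x = S y.
Proof.
move=> rs cs xN yN; rewrite /merge; move: (size_iota 0 N).
have : forall x y, x < N -> y < N -> nth 0 (iota 0 N) x = nth 0 (iota 0 N) y -> S x = S y.
  by move=> a b aN bN; rewrite !nth_iota // !add0n => ->.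
elim: es rs cs (iota 0 N) => [|e es IH] /=; first by move=> _ _ lab h _; exact: h.
move=> /andP[/andP[e1 e2] rs] /andP[/negPn/eqP ce cs] lab h sl.
apply: IH => //; last by rewrite size_map.
move=> a b aN bN; rewrite !(nth_map 0) ?sl //.
have e12 a' : a' < N -> nth 0 lab a' = nth 0 lab e.2 -> S a' = S e.1.
  by move=> a'N /(h _ _ a'N e2) ->.
case: eqP => [/(e12 _ aN) ->|_]; case: eqP => [/(e12 _ bN) ->|_] // l; exact: h.
Qed.

End Merge.

Section Wgmv.
Variables (N : nat) (free dem : seq (nat * nat)) (links : seq (nat * nat)).

Definition ends i := nth (0, 0) links i.
Definition pick (X : seq nat) := [seq ends i | i <- X].
Definition others X d := free ++ pick X ++ [seq d' <- dem | d' != d].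
Definition comp (lab : seq nat) x := [seq l == nth 0 lab x | l <- lab].
(** Contracting the free edges, the picked links and all other demands leaves, around either end of
    [d], the smallest set that cuts [d] and no other demand. *)
Definition cand_of X d :=
  let lab := merge N (others X d) in
  if nth 0 lab d.1 == nth 0 lab d.2 then [::] else [:: comp lab d.1; comp lab d.2].
Definition cand X := flatten [seq cand_of X d | d <- dem].
Definition subset_of (S T : seq bool) := all (fun st => st.1 ==> st.2) (zip S T).
Definition minimal_in C S := all (fun T => subset_of T S ==> subset_of S T) C.
Definition act X := undup [seq S <- cand X | minimal_in (cand X) S].
Definition mem_map (S : seq bool) : pred nat := nth false S.

Hypothesis freeN : inrange N free.
Hypothesis demN : inrange N dem.
Hypothesis linksN : inrange N links.
Hypothesis dem_uniq : uniq dem.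

Definition viol X (S : pred nat) :=
  [&& closed free S, closed (pick X) S & count (cut S) dem == 1].
Definition valid X := all (fun i => i < size links) X.

Lemma viol_cut X S : viol X S -> exists d, [/\ d \in dem, cut S d & forall d', d' \in dem -> cut S d' -> d' = d].
Proof.
case/and3P=> _ _ c1; have : has (cut S) dem by rewrite has_count (eqP c1).
case/hasP => d dd cd; exists d; split=> // d' d'd cd'; apply/eqP/negPn/negP => ne.
have : uniq [:: d; d'] by rewrite /= inE eq_sym ne.
have sub : {subset [:: d; d'] <= filter (cut S) dem}.
  by move=> x; rewrite !inE mem_filter => /orP[] /eqP ->; rewrite ?cd ?cd'.
by move=> /uniq_leq_size /(_ sub); rewrite size_filter (eqP c1).
Qed.

Lemma cut1 S d : d \in dem -> cut S d -> (forall d', d' \in dem -> cut S d' -> d' = d) -> count (cut S) dem = 1.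
Proof.
move=> dd cd u; have -> : count (cut S) dem = count (pred1 d) dem.
  by apply: eq_in_count => x xd /=; apply/idP/eqP => [|->] //; exact: u.
by rewrite count_uniq_mem // dd.
Qed.

Lemma inrange_others X d : valid X -> inrange N (others X d).
Proof.
move=> vX; rewrite /inrange !all_cat; apply/and3P; split => //.
  apply/allP => e /mapP[i iX ->]; have := allP vX i iX => il.
  by apply: (allP linksN); rewrite mem_nth.
by apply/allP => e; rewrite mem_filter => /andP[_]; apply: (allP demN).
Qed.

Lemma mem_comp X d x f : valid X -> x < N -> mem_map (comp (merge N (others X d)) f) x =
  (nth 0 (merge N (others X d)) x == nth 0 (merge N (others X d)) f).
Proof. by move=> vX xN; rewrite /mem_map /comp (nth_map 0) ?size_merge. Qed.

Lemma size_comp X d f : size (comp (merge N (others X d)) f) = N.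
Proof. by rewrite size_map size_merge. Qed.

Lemma cand_size X S : S \in cand X -> size S = N.
Proof.
case/flattenP => s /mapP[d _ ->]; rewrite /cand_of; case: ifP => // _.
by rewrite !inE => /orP[] /eqP ->; exact: size_comp.
Qed.

Lemma dem_range d : d \in dem -> d.1 < N /\ d.2 < N.
Proof. by move=> /(allP demN)/andP. Qed.

Lemma cand_viol X S : valid X -> S \in cand X -> viol X (mem_map S).
Proof.
move=> vX /flattenP[s /mapP[d dd ->]]; rewrite /cand_of; case: ifP => // /negbT ne.
have io := inrange_others d vX; have [d1 d2] := dem_range dd.
have ce f e : e \in others X d -> ~~ cut (mem_map (comp (merge N (others X d)) f)) e.
  move=> eo; have /andP[e1 e2] := allP io e eo.
  by rewrite /cut !mem_comp // (merge_edge io eo) eqxx.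
have cf f : closed free (mem_map (comp (merge N (others X d)) f)).
  by apply/allP => e ef; apply: ce; rewrite mem_cat ef.
have cX f : closed (pick X) (mem_map (comp (merge N (others X d)) f)).
  by apply/allP => e ef; apply: ce; rewrite !mem_cat ef orbT.
have cd f d' : d' \in dem -> cut (mem_map (comp (merge N (others X d)) f)) d' -> d' = d.
  move=> d'd; apply: contraTeq => nd; apply: ce.
  by rewrite !mem_cat mem_filter nd d'd !orbT.
rewrite !inE => /orP[] /eqP ->; rewrite /viol cf cX /= (@cut1 _ d) //; try exact: cd.
  by rewrite /cut !mem_comp // eqxx [nth 0 _ d.2 == _]eq_sym (negbTE ne).
by rewrite /cut !mem_comp // eqxx (negbTE ne).
Qed.

Definition included (S T : pred nat) := forall x, x < N -> S x -> T x.

Lemma viol_cand X T : valid X -> viol X T -> exists2 S, S \in cand X & included (mem_map S) T.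
Proof.
move=> vX vT; have [d [dd cd u]] := viol_cut vT; have io := inrange_others d vX.
have [d1 d2] := dem_range dd.
have cT : closed (others X d) T.
  case/and3P: vT => cf cX _; rewrite /closed !all_cat; apply/and3P; split=> //.
  apply/allP => d'; rewrite mem_filter => /andP[nd d'd]; apply: contraNN nd => cd'.
  by apply/eqP; exact: u.
have ne : nth 0 (merge N (others X d)) d.1 == nth 0 (merge N (others X d)) d.2 = false.
  by apply/eqP => /(merge_closed io cT d1 d2) e; move: cd; rewrite /cut e eqxx.
have inc f : f < N -> T f -> included (mem_map (comp (merge N (others X d)) f)) T.
  by move=> fN Tf x xN; rewrite mem_comp // => /eqP /(merge_closed io cT xN fN) ->.
have cand2 S : S \in cand_of X d -> S \in cand X by move=> h; apply/flattenP; exists (cand_of X d); rewrite ?map_f.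
move: cd; rewrite /cut; case T1 : (T d.1) => T2.
  exists (comp (merge N (others X d)) d.1); last exact: inc.
  by apply: cand2; rewrite /cand_of ne mem_head.
exists (comp (merge N (others X d)) d.2); last by apply: inc => //; case: (T d.2) T2.
by apply: cand2; rewrite /cand_of ne !inE eqxx orbT.
Qed.

Lemma subsetP S T : size S = N -> size T = N -> reflect (included (mem_map S) (mem_map T)) (subset_of S T).
Proof.
move=> sS sT; apply: (iffP allP) => [h x xN Sx|h [a b]].
  have /h : (nth false S x, nth false T x) \in zip S T.
    by rewrite -nth_zip ?sS ?sT // mem_nth // size_zip sS sT minnn.
  by move=> /implyP; apply.
move=> /(nthP (false, false))[x]; rewrite size_zip sS sT minnn => xN.
rewrite nth_zip ?sS ?sT // => -[<- <-] /=; apply/implyP; exact: h.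
Qed.

Lemma act_viol X S : valid X -> S \in act X -> viol X (mem_map S).
Proof. by move=> vX; rewrite mem_undup mem_filter => /andP[_]; exact: cand_viol. Qed.

Lemma act_size X S : S \in act X -> size S = N.
Proof. by rewrite mem_undup mem_filter => /andP[_]; exact: cand_size. Qed.

Lemma act_minimal X S T : valid X -> S \in act X -> viol X T -> included T (mem_map S) -> included (mem_map S) T.
Proof.
move=> vX; rewrite mem_undup mem_filter => /andP[/allP mS cS] vT TS.
have [S' cS' S'T] := viol_cand vX vT.
have S'S : subset_of S' S by apply/subsetP; rewrite ?(cand_size cS') ?(cand_size cS) // => x xN /(S'T x xN)/(TS x xN).
have := mS S' cS'; rewrite S'S /= => /subsetP; rewrite (cand_size cS') (cand_size cS) => /(_ erefl erefl) SS'.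
by move=> x xN /(SS' x xN)/(S'T x xN).
Qed.

(** Below a candidate that is not minimal there is another one with strictly fewer points, so the
    descent from a candidate inside [T] ends at an active set. *)
Lemma viol_act X T : valid X -> viol X T -> exists2 S, S \in act X & included (mem_map S) T.
Proof.
move=> vX vT; have [S0 cS0 S0T] := viol_cand vX vT.
move: {2}(count id S0) (leqnn (count id S0)) => k.
elim: k S0 cS0 S0T => [|k IH] S0 cS0 S0T ck.
  have [d [dd cd _]] := viol_cut (cand_viol vX cS0); have [d1 d2] := dem_range dd.
  have out x : mem_map S0 x = false.
    apply/negbTE/negP => h; move: ck; rewrite leqn0 -[_ == 0]negbK -lt0n -has_count.
    case/negP; apply/hasP; exists true => //; rewrite -h; apply: mem_nth.
    by rewrite ltnNge; apply/negP => s; move: h; rewrite /mem_map nth_default.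
  by move: cd; rewrite /cut !out.
have [mS|] := boolP (minimal_in (cand X) S0).
  by exists S0; rewrite // mem_undup mem_filter mS.
case/allPn => S1 cS1; rewrite negb_imply => /andP[S10 nS01].
have s0 := cand_size cS0; have s1 := cand_size cS1.
have i10 := elimT (subsetP s1 s0) S10.
apply: (IH S1) => // [x xN /(i10 x xN)/(S0T x xN)//|].
rewrite -ltnS; apply: leq_trans ck.
have cnt S : size S = N -> count id S = count (mem_map S) (iota 0 N).
  by move=> sS; rewrite -{1}(mkseq_nth false S) sS count_map; apply: eq_count.
rewrite !cnt // ltn_neqAle; apply/andP; split; last first.
  by rewrite -[X in _ <= X](@eq_in_count _ (predU (mem_map S1) (mem_map S0))) ?count_predUI;
     [apply: sub_count => x /= -> | move=> x; rewrite mem_iota => /andP[_ xN] /=; case h: (mem_map S1 x) => //=; rewrite (i10 x xN h)].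
apply: contraNneq nS01 => e; apply/subsetP => // x xN h0; apply/negPn/negP => n1.
have : count (mem_map S1) (iota 0 N) < count (mem_map S0) (iota 0 N).
  have -> : count (mem_map S0) (iota 0 N) = count (mem_map S1) (iota 0 N) + count (predD (mem_map S0) (mem_map S1)) (iota 0 N).
    rewrite -count_predUI [X in _ = _ + X](@eq_count _ _ pred0) ?count_pred0 ?addn0; last first.
      by move=> y /=; case: (mem_map S1 y); case: (mem_map S0 y).
    apply: eq_in_count => y; rewrite mem_iota => /andP[_ yN] /=.
    by case h: (mem_map S1 y) => //=; rewrite (i10 y yN h).
  rewrite -addn1 leq_add2l -has_count; apply/hasP; exists x; first by rewrite mem_iota.
  by rewrite /= n1.
by rewrite e ltnn.
Qed.

(* A minimal violated set is not crossed by any violated set. *)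
Lemma act_uncrossed X S T : valid X -> S \in act X -> viol X T ->
  included (mem_map S) T \/ forall x, x < N -> mem_map S x -> T x = false.
Proof.
move=> vX aS vT; have vS := act_viol vX aS; set P := mem_map S in vS *.
have [d [dd cd ud]] := viol_cut vS; have [d' [dd' cd' ud']] := viol_cut vT.
case/and3P: (vS) => fS xS _; case/and3P: (vT) => fT xT _.
pose I x := P x && T x; pose D x := P x && ~~ T x.
have cl es : closed es P -> closed es T -> closed es I /\ closed es D.
  move=> /allP cP /allP cT; split; apply/allP => e ee; have := cP e ee; have := cT e ee;
  by rewrite /cut /I /D !negbK => /eqP -> /eqP ->.
have [fI fD] := cl _ fS fT; have [xI xD] := cl _ xS xT.
have inI : count (cut I) dem = 1 -> included P T.
  move=> c; have vI : viol X I by rewrite /viol fI xI c.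
  have IP : included I P by move=> x _ /andP[].
  by move=> x xN /(act_minimal vX aS vI IP xN)/andP[].
have inD : count (cut D) dem = 1 -> forall x, x < N -> P x -> T x = false.
  move=> c; have vD : viol X D by rewrite /viol fD xD c.
  have DP : included D P by move=> x _ /andP[].
  by move=> x xN /(act_minimal vX aS vD DP xN)/andP[_ /negbTE].
have nP e : e \in dem -> P e.1 != P e.2 -> e = d by exact: ud.
have nT e : e \in dem -> T e.1 != T e.2 -> e = d' by exact: ud'.
(* Whichever of the intersection and the difference cuts one demand is violated, and the minimality
   of [S] makes it all of [S]. *)
suff [|] : count (cut I) dem = 1 \/ count (cut D) dem = 1 by [move/inI; left | move/inD; right].
have cI e : e \in dem -> cut I e -> e = d \/ e = d'.
  move=> ed; rewrite /cut /I; case hP : (P e.1 != P e.2); first by left; exact: nP.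
  move/negbFE/eqP: hP => ->; case hT : (T e.1 != T e.2); first by right; exact: nT.
  by move/negbFE/eqP: hT => ->; rewrite eqxx.
have cD e : e \in dem -> cut D e -> e = d \/ e = d'.
  move=> ed; rewrite /cut /D; case hP : (P e.1 != P e.2); first by left; exact: nP.
  move/negbFE/eqP: hP => ->; case hT : (T e.1 != T e.2); first by right; exact: nT.
  by move/negbFE/eqP: hT => ->; rewrite eqxx.
have [e|ne] := eqVneq d' d.
  rewrite -e in cd cI cD; move: (cd) (cd'); rewrite /cut => h1 h2.
  case E : (P d'.1 == T d'.1); [left | right].
    apply: (cut1 dd'); last by move=> e' e'd /cI[].
    by move: h1 h2 E; rewrite /cut /I; case: (P d'.1); case: (P d'.2); case: (T d'.1); case: (T d'.2).
  apply: (cut1 dd'); last by move=> e' e'd /cD[].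
  by move: h1 h2 E; rewrite /cut /D; case: (P d'.1); case: (P d'.2); case: (T d'.1); case: (T d'.2).
have Td : T d.1 = T d.2 by apply/eqP; apply: contraNT ne => /(nT _ dd) ->.
have Pd' : P d'.1 = P d'.2 by apply/eqP; apply: contraNT ne => /(nP _ dd') ->.
move: (cd) (cd'); rewrite /cut => hd hd'.
have one Q e f : (forall g, g \in dem -> cut Q g -> g = e \/ g = f) -> e \in dem -> cut Q e -> ~~ cut Q f ->
    count (cut Q) dem = 1.
  by move=> h ed ce nf; apply: (cut1 ed) => // g gd cg; case: (h g gd cg) => // gf; rewrite -gf cg in nf.
have cI' e : e \in dem -> cut I e -> e = d' \/ e = d by move=> ed /(cI _ ed)[]; [right|left].
have cD' e : e \in dem -> cut D e -> e = d' \/ e = d by move=> ed /(cD _ ed)[]; [right|left].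
(* With distinct demands, [P] is constant on [d'] and [T] on [d]; these two values decide which of
   the two sets cuts exactly one demand. *)
case E' : (P d'.1); case E : (T d.1).
- right; apply: (one D d' d) => //; rewrite /cut /D -?Td -?Pd' ?E ?E' ?andbF //=.
  by case: (T d'.1) hd'; case: (T d'.2).
- left; apply: (one I d' d) => //; rewrite /cut /I -?Td -?Pd' ?E ?E' ?andbF //=.
- left; apply: (one I d d') => //; rewrite /cut /I -?Td -?Pd' ?E ?E' ?andbT //=.
- right; apply: (one D d d') => //; rewrite /cut /D -?Td -?Pd' ?E ?E' ?andbT //=.
Qed.

End Wgmv.
End Wgmv.

(** * The tree of regions joined by the surviving links *)

Module Wtree.
From mathcomp Require Import all_boot zify.
Import Wgmv.

Lemma cut_addb S T e : cut (fun x => S x (+) T x) e = cut S e (+) cut T e.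
Proof. by rewrite /cut; case: (S e.1); case: (S e.2); case: (T e.1); case: (T e.2). Qed.

Section Tree.
Variables (N : nat) (free dem : seq (nat * nat)) (links : seq (nat * nat)).
Hypothesis freeN : inrange N free.
Hypothesis demN : inrange N dem.
Hypothesis linksN : inrange N links.
Hypothesis dem_uniq : uniq dem.

Local Notation ends := (ends links).
Local Notation viol := (viol free dem links).
Local Notation valid := (valid links).

Lemma viol_ext X S T : valid X -> (forall x, x < N -> S x = T x) -> viol X S = viol X T.
Proof.
move=> vX ST.
have e es : inrange N es -> {in es, cut S =1 cut T}.
  by move=> /allP r e /r /andP[e1 e2]; rewrite /cut !ST.
rewrite /viol; congr (_ && (_ && _)).
- by apply: eq_in_all => f /(e _ freeN) ->.
- apply: eq_in_all => f /mapP[i iX ->]; congr negb; apply: (e _ linksN).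
  by rewrite mem_nth // (allP vX).
- by congr (_ == 1); apply: eq_in_count => f /(e _ demN).
Qed.

Lemma viol_addb1 X S b : viol X (fun x => S x (+) b) = viol X S.
Proof.
have e : cut (fun x => S x (+) b) =1 cut S.
  by move=> f; rewrite /cut; case: (S _); case: (S _); case: b.
rewrite /viol; congr (_ && (_ && _)); last by congr (_ == 1); exact: eq_count.
- by apply: eq_all => f; rewrite e.
- by apply: eq_all => f; rewrite e.
Qed.

Lemma viol_sub X Y S : {subset X <= Y} -> viol Y S -> viol X S.
Proof.
move=> sXY /and3P[fS YS dS]; apply/and3P; split=> //.
by apply/allP => e /mapP[i /sXY iY ->]; apply: (allP YS); apply: map_f.
Qed.

Lemma viol_cons X S i : ~~ cut S (ends i) -> viol X S -> viol (i :: X) S.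
Proof. by move=> c /and3P[fS YS dS]; apply/and3P; split=> //=; rewrite c. Qed.

(** Through [rho] the links of [K] become the edges of a tree on the regions [0] to [size K], and
    [W g] is one side of the tree edge [g]. [rt_cut] makes every link a bridge and [rt_conn] gives
    connectedness. By [rt_viol] each side shows that its link is still needed. *)
Record region_tree (M K : seq nat) (rho : nat -> nat) (W : nat -> pred nat) : Prop := {
  rt_uniq : uniq K;
  rt_id : forall x, x < N -> rho x <= size K;
  rt_viol : forall g, g \in K -> viol M (fun x => W g (rho x));
  rt_cut : forall g g', g \in K -> g' \in K ->
    cut (fun x => W g (rho x)) (ends g') = (g' == g);
  rt_conn : forall Q : pred nat, (forall g, g \in K -> ~~ cut (fun x => Q (rho x)) (ends g)) ->
    forall p q, p <= size K -> q <= size K -> Q p = Q q }.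

Section Struct.
Variables (M K : seq nat) (rho : nat -> nat) (W : nat -> pred nat).
Hypothesis vM : valid M.
Hypothesis vK : valid K.
Hypothesis rt : region_tree M K rho W.

Lemma end_lt i (s : bool) : i < size links -> (if s then (ends i).2 else (ends i).1) < N.
Proof. by move=> iL; have /andP[a b] := allP linksN _ (mem_nth (0,0) iL); case: s. Qed.

(** Normalises [W g] to the side of the tree edge [g] that does not contain [r]. *)
Definition away r g : pred nat := fun p => W g p (+) W g r.
Definition incident r g := (rho (ends g).1 == r) || (rho (ends g).2 == r).

Lemma away_self r g : away r g r = false.
Proof. exact: addbb. Qed.

Lemma away_cut r g g' : g \in K -> g' \in K -> cut (fun x => away r g (rho x)) (ends g') = (g' == g).
Proof.
move=> gK g'K; rewrite -(rt_cut rt gK g'K) /away /cut.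
by case: (W g r); case: (W g _); case: (W g _).
Qed.

Lemma away_ends r g p q : g \in K -> (p = (ends g).1 /\ q = (ends g).2) \/ (q = (ends g).1 /\ p = (ends g).2) ->
  rho p = r -> away r g (rho q).
Proof.
move=> gK h e; have := away_cut r gK gK; rewrite eqxx /cut.
by case: h => [] [<- <-]; rewrite e away_self; case: (away _ _ _).
Qed.

Lemma away_disjoint r g g' p : g \in K -> g' \in K -> incident r g -> incident r g' -> g != g' ->
  r <= size K -> p <= size K -> away r g p -> away r g' p = false.
Proof.
move=> gK g'K ig ig' ne rK pK ap.
pose Q q := away r g q && away r g' q.
have Qr : Q r = false by rewrite /Q away_self.
have : Q p = Q r.
  apply: (rt_conn rt) => // h hK; rewrite /cut /Q.
  have c := away_cut r gK hK; have c' := away_cut r g'K hK.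
  have [hg|nhg] := eqVneq h g; last have [hg'|nhg'] := eqVneq h g'; last first.
  - move: c c'; rewrite (negbTE nhg) (negbTE nhg') /cut.
    by move=> /negbFE/eqP -> /negbFE/eqP ->; rewrite eqxx.
  - move: c; rewrite (negbTE nhg) /cut => /negbFE/eqP; rewrite hg' => e.
    case/orP: ig' => /eqP er; move: e; rewrite er away_self.
      by move=> <-; rewrite away_self.
    by move=> ->; rewrite away_self.
  move: c'; rewrite hg (negbTE ne) /cut => /negbFE/eqP e.
  case/orP: ig => /eqP er; move: e; rewrite er away_self.
    by move=> <-; rewrite away_self !andbF.
  by move=> ->; rewrite away_self !andbF.
by rewrite Qr /Q ap.
Qed.

Lemma away_exists r p : r <= size K -> p <= size K -> p != r ->
  exists g, [/\ g \in K, incident r g & away r g p].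
Proof.
move=> rK pK ne.
pose Q q := (q == r) || has (fun g => incident r g && away r g q) K.
suff : Q p by rewrite /Q (negbTE ne) => /hasP[g gK /andP[]]; exists g.
rewrite (@rt_conn _ _ _ _ rt Q _ p r) // ?/Q ?eqxx // => g gK; rewrite /cut negbK.
have [ig|nig] := boolP (incident r g).
  have t q : q = (ends g).1 \/ q = (ends g).2 -> (rho q == r) || has (fun h => incident r h && away r h (rho q)) K.
    move=> hq; case: eqVneq => //= nq; apply/hasP; exists g; rewrite // ig /=.
    case/orP: (ig) => /eqP er; case: hq => hq; try by rewrite hq er eqxx in nq.
      by apply: (away_ends gK _ er); left.
    by apply: (away_ends gK _ er); right.
  by rewrite !t //; [right | left].
move: (nig); rewrite negb_or => /andP[/negbTE -> /negbTE ->] /=; apply/eqP.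
apply: eq_in_has => h hK; case ih : (incident r h) => //=.
have := away_cut r hK gK; rewrite /cut; have -> : (g == h) = false by apply: contraNF nig => /eqP ->.
by move/negbFE/eqP.
Qed.

Lemma same_region u v : u < N -> v < N -> (forall g, g \in K -> W g (rho u) = W g (rho v)) -> rho u = rho v.
Proof.
move=> uN vN h; apply/eqP/negPn/negP => ne.
have [g [gK _]] := away_exists (rt_id rt vN) (rt_id rt uN) ne.
by rewrite /away h // addbb.
Qed.

Definition deg p := count (fun g => rho (ends g).1 == p) K + count (fun g => rho (ends g).2 == p) K.

Lemma deg_gt0 p : K != [::] -> p <= size K -> 0 < deg p.
Proof.
case EK : {1}K => [//|g K'] _ pK; have gK : g \in K by rewrite EK mem_head.
rewrite lt0n; apply/negP => /eqP d0.
have all1 : forall h, h \in K -> ~~ incident p h.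
  move=> h hK; rewrite negb_or; move: d0; rewrite /deg => /eqP; rewrite addn_eq0 -!leqn0 ![_ <= 0]leqNgt -!has_count.
  by case/andP=> /hasPn/(_ h hK) /= -> /hasPn/(_ h hK).
have c q : q <= size K -> (q == p) = true.
  move=> qK; rewrite -[RHS](eqxx p); apply: (rt_conn rt (Q := pred1 p)) => // h hK.
  by have := all1 h hK; rewrite /incident negb_or /cut /= => /andP[/negbTE -> /negbTE ->].
have := rt_cut rt gK gK; have gL := allP vK _ gK; rewrite eqxx /cut.
have [/= a b] := (end_lt false gL, end_lt true gL).
by rewrite (eqP (c _ (rt_id rt a))) (eqP (c _ (rt_id rt b))) eqxx.
Qed.

(** A leaf is, up to complement, a side of its only link, and sides are violated. *)
Lemma leaf_viol p : p <= size K -> deg p = 1 -> viol M (fun x => rho x == p).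
Proof.
move=> pK d1.
have [g gK gu] : exists2 g, g \in K & forall h, h \in K -> (rho (ends h).1 == p) != (rho (ends h).2 == p) = (h == g).
  have uK := rt_uniq rt; move: d1; rewrite /deg.
  have key f f' : count f K = 1 -> count f' K = 0 -> exists2 g : nat, g \in K & forall h, h \in K -> (f h != f' h) = (h == g).
    move=> c1 c0; have : has f K by rewrite has_count c1.
    case/hasP => g gK fg; exists g => // h hK.
    have /hasPn n0 : ~~ has f' K by rewrite has_count c0.
    rewrite (negbTE (n0 h hK)); have [->|ne] := eqVneq h g; first by rewrite fg.
    apply: contra_eqF c1 => fh; have : size [:: h; g] <= size (filter f K).
      apply: uniq_leq_size => [|y]; rewrite /= ?inE ?ne // mem_filter.
      by case/orP => /eqP ->; rewrite ?hK ?gK ?andbT //; case: (f h) fh.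
    by rewrite size_filter; case: (count f K) => [|[]].
  have [|c2] := posnP (count (fun g => rho (ends g).2 == p) K).
    by move=> c0; rewrite c0 addn0 => c1; exact: key c1 c0.
  move=> c1; have [e1 e2] : count (fun g => rho (ends g).1 == p) K = 0 /\ count (fun g => rho (ends g).2 == p) K = 1 by lia.
  by have [g gK gu] := key _ _ e2 e1; exists g => // h hK; rewrite eq_sym gu.
have Q q : q <= size K -> (q == p) (+) W g q = ~~ W g p.
  move=> qK; rewrite -[RHS]addTb -(eqxx p); apply: (rt_conn rt (Q := fun q => (q == p) (+) W g q)) => // h hK.
  rewrite (cut_addb (fun x => rho x == p) (fun x => W g (rho x))) (rt_cut rt gK hK).
  by rewrite [cut _ _](gu h hK) addbb.
rewrite (@viol_ext M _ (fun x => W g (rho x) (+) ~~ W g p)) ?viol_addb1 ?(rt_viol rt gK) // => x xN.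
by rewrite -(Q _ (rt_id rt xN)) addbC addbK.
Qed.

(* Inserting the link e in the tree: a violated set cutting e is made constant on each branch at the region of e. *)
Section Split.
Variables (e : nat) (S0 : pred nat).
Hypothesis eL : e < size links.
Hypothesis rtM : forall g, g \in K -> ~~ cut (fun x => W g (rho x)) (ends e).
Hypothesis vS0 : viol (K ++ M) S0.
Hypothesis cS0 : cut S0 (ends e).
Hypothesis feas : forall S, ~~ viol (K ++ e :: M) S.

Let u := (ends e).1.
Let v := (ends e).2.
Let r := rho u.
Let n := (size K).+1.

Let uN : u < N := end_lt false eL.
Let vN : v < N := end_lt true eL.

Lemma split_rv : rho v = r.
Proof. by apply/esym/same_region => // g /rtM; rewrite /cut negbK => /eqP. Qed.

Let rK : r <= size K := rt_id rt uN.

Definition anchor g := if rho (ends g).1 == r then (ends g).1 else (ends g).2.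
Definition absorb (S : pred nat) g : pred nat :=
  fun x => if away r g (rho x) then S (anchor g) else S x.

Lemma absorbE S g x : absorb S g x = S x (+) (away r g (rho x) && (S x != S (anchor g))).
Proof. by rewrite /absorb; case: (away _ _ _) => /=; case: (S x); case: (S _). Qed.

(** [Y], the part of the branch where [S] must change, respects [K], [M] and [e]; since nothing is
    violated once [e] is added, [Y] does not cut exactly one demand. It can only cut the demand of
    [S] and that of the branch, hence both or none, and the sum of [S] and [Y] again cuts exactly
    one. *)
Lemma absorb_viol S g : g \in K -> incident r g -> viol (K ++ M) S -> viol (K ++ M) (absorb S g).
Proof.
move=> gK ig vS; have vKM : valid (K ++ M) by rewrite /valid all_cat; apply/andP.
pose Y x := away r g (rho x) && (S x != S (anchor g)).
have vB : viol M (fun x => away r g (rho x)) by rewrite /away viol_addb1; exact: (rt_viol rt gK).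
case/and3P: (vB) => fB MB _; case/and3P: (vS) => fS; rewrite {1}/pick map_cat /closed all_cat => /andP[KS MS] _.
have clY es : closed es S -> closed es (fun x => away r g (rho x)) -> closed es Y.
  move=> /allP a /allP b; apply/allP => f fe; have := a f fe; have := b f fe.
  by rewrite /cut /Y !negbK => /eqP -> /eqP ->.
have fY := clY _ fS fB; have MY := clY _ MS MB.
have KY : closed (pick links K) Y.
  apply/allP => _ /mapP[h hK ->]; have := allP KS _ (map_f ends hK); rewrite /cut !negbK => /eqP eS.
  have := away_cut r gK hK; move: eS; case: eqVneq => [->|_] eS.
    by rewrite /Y /anchor; case: ifP => _; rewrite eS eqxx !andbF.
  by rewrite /cut /Y => /negbFE/eqP ->; rewrite eS.
have eY : ~~ cut Y (ends e).
  by rewrite /cut /Y -/u -/v split_rv -/r /away addbb.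
have cY : count (cut Y) dem != 1.
  apply: contra (feas Y) => c; apply/and3P; split => //.
  by rewrite /closed /pick map_cat all_cat /= eY; apply/and3P; split.
have E x : absorb S g x = S x (+) Y x by rewrite absorbE.
rewrite (@viol_ext _ _ (fun x => S x (+) Y x)) //.
have cl es : closed es S -> closed es Y -> closed es (fun x => S x (+) Y x).
  by move=> /allP a /allP b; apply/allP => f fe; rewrite cut_addb (negbTE (a f fe)) (negbTE (b f fe)).
rewrite /viol cl //= ?/pick ?map_cat.
rewrite cl /= /closed ?all_cat; try by apply/andP; split.
have [d0 [dd0 cd0 ud0]] := viol_cut vS; have [d1 [dd1 cd1 ud1]] := viol_cut vB.
have sub d : d \in dem -> cut Y d -> d = d0 \/ d = d1.
  move=> dd; rewrite /cut /Y.
  case hS : (S d.1 != S d.2); first by left; exact: ud0.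
  move/negbFE/eqP: hS => ->.
  case hB : (away r g (rho d.1) != away r g (rho d.2)); first by right; exact: ud1.
  by move/negbFE/eqP: hB => ->; rewrite eqxx.
have cS d : d \in dem -> cut S d = (d == d0).
  by move=> dd; apply/idP/eqP => [|->] //; exact: ud0.
apply/eqP; case Y0 : (cut Y d0); last first.
  apply: (cut1 dem_uniq dd0); rewrite ?cut_addb ?cd0 ?Y0 // => d dd; rewrite cut_addb cS //.
  case: eqVneq => //= ne cY'; case: (sub d dd cY') => // ed; case/negP: cY; apply/eqP.
  apply: (cut1 dem_uniq dd cY') => d' dd' c'; case: (sub d' dd' c') => [e0|-> //].
  by rewrite -e0 c' in Y0.
have ne : d1 != d0.
  apply: contra cY => /eqP e1; apply/eqP/(cut1 dem_uniq dd0 Y0) => d dd /(sub d dd).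
  by rewrite e1 => -[].
have Y1 : cut Y d1.
  case n1 : (cut Y d1) => //; case/negP: cY; apply/eqP/(cut1 dem_uniq dd0 Y0) => d dd c.
  by case: (sub d dd c) => // e1; move: n1; rewrite -e1 c.
apply: (cut1 dem_uniq dd1); first by rewrite cut_addb cS // (negbTE ne).
move=> d dd; rewrite cut_addb cS //; case: eqVneq => [->|nd]; first by rewrite Y0.
by move=> /(sub d dd)[] // ed; rewrite ed eqxx in nd.
Qed.

Let Kr := [seq g <- K | incident r g].
Definition absorbed := foldl absorb S0 Kr.

Lemma anchor_region g : incident r g -> rho (anchor g) = r.
Proof. by rewrite /incident /anchor; case: eqP => //= _ /eqP. Qed.

Lemma absorb_region S g x : rho x = r -> absorb S g x = S x.
Proof. by move=> e0; rewrite /absorb e0 /away addbb. Qed.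

Lemma absorbed_region x : rho x = r -> absorbed x = S0 x.
Proof.
rewrite /absorbed => e0; elim: Kr S0 => //= g s IH S; by rewrite IH absorb_region.
Qed.

Lemma absorbed_viol : viol (K ++ M) absorbed.
Proof.
rewrite /absorbed; have : all (fun g => (g \in K) && incident r g) Kr.
  by apply/allP => g; rewrite mem_filter andbC.
elim: Kr S0 vS0 => //= g s IH S vS /andP[/andP[gK ig] h]; apply: IH => //; exact: absorb_viol.
Qed.

Lemma absorbed_branch g x : x < N -> g \in K -> incident r g -> away r g (rho x) -> absorbed x = S0 (anchor g).
Proof.
move=> xN gK ig ax; have gs : g \in Kr by rewrite mem_filter ig.
have : uniq Kr by rewrite filter_uniq // (rt_uniq rt).
have : all (fun g => (g \in K) && incident r g) Kr.
  by apply/allP => h; rewrite mem_filter andbC.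
rewrite /absorbed; elim: Kr gs S0 => //= h s IH; rewrite inE => + S /andP[/andP[hK ih] al] /andP[hs us].
have stay T : all (fun g => (g \in K) && incident r g) s -> g \notin s -> foldl absorb T s x = T x.
  elim: s T {IH al hs us} => //= k s IH T /andP[/andP[kK ik] al]; rewrite inE negb_or => /andP[ne ns].
  by rewrite IH // /absorb (away_disjoint gK kK ig ik ne rK (rt_id rt xN) ax).
case/orP => [/eqP gh|gs]; last by rewrite IH // absorb_region // anchor_region.
by rewrite stay ?gh // /absorb -gh ax.
Qed.

(** [S0] divides the region [r] of [e]: the part of the first end of [e] keeps the number [r], the
    other part becomes the new region [n]. *)
Definition split_rho x := if (rho x == r) && (S0 x != S0 u) then n else rho x.
(** The side of the new link [e] consists of the region [n] and of the branches attached to it; on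
    an old side, [n] counts as [r]. *)
Definition split_W g : pred nat := fun p =>
  if g == e then (p == n) || [&& p != r & has (fun h => [&& incident r h, away r h p & S0 (anchor h) != S0 u]) K]
  else W g (if p == n then r else p).

Lemma split_old g x : x < N -> g != e -> split_W g (split_rho x) = W g (rho x).
Proof.
move=> xN ne; rewrite /split_W (negbTE ne) /split_rho; have := rt_id rt xN.
have [xr|nr] := eqVneq (rho x) r => /= xK; last by rewrite ltn_eqF ?ltnS.
have nr : (r == n) = false by rewrite ltn_eqF ?ltnS.
by rewrite xr; case: (S0 x != S0 u); rewrite ?eqxx ?nr.
Qed.

Lemma split_new x : x < N -> split_W e (split_rho x) = (absorbed x != S0 u).
Proof.
move=> xN; rewrite /split_W eqxx /split_rho; have xK := rt_id rt xN.
have [xr|nr] := eqVneq (rho x) r => /=.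
  rewrite absorbed_region //; case: (S0 x != S0 u); first by rewrite eqxx.
  by rewrite xr eqxx orbF ltn_eqF // ltnS.
rewrite nr ltn_eqF ?ltnS //=; have [g [gK ig ax]] := away_exists rK xK nr.
rewrite (absorbed_branch xN gK ig ax); apply/hasP/idP => [[h hK /and3P[ih ah]]|c].
  have [->//|ne] := eqVneq g h.
  by rewrite (away_disjoint gK hK ig ih ne rK xK ax) in ah.
by exists g; rewrite ?ig ?ax.
Qed.

Hypothesis eK : e \notin K.

Lemma split_tree : region_tree M (e :: K) split_rho split_W.
Proof.
have ee x : x \in K -> (x == e) = false by move=> xK; apply: contraNF eK => /eqP <-.
have lt i : i \in e :: K -> i < size links by rewrite inE => /orP[/eqP -> //|/(allP vK)].
have gl i : i \in e :: K -> (ends i).1 < N /\ (ends i).2 < N.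
  by move=> /lt iL; split; [exact: (end_lt false iL) | exact: (end_lt true iL)].
have vE : valid (e :: K) by apply/allP => i /lt.
split.
- by rewrite /= eK (rt_uniq rt).
- by move=> x xN; rewrite /split_rho /= -/n; case: ifP => // _; rewrite ltnW // ltnS (rt_id rt).
- move=> g; rewrite inE => /orP[/eqP ->|gK].
    rewrite (@viol_ext _ _ (fun x => absorbed x (+) S0 u)) ?viol_addb1 //.
      by apply: (@viol_sub _ (K ++ M)); [move=> i iM; rewrite mem_cat iM orbT | exact: absorbed_viol].
    by move=> x xN; rewrite split_new //; case: (absorbed x); case: (S0 u).
  rewrite (@viol_ext _ _ (fun x => W g (rho x))) ?(rt_viol rt) // => x xN.
  by rewrite split_old // ee.
- move=> g g' gE g'E; have [a b] := gl _ g'E; rewrite /cut; move: gE; rewrite inE => /orP[/eqP ->|gK].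
    rewrite !split_new //; move: g'E; rewrite inE => /orP[/eqP ->|g'K].
      rewrite eqxx !absorbed_region ?split_rv //; move: cS0; rewrite /cut -/u -/v.
      by case: (S0 u); case: (S0 v).
    have /and3P[_ + _] := absorbed_viol; rewrite /closed /pick map_cat all_cat => /andP[/allP h _].
    by have := h _ (map_f ends g'K); rewrite /cut negbK => /eqP ->; rewrite eqxx ee.
  rewrite !split_old ?ee //; move: g'E; rewrite inE => /orP[/eqP ->|g'K]; last exact: (rt_cut rt).
  by rewrite [RHS]eq_sym ee //; apply/negbTE; have := rtM gK; rewrite /cut.
move=> Q h.
have nr : n != r by rewrite gtn_eqF // ltnS.
have Qnr : Q n = Q r.
  have := h e (mem_head _ _); rewrite /cut negbK /split_rho -/u -/v split_rv eqxx -/r !eqxx /=.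
  by move: cS0; rewrite /cut -/u -/v eq_sym => ->; move/eqP.
have Qs x : Q (split_rho x) = Q (rho x) by rewrite /split_rho; case: ifP => // /andP[/eqP -> _].
have key p : p <= size K -> Q p = Q r.
  move=> pK; apply: (rt_conn rt) => // g gK; have := h g; rewrite inE gK orbT => /(_ isT).
  by rewrite /cut !Qs.
have key' p : p <= n -> Q p = Q r by rewrite leq_eqVlt ltnS => /orP[/eqP ->|/key].
by move=> p q pK qK; rewrite !key'.
Qed.

End Split.
End Struct.
End Tree.
End Wtree.

(** * The primal-dual algorithm with parities *)

Module Wstep.
From mathcomp Require Import all_boot zify.
Import Wgmv Wtree.

(** The remaining slack and a parity bit for each end of the link. *)
Definition link_state : Type := nat * (bool * bool).
(** Link states and picked links, newest first; then the parity of the clock, the sets grown last,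
    and the dual values raised so far. The sets grown last serve the analysis, which calls a region
    dormant when it meets none of them. *)
Definition wstate : Type :=
  (seq link_state * seq nat) * (bool * (seq (seq bool) * seq (seq bool * nat))).

Section Algo.
Variables (N : nat) (free dem links : seq (nat * nat)) (w : seq nat).
Local Notation ends := (ends links).
Local Notation act := (act N free dem links).

Definition end_of (h : nat * bool) := if h.2 then (ends h.1).2 else (ends h.1).1.
Definition half (A : seq (seq bool)) (h : nat * bool) :=
  has (fun S => nth false S (end_of h) && ~~ nth false S (end_of (h.1, ~~ h.2))) A.
Definition crossing A := [seq i <- iota 0 (size links) | half A (i, false) || half A (i, true)].
Definition link0 : link_state := (0, (false, false)).
Definition slack (dyn : seq link_state) i := (nth link0 dyn i).1.
Definition par (dyn : seq link_state) (h : nat * bool) :=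
  if h.2 then (nth link0 dyn h.1).2.2 else (nth link0 dyn h.1).2.1.

(** An active end whose bit differs from the clock gives up one unit of slack to come into phase. *)
Definition adjust A tau i (d : link_state) : link_state :=
  let bu := half A (i, false) && (d.2.1 != tau) in
  let bv := half A (i, true) && (d.2.2 != tau) in
  (d.1 - bu - bv, (d.2.1 (+) bu, d.2.2 (+) bv)).
(** Growth at both ends consumes slack at rate two. After [adjust] both bits then equal the clock,
    the slack is even, and the halving loses nothing. *)
Definition room A i (d : link_state) :=
  if half A (i, false) && half A (i, true) then d.1./2 else d.1.
Definition grow A D i (d : link_state) : link_state :=
  let du := if half A (i, false) then D else 0 in
  let dv := if half A (i, true) then D else 0 in
  (d.1 - du - dv, (d.2.1 (+) odd du, d.2.2 (+) odd dv)).
Definition minl s := foldl minn (head 0 s) (behead s).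
Definition map_links (f : nat -> link_state -> link_state) (dyn : seq link_state) :=
  mkseq (fun i => f i (nth link0 dyn i)) (size links).

Definition tight A dyn := [seq i <- crossing A | slack dyn i == 0].
(** The adjustment alone may exhaust a link; then [D] is 0 and only the adjusted slacks are
    recorded, so that the next step can pick this link. *)
Definition grow_all A (dyn1 : seq link_state) (st : wstate) : wstate :=
  let D := minl [seq room A i (nth link0 dyn1 i) | i <- crossing A] in
  if D == 0 then ((dyn1, st.1.2), st.2) else
  ((map_links (grow A D) dyn1, st.1.2),
   (st.2.1 (+) odd D, (A, [seq (B, D) | B <- A] ++ st.2.2.2))).
Definition wstep (st : wstate) : wstate :=
  let A := act st.1.2 in
  if nilp A then st else
  if tight A st.1.1 is i :: _ then ((st.1.1, i :: st.1.2), st.2) else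
  grow_all A (map_links (adjust A st.2.1) st.1.1) st.

Definition winit : wstate :=
  (([seq (c, (false, false)) | c <- w], [::]), (false, ([:: nseq N true], [::]))).
Definition wrun := iter (size links).*2.+1 wstep winit.

Definition feas X := nilp (cand N free dem links X).
(** Reverse deletion, newest link first: the first component collects the links kept, the second is
    the list still to be examined, beginning with [i]. *)
Definition prune_step (KR : seq nat * seq nat) i :=
  let R := behead KR.2 in ((if feas (KR.1 ++ R) then KR.1 else i :: KR.1), R).
Definition prune K M := (foldl prune_step (K, M) M).1.
Definition duals : seq (seq bool * nat) := wrun.2.2.2.
Definition kept := prune [::] wrun.1.2.

Lemma prune_cons K i M :
  prune K (i :: M) = if feas (K ++ M) then prune K M else prune (i :: K) M.
Proof. by rewrite /prune /= /prune_step /=; case: ifP. Qed.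

Hypothesis freeN : inrange N free.
Hypothesis demN : inrange N dem.
Hypothesis linksN : inrange N links.
Hypothesis dem_uniq : uniq dem.
Hypothesis size_w : size w = size links.
Hypothesis even_w : forall i, odd (nth 0 w i) = false.
Hypothesis N_gt0 : 0 < N.

Local Notation viol := (viol free dem links).
Local Notation valid := (valid links).
Hypothesis all_feas : forall S, ~~ viol (iota 0 (size links)) S.

Lemma feasP X : valid X -> reflect (forall S, ~~ viol X S) (feas X).
Proof.
move=> vX; apply: (iffP nilP) => [c0 S|h].
  by apply/negP => /(viol_cand freeN demN linksN vX)[T]; rewrite c0.
case E : (cand _ _ _ _ _) => [//|S s]; have cS : S \in cand N free dem links X by rewrite E mem_head.
by have := h (mem_map S); rewrite (cand_viol freeN demN linksN dem_uniq vX cS).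
Qed.

Lemma end_of_lt h : h.1 < size links -> end_of h < N.
Proof. by move=> l; rewrite /end_of; exact: (end_lt linksN h.2 l). Qed.

Lemma cut_ends i S : cut S (ends i) = (S (end_of (i, false)) != S (end_of (i, true))).
Proof. by []. Qed.

Section Active.
Variables (M : seq nat) (A : seq (seq bool)).
Hypothesis vM : valid M.
Hypothesis AE : A = act M.

Let aviol S : S \in A -> viol M (mem_map S).
Proof. by rewrite AE => /(act_viol freeN demN linksN dem_uniq vM). Qed.

Lemma active_equal S T x : S \in A -> T \in A -> x < N -> mem_map S x -> mem_map T x -> S = T.
Proof.
move=> SA TA xN Sx Tx.
have inc S' T' : S' \in A -> T' \in A -> mem_map S' x -> mem_map T' x -> included N (mem_map S') (mem_map T').
  move=> S'A T'A S'x T'x; have aS' : S' \in act M by rewrite -AE.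
  case: (act_uncrossed freeN demN linksN dem_uniq vM aS' (aviol T'A)) => // /(_ x xN S'x).
  by rewrite T'x.
have sz S' : S' \in A -> size S' = N by rewrite AE; exact: act_size.
apply: (@eq_from_nth _ false); rewrite ?sz // => y yN.
have := inc S T SA TA Sx Tx y yN; have := inc T S TA SA Tx Sx y yN; rewrite /mem_map.
by case: (nth _ S y); case: (nth _ T y) => // a b; [case: (b isT) | case: (a isT)].
Qed.

Lemma uniq_active : uniq A. Proof. by rewrite AE undup_uniq. Qed.

(** Active sets are pairwise disjoint, so each end of the link belongs to at most one of them. *)
Lemma count_cut i : i < size links ->
  count (fun S => cut (mem_map S) (ends i)) A <= half A (i, false) + half A (i, true).
Proof.
move=> iL.
have le1 (P : pred (seq bool)) x : x < N -> (forall S, P S -> mem_map S x) -> count P A <= has P A.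
  move=> xN h; have [hP|] := boolP (has P A); last by rewrite has_count -leqNgt leqn0 => /eqP ->.
  rewrite -size_filter; have uf : uniq (filter P A) := filter_uniq _ uniq_active.
  case E : (filter P A) uf => [|S [|T s]] //= /andP[]; rewrite inE negb_or => /andP[/eqP ne _] _.
  have mem V : V \in filter P A -> V \in A /\ P V by rewrite mem_filter => /andP[].
  have [SA PS] : S \in A /\ P S by apply: mem; rewrite E mem_head.
  have [TA PT] : T \in A /\ P T by apply: mem; rewrite E !inE eqxx orbT.
  by case: ne; apply: (active_equal SA TA xN); apply: h.
have a := @end_of_lt (i, false) iL; have b := @end_of_lt (i, true) iL.
apply: leq_trans (leq_add (le1 _ _ a _) (le1 _ _ b _)); last 2 first.
- by move=> S /andP[].
- by move=> S /andP[].
rewrite -count_predUI; apply: leq_trans (leq_addr _ _); apply: sub_count => S /=.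
by rewrite cut_ends /mem_map; case: (nth _ S _); case: (nth _ S _).
Qed.

Lemma halfP h : reflect (exists S, [/\ S \in A, mem_map S (end_of h) & ~~ mem_map S (end_of (h.1, ~~ h.2))]) (half A h).
Proof. by apply: (iffP hasP) => [[S SA /andP[]]|[S [SA a b]]]; exists S; rewrite // -/(mem_map S _) a. Qed.

Lemma crossingP i : i < size links ->
  (i \in crossing A) = has (fun S => cut (mem_map S) (ends i)) A.
Proof.
move=> iL; rewrite mem_filter mem_iota /= iL andbT -has_predU; apply: eq_has => S /=.
by rewrite cut_ends /mem_map; case: (nth _ S _); case: (nth _ S _).
Qed.

Lemma crossing_notin i : i \in crossing A -> i \notin M.
Proof.
move=> ic; have iL : i < size links by move: ic; rewrite mem_filter mem_iota => /andP[_].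
rewrite crossingP // in ic; case/hasP: ic => S /aviol /and3P[_ /allP cM _]; apply: contraL => iM.
by apply: cM; apply: map_f.
Qed.

Lemma crossing_nonempty : A != [::] -> crossing A != [::].
Proof.
case EA : {1}A => [//|S A'] _; have SA : S \in A by rewrite EA mem_head.
apply/eqP => c0; case/negP: (all_feas (mem_map S)); have /and3P[a b c] := aviol SA.
apply/and3P; split => //; apply/allP => e /mapP[i]; rewrite mem_iota => /andP[_ iL] ->.
have := crossingP iL; rewrite c0 in_nil => /esym /negbT /hasPn; exact.
Qed.

Lemma active_point S : S \in A -> find id S < N /\ mem_map S (find id S).
Proof.
move=> SA; have hS : has id S.
  have [d [dd cd _]] := viol_cut (aviol SA); apply/(has_nthP false); move: cd; rewrite /cut.
  have lt x : mem_map S x -> x < size S.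
    by move=> h; rewrite ltnNge; apply/negP => s; move: h; rewrite /mem_map nth_default.
  have ex x : mem_map S x -> exists2 i, i < size S & nth false S i by move=> h; exists x; [exact: lt|].
  by case E : (mem_map S d.1) => h; [exact: (ex _ E) | apply: (ex d.2); case: (mem_map S d.2) h].
split; last exact: (nth_find false hS).
by move: (hS); rewrite has_find; rewrite AE in SA; rewrite (act_size SA).
Qed.

End Active.

Lemma minl_leq s x : x \in s -> minl s <= x.
Proof.
have h t m : foldl minn m t <= m /\ {in t, forall y, foldl minn m t <= y}.
  elim: t m => //= a t IH m; have [l l'] := IH (minn m a); split.
    by apply: leq_trans l _; exact: geq_minl.
  move=> y; rewrite inE => /orP[/eqP ->|/l' //]; apply: leq_trans l _; exact: geq_minr.
by case: s => // a s; rewrite inE /minl /=; have [l l'] := h s a => /orP[/eqP ->|/l'].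
Qed.

Lemma minl_mem s : s != [::] -> minl s \in s.
Proof.
have h t m : foldl minn m t \in m :: t.
  elim: t m => //= [|a t IH] m; first by rewrite mem_head.
  have := IH (minn m a); rewrite !inE => /orP[/eqP ->|->]; last by rewrite !orbT.
  by rewrite /minn; case: ifP; rewrite eqxx ?orbT.
by case: s => // a s _; exact: h.
Qed.

Lemma nth_map_links f dyn i : i < size links -> nth link0 (map_links f dyn) i = f i (nth link0 dyn i).
Proof. by move=> iL; rewrite nth_mkseq. Qed.

Definition parity_ok (dyn : seq link_state) := forall i, i < size links ->
  odd (slack dyn i) = par dyn (i, false) (+) par dyn (i, true).
Definition bump A dyn tau (h : nat * bool) := half A h && (par dyn h != tau).

Section Moves.
Variables (A : seq (seq bool)) (dyn : seq link_state) (tau : bool).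
Hypothesis ok : parity_ok dyn.
Hypothesis not_tight : tight A dyn = [::].

Let dyn1 := map_links (adjust A tau) dyn.

Lemma crossing_pos i : i < size links -> half A (i, false) || half A (i, true) -> 0 < slack dyn i.
Proof.
move=> iL h; rewrite lt0n; apply/negP => s0; have : i \in tight A dyn.
  by rewrite !mem_filter s0 mem_iota iL h.
by rewrite not_tight.
Qed.

Lemma adjust_par h : h.1 < size links -> par dyn1 h = par dyn h (+) bump A dyn tau h.
Proof. by case: h => i [] /= iL; rewrite /par /= nth_map_links. Qed.

Lemma adjust_slack i : i < size links ->
  slack dyn i = slack dyn1 i + (bump A dyn tau (i, false) + bump A dyn tau (i, true)).
Proof.
move=> iL; rewrite /slack nth_map_links //= -/(slack dyn i) -/(bump A dyn tau (i, false)) -/(bump A dyn tau (i, true)).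
have := ok iL; have := crossing_pos iL; rewrite /bump.
clear; case: (half A _); case: (half A _); case: (par _ _); case: (par _ _); case: tau => //=;
  case: (slack dyn i) => [|[|s]] //=; lia.
Qed.

Lemma adjust_ok : parity_ok dyn1.
Proof.
move=> i iL; have := ok iL; rewrite (adjust_slack iL) !oddD !oddb !adjust_par //.
by do 2!case: (bump _ _ _ _); case: (odd _); case: (par _ _); case: (par _ _).
Qed.

Lemma adjust_active h : h.1 < size links -> half A h -> par dyn1 h = tau.
Proof. by move=> iL hh; rewrite adjust_par // /bump hh; case: (par _ _); case: tau. Qed.

Let D := minl [seq room A i (nth link0 dyn1 i) | i <- crossing A].
Let dyn2 := map_links (grow A D) dyn1.

Lemma grow_slack i : i < size links ->
  slack dyn1 i = slack dyn2 i + D * (half A (i, false) + half A (i, true)).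
Proof.
move=> iL; rewrite /slack /dyn2 nth_map_links //= -/(slack dyn1 i).
have : half A (i, false) || half A (i, true) -> D <= room A i (nth link0 dyn1 i).
  by move=> c; apply: minl_leq; apply: map_f; rewrite mem_filter mem_iota c iL.
rewrite /room -/(slack dyn1 i); clear; move: (slack dyn1 i) D => x d.
by case: (half A _); case: (half A _) => //= h; try have := h isT; lia.
Qed.

Lemma grow_par h : h.1 < size links -> par dyn2 h = par dyn1 h (+) (half A h && odd D).
Proof.
by case: h => i [] /= iL; rewrite /par /= /dyn2 nth_map_links //=; case: (half A _).
Qed.

Lemma grow_ok : parity_ok dyn2.
Proof.
move=> i iL; have := adjust_ok iL; rewrite (grow_slack iL) oddD oddM !grow_par // oddD !oddb.
by case: (half A _); case: (half A _); case: (odd D); case: (odd _); case: (par _ _); case: (par _ _).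
Qed.

Lemma grow_active h : h.1 < size links -> half A h -> par dyn2 h = tau (+) odd D.
Proof. by move=> iL hh; rewrite grow_par // adjust_active // hh. Qed.

End Moves.

Definition covered (G : seq (seq bool)) x := has (fun S => mem_map S x) G.
Definition load (rec : seq (seq bool * nat)) i :=
  sumn [seq if cut (mem_map r.1) (ends i) then r.2 else 0 | r <- rec].
Definition total (rec : seq (seq bool * nat)) := sumn [seq r.2 | r <- rec].

(** [wi_meets] survives picks because these only shrink the family of violated sets. Through it, a
    region with an active set is known to meet the sets grown last, initially the whole ground
    set. *)
Record winv (st : wstate) : Prop := {
  wi_size : size st.1.1 = size links;
  wi_valid : valid st.1.2;
  wi_uniq : uniq st.1.2;
  wi_par : parity_ok st.1.1;
  wi_meets : forall T, viol st.1.2 T -> exists x, [/\ x < N, T x & covered st.2.2.1 x];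
  wi_cover : exists2 x, x < N & covered st.2.2.1 x;
  wi_load : forall i, i < size links -> slack st.1.1 i + load st.2.2.2 i <= nth 0 w i;
  wi_rec : forall r, r \in st.2.2.2 -> size r.1 = N /\ viol [::] (mem_map r.1) }.

Lemma winv_init : winv winit.
Proof.
have nthi i : i < size links -> nth link0 winit.1.1 i = (nth 0 w i, (false, false)).
  by move=> iL; rewrite (nth_map 0) ?size_w.
have cov x : x < N -> covered winit.2.2.1 x by move=> xN; rewrite /covered /= /mem_map nth_nseq xN.
split=> //.
- by rewrite size_map.
- by move=> i iL; rewrite /slack /par /= nthi //= even_w.
- move=> T vT; have [d [dd cd _]] := viol_cut vT; have [d1 d2] := dem_range demN dd.
  by move: cd; rewrite /cut; case T1 : (T d.1) => T2; [exists d.1|exists d.2]; split; rewrite ?cov //; by case: (T d.2) T2.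
- by exists 0; rewrite ?cov.
- by move=> i iL; rewrite /slack nthi // /load /= addn0.
Qed.

Lemma crossing_valid A i : i \in crossing A -> i < size links.
Proof. by rewrite mem_filter mem_iota => /andP[_]. Qed.

Lemma size_map_links f dyn : size (map_links f dyn) = size links.
Proof. by rewrite size_mkseq. Qed.

Lemma winv_step st : winv st -> winv (wstep st).
Proof.
move=> [sz vM uM pk mt cv ld rc]; rewrite /wstep; set A := act _.
have AE : A = act st.1.2 by [].
case: ifP => [_|/nilP/eqP An]; first by split.
case Et : (tight A st.1.1) => [|i t].
  rewrite /grow_all; set dyn1 := map_links _ _; set D := minl _.
  have ld1 i : i < size links -> slack dyn1 i + load st.2.2.2 i <= nth 0 w i.
    by move=> iL; apply: leq_trans (ld i iL); rewrite (adjust_slack st.2.1 pk Et iL) -/dyn1 leq_add2r leq_addr.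
  case: ifP => D0 /=; first by split=> //=; [exact: size_map_links | exact: adjust_ok].
  split=> //=.
  - exact: size_map_links.
  - exact: grow_ok.
  - move=> T vT; have [S SA ST] := viol_act freeN demN linksN dem_uniq vM vT.
    have [xN Sx] := active_point vM AE SA; exists (find id S); split=> //; first exact: ST.
    by apply/hasP; exists S.
  - case EA : A An => [//|S A'] _; have SA : S \in A by rewrite EA mem_head.
    have [xN Sx] := active_point vM AE SA; exists (find id S); rewrite // -EA.
    by apply/hasP; exists S.
  - move=> i iL; apply: leq_trans (ld1 i iL); rewrite (grow_slack _ _ _ iL) -/dyn1 -/D -addnA leq_add2l.
    rewrite /load map_cat sumn_cat leq_add2r -map_comp.
    apply: leq_trans (leq_mul (leqnn D) (count_cut vM AE iL)).
    by clear; elim: (A) => //= S s IH; case: (cut _ _); rewrite ?mulnDr ?muln1 /= ?mul0n; lia.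
  - move=> r; rewrite mem_cat => /orP[/mapP[S SA ->]|/rc //] /=; split.
      by rewrite AE in SA; exact: (act_size SA).
    by apply: (@viol_sub _ _ _ [::] st.1.2) => //; rewrite AE in SA; exact: (act_viol freeN demN linksN dem_uniq vM SA).
have : i \in tight A st.1.1 by rewrite Et mem_head.
rewrite mem_filter => /andP[_ ic].
split=> //=; first by rewrite /valid /= (crossing_valid ic).
  by rewrite uM andbT (crossing_notin vM AE ic).
by move=> T vT; apply: mt; apply: viol_sub vT => j; rewrite inE orbC => ->.
Qed.

Lemma winv_iter n : winv (iter n wstep winit).
Proof. by elim: n => [|n IH] /=; [exact: winv_init | exact: winv_step]. Qed.

(** A growth step leaves a tight link, and a pick lengthens the list of distinct links, so this
    drops until no set is active. Its initial value is at most [(size links).*2.+1], the number of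
    rounds in [wrun]. *)
Definition progress (st : wstate) :=
  (size links - size st.1.2).*2 + (tight (act st.1.2) st.1.1 == [::]).

Lemma progress_step st : winv st -> ~~ nilp (act st.1.2) -> progress (wstep st) < progress st.
Proof.
move=> iv nA; have iv' := winv_step iv; move: iv'; rewrite /wstep (negbTE nA); set A := act _.
case Et : (tight A st.1.1) => [|i t] iv'.
  rewrite /progress -/A Et eqxx /=.
  suff : tight A (grow_all A (map_links (adjust A st.2.1) st.1.1) st).1.1 != [::].
    rewrite /grow_all; case: ifP => _ /=; rewrite -/A => /negbTE ->; lia.
  rewrite /grow_all; set dyn1 := map_links _ _; set D := minl _.
  have cn : crossing A != [::] by apply: (crossing_nonempty (wi_valid iv) erefl); move: nA; case: (act _).
  have : D \in [seq room A i (nth link0 dyn1 i) | i <- crossing A].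
    by apply: minl_mem; case: (crossing A) cn.
  case/mapP => i ic DE; have iL := crossing_valid ic.
  have t0 dyn : slack dyn i = 0 -> tight A dyn != [::].
    move=> s0; apply/eqP => t0; have : i \in tight A dyn by rewrite mem_filter ic s0.
    by rewrite t0.
  have hc : half A (i, false) || half A (i, true) by move: ic; rewrite mem_filter => /andP[].
  have gs := grow_slack A st.1.1 st.2.1 iL; rewrite -/dyn1 -/D in gs.
  have ok1 : parity_ok dyn1 := adjust_ok _ (wi_par iv) Et.
  (* An odd slack on a link growing from both ends would leave one unit behind and no link tight;
     equal parity bits exclude it. *)
  have ev : half A (i, false) -> half A (i, true) -> ~~ odd (slack dyn1 i).
    move=> h1 h2; by rewrite ok1 // !adjust_active // addbb.
  case: ifP => D0 /=; apply: t0.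
    move: DE ev hc; rewrite (eqP D0) /room -/(slack dyn1 i).
    by clear; case: (half A _); case: (half A _) => //= e ev _; try have := ev isT isT; lia.
  move: DE ev hc gs; rewrite /room -/(slack dyn1 i).
  by clear; case: (half A _); case: (half A _) => //= e ev _; try have := ev isT isT; lia.
have := wi_valid iv'; have := wi_uniq iv'; rewrite /progress /= => u v.
have : size (i :: st.1.2) <= size (iota 0 (size links)).
  by apply: uniq_leq_size => // j jM; rewrite mem_iota; exact: (@allP _ _ (i :: st.1.2) v j jM).
rewrite -/A Et size_iota /=; case: (_ == _); lia.
Qed.

Lemma wrun_done : act wrun.1.2 = [::].
Proof.
have h n : nilp (act (iter n wstep winit).1.2) \/ progress (iter n wstep winit) + n <= progress winit.
  elim: n => [|n [IH|IH]]; first by right; rewrite addn0.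
    by left; rewrite /= /wstep IH.
  have [|nA] := boolP (nilp (act (iter n wstep winit).1.2)).
    by move=> z; left; rewrite /= /wstep z.
  right; have := progress_step (winv_iter n) nA; rewrite /=; lia.
have top : progress winit <= (size links).*2.+1.
  by rewrite /progress /= subn0; clear; case: (_ == _); lia.
case: (h (size links).*2.+1) => [/nilP //|]; rewrite -/wrun => le.
have [/nilP //|nA] := boolP (nilp (act wrun.1.2)).
have := progress_step (winv_iter (size links).*2.+1) nA; rewrite -/wrun; move: le top; clear; lia.
Qed.

End Algo.
End Wstep.

(** * The factor two, by potentials on the regions *)

Module Wpot.
From mathcomp Require Import all_boot zify.
Import Wgmv Wtree Wstep.

Lemma sum_fibers (T : eqType) (s : seq T) (f : T -> nat) (Q : pred T) n :
  {in s, forall h, Q h -> f h < n} ->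
  \sum_(p <- iota 0 n) count (fun h => (f h == p) && Q h) s = count Q s.
Proof.
elim: s => [|h s IH] lt /=; first by rewrite big1.
rewrite big_split /= IH; last by move=> x xs; apply: lt; rewrite inE xs orbT.
congr (_ + _); case Qh : (Q h); last by rewrite big1 // => p _; rewrite andbF.
have fn : f h < n by apply: lt; rewrite ?mem_head.
rewrite (bigD1_seq (f h)) ?iota_uniq ?mem_iota //= eqxx big1 // => p.
by rewrite eq_sym => /negbTE ->.
Qed.

Lemma sub_in_count (T : eqType) (s : seq T) (P Q : pred T) :
  {in s, forall x, P x -> Q x} -> count P s <= count Q s.
Proof.
move=> h; rewrite (@eq_in_count _ P (predI P Q)); first by apply: sub_count => x /andP[].
by move=> x xs /=; case Px : (P x) => //=; rewrite (h x xs Px).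
Qed.

Section Potential.
Variables (N : nat) (free dem links : seq (nat * nat)) (w : seq nat).
Hypothesis freeN : inrange N free.
Hypothesis demN : inrange N dem.
Hypothesis linksN : inrange N links.
Hypothesis dem_uniq : uniq dem.
Hypothesis size_w : size w = size links.
Hypothesis even_w : forall i, odd (nth 0 w i) = false.
Hypothesis N_gt0 : 0 < N.
Local Notation ends := (ends links).
Local Notation act := (act N free dem links).
Local Notation end_of := (end_of links).
Local Notation half := (half links).
Local Notation viol := (viol free dem links).
Local Notation valid := (valid links).
Local Notation winv := (winv N free dem links w).
Local Notation wstep := (wstep N free dem links).
Local Notation winit := (winit N w).
Local Notation wrun := (wrun N free dem links w).
Local Notation prune := (prune N free dem links).
Local Notation feas := (feas N free dem links).
Local Notation region_tree := (region_tree N free dem links).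
Hypothesis all_feas : forall S, ~~ viol (iota 0 (size links)) S.

Definition halves (K : seq nat) : seq (nat * bool) := flatten [seq [:: (g, false); (g, true)] | g <- K].

Lemma mem_halves K h : (h \in halves K) = (h.1 \in K).
Proof.
apply/flattenP/idP => [[s /mapP[g gK ->]]|hK].
  by rewrite !inE => /orP[] /eqP ->.
exists [:: (h.1, false); (h.1, true)]; first exact: map_f.
by case: h {hK} => g []; rewrite !inE eqxx ?orbT.
Qed.

Lemma count_halves P g s : count P (halves (g :: s)) = P (g, false) + (P (g, true) + count P (halves s)).
Proof. by []. Qed.

Section Fixed.
Variables (K : seq nat) (rho : nat -> nat).
Definition at_region p h := rho (end_of h) == p.
Definition meets G p := has (fun x => (rho x == p) && covered G x) (iota 0 N).
Definition mixed dyn p := has (fun h => at_region p h && par dyn h) (halves K) &&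
                          has (fun h => at_region p h && ~~ par dyn h) (halves K).
Definition degree p := count (at_region p) (halves K).
(** The potential of a region. If it meets the sets grown last, it holds the 2 of the tree count and
    one unit for each end still to be brought into phase. A dormant region may be joined to an
    active one with all its ends out of phase; it reserves one unit for each end, and another if
    their parities differ. *)
Definition term dyn tau G p :=
  if meets G p then 2 + count (fun h => at_region p h && (par dyn h != tau)) (halves K)
  else degree p + mixed dyn p.
(** To be read with [R] twice the final dual total and [Y] the total so far: the slack left on [K],
    together with 2 per region, is paid by twice the growth still to come and by the potentials. At
    the start all slack is left and every potential is 2, which is the approximation bound. *)
Definition budget dyn tau G Y R :=
  \sum_(g <- K) slack dyn g + (size K).+1.*2 + Y.*2 <= R + \sum_(p <- iota 0 (size K).+1) term dyn tau G p.

Lemma degreeE p : degree p = deg links K rho p.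
Proof.
rewrite /degree /deg /halves; elim: K => //= g s ->; rewrite /at_region /end_of /=; lia.
Qed.

Lemma meetsP G p : reflect (exists x, [/\ x < N, rho x = p & covered G x]) (meets G p).
Proof.
apply: (iffP hasP) => [[x]|[x [xN e c]]].
  by rewrite mem_iota => /andP[_ xN] /andP[/eqP e c]; exists x.
by exists x; rewrite ?mem_iota //= e eqxx.
Qed.

Hypothesis vK : valid K.

Lemma half_in h : h \in halves K -> h.1 < size links.
Proof. by rewrite mem_halves; exact: (allP vK). Qed.

Section Step.
Variables (M : seq nat) (W : nat -> pred nat) (st : wstate).
Hypothesis iv : winv st.
Hypothesis ME : M = st.1.2.
Hypothesis rt : region_tree M K rho W.
Let A := act M.
Let AE : A = act M := erefl.
Let vM : valid M. Proof. rewrite ME; exact: wi_valid iv. Qed.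
Hypothesis Anil : A != [::].
Let dyn := st.1.1.
Let tau := st.2.1.
Let G := st.2.2.1.
Hypothesis not_tight : tight links A dyn = [::].
Let dyn1 := map_links links (adjust links A tau) dyn.
Let D := minl [seq room links A i (nth link0 dyn1 i) | i <- crossing links A].
Let dyn2 := map_links links (grow links A D) dyn1.
Let ok : parity_ok links dyn := wi_par iv.

(** The sides [W g] are violated, and violated sets do not cross an active one; so an active set
    cannot extend over two regions. *)
Lemma active_region S x y : S \in A -> x < N -> y < N -> mem_map S x -> mem_map S y -> rho x = rho y.
Proof.
move=> SA xN yN Sx Sy; apply: (same_region rt) => // g gK.
have := act_uncrossed freeN demN linksN dem_uniq vM SA (rt_viol rt gK).
case=> h; first by rewrite (h x xN Sx) (h y yN Sy).
by rewrite (h x xN Sx) (h y yN Sy).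
Qed.

Lemma active_meets S x : S \in A -> x < N -> mem_map S x -> meets G (rho x).
Proof.
move=> SA xN Sx; have vS : viol st.1.2 (mem_map S) by rewrite -ME; exact: (act_viol freeN demN linksN dem_uniq vM SA).
have [y [yN Sy cy]] := wi_meets iv vS; apply/meetsP; exists y; split=> //.
exact: (active_region SA yN xN).
Qed.

Lemma half_meets h : h \in halves K -> half A h -> meets G (rho (end_of h)) /\ meets A (rho (end_of h)).
Proof.
move=> /half_in hL /halfP[S [SA Se _]]; have eN := end_of_lt linksN hL.
split; first exact: (active_meets SA).
by apply/meetsP; exists (end_of h); split=> //; apply/hasP; exists S.
Qed.

(** Each forfeited unit corresponds to an end coming into phase in a region that meets [G], whose
    potential drops by one. *)
Lemma adjust_budget Y R : budget dyn1 tau G Y R -> budget dyn tau G Y R.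
Proof.
rewrite /budget.
have -> : \sum_(g <- K) slack dyn g = \sum_(g <- K) slack dyn1 g + count (bump links A dyn tau) (halves K).
  elim: (K) vK => [_|g s IH /andP[gL vs]]; rewrite ?big_nil // !big_cons IH //.
  by rewrite count_halves (adjust_slack tau ok not_tight gL) -/dyn1; clear; lia.
have -> : \sum_(p <- iota 0 (size K).+1) term dyn tau G p = \sum_(p <- iota 0 (size K).+1) term dyn1 tau G p + count (bump links A dyn tau) (halves K).
  rewrite -(@sum_fibers _ (halves K) (fun h => rho (end_of h)) (bump links A dyn tau) (size K).+1); last first.
    by move=> h hK _; rewrite ltnS (rt_id rt) // (end_of_lt linksN) // half_in.
  rewrite -big_split; apply: eq_bigr => p _ /=; rewrite /term; case: ifP => mp.
    rewrite -addnA; congr (_ + _); rewrite -count_predUI.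
    rewrite [X in _ + X](@eq_in_count _ _ pred0) ?count_pred0 ?addn0; last first.
      move=> h hK /=; rewrite adjust_par ?half_in // /bump; case: (half A h) => /=; last by rewrite !andbF.
      by case: (par _ _); case: tau; rewrite ?andbF.
    apply: eq_in_count => h hK /=; rewrite adjust_par ?half_in // -/(at_region p h) /bump.
    by case: (at_region p h) => //=; case: (half A h) => //=; case: (par _ _); case: tau.
  have no h : h \in halves K -> at_region p h -> half A h = false.
    by move=> hK /eqP e; apply: contraFF mp => hh; have [+ _] := half_meets hK hh; rewrite e.
  have -> : count (fun h => (rho (end_of h) == p) && bump links A dyn tau h) (halves K) = 0.
    rewrite (@eq_in_count _ _ pred0) ?count_pred0 // => h hK /=; apply/negbTE; rewrite negb_and.
    by case e : (rho _ == p) => //=; rewrite /bump (no h hK).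
  rewrite addn0; congr (_ + nat_of_bool (_ && _)); apply: eq_in_has => h hK; case a : (at_region p h) => //=;
    by rewrite adjust_par ?half_in // /bump no // addbF.
lia.
Qed.

Lemma sum_degree : \sum_(p <- iota 0 (size K).+1) degree p = (size K).*2.
Proof.
transitivity (count predT (halves K)); last first.
  rewrite count_predT /halves size_flatten /shape -map_comp; elim: (K) => //= g s ->; lia.
rewrite -(@sum_fibers _ (halves K) (fun h => rho (end_of h)) predT (size K).+1).
  by apply: eq_bigr => p _; apply: eq_count => h /=; rewrite andbT.
by move=> h hK _; rewrite ltnS (rt_id rt) // (end_of_lt linksN) // half_in.
Qed.

(** The degree count in a tree, made local. A region with active sets is paid by them. A region
    without one is no leaf, because a leaf is violated and would contain an active set; its degree
    is therefore at least 2, which balances the [D.*2] on the left. When it falls dormant, its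
    out-of-phase ends pay for [mixed]. *)
Lemma grow_term p : p <= size K -> 0 < D ->
  term dyn2 (tau (+) odd D) A p + D * count (fun h => at_region p h && half A h) (halves K) + D.*2 <=
  D.*2 * count (fun S => rho (find id S) == p) A + term dyn1 tau G p + D * degree p.
Proof.
move=> pK D0.
have dE : degree p = count (fun h => at_region p h && half A h) (halves K)
                    + count (fun h => at_region p h && ~~ half A h) (halves K).
  rewrite -count_predUI [X in _ + X](@eq_count _ _ pred0) ?count_pred0 ?addn0; last first.
    by move=> h /=; case: (half A h); rewrite ?andbF.
  by apply: eq_count => h /=; case: (half A h); rewrite ?andbT ?andbF ?orbF.
have [mA|nA] := boolP (meets A p).
  have [x [xN xp /hasP[S SA Sx]]] := meetsP _ _ mA.
  have mG : meets G p by rewrite -xp; exact: (active_meets SA).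
  have k1 : 0 < count (fun S => rho (find id S) == p) A.
    rewrite -has_count; apply/hasP; exists S => //=; have [fN Sf] := active_point freeN demN linksN dem_uniq vM AE SA.
    by rewrite (active_region SA fN xN) // xp.
  have v2 : count (fun h => at_region p h && (par dyn2 h != tau (+) odd D)) (halves K) <=
            count (fun h => at_region p h && ~~ half A h) (halves K).
    apply: sub_in_count => h hK /= /andP[-> ne]; apply: contra ne => hh.
    by rewrite grow_active ?half_in.
  rewrite /term mA mG dE; move: k1 v2 D0; move: (count _ _) (count _ _) (count _ _) (count _ _) (count _ _); clear; nia.
have no h : h \in halves K -> at_region p h -> half A h = false.
  by move=> hK /eqP e; apply: contraNF nA => hh; have [_] := half_meets hK hh; rewrite e.
have a0 : count (fun h => at_region p h && half A h) (halves K) = 0.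
  rewrite (@eq_in_count _ _ pred0) ?count_pred0 // => h hK /=; apply/negbTE; rewrite negb_and.
  by case e : (at_region p h) => //=; rewrite (no h hK).
have Kn : K != [::].
  apply: contraNneq nA => K0; case EA : A Anil => [//|S A'] _; have SA : S \in A by rewrite EA mem_head.
  have [fN Sf] := active_point freeN demN linksN dem_uniq vM AE SA.
  apply/meetsP; exists (find id S); split=> //; last by apply/hasP; exists S; rewrite -?EA.
  by have := rt_id rt fN; move: pK; rewrite K0 /= !leqn0 => /eqP -> /eqP.
have d2 : 1 < degree p.
  rewrite degreeE ltn_neqAle (deg_gt0 linksN vK rt Kn pK) andbT; apply/eqP => d1.
  have vp := leaf_viol freeN demN linksN dem_uniq vM vK rt pK (esym d1).
  have [S SA Sp] := viol_act freeN demN linksN dem_uniq vM vp.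
  have [fN Sf] := active_point freeN demN linksN dem_uniq vM AE SA.
  case/negP: nA; apply/meetsP; exists (find id S); split=> //; first exact/eqP/Sp.
  by apply/hasP; exists S.
have mix : mixed dyn2 p = mixed dyn1 p.
  by congr (_ && _); apply: eq_in_has => h hK; case a : (at_region p h) => //=;
    rewrite grow_par ?half_in // no // addbF.
rewrite {1}/term (negbTE nA) a0 mix /term; case: ifP => mG; last by move: d2 D0; clear; nia.
have mv : mixed dyn1 p -> 0 < count (fun h => at_region p h && (par dyn1 h != tau)) (halves K).
  rewrite -has_count /mixed => /andP[/hasP[h hK /andP[ah ph]] /hasP[h' h'K /andP[ah' ph']]].
  by apply/hasP; case: (tau); [exists h' | exists h]; rewrite ?ah ?ah' ?ph //= (negbTE ph').
move: mv d2 D0; move: (count _ _) (degree p) (count _ _); case: (mixed _ _) => c d e; clear -c d e; nia.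
Qed.

Lemma grow_budget Y R : 0 < D ->
  budget dyn2 (tau (+) odd D) A (Y + D * size A) R -> budget dyn1 tau G Y R.
Proof.
move=> D0; rewrite /budget.
have -> : \sum_(g <- K) slack dyn1 g = \sum_(g <- K) slack dyn2 g + D * count (half A) (halves K).
  elim: (K) vK => [_|g s IH /andP[gL vs]]; rewrite ?big_nil ?muln0 // !big_cons IH //.
  rewrite count_halves (grow_slack A dyn tau gL) -/dyn1 -/D -/dyn2; clear; nia.
have H : \sum_(p <- iota 0 (size K).+1) (term dyn2 (tau (+) odd D) A p + D * count (fun h => at_region p h && half A h) (halves K) + D.*2)
  <= \sum_(p <- iota 0 (size K).+1) (D.*2 * count (fun S => rho (find id S) == p) A + term dyn1 tau G p + D * degree p).
  rewrite !big_seq; apply: leq_sum => p; rewrite mem_iota /= add0n ltnS => pK; exact: grow_term.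
move: H; rewrite !big_split /= -!big_distrr /= sum_degree.
have -> : \sum_(p <- iota 0 (size K).+1) D.*2 = (size K).+1 * D.*2 by rewrite big_const_seq count_predT size_iota iter_addn_0 mulnC.
have -> : \sum_(p <- iota 0 (size K).+1) count (fun h => at_region p h && half A h) (halves K) = count (half A) (halves K).
  by apply: sum_fibers => h hK _; rewrite ltnS (rt_id rt) // (end_of_lt linksN) // half_in.
have -> : \sum_(p <- iota 0 (size K).+1) count (fun S => rho (find id S) == p) A = size A.
  rewrite -[RHS]count_predT -(@sum_fibers _ A (fun S => rho (find id S)) predT (size K).+1).
    by apply: eq_bigr => p _; apply: eq_count => S /=; rewrite andbT.
  move=> S SA _; rewrite ltnS (rt_id rt) //; by case: (active_point freeN demN linksN dem_uniq vM AE SA).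
set a := \sum_(i <- _) term dyn2 _ _ _; set b := \sum_(i <- _) term dyn1 _ _ _.
set c := \sum_(g <- K) _; set d := count _ _; move: a b c d (D) (size A) (size K) => a b c d D' sA sK.
by clear; nia.
Qed.

End Step.

Lemma no_link_budget dyn tau G Y R : K = [::] -> (exists2 x, x < N & (rho x = 0) /\ covered G x) ->
  Y.*2 <= R -> budget dyn tau G Y R.
Proof.
move=> K0 [x xN [r0 cx]] le; rewrite /budget K0 big_nil /= big_seq1 /term.
have -> : meets G 0 by apply/meetsP; exists x.
by lia.
Qed.

End Fixed.

Section Split.
Variables (M K : seq nat) (rho : nat -> nat) (W : nat -> pred nat) (e : nat) (S0 : pred nat).
Hypothesis vM : valid M.
Hypothesis vK : valid (e :: K).
Hypothesis rt : region_tree M K rho W.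
Let r := rho (ends e).1.
Let n := (size K).+1.
Let rho' := split_rho links K rho e S0.
Variable W' : nat -> pred nat.
Hypothesis rt' : region_tree M (e :: K) rho' W'.
Hypothesis e_in : rho (ends e).2 = r.
Hypothesis cS0 : cut S0 (ends e).
Variables (dyn : seq link_state) (tau : bool) (G : seq (seq bool)).
Hypothesis meetsG : forall T, viol M T -> exists x, [/\ x < N, T x & covered G x].
Hypothesis ok : parity_ok links dyn.
Hypothesis tight_e : slack dyn e = 0.

Let vKs : valid K. Proof. by case/andP: vK. Qed.
Let eL : e < size links. Proof. by case/andP: vK. Qed.

Lemma split_rho_r x : x < N -> (rho x == r) = (rho' x == r) || (rho' x == n).
Proof.
move=> xN; rewrite /rho' /split_rho -/r -/n; have := rt_id rt xN.
have nr : (n == r) = false by rewrite gtn_eqF // ltnS (rt_id rt) // (end_lt linksN false eL).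
case: eqVneq => [->|ne] le /=; first by case: ifP; rewrite ?eqxx ?nr.
by rewrite (negbTE ne) ltn_eqF ?ltnS.
Qed.

Lemma split_rho_other p x : x < N -> p != r -> p <= size K -> (rho' x == p) = (rho x == p).
Proof.
move=> xN pr pK; rewrite /rho' /split_rho -/r -/n; case: ifP => // /andP[/eqP -> _].
by rewrite gtn_eqF ?ltnS // eq_sym (negbTE pr).
Qed.

Lemma split_rho_ends : rho' (ends e).1 = r /\ rho' (ends e).2 = n.
Proof.
rewrite /rho' /split_rho -/r -/n e_in !eqxx /=; split=> //.
by move: cS0; rewrite /cut eq_sym => ->.
Qed.

Lemma split_term_other p : p != r -> p <= size K ->
  term (e :: K) rho' dyn tau G p = term K rho dyn tau G p.
Proof.
move=> pr pK; have [e1 e2] := split_rho_ends.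
have pn : (n == p) = false by rewrite gtn_eqF ?ltnS.
have en h : h \in halves K -> at_region rho' p h = at_region rho p h.
  by move=> hK; rewrite /at_region split_rho_other // (end_of_lt linksN) // (half_in vKs).
have ne h : h.1 = e -> at_region rho' p h = false.
  by case: h => i [] /= ->; rewrite /at_region /end_of /= ?e1 ?e2 ?pn // eq_sym (negbTE pr).
have me : meets rho' G p = meets rho G p.
  by apply: eq_in_has => x; rewrite mem_iota => /andP[_ xN]; rewrite split_rho_other.
rewrite /term me /degree /mixed !count_halves !ne //= !ne //= !add0n.
case: ifP => _; first by congr (_ + _); apply: eq_in_count => h hK; rewrite en.
congr (_ + nat_of_bool (_ && _)); first by apply: eq_in_count => h hK; rewrite en.
  by apply: eq_in_has => h hK; rewrite en.
by apply: eq_in_has => h hK; rewrite en.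
Qed.

Lemma split_degree p : p <= n -> ~~ meets rho' G p -> degree (e :: K) rho' p != 1.
Proof.
move=> pn; apply: contra => /eqP; rewrite degreeE => d1.
have vp := leaf_viol freeN demN linksN dem_uniq vM vK rt' pn d1.
by have [x [xN /eqP e0 c]] := meetsG vp; apply/meetsP; exists x.
Qed.

(** The link [e] is tight, so its two bits agree. The tight case joins an active and a dormant part:
    if [e] is in phase while all other ends of the dormant part are not, that part is [mixed], and
    this unit closes the inequality. Such other ends exist by [split_degree]. If two dormant parts
    disagree, [e] differs from one of them, which is then mixed. *)
Lemma split_term : term K rho dyn tau G r + 2 <=
  term (e :: K) rho' dyn tau G r + term (e :: K) rho' dyn tau G n.
Proof.
have [e1 e2] := split_rho_ends.
have rK : r <= size K by rewrite (rt_id rt) // (end_lt linksN false eL).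
have nr : (n == r) = false by rewrite gtn_eqF // ltnS.
have rn : (r == n) = false by rewrite eq_sym.
have pe : par dyn (e, true) = par dyn (e, false).
  by have := ok eL; rewrite tight_e; case: (par _ _); case: (par _ _).
have or h : h \in halves K -> at_region rho r h = at_region rho' r h || at_region rho' n h.
  by move=> hK; rewrite /at_region split_rho_r // (end_of_lt linksN) // (half_in vKs).
have cor Q : count (fun h => at_region rho r h && Q h) (halves K) =
   count (fun h => at_region rho' r h && Q h) (halves K) + count (fun h => at_region rho' n h && Q h) (halves K).
  rewrite -count_predUI [X in _ + X](@eq_count _ _ pred0) ?count_pred0 ?addn0.
    by apply: eq_in_count => h hK /=; rewrite or // andb_orl.
  move=> h /=; rewrite /at_region; case: (eqVneq (rho' _) r) => [->|] //=; by rewrite rn ?andbF.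
have hor Q : has (fun h => at_region rho r h && Q h) (halves K) =
   has (fun h => at_region rho' r h && Q h) (halves K) || has (fun h => at_region rho' n h && Q h) (halves K).
  by rewrite -has_predU; apply: eq_in_has => h hK /=; rewrite or // andb_orl.
have cT p : count (at_region rho' p) (halves K) = count (fun h => at_region rho' p h && true) (halves K).
  by apply: eq_count => h /=; rewrite andbT.
have cT' p : count (at_region rho p) (halves K) = count (fun h => at_region rho p h && true) (halves K).
  by apply: eq_count => h /=; rewrite andbT.
have mor : meets rho G r = meets rho' G r || meets rho' G n.
  by rewrite -has_predU; apply: eq_in_has => x; rewrite mem_iota => /andP[_ xN] /=; rewrite split_rho_r // andb_orl.
have le p : count (fun h => at_region rho' p h && (par dyn h != tau)) (halves K) <= count (fun h => at_region rho' p h && true) (halves K).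
  by apply: sub_count => h /= /andP[-> _].
have lt p : (forall h, h \in halves K -> at_region rho' p h -> par dyn h != tau) \/
    count (fun h => at_region rho' p h && (par dyn h != tau)) (halves K) < count (fun h => at_region rho' p h && true) (halves K).
  have [/hasP[h hK /andP[ah ph]]|/hasPn no] := boolP (has (fun h => at_region rho' p h && (par dyn h == tau)) (halves K)).
    right; have -> : count (fun h => at_region rho' p h && true) (halves K) = count (fun h => at_region rho' p h && (par dyn h != tau)) (halves K) + count (fun h => at_region rho' p h && (par dyn h == tau)) (halves K).
      rewrite -count_predUI [X in _ + X](@eq_count _ _ pred0) ?count_pred0 ?addn0.
        by apply: eq_count => k /=; case: (at_region _ _ _); case: (_ == _).
      by move=> k /=; case: (at_region _ _ _); case: (_ == _).
    by rewrite -addn1 leq_add2l -has_count; apply/hasP; exists h; rewrite ?ah.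
  by left=> h hK ah; have := no h hK; rewrite ah.
have mx p : 0 < count (fun h => at_region rho' p h && true) (halves K) -> par dyn (e, false) = tau ->
   count (fun h => at_region rho' p h && (par dyn h != tau)) (halves K) < count (fun h => at_region rho' p h && true) (halves K) \/
   (if tau then has (fun h => at_region rho' p h && ~~ par dyn h) (halves K) else has (fun h => at_region rho' p h && par dyn h) (halves K)).
  rewrite -has_count => /hasP[h hK /andP[ah _]] pt; case: (lt p) => [all|]; last by left.
  right; have := all h hK ah; case: (tau) => ph; apply/hasP; exists h; rewrite ?ah //; by case: (par _ _) ph.
have dr := @split_degree r _; have dn := @split_degree n _.
have := le r; have := le n; have := mx r; have := mx n; have := dr (leqW rK); have := dn (leqnn n).
have ends_at p : (at_region rho' p (e, false) = (r == p)) * (at_region rho' p (e, true) = (n == p)).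
  by rewrite /at_region /end_of /= e1 e2.
have has_halves P : has P (halves (e :: K)) = [|| P (e, false), P (e, true) | has P (halves K)] by [].
clear dr dn le mx lt; rewrite /term /degree /mixed mor !count_halves !has_halves !ends_at !eqxx !nr !rn /= pe !cT !cT' !cor !hor.
move: (count (fun h => at_region rho' r h && true) _) (count (fun h => at_region rho' n h && true) _).
move: (count (fun h => at_region rho' r h && _) _) (count (fun h => at_region rho' n h && _) _).
move: (par dyn (e, false)) => q.
move: (has (fun h => at_region rho' r h && par dyn h) _) (has (fun h => at_region rho' n h && par dyn h) _) => a b.
move: (has (fun h => at_region rho' r h && ~~ par dyn h) _) (has (fun h => at_region rho' n h && ~~ par dyn h) _) => c d.
move=> vr vn ur un; clear; case: (meets rho' G r); case: (meets rho' G n) => /=.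
- by case: q; case: tau => /=; lia.
- by move=> h _ m _ l l'; move: h m; case: q; case: tau; case: b; case: d => /=; lia.
- by move=> _ h _ m l l'; move: h m; case: q; case: tau; case: a; case: c => /=; lia.
- by move=> _ _ _ _ _ _; case: q; case: a; case: b; case: c; case: d => /=; lia.
Qed.

Lemma split_budget Y R : budget K rho dyn tau G Y R -> budget (e :: K) rho' dyn tau G Y R.
Proof.
rewrite /budget big_cons tight_e add0n.
have rK : r <= size K by rewrite (rt_id rt) // (end_lt linksN false eL).
have sp k : \sum_(p <- iota 0 k.+1) term (e :: K) rho' dyn tau G p =
    \sum_(p <- iota 0 k) term (e :: K) rho' dyn tau G p + term (e :: K) rho' dyn tau G k.
  by rewrite -addn1 iotaD big_cat big_seq1.
have rI : r \in iota 0 n by rewrite mem_iota /= ltnS.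
rewrite [size (e :: K)]/= sp -/n !(bigD1_seq r rI (iota_uniq _ _)).
have -> : \sum_(p <- iota 0 n | p != r) term (e :: K) rho' dyn tau G p = \sum_(p <- iota 0 n | p != r) term K rho dyn tau G p.
  rewrite big_seq_cond [RHS]big_seq_cond; apply: eq_bigr => p; rewrite mem_iota /= ltnS => /andP[pK pr]; exact: split_term_other.
have := split_term; set A1 := term K _ _ _ _ _; set A2 := term (e :: K) _ _ _ _ r; set A3 := term (e :: K) _ _ _ _ n.
move: A1 A2 A3 (\sum_(p <- _ | _) _) (\sum_(g <- K) _) (size K) => A1 A2 A3 B C k; clear.
by rewrite /=; lia.
Qed.

End Split.

(** [K] consists of those links of the final solution [F] that are picked after the state [st]; what
    reverse deletion will do with the links already picked is expressed by [prune K st.1.2]. *)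
Definition claim F R (st : wstate) := exists K rho W,
  [/\ F = prune K st.1.2, valid K, forall S, ~~ viol (K ++ st.1.2) S,
      region_tree st.1.2 K rho W & budget K rho st.1.1 st.2.1 st.2.2.1 (total st.2.2.2) R].

Lemma region_tree_sub M M' K rho W : {subset M' <= M} -> region_tree M K rho W -> region_tree M' K rho W.
Proof. by move=> sM [u i v c q]; split=> // g /v; exact: viol_sub. Qed.

(** Undoing a growth step moves the budget back over growth and adjustment. Undoing the pick of [e]
    leaves [K] unchanged if reverse deletion drops [e]; otherwise some set [S0] is violated without
    [e], and it splits the region of [e]. *)
Lemma claim_step F R st : winv st -> claim F R (wstep st) -> claim F R st.
Proof.
move=> iv; rewrite /Wstep.wstep; case: ifP => // /nilP/eqP An.
case Et : (tight links _ st.1.1) => [|e t].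
  case=> K [rho [W []]]; rewrite /grow_all.
  case: ifP => /= D0 FE vK fe rt b; exists K, rho, W; split=> //.
    exact: (adjust_budget vK iv erefl rt An Et b).
  apply: (adjust_budget vK iv erefl rt An Et).
  apply: (grow_budget vK iv erefl rt An); first by rewrite lt0n D0.
  move: b; rewrite /total map_cat sumn_cat.
  have -> D (A : seq (seq bool)) : sumn [seq x.2 | x <- [seq (B, D) | B <- A]] = D * size A.
    by elim: A => //= [|B A ->]; rewrite ?muln0 ?mulnS.
  by rewrite addnC.
have : e \in tight links (act st.1.2) st.1.1 by rewrite Et mem_head.
rewrite mem_filter => /andP[/eqP s0 ec]; have eL := crossing_valid ec.
case=> K [rho [W []]] /= FE vK fe rt b.
have vM := wi_valid iv.
have sM : {subset st.1.2 <= e :: st.1.2} by move=> x; rewrite inE orbC => ->.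
have rtM := region_tree_sub sM rt.
rewrite prune_cons in FE.
have vKM : valid (K ++ st.1.2) by rewrite /Wgmv.valid all_cat; apply/andP.
move: FE; case: (feasP freeN demN linksN dem_uniq vKM) => [fe'|nf] FE; first by exists K, rho, W.
have [S0 vS0] : exists S0, viol (K ++ st.1.2) S0.
  have : ~~ feas (K ++ st.1.2) by apply/negP => /(feasP freeN demN linksN dem_uniq vKM).
  rewrite /Wstep.feas; case E : (cand _ _ _ _ _) => [//|S s] _; exists (mem_map S).
  by apply: (cand_viol freeN demN linksN dem_uniq vKM); rewrite E mem_head.
have cS0 : cut S0 (ends e).
  case nc : (cut S0 (ends e)) => //; move/negbT: nc => nc; case/negP: (fe S0); apply: (viol_sub (Y := e :: K ++ st.1.2)); last exact: viol_cons.
  by move=> x; rewrite !(inE, mem_cat) orbCA.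
have eK : e \notin K.
  apply: contraL cS0 => eK; have /and3P[_ /allP cl _] := vS0; apply: cl.
  by apply: map_f; rewrite mem_cat eK.
have rtc g : g \in K -> ~~ cut (fun x => W g (rho x)) (ends e).
  by move=> gK; have /and3P[_ /allP cl _] := rt_viol rt gK; apply: cl; exact: mem_head.
have rt' := split_tree freeN demN linksN dem_uniq vM vK rtM eL rtc vS0 cS0 fe eK.
have vK' : valid (e :: K) by rewrite /Wgmv.valid /= eL.
exists (e :: K), (split_rho links K rho e S0), (split_W links K rho W e S0); split=> //.
  move=> S; apply: contra (fe S); apply: viol_sub.
  by move=> x; rewrite !(inE, mem_cat) orbCA.
apply: (split_budget (M := st.1.2) vM vK' rtM rt') => //.
- exact: (split_rv linksN rtM eL rtc).
- exact: wi_meets iv.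
- exact: wi_par iv.
Qed.

Local Notation kept := (kept N free dem links w).
Local Notation duals := (duals N free dem links w).

(** In the last state [K] is empty and the single region meets the sets grown last, so the budget
    holds with [Y] the whole dual total. All rounds are then undone. In the first state every region
    is nonempty and covered, all potentials are 2, and they cancel against the 2 per region. *)
Theorem wgmv :
  [/\ valid kept, forall S, ~~ viol kept S,
      \sum_(g <- kept) nth 0 w g <= (total duals).*2,
      forall i, i < size links -> load links duals i <= nth 0 w i
    & forall r, r \in duals -> size r.1 = N /\ viol [::] (mem_map r.1)].
Proof.
have iv n := winv_iter freeN demN linksN dem_uniq size_w even_w N_gt0 n.
have ivr : winv wrun := iv _.
have fin := wrun_done freeN demN linksN dem_uniq size_w even_w N_gt0 all_feas.
have c0 : claim kept (total duals).*2 winit.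
  have : claim kept (total duals).*2 wrun.
    exists [::], (fun=> 0), (fun=> pred0); split=> //.
    - move=> S; apply/negP => /(viol_act freeN demN linksN dem_uniq (wi_valid ivr))[T].
      by rewrite fin.
    - by split=> // Q _ p q; rewrite /= !leqn0 => /eqP -> /eqP ->.
    apply: no_link_budget => //; have [x xN cx] := wi_cover ivr; by exists x.
  rewrite /Wstep.wrun; elim: _.+1 => //= n IH /claim_step; move/(_ (iv n)); exact: IH.
case: c0 => K [rho [W [FE vK fe rt b]]]; rewrite /= in FE fe b; rewrite cats0 in fe.
have FK : kept = K by rewrite FE.
split; rewrite ?FK //; last 2 first.
- by move=> i iL; apply: leq_trans (wi_load ivr iL); exact: leq_addl.
- by move=> r; exact: (wi_rec ivr).
move: b; rewrite /budget /= addn0.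
have -> : \sum_(g <- K) slack [seq (c, (false, false)) | c <- w] g = \sum_(g <- K) nth 0 w g.
  rewrite !big_seq; apply: eq_bigr => g gK; rewrite /slack (nth_map 0) // size_w; exact: (allP vK).
have -> : \sum_(p <- 0 :: iota 1 (size K)) term K rho [seq (c, (false, false)) | c <- w] false [:: nseq N true] p = (size K).+1.*2.
  transitivity (\sum_(p <- iota 0 (size K).+1) 2); last by rewrite big_const_seq count_predT size_iota iter_addn_0 mul2n.
  rewrite [LHS]big_seq [RHS]big_seq; apply: eq_bigr => p; rewrite -[0 :: _]/(iota 0 (size K).+1) mem_iota /= add0n ltnS => pK.
  have mp : meets rho [:: nseq N true] p.
    apply/meetsP; suff [x xN xp] : exists2 x, x < N & rho x = p.
      by exists x; split=> //; rewrite /covered /= /mem_map nth_nseq xN.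
    have [K0|Kn] := boolP (K == [::]).
      exists 0 => //; have := rt_id rt N_gt0; move: pK; rewrite (eqP K0) /= !leqn0 => /eqP -> /eqP //.
    have := deg_gt0 linksN vK rt Kn pK; rewrite -degreeE -has_count => /hasP[h hK /eqP hp].
    by exists (end_of h) => //; apply: (end_of_lt linksN); exact: (half_in vK).
  rewrite /term mp (@eq_in_count _ _ pred0) ?count_pred0 // => h hK /=.
  rewrite /par (nth_map 0) ?size_w ?(half_in vK) //=; by case: ifP; rewrite eqxx andbF.
by rewrite leq_add2r.
Qed.

End Potential.
End Wpot.

(** * Closure properties of polynomial-time programs *)

Module Pt.
Require Import Defs.
From mathcomp Require Import all_boot zify.
Local Open Scope nat_scope.

Class Enc (T : Type) := enc : T -> tree.
#[global] Instance enc_inst_bool : Enc bool := enc_bool.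
#[global] Instance enc_inst_unit : Enc unit := fun=> Leaf.
(** Unary: it serves for indices and lengths, which are bounded by the size of the input. Capacities
    and dual values use the binary [bin] instead. *)
#[global] Instance enc_inst_nat : Enc nat := fix e n := if n is k.+1 then Node Leaf (e k) else Leaf.
#[global] Instance enc_inst_prod A B (eA : Enc A) (eB : Enc B) : Enc (A * B) := fun p => Node (enc p.1) (enc p.2).
#[global] Instance enc_inst_seq A (eA : Enc A) : Enc (seq A) := enc_seq (@enc A _).
#[global] Instance enc_inst_option A (eA : Enc A) : Enc (option A) :=
  fun o => if o is Some a then Node Leaf (enc a) else Leaf.

Definition tsize T {eT : Enc T} (x : T) := tree_size (enc x).

Lemma tree_size_gt0 u : 0 < tree_size u. Proof. by case: u. Qed.
Lemma tsize_gt0 T (eT : Enc T) (x : T) : 0 < tsize x. Proof. exact: tree_size_gt0. Qed.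
Lemma tsize_pair A B (eA : Enc A) (eB : Enc B) (p : A * B) : tsize p = (tsize p.1 + tsize p.2).+1.
Proof. by []. Qed.
Lemma tsize_cons A (eA : Enc A) (a : A) s : tsize (a :: s) = (tsize a + tsize s).+1.
Proof. by []. Qed.
Lemma tsize_nil A (eA : Enc A) : tsize ([::] : seq A) = 1.
Proof. by []. Qed.
Lemma tsize_nat n : tsize n = n.*2.+1.
Proof. by rewrite /tsize; elim: n => //= n ->; lia. Qed.
Lemma tsize_bool (b : bool) : tsize b <= 3. Proof. by case: b. Qed.
Lemma size_tsize A (eA : Enc A) (s : seq A) : size s < tsize s.
Proof. by elim: s => //= a s IH; rewrite tsize_cons; lia. Qed.

(** Evaluating an expression costs at least the size of its value, so nothing larger than the
    running time is ever stored. Through [pt_size] this bounds the intermediate results of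
    compositions. *)
Lemma exec_size p s s' t : exec p s s' t -> forall i, s' i = s i \/ tree_size (s' i) <= t.
Proof.
have ev st e : tree_size (eval_expr st e) <= cost st e.
  elim: e => //= [e1 I1 e2 I2|e I|e I]; first by rewrite ltnS leq_add.
    by case: (eval_expr st e) I (tree_size_gt0) => //= u1 u2; lia.
  by case: (eval_expr st e) I (tree_size_gt0) => //= u1 u2; lia.
elim=> {p s s' t}.
- by left.
- move=> x e s i; rewrite /upd; case: eqP => _; [right; exact: leq_trans (ev s e) _ | by left].
- move=> p1 p2 s s1 s2 t1 t2 _ I1 _ I2 i; case: (I2 i) => [->|]; last by right; lia.
  by case: (I1 i) => [|]; [left | right; lia].
- by move=> e p1 p2 s s' t _ I i; case: (I i); [left | right; lia].
- by left.
- move=> e p s s1 s2 t1 t2 _ _ I1 _ I2 i; case: (I2 i) => [->|]; last by right; lia.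
  by case: (I1 i) => [|]; [left | right; lia].
Qed.

Definition pbound (g : nat -> nat) := exists a k, forall n, g n <= a * n.+1 ^ k.

Lemma pbound_le g h : (forall n, g n <= h n) -> pbound h -> pbound g.
Proof. by move=> gh [a [k H]]; exists a, k => n; apply: leq_trans (H n). Qed.
Lemma pbound_const c : pbound (fun=> c).
Proof. by exists c, 0 => n; rewrite muln1. Qed.
Lemma pbound_id : pbound id.
Proof. by exists 1, 1 => n; rewrite mul1n expn1. Qed.
Lemma pbound_add g h : pbound g -> pbound h -> pbound (fun n => g n + h n).
Proof.
move=> [a [k H]] [b [l H']]; exists (a + b), (k + l) => n.
have := H n; have := H' n; have := expn_gt0 n.+1 k; have := expn_gt0 n.+1 l; rewrite /= expnD.
move: (n.+1 ^ k) (n.+1 ^ l) (g n) (h n); clear; nia.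
Qed.
Lemma pbound_mul g h : pbound g -> pbound h -> pbound (fun n => g n * h n).
Proof.
move=> [a [k H]] [b [l H']]; exists (a * b), (k + l) => n.
by rewrite expnD mulnACA leq_mul.
Qed.
Lemma pbound_comp g h : pbound g -> pbound h -> pbound (fun n => g (h n)).
Proof.
move=> [a [k H]] [b [l H']]; exists (a * b.+1 ^ k), (l * k) => n.
apply: leq_trans (H _) _; rewrite -mulnA leq_mul2l expnM -expnMn; apply/orP; right.
have h1 : (h n).+1 <= b.+1 * n.+1 ^ l.
  have := H' n; have := expn_gt0 n.+1 l; move: (h n) (n.+1 ^ l); clear; nia.
by case: k H => // k _; rewrite leq_exp2r.
Qed.

(* The program family works above any register r, so that programs can be nested. *)
Definition PT {X Y : Type} {eX : Enc X} {eY : Enc Y} (f : X -> Y) := exists (P : nat -> cmd) (a k : nat),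
  forall r s x, s r = enc x -> exists s' t,
    [/\ exec (P r) s s' t, s' r = enc (f x), forall i, i < r -> s' i = s i & t <= a * (tsize x).+1 ^ k].

Lemma pt_ext X (eX : Enc X) Y (eY : Enc Y) (f g : X -> Y) : f =1 g -> PT f -> PT g.
Proof. by move=> fg [P [a [k H]]]; exists P, a, k => r s x /H; rewrite fg. Qed.

(* f may be replaced by any function with the same encoded values. *)
Lemma pt_enc X (eX : Enc X) Y Z (eY : Enc Y) (eZ : Enc Z) (f : X -> Y) (g : X -> Z) : (forall x, enc (f x) = enc (g x)) -> PT f -> PT g.
Proof. by move=> fg [P [a [k H]]]; exists P, a, k => r s x /H; rewrite fg. Qed.

Lemma pt_size X (eX : Enc X) Y (eY : Enc Y) (f : X -> Y) : PT f -> exists2 g, pbound g & forall x, tsize (f x) <= g (tsize x).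
Proof.
move=> [P [a [k H]]]; exists (fun n => n + a * n.+1 ^ k).
  by apply: pbound_add; [exact: pbound_id | exists a, k].
move=> x; have [s' [t [e E _ le]]] := H 0 (fun=> enc x) x erefl.
by rewrite /tsize -E; case: (exec_size e 0) => [->|l]; rewrite -/(tsize x); lia.
Qed.

Lemma pt_expr X (eX : Enc X) Y (eY : Enc Y) (f : X -> Y) (e : nat -> expr) c :
  (forall s r x, s r = enc x -> eval_expr s (e r) = enc (f x) /\ cost s (e r) <= c * (tsize x).+1) -> PT f.
Proof.
move=> H; exists (fun r => Assign r (e r)), c.+1, 1 => r s x E; have [ev co] := H s r x E.
exists (upd s r (eval_expr s (e r))), (cost s (e r)).+1; split; first exact: ExecAssign.
- by rewrite /upd eqxx.
- by move=> i ir; rewrite /upd ltn_eqF.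
- by rewrite expn1; lia.
Qed.

Lemma pt_id X (eX : Enc X) : PT (fun x : X => x).
Proof. by apply: (@pt_expr _ _ _ _ _ EVar 1) => s r x E; rewrite /= E mul1n leqnSn. Qed.

Lemma pt_tree X (eX : Enc X) (u : tree) Y (eY : Enc Y) (y : Y) : enc y = u -> PT (fun _ : X => y).
Proof.
move=> _; pose fix build u := match u with Leaf => ENil | Node u v => ECons (build u) (build v) end.
apply: (@pt_expr _ _ _ _ _ (fun=> build (enc y)) (tree_size (enc y))) => s r x _; split.
  by elim: (enc y) => //= u1 -> u2 ->.
apply: leq_trans (leq_pmulr _ _) => //; elim: (enc y) => //= u1 I1 u2 I2; rewrite ltnS; exact: leq_add.
Qed.

Lemma pt_const X (eX : Enc X) Y (eY : Enc Y) (y : Y) : PT (fun _ : X => y).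
Proof. exact: (@pt_tree _ _ (enc y)). Qed.

Lemma pt_comp X (eX : Enc X) Y Z (eY : Enc Y) (eZ : Enc Z) (f : X -> Y) (g : Y -> Z) :
  PT f -> PT g -> PT (fun x => g (f x)).
Proof.
move=> pf [P [a [k H]]]; have [h [b [l hb]] hs] := pt_size pf; have [P' [a' [k' H']]] := pf.
have [c [m cm]] : pbound (fun n => (a' * n.+1 ^ k' + a * (h n).+1 ^ k).+1).
  apply: (@pbound_le _ (fun n => (a' * n.+1 ^ k' + a * (h n).+1 ^ k) + 1)); first by move=> n; rewrite addn1.
  apply: pbound_add; last exact: pbound_const.
  apply: pbound_add; first by exists a', k'.
  by apply: (@pbound_comp (fun n => a * n.+1 ^ k)); [exists a, k | exists b, l].
exists (fun r => Seq (P' r) (P r)), c, m => r s x E.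
have [s1 [t1 [e1 E1 p1 l1]]] := H' r s x E; have [s2 [t2 [e2 E2 p2 l2]]] := H r s1 (f x) E1.
exists s2, (t1 + t2).+1; split => //; first exact: ExecSeq e1 e2.
  by move=> i ir; rewrite p2 // p1.
apply: leq_trans (cm (tsize x)); rewrite ltnS leq_add //; apply: leq_trans l2 _; rewrite leq_mul2l.
apply/orP; right; case: (k) => // k0; rewrite leq_exp2r // ltnS; exact: hs.
Qed.

Lemma pt_pair X (eX : Enc X) Y Z (eY : Enc Y) (eZ : Enc Z) (f : X -> Y) (g : X -> Z) :
  PT f -> PT g -> PT (fun x => (f x, g x)).
Proof.
move=> pf pg; have [h [b [l hb]] hs] := pt_size pf; have [h' [b' [l' hb']] hs'] := pt_size pg.
move: pf pg => [P [a [k H]]] [P' [a' [k' H']]].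
have [c [m cm]] : pbound (fun n => (n + n + h n + h' n) + (a * n.+1 ^ k + a' * n.+1 ^ k') + 20).
  by do !apply: pbound_add; try exact: pbound_id; try exact: pbound_const; [exists b, l | exists b', l' | exists a, k | exists a', k'].
exists (fun r => Seq (Assign r.+1 (EVar r)) (Seq (P r.+1) (Seq (Assign r.+2 (EVar r)) (Seq (P' r.+2)
  (Assign r (ECons (EVar r.+1) (EVar r.+2))))))), c, m => r s x E.
have [s1 [t1 [e1 E1 p1 l1]]] := H r.+1 (upd s r.+1 (eval_expr s (EVar r))) x ltac:(by rewrite /upd eqxx).
have s1r : s1 r = enc x by rewrite p1 // /upd ltn_eqF.
have [s2 [t2 [e2 E2 p2 l2]]] := H' r.+2 (upd s1 r.+2 (eval_expr s1 (EVar r))) x ltac:(by rewrite /upd eqxx).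
have s2r1 : s2 r.+1 = enc (f x) by rewrite p2 // /upd ltn_eqF.
eexists; eexists; split.
- apply: ExecSeq (ExecAssign _ _ _) _; apply: ExecSeq e1 _; apply: ExecSeq (ExecAssign _ _ _) _.
  apply: ExecSeq e2 _; exact: ExecAssign.
- by rewrite /upd eqxx /= s2r1 E2.
- move=> i ir; have [i1 i2] : i < r.+1 /\ i < r.+2 by lia.
  by rewrite [LHS]/upd ltn_eqF // p2 // [LHS]/upd ltn_eqF // p1 // [LHS]/upd ltn_eqF.
- have q0 := cm (@tsize X eX x); have q1 := hs x; have q2 := hs' x; move: q0 q1 q2 l1 l2 => /=; rewrite E s1r s2r1 E2 -/(tsize x) -/(tsize (f x)) -/(tsize (g x)).
  by clear; lia.
Qed.

Section Derived.
Context {X : Type} {eX : Enc X}.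

Lemma pt_fst Y Z (eY : Enc Y) (eZ : Enc Z) (f : X -> Y * Z) : PT f -> PT (fun x => (f x).1).
Proof.
move=> pf; apply: (pt_comp (g := fst) pf); apply: (pt_expr (e := fun r => EHd (EVar r)) (c := 1)) => s r x E.
by rewrite /= E mul1n.
Qed.

Lemma pt_snd Y Z (eY : Enc Y) (eZ : Enc Z) (f : X -> Y * Z) : PT f -> PT (fun x => (f x).2).
Proof.
move=> pf; apply: (pt_comp (g := snd) pf); apply: (pt_expr (e := fun r => ETl (EVar r)) (c := 1)) => s r x E.
by rewrite /= E mul1n.
Qed.

Lemma pt_cons Y (eY : Enc Y) (f : X -> Y) (g : X -> seq Y) : PT f -> PT g -> PT (fun x => f x :: g x).
Proof. by move=> pf pg; apply: (pt_enc _ (pt_pair pf pg)). Qed.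

Lemma pt_some Y (eY : Enc Y) (f : X -> Y) : PT f -> PT (fun x => Some (f x)).
Proof. by move=> pf; apply: (pt_enc _ (pt_pair (pt_const _ _ tt) pf)). Qed.

Lemma pt_succ (f : X -> nat) : PT f -> PT (fun x => (f x).+1).
Proof. by move=> pf; apply: (pt_enc _ (pt_pair (pt_const _ _ tt) pf)). Qed.

(* In the first branch the pair of the input and of the tested value is seen as a value of type A. *)
Lemma pt_match A Y Z (eA : Enc A) (eY : Enc Y) (eZ : Enc Z) (c : X -> Z) (f res : X -> Y) (g : A -> Y) :
  PT c -> PT f -> PT g ->
  (forall x, if truth (enc (c x)) then exists2 a, enc a = Node (enc x) (enc (c x)) & enc (g a) = enc (res x)
             else enc (f x) = enc (res x)) -> PT res.
Proof.
move=> pc pf pg R; have := pt_pair pc (pt_id eX).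
move: pf pg => [P [a [k H]]] [P' [a' [k' H']]] [Q [b [l K]]].
have [h hb hs] := pt_size pc.
have [d [m dm]] : pbound (fun n => (n + n + n + n + h n + h n + h n) + (a * n.+1 ^ k + a' * (n + h n + 1).+1 ^ k') + b * n.+1 ^ l + 20).
  have pe e j : pbound (fun n => e * n.+1 ^ j) by exists e, j.
  do !apply: pbound_add; try exact: pbound_id; try exact: pbound_const; try exact: hb; try exact: pe.
  apply: (@pbound_comp (fun n => a' * n.+1 ^ k')) (pe _ _) _.
  by do !apply: pbound_add; try exact: pbound_id; try exact: pbound_const.
exists (fun r => Seq (Assign r.+1 (EVar r)) (Seq (Q r.+1) (If (EHd (EVar r.+1))
  (Seq (Assign r (ECons (ETl (EVar r.+1)) (EHd (EVar r.+1)))) (P' r)) (P r)))), d, m => r s x E.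
have [s1 [t1 [e1 E1 p1 l1]]] := K r.+1 (upd s r.+1 (eval_expr s (EVar r))) x ltac:(by rewrite /upd eqxx).
have s1r : s1 r = enc x by rewrite p1 // /upd ltn_eqF.
have tE : eval_expr s1 (EHd (EVar r.+1)) = enc (c x) by rewrite /= E1.
have s1i i : i < r -> s1 i = s i by move=> ir; rewrite p1 ?(leqW ir) // /upd ltn_eqF // ltnW.
have dx := dm (@tsize X eX x); have hx := hs x.
have sz : tree_size (s1 r.+1) = (tsize (c x) + tsize x).+1 by rewrite E1.
have := R x; case T : (truth (enc (c x))) => Rx; first case: Rx => u Eu Rx; rewrite -Rx.
  have [|s2 [t2 [e2 E2 p2 l2]]] := H' r (upd s1 r (eval_expr s1 (ECons (ETl (EVar r.+1)) (EHd (EVar r.+1))))) u.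
    by rewrite /upd eqxx Eu /= E1.
  have su : (tsize u).+1 <= (tsize x + h (tsize x) + 1).+1 by rewrite /tsize Eu /= -/(tsize (c x)) -/(tsize x); lia.
  have le : a' * (tsize u).+1 ^ k' <= a' * (tsize x + h (tsize x) + 1).+1 ^ k'.
    by rewrite leq_mul2l; apply/orP; right; case: (k') => // k0; rewrite leq_exp2r.
  eexists; eexists; split.
  - apply: ExecSeq (ExecAssign _ _ _) _; apply: ExecSeq e1 _; apply: ExecIf; rewrite tE T.
    apply: ExecSeq (ExecAssign _ _ _) e2.
  - exact: E2.
  - by move=> i ir; rewrite p2 // /upd ltn_eqF // s1i.
  - move: dx hx l1 l2 le => /=; rewrite E sz -/(tsize x); clear; lia.
have [s2 [t2 [e2 E2 p2 l2]]] := H r s1 x s1r; eexists; eexists; split.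
- apply: ExecSeq (ExecAssign _ _ _) _; apply: ExecSeq e1 _; apply: ExecIf; rewrite tE T; exact: e2.
- exact: E2.
- by move=> i ir; rewrite p2 // s1i.
- move: dx hx l1 l2 => /=; rewrite E sz -/(tsize x); clear; lia.
Qed.

End Derived.

Lemma pt_if X (eX : Enc X) Y (eY : Enc Y) (c : X -> bool) (f g : X -> Y) : PT c -> PT f -> PT g ->
  PT (fun x => if c x then f x else g x).
Proof.
move=> pc pf pg; apply: (pt_match pc pg (pt_comp (pt_fst (pt_id (enc_inst_prod eX enc_inst_bool))) pf)) => x.
by case E : (c x) => //=; exists (x, true).
Qed.

Lemma pt_case_seq X (eX : Enc X) Y Z (eY : Enc Y) (eZ : Enc Z) (s : X -> seq Z) (f : X -> Y) (g : X -> Z -> seq Z -> Y) :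
  PT s -> PT f -> PT (fun p : X * (Z * seq Z) => g p.1 p.2.1 p.2.2) ->
  PT (fun x => if s x is z :: l then g x z l else f x).
Proof.
by move=> ps pf pg; apply: (pt_match ps pf pg) => x; case E : (s x) => [|z l] //=; exists (x, (z, l)).
Qed.

Lemma pt_case_option X (eX : Enc X) Y Z (eY : Enc Y) (eZ : Enc Z) (s : X -> option Z) (f : X -> Y) (g : X -> Z -> Y) :
  PT s -> PT f -> PT (fun p : X * Z => g p.1 p.2) ->
  PT (fun x => if s x is Some z then g x z else f x).
Proof.
move=> ps pf pg.
have pg' : PT (fun p : X * (unit * Z) => g p.1 p.2.2).
  apply: (pt_comp (f := fun p : X * (unit * Z) => (p.1, p.2.2)) (g := fun p => g p.1 p.2)) pg.
  apply: pt_pair; first exact: pt_fst (pt_id _).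
  exact: pt_snd (pt_snd (pt_id _)).
by apply: (pt_match ps pf pg') => x; case E : (s x) => [z|] //=; exists (x, (tt, z)).
Qed.

Lemma pt_case_nat X (eX : Enc X) Y (eY : Enc Y) (s : X -> nat) (f : X -> Y) (g : X -> nat -> Y) :
  PT s -> PT f -> PT (fun p : X * nat => g p.1 p.2) ->
  PT (fun x => if s x is n.+1 then g x n else f x).
Proof.
move=> ps pf pg.
have pg' : PT (fun p : X * (unit * nat) => g p.1 p.2.2).
  apply: (pt_comp (f := fun p : X * (unit * nat) => (p.1, p.2.2)) (g := fun p => g p.1 p.2)) pg.
  apply: pt_pair; first exact: pt_fst (pt_id _).
  exact: pt_snd (pt_snd (pt_id _)).
by apply: (pt_match ps pf pg') => x; case E : (s x) => [|z] //=; exists (x, (tt, z)).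
Qed.

Lemma pt_foldl X (eX : Enc X) A B (eA : Enc A) (eB : Enc B) (f : X -> B -> A -> B) (b : X -> B) (s : X -> seq A) :
  PT s -> PT b -> PT (fun p : X * (B * A) => f p.1 p.2.1 p.2.2) ->
  (exists2 q, pbound q & forall x k, tsize (foldl (f x) (b x) (take k (s x))) <= q (tsize x)) ->
  PT (fun x => foldl (f x) (b x) (s x)).
Proof.
move=> ps pb [P [a [k H]]] [q qb Q]; have [h hb hs] := pt_size ps.
have [R [d [l K]]] := pt_pair (pt_id eX) (pt_pair ps pb).
pose T n := (n + q n + h n + n + q n + h n) + (a * (n + (q n + h n + 1) + 1).+1 ^ k) + (q n + h n + h n + h n) + 30.
have pe e j : pbound (fun n => e * n.+1 ^ j) by exists e, j.
have Tb : pbound T.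
  do !apply: pbound_add; try exact: pbound_id; try exact: pbound_const; try exact: hb; try exact: qb.
  apply: (@pbound_comp (fun n => a * n.+1 ^ k)) (pe _ _) _.
  by do !apply: pbound_add; try exact: pbound_id; try exact: pbound_const.
have [e [m em]] : pbound (fun n => n + d * n.+1 ^ l + (h n + q n + n + h n + q n + n + h n + q n + n + 50) + h n * (T n + h n + 3) + q n).
  do !apply: pbound_add; try exact: pbound_id; try exact: pbound_const; try exact: hb; try exact: qb; try exact: pe.
  apply: pbound_mul; first exact: hb.
  by do !apply: pbound_add => //; exact: pbound_const.
pose body r := Seq (Assign r.+3 (ECons (EVar r) (ECons (EVar r.+2) (EHd (EVar r.+1)))))
  (Seq (P r.+3) (Seq (Assign r.+2 (EVar r.+3)) (Assign r.+1 (ETl (EVar r.+1))))).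
have run r x (w : seq A) j s0 : s0 r = enc x -> s0 r.+1 = enc w -> s0 r.+2 = enc (foldl (f x) (b x) (take j (s x))) ->
    w = drop j (s x) -> exists s' t, [/\ exec (While (EVar r.+1) (body r)) s0 s' t, s' r.+2 = enc (foldl (f x) (b x) (s x)),
      s' r = enc x, forall i, i < r -> s' i = s0 i & t <= size w * (T (tsize x) + h (tsize x) + 3) + 2].
  elim: w j s0 => [|y w IH] j s0 E0 E1 E2 Ew.
    exists s0, (cost s0 (EVar r.+1)).+1; split=> //; first by apply: ExecWhileStop; rewrite /= E1.
      by rewrite E2 -{2}(cat_take_drop j (s x)) -Ew cats0.
    by rewrite /= E1.
  have js : j < size (s x) by rewrite ltnNge; apply/negP => le; rewrite drop_oversize in Ew.
  have [Ey Ew'] : y = nth y (s x) j /\ w = drop j.+1 (s x).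
    by move: Ew; rewrite (drop_nth y js) => -[<- <-].
  set acc := foldl (f x) (b x) (take j (s x)) in E2.
  have Eacc : f x acc y = foldl (f x) (b x) (take j.+1 (s x)).
    by rewrite (take_nth y js) -cats1 foldl_cat /= -Ey.
  pose s1 := upd s0 r.+3 (eval_expr s0 (ECons (EVar r) (ECons (EVar r.+2) (EHd (EVar r.+1))))).
  have [|s2 [t2 [e2 F2 p2 l2]]] := H r.+3 s1 (x, (acc, y)).
    by rewrite /s1 /upd eqxx /= E0 E1 E2.
  pose s3 := upd s2 r.+2 (eval_expr s2 (EVar r.+3)).
  pose s4 := upd s3 r.+1 (eval_expr s3 (ETl (EVar r.+1))).
  have s2l i : i < r.+3 -> s2 i = s0 i by move=> ir; rewrite p2 // /s1 /upd ltn_eqF.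
  have s3l i : i < r.+2 -> s3 i = s0 i by move=> ir; rewrite /s3 /upd ltn_eqF // s2l // ltnW.
  have s4l i : i < r.+1 -> s4 i = s0 i by move=> ir; rewrite /s4 /upd ltn_eqF // s3l // ltnW.
  have F1 : s4 r.+1 = enc w by rewrite /s4 /upd eqxx /= s3l // E1.
  have F3 : s4 r.+2 = enc (foldl (f x) (b x) (take j.+1 (s x))).
    by rewrite /s4 /upd gtn_eqF // /s3 /upd eqxx /= F2 /= Eacc.
  have F0 : s4 r = enc x by rewrite s4l.
  have [s' [t' [e' G2 G0 pr le]]] := IH j.+1 s4 F0 F1 F3 Ew'.
  exists s', (cost s0 (EVar r.+1) + ((cost s0 (ECons (EVar r) (ECons (EVar r.+2) (EHd (EVar r.+1))))).+1
    + (t2 + ((cost s2 (EVar r.+3)).+1 + (cost s3 (ETl (EVar r.+1))).+1).+1).+1).+1 + t').+1; split=> //.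
  - apply: ExecWhileLoop e'; first by rewrite /= E1.
    apply: ExecSeq (ExecAssign _ _ _) _; apply: ExecSeq e2 _; apply: ExecSeq (ExecAssign _ _ _) _; exact: ExecAssign.
  - by move=> i ir; rewrite pr // s4l // ltnW.
  have ws : tsize (y :: w) <= tsize (s x).
    by rewrite Ew -{2}(cat_take_drop j (s x)); elim: (take j (s x)) => //= z v; rewrite tsize_cons; lia.
  have hx := hs x; have qj := Q x j; have qj1 := Q x j.+1; rewrite -/acc -Eacc in qj qj1.
  have le2 : t2 <= a * (tsize x + (q (tsize x) + h (tsize x) + 1) + 1).+1 ^ k.
    apply: leq_trans l2 _; rewrite leq_mul2l; apply/orP; right; case: (k) => // k0; rewrite leq_exp2r // !tsize_pair /=.
    by move: ws hx qj; rewrite tsize_cons; clear; lia.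
  have c3 : s3 r.+1 = enc (y :: w) by rewrite s3l.
  move: le le2 qj qj1 hx ws; rewrite /= E0 E1 E2 c3 F2 /= -/(tsize x) -/(tsize acc) -/(tsize (f x acc y)) -/(tsize y) -[tree_size (_ w)]/(tsize w) tsize_cons /T.
  clear; move: (a * _) => ak; move: (tsize w) (tsize y) (size w) (tsize x) (tsize acc) (tsize (f x acc y)) (tsize (s x)).
  move=> n1 n2 n3 n4 n5 n6 n7; move: (q n4) (h n4) => n8 n9; nia.
exists (fun r => Seq (Assign r.+1 (EVar r)) (Seq (R r.+1) (Seq (Assign r (EHd (EVar r.+1))) (Seq (Assign r.+2 (ETl (ETl (EVar r.+1))))
  (Seq (Assign r.+1 (EHd (ETl (EVar r.+1)))) (Seq (While (EVar r.+1) (body r)) (Assign r (EVar r.+2)))))))), e, m => r s0 x E.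
have [s1 [t1 [e1 E1 p1 l1]]] := K r.+1 (upd s0 r.+1 (eval_expr s0 (EVar r))) x ltac:(by rewrite /upd eqxx).
pose s2 := upd s1 r (eval_expr s1 (EHd (EVar r.+1))).
pose s3 := upd s2 r.+2 (eval_expr s2 (ETl (ETl (EVar r.+1)))).
pose s4 := upd s3 r.+1 (eval_expr s3 (EHd (ETl (EVar r.+1)))).
have n1 : (r.+1 == r) = false by rewrite gtn_eqF.
have n2 : (r.+1 == r.+2) = false by rewrite ltn_eqF.
have n3 : (r.+2 == r.+1) = false by rewrite gtn_eqF.
have n4 : (r == r.+1) = false by rewrite ltn_eqF.
have n5 : (r == r.+2) = false by rewrite ltn_eqF.
have s2r : s2 r.+1 = s1 r.+1 by rewrite /s2 /upd n1.
have s3r : s3 r.+1 = s1 r.+1 by rewrite /s3 /upd n2.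
have F0 : s4 r = enc x by rewrite /s4 /s3 /s2 /upd n4 n5 eqxx /= E1.
have F1 : s4 r.+1 = enc (s x) by rewrite /s4 /upd eqxx /= s3r E1.
have F2 : s4 r.+2 = enc (foldl (f x) (b x) (take 0 (s x))).
  by rewrite take0 /s4 /upd n3 /s3 /upd eqxx /= s2r E1.
have [s' [t' [e' G2 G0 pr le]]] := run r x (s x) 0 s4 F0 F1 F2 (esym (drop0 _)).
eexists; eexists; split.
- apply: ExecSeq (ExecAssign _ _ _) _; apply: ExecSeq e1 _; apply: ExecSeq (ExecAssign _ _ _) _.
  apply: ExecSeq (ExecAssign _ _ _) _; apply: ExecSeq (ExecAssign _ _ _) _; apply: ExecSeq e' _; exact: ExecAssign.
- by rewrite /upd eqxx /= G2.
- move=> i ir; have [i1 i2] : i < r.+1 /\ i < r.+2 by lia.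
  rewrite [LHS]/upd ltn_eqF // pr // /s4 [LHS]/upd ltn_eqF // /s3 [LHS]/upd ltn_eqF // /s2 [LHS]/upd ltn_eqF //.
  by rewrite p1 // [LHS]/upd ltn_eqF.
have em' := em (@tsize X eX x); have hx := hs x; have q0 := Q x 0; have qn := Q x (size (s x)).
rewrite take_size in qn; rewrite take0 /= in q0; have sz := size_tsize eA (s x).
have le' : size (s x) * (T (tsize x) + h (tsize x) + 3) <= h (tsize x) * (T (tsize x) + h (tsize x) + 3).
  by rewrite leq_mul2r; apply/orP; right; lia.
rewrite -/s2 -/s3; move: em' hx q0 qn l1 le le'; rewrite /= E s2r s3r E1 G2 /= -/(tsize x) -/(tsize (s x)) -/(tsize (b x)) -/(tsize (foldl (f x) (b x) (s x))).
by clear; lia.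
Qed.
End Pt.

(** * Programs for lists and unary numbers *)

Module Pt2.
From Corelib Require Import BinNums.
Require Import Defs.
From mathcomp Require Import all_boot zify.
Import Pt.
Local Open Scope nat_scope.

Lemma pt_app2 X A B Y (eX : Enc X) (eA : Enc A) (eB : Enc B) (eY : Enc Y) (f : A -> B -> Y) (a : X -> A) (b : X -> B) :
  PT (fun p : A * B => f p.1 p.2) -> PT a -> PT b -> PT (fun x => f (a x) (b x)).
Proof. by move=> pf pa pb; exact: (pt_comp (pt_pair pa pb) pf). Qed.

Lemma pt_app3 X A B C Y (eX : Enc X) (eA : Enc A) (eB : Enc B) (eC : Enc C) (eY : Enc Y)
  (f : A -> B -> C -> Y) (a : X -> A) (b : X -> B) (c : X -> C) :
  PT (fun p : A * (B * C) => f p.1 p.2.1 p.2.2) -> PT a -> PT b -> PT c -> PT (fun x => f (a x) (b x) (c x)).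
Proof. by move=> pf pa pb pc; exact: (pt_comp (pt_pair pa (pt_pair pb pc)) pf). Qed.

(** A hook, redefined by [::=] once more constructions have been shown to be polynomial. *)
Ltac pt_extra := fail.
Ltac pt1 := first
  [ eassumption | simple eapply pt_id | simple eapply pt_pair | simple eapply pt_fst | simple eapply pt_snd
  | simple eapply pt_cons | simple eapply pt_some | simple eapply pt_succ | simple eapply pt_if
  | pt_extra | simple eapply pt_const ]; cbv beta.
Ltac pt := cbv beta; repeat pt1.

Lemma tsize_mem X (eX : Enc X) (x : X) s1 s2 : tsize x < tsize (s1 ++ x :: s2).
Proof. by elim: s1 => [|y s1 IH] /=; rewrite tsize_cons; lia. Qed.

(** The increment allowed in a step depends on the input and on the list element but not on the
    accumulator, so the increments simply add up along the list. *)
Lemma pt_foldl_add X (eX : Enc X) A B (eA : Enc A) (eB : Enc B) (f : X -> B -> A -> B) (b : X -> B) (s : X -> seq A)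
  (inv : X -> B -> Prop) c k :
  PT s -> PT b -> PT (fun p : X * (B * A) => f p.1 p.2.1 p.2.2) -> (forall x, inv x (b x)) ->
  (forall x acc a, inv x acc -> inv x (f x acc a) /\ tsize (f x acc a) <= tsize acc + c * (tsize x + tsize a).+1 ^ k) ->
  PT (fun x => foldl (f x) (b x) (s x)).
Proof.
move=> ps pb pf ib H; apply: (pt_foldl ps pb pf).
have [h hb hs] := pt_size ps; have [g gb gs] := pt_size pb.
exists (fun n => g n + h n * (c * (n + h n).+1 ^ k)).
  apply: pbound_add => //; apply: pbound_mul => //; apply: (@pbound_comp (fun n => c * n.+1 ^ k)); first by exists c, k.
  by apply: pbound_add => //; exact: pbound_id.
move=> x j; have key l l2 acc : inv x acc -> tsize (l ++ l2) <= h (tsize x) ->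
    tsize (foldl (f x) acc l) <= tsize acc + size l * (c * (tsize x + h (tsize x)).+1 ^ k).
  elim: l l2 acc => [|a l IH] l2 acc iv le; first by rewrite addn0.
  have [iv' le'] := H x acc a iv; rewrite cat_cons tsize_cons in le.
  have le2 : tsize a <= h (tsize x) by lia.
  apply: leq_trans (IH l2 _ iv' _) _; first by lia.
  rewrite mulSn addnA leq_add2r; apply: leq_trans le' _; rewrite leq_add2l leq_mul2l; apply/orP; right.
  by case: (k) => // k0; rewrite leq_exp2r // ltnS leq_add2l.
have le : tsize (take j (s x) ++ drop j (s x)) <= h (tsize x) by rewrite cat_take_drop.
apply: leq_trans (key _ _ _ (ib x) le) _; rewrite leq_add // leq_mul2r; apply/orP; right.
apply: leq_trans (hs x); apply: leq_trans (ltnW (size_tsize eA (s x))); by rewrite size_take_min geq_minr.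
Qed.

Lemma pt_rev X (eX : Enc X) A (eA : Enc A) (s : X -> seq A) : PT s -> PT (fun x => rev (s x)).
Proof.
move=> ps; apply: (pt_ext (f := fun x => foldl (fun acc a => a :: acc) [::] (s x))).
  move=> x; rewrite -[RHS]cats0.
  by elim: (s x) [::] => //= a l IH acc; rewrite IH rev_cons cat_rcons.
apply: (@pt_foldl_add _ _ _ _ _ _ (fun _ acc a => a :: acc) (fun _ => [::]) s (fun _ _ => True) 1 1) => //; pt.
by move=> x acc a _; split=> //; rewrite tsize_cons expn1; lia.
Qed.

Lemma pt_map X (eX : Enc X) A B (eA : Enc A) (eB : Enc B) (f : X -> A -> B) (s : X -> seq A) :
  PT (fun p : X * A => f p.1 p.2) -> PT s -> PT (fun x => [seq f x a | a <- s x]).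
Proof.
move=> pf ps; apply: (pt_ext (f := fun x => rev (foldl (fun acc a => f x a :: acc) [::] (s x)))).
  move=> x; have H l acc : foldl (fun acc a => f x a :: acc) acc l = rev [seq f x a | a <- l] ++ acc.
    by elim: l acc => //= a l IH acc; rewrite IH rev_cons cat_rcons.
  by rewrite H cats0 revK.
have [g [c [k gk]] gs] := pt_size pf.
apply: pt_rev; apply: (@pt_foldl_add _ _ _ _ _ _ (fun x acc a => f x a :: acc) (fun _ => [::]) s (fun _ _ => True) (c * 2 ^ k + 1) k) => //; pt.
  by apply: (pt_comp (f := fun p : X * (seq B * A) => (p.1, p.2.2)) (g := fun p => f p.1 p.2)) => //; pt.
move=> x acc a _; split=> //; rewrite tsize_cons.
pose proof (gs (x, a)) as g1; pose proof (gk (tsize (x, a))) as g2; rewrite tsize_pair /= in g1 g2.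
have le : (tsize x + tsize a).+2 ^ k <= 2 ^ k * (tsize x + tsize a).+1 ^ k.
  rewrite -expnMn; case: (k) => // j; rewrite leq_exp2r //; lia.
pose proof (expn_gt0 (tsize x + tsize a).+1 k) as g3; rewrite /= in g3.
move: le g1 g2 g3; move: (tsize acc) (tsize (f x a)) (g _) (2 ^ k) (_.+2 ^ k) (_.+1 ^ k) => p q r u v w; clear; nia.
Qed.

Lemma pt_filter X (eX : Enc X) A (eA : Enc A) (f : X -> A -> bool) (s : X -> seq A) :
  PT (fun p : X * A => f p.1 p.2) -> PT s -> PT (fun x => [seq a <- s x | f x a]).
Proof.
move=> pf ps; apply: (pt_ext (f := fun x => rev (foldl (fun acc a => if f x a then a :: acc else acc) [::] (s x)))).
  move=> x; have H l acc : foldl (fun acc a => if f x a then a :: acc else acc) acc l = rev [seq a <- l | f x a] ++ acc.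
    by elim: l acc => //= a l IH acc; rewrite IH; case: (f x a); rewrite ?rev_cons ?cat_rcons.
  by rewrite H cats0 revK.
apply: pt_rev; apply: (@pt_foldl_add _ _ _ _ _ _ (fun x acc a => if f x a then a :: acc else acc) (fun _ => [::]) s (fun _ _ => True) 1 1) => //; pt.
  by apply: (pt_comp (f := fun p : X * (seq A * A) => (p.1, p.2.2)) (g := fun p => f p.1 p.2)) => //; pt.
by move=> x acc a _; split=> //; case: ifP => _; rewrite ?tsize_cons expn1; lia.
Qed.

Lemma pt_orb X (eX : Enc X) (f g : X -> bool) : PT f -> PT g -> PT (fun x => f x || g x).
Proof. by move=> pf pg; apply: (pt_ext (f := fun x => if f x then true else g x)); pt. Qed.
Lemma pt_andb X (eX : Enc X) (f g : X -> bool) : PT f -> PT g -> PT (fun x => f x && g x).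
Proof. by move=> pf pg; apply: (pt_ext (f := fun x => if f x then g x else false)); pt. Qed.
Lemma pt_negb X (eX : Enc X) (f : X -> bool) : PT f -> PT (fun x => ~~ f x).
Proof. by move=> pf; apply: (pt_ext (f := fun x => if f x then false else true)); pt. Qed.
Lemma pt_implb X (eX : Enc X) (f g : X -> bool) : PT f -> PT g -> PT (fun x => f x ==> g x).
Proof. by move=> pf pg; apply: (pt_ext (f := fun x => if f x then g x else true)); pt. Qed.
Lemma pt_addb X (eX : Enc X) (f g : X -> bool) : PT f -> PT g -> PT (fun x => f x (+) g x).
Proof.
move=> pf pg; apply: (pt_ext (f := fun x => if f x then ~~ g x else g x)) => [x|]; first by case: (f x).
by apply: pt_if => //; exact: pt_negb.
Qed.
Lemma pt_eqb X (eX : Enc X) (f g : X -> bool) : PT f -> PT g -> PT (fun x => f x == g x).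
Proof.
move=> pf pg; apply: (pt_ext (f := fun x => ~~ (f x (+) g x))) => [x|]; first by case: (f x); case: (g x).
by apply: pt_negb; exact: pt_addb.
Qed.

Lemma pt_has X (eX : Enc X) A (eA : Enc A) (f : X -> A -> bool) (s : X -> seq A) :
  PT (fun p : X * A => f p.1 p.2) -> PT s -> PT (fun x => has (f x) (s x)).
Proof.
move=> pf ps; apply: (pt_ext (f := fun x => if [seq a <- s x | f x a] is _ :: _ then true else false)).
  by move=> x; elim: (s x) => //= a l IH; case: (f x a).
by apply: pt_case_seq; [apply: pt_filter | pt | pt].
Qed.

Lemma pt_all X (eX : Enc X) A (eA : Enc A) (f : X -> A -> bool) (s : X -> seq A) :
  PT (fun p : X * A => f p.1 p.2) -> PT s -> PT (fun x => all (f x) (s x)).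
Proof.
move=> pf ps; apply: (pt_ext (f := fun x => ~~ has (fun a => ~~ f x a) (s x))) => [x|]; first by rewrite has_predC negbK.
by apply: pt_negb; apply: pt_has => //; exact: pt_negb.
Qed.

Lemma pt_size_seq X (eX : Enc X) A (eA : Enc A) (s : X -> seq A) : PT s -> PT (fun x => size (s x)).
Proof.
move=> ps; apply: (@pt_enc _ _ _ _ _ _ (fun x => [seq tt | a <- s x])); last by apply: pt_map => //; pt.
by move=> x; elim: (s x) => //= a l IH; congr (Node _ _).
Qed.

Lemma pt_units X (eX : Enc X) (n : X -> nat) : PT n -> PT (fun x => nseq (n x) tt).
Proof. by move=> pn; apply: (pt_enc _ pn) => x; elim: (n x) => //= a IH; congr (Node _ _). Qed.

Lemma iter_foldl T (f : T -> T) x n : iter n f x = foldl (fun acc (_ : unit) => f acc) x (nseq n tt).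
Proof. by elim: n x => // n IH x; rewrite iterSr /= IH. Qed.

Lemma pt_iter X (eX : Enc X) B (eB : Enc B) (f : X -> B -> B) (b : X -> B) (n : X -> nat)
  (inv : X -> B -> Prop) c k :
  PT n -> PT b -> PT (fun p : X * B => f p.1 p.2) -> (forall x, inv x (b x)) ->
  (forall x acc, inv x acc -> inv x (f x acc) /\ tsize (f x acc) <= tsize acc + c * (tsize x) ^ k) ->
  PT (fun x => iter (n x) (f x) (b x)).
Proof.
move=> pn pb pf ib H; apply: (pt_ext (fun x => esym (iter_foldl _ _ _))).
apply: (@pt_foldl_add _ _ _ _ _ _ (fun x acc _ => f x acc) b _ inv c k) => //; first exact: pt_units.
  by apply: (pt_comp (f := fun p : X * (B * unit) => (p.1, p.2.1)) (g := fun p => f p.1 p.2)) => //; pt.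
move=> x acc a /H[i le]; split=> //; apply: leq_trans le _; rewrite leq_add2l leq_mul2l; apply/orP; right.
by case: (k) => // j; rewrite leq_exp2r //; lia.
Qed.

Lemma pt_cat X (eX : Enc X) A (eA : Enc A) (s t : X -> seq A) : PT s -> PT t -> PT (fun x => s x ++ t x).
Proof.
move=> ps pt'; apply: (pt_ext (f := fun x => foldl (fun acc a => a :: acc) (t x) (rev (s x)))).
  move=> x; rewrite -{2}(revK (s x)); elim: (rev (s x)) (t x) => //= a l IH acc.
  by rewrite IH rev_cons cat_rcons.
apply: (@pt_foldl_add _ _ _ _ _ _ (fun _ acc a => a :: acc) t (fun x => rev (s x)) (fun _ _ => True) 1 1) => //; [exact: pt_rev | pt |].
by move=> x acc a _; split=> //; rewrite tsize_cons expn1; lia.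
Qed.

Lemma tsize_cat A (eA : Enc A) (s t : seq A) : (tsize (s ++ t)).+1 = tsize s + tsize t.
Proof. by elim: s => //= a s; rewrite !tsize_cons; lia. Qed.

Lemma pt_flatten X (eX : Enc X) A (eA : Enc A) (s : X -> seq (seq A)) : PT s -> PT (fun x => flatten (s x)).
Proof.
move=> ps; apply: (pt_ext (f := fun x => foldl cat [::] (s x))).
  move=> x; have H l acc : foldl cat acc l = acc ++ flatten l :> seq A.
    by elim: l acc => /= [|a l IH] acc; rewrite ?cats0 // IH catA.
  by rewrite H.
apply: (@pt_foldl_add _ _ _ _ _ _ (fun _ => cat) (fun _ => [::]) s (fun _ _ => True) 1 1) => //; [pt | by apply: pt_cat; pt |].
by move=> x acc a _; split=> //; have := tsize_cat eA acc a; rewrite expn1; lia.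
Qed.

Lemma pt_behead X (eX : Enc X) A (eA : Enc A) (s : X -> seq A) : PT s -> PT (fun x => behead (s x)).
Proof.
by move=> ps; apply: (pt_ext (f := fun x => if s x is a :: l then l else [::])); [move=> x; case: (s x) | apply: pt_case_seq; pt].
Qed.
Lemma pt_head X (eX : Enc X) A (eA : Enc A) (d : X -> A) (s : X -> seq A) : PT d -> PT s -> PT (fun x => head (d x) (s x)).
Proof. by move=> pd ps; apply: pt_case_seq; pt. Qed.
Lemma pt_nilp X (eX : Enc X) A (eA : Enc A) (s : X -> seq A) : PT s -> PT (fun x => nilp (s x)).
Proof. by move=> ps; apply: (pt_ext (f := fun x => if s x is a :: l then false else true)); [move=> x; case: (s x) | apply: pt_case_seq; pt]. Qed.
Lemma pt_drop X (eX : Enc X) A (eA : Enc A) (n : X -> nat) (s : X -> seq A) : PT n -> PT s -> PT (fun x => drop (n x) (s x)).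
Proof.
move=> pn ps; apply: (pt_ext (f := fun x => iter (n x) behead (s x))).
  by move=> x; elim: (n x) (s x) => [|k IH] l; rewrite ?drop0 // iterSr IH; case: l.
apply: (@pt_iter _ _ _ _ (fun _ => behead) s n (fun _ _ => True) 1 1) => //; first by apply: pt_behead; pt.
by move=> x acc _; split=> //; case: acc => [|a l]; rewrite ?tsize_cons /=; lia.
Qed.
Lemma pt_nth X (eX : Enc X) A (eA : Enc A) (d : X -> A) (s : X -> seq A) (n : X -> nat) :
  PT d -> PT s -> PT n -> PT (fun x => nth (d x) (s x) (n x)).
Proof.
move=> pd ps pn; apply: (pt_ext (f := fun x => head (d x) (drop (n x) (s x)))); last by apply: pt_head => //; exact: pt_drop.
by move=> x; rewrite -nth0 nth_drop addn0.
Qed.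

Lemma pt_pred X (eX : Enc X) (n : X -> nat) : PT n -> PT (fun x => (n x).-1).
Proof.
move=> pn; apply: (pt_ext (f := fun x => if n x is k.+1 then k else 0)) => [x|]; first by case: (n x).
by apply: pt_case_nat; pt.
Qed.
Lemma pt_sub X (eX : Enc X) (m n : X -> nat) : PT m -> PT n -> PT (fun x => m x - n x).
Proof.
move=> pm pn; apply: (pt_ext (f := fun x => iter (n x) predn (m x))) => [x|]; first by rewrite iter_predn.
apply: (@pt_iter _ _ _ _ (fun _ => predn) m n (fun _ _ => True) 1 1) => //; first by apply: pt_pred; pt.
by move=> x acc _; split=> //; rewrite !tsize_nat; lia.
Qed.
Lemma pt_add X (eX : Enc X) (m n : X -> nat) : PT m -> PT n -> PT (fun x => m x + n x).
Proof.
move=> pm pn; apply: (pt_ext (f := fun x => size (nseq (m x) tt ++ nseq (n x) tt))) => [x|]; first by rewrite size_cat !size_nseq.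
by apply: pt_size_seq; apply: pt_cat; exact: pt_units.
Qed.
Lemma pt_double X (eX : Enc X) (n : X -> nat) : PT n -> PT (fun x => (n x).*2).
Proof. by move=> pn; apply: (pt_ext (f := fun x => n x + n x)) => [x|]; [rewrite addnn | exact: pt_add]. Qed.
Lemma pt_is0 X (eX : Enc X) (n : X -> nat) : PT n -> PT (fun x => n x == 0).
Proof.
by move=> pn; apply: (pt_ext (f := fun x => if n x is k.+1 then false else true)); [move=> x; case: (n x) | apply: pt_case_nat; pt].
Qed.
Lemma pt_leq X (eX : Enc X) (m n : X -> nat) : PT m -> PT n -> PT (fun x => m x <= n x).
Proof. by move=> pm pn; apply: pt_is0; exact: pt_sub. Qed.
Lemma pt_eqn X (eX : Enc X) (m n : X -> nat) : PT m -> PT n -> PT (fun x => m x == n x).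
Proof.
move=> pm pn; apply: (pt_ext (f := fun x => (m x <= n x) && (n x <= m x))) => [x|]; first by rewrite -eqn_leq.
by apply: pt_andb; exact: pt_leq.
Qed.
Lemma pt_min X (eX : Enc X) (m n : X -> nat) : PT m -> PT n -> PT (fun x => minn (m x) (n x)).
Proof. by move=> pm pn; apply: pt_if => //; apply: pt_leq; pt. Qed.
Lemma pt_max X (eX : Enc X) (m n : X -> nat) : PT m -> PT n -> PT (fun x => maxn (m x) (n x)).
Proof. by move=> pm pn; apply: pt_if => //; apply: pt_leq; pt. Qed.
Lemma pt_iota X (eX : Enc X) (m n : X -> nat) : PT m -> PT n -> PT (fun x => iota (m x) (n x)).
Proof.
move=> pm pn.
apply: (pt_ext (f := fun x => [seq m x + k | k <- rev (iter (n x) (fun l => size l :: l) [::])])).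
  move=> x; suff -> : iter (n x) (fun l => size l :: l) [::] = rev (iota 0 (n x)) by rewrite revK -[in RHS](addn0 (m x)) iotaDl.
  by elim: (n x) => // k IH; rewrite iterS IH size_rev size_iota -[in RHS]addn1 iotaD add0n cats1 rev_rcons.
apply: pt_map; first by apply: pt_add; [apply: (pt_comp (pt_fst (pt_id _)) pm) | pt].
apply: pt_rev.
(* The length of the list under construction is bounded by that of the encoding. *)
apply: (pt_ext (f := fun x => (iter (n x) (fun p : seq nat * nat => (p.2 :: p.1, p.2.+1)) ([::], 0)).1)).
  move=> x; have H k : iter k (fun p : seq nat * nat => (p.2 :: p.1, p.2.+1)) ([::], 0) = (iter k (fun l => size l :: l) [::], k).
    have sz i : size (iter i (fun l => size l :: l) [::]) = i by elim: i => //= i ->.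
    by elim: k => //= k ->; rewrite /= sz.
  by rewrite H.
apply: pt_fst; apply: (pt_ext (f := fun x => foldl (fun (p : seq nat * nat) (_ : unit) => (p.2 :: p.1, p.2.+1)) ([::], 0) (nseq (n x) tt))).
  by move=> x; rewrite -iter_foldl.
apply: pt_foldl; [exact: pt_units | pt | pt |].
have [h hb hs] := pt_size pn.
exists (fun k => h k * (h k).*2.+2 + 2 * h k + 10).
  apply: (@pbound_le _ (fun k => h k * (h k + h k + 2) + (h k + h k) + 10)); first by move=> k; lia.
  exact: (pbound_add (pbound_add (pbound_mul hb (pbound_add (pbound_add hb hb) (pbound_const 2))) (pbound_add hb hb)) (pbound_const 10)).
move=> x k; have -> : take k (nseq (n x) tt) = nseq (minn k (n x)) tt.
  by apply: (@eq_from_nth _ tt); rewrite ?size_take_min ?size_nseq // => i _; case: (nth _ _ _); case: (nth _ _ _).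
have le : minn k (n x) <= h (tsize x) by apply: leq_trans (hs x); rewrite tsize_nat; lia.
rewrite -iter_foldl; move: (minn k (n x)) (h (tsize x)) le => j b; clear.
have H i : (iter i (fun p : seq nat * nat => (p.2 :: p.1, p.2.+1)) ([::], 0)).2 = i by elim: i => //= i ->.
suff h1 : @tsize _ (enc_inst_seq enc_inst_nat) (iter j (fun p : seq nat * nat => (p.2 :: p.1, p.2.+1)) ([::], 0)).1 <= j * j.*2.+2 + 1.
  move=> jb; rewrite tsize_pair H tsize_nat; have h2 : j * j.*2.+2 <= b * b.*2.+2 by apply: leq_mul; lia.
  by move: h1 h2 jb; clear; lia.
elim: j => // j IH; rewrite iterS tsize_cons H tsize_nat; move: IH; move: (tsize _) => z; clear; nia.
Qed.

Lemma pt_mkseq X (eX : Enc X) A (eA : Enc A) (f : X -> nat -> A) (n : X -> nat) :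
  PT (fun p : X * nat => f p.1 p.2) -> PT n -> PT (fun x => mkseq (f x) (n x)).
Proof. by move=> pf pn; apply: pt_map => //; apply: pt_iota => //; pt. Qed.

Lemma pt_mem_nat X (eX : Enc X) (n : X -> nat) (s : X -> seq nat) : PT n -> PT s -> PT (fun x => n x \in s x).
Proof.
move=> pn ps; apply: (pt_ext (f := fun x => has (fun a => a == n x) (s x))) => [x|]; first by rewrite has_pred1.
apply: pt_has => //; apply: pt_eqn; [pt | exact: (pt_comp (pt_fst (pt_id _)) pn)].
Qed.

Lemma pt_zip X (eX : Enc X) A B (eA : Enc A) (eB : Enc B) (a0 : A) (b0 : B) (s : X -> seq A) (t : X -> seq B) :
  PT s -> PT t -> PT (fun x => zip (s x) (t x)).
Proof.
move=> ps ptt; apply: (pt_ext (f := fun x => [seq (nth a0 (s x) i, nth b0 (t x) i) | i <- iota 0 (minn (size (s x)) (size (t x)))])).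
  move=> x; elim: (s x) (t x) => [|a l IH] [|b l'] //=; rewrite ?min0n ?minn0 // minnSS /= -IH; congr (_ :: _).
  by rewrite -[1]addn0 iotaDl -map_comp; apply: eq_map.
apply: pt_map; last by apply: pt_iota; [pt | apply: pt_min; exact: pt_size_seq].
by apply: pt_pair; apply: pt_nth; pt; [exact: (pt_comp (pt_fst (pt_id _)) ps) | exact: (pt_comp (pt_fst (pt_id _)) ptt)].
Qed.

Lemma pt_eq_bits X (eX : Enc X) (s t : X -> seq bool) : PT s -> PT t -> PT (fun x => s x == t x).
Proof.
move=> ps ptt; apply: (pt_ext (f := fun x => (size (s x) == size (t x)) && all (fun p => p.1 == p.2) (zip (s x) (t x)))).
  by move=> x; elim: (s x) (t x) => [|a l IH] [|b l'] //=; rewrite eqSS eqseq_cons -IH andbCA.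
apply: pt_andb; first by apply: pt_eqn; exact: pt_size_seq.
apply: pt_all; [by apply: pt_eqb; pt | exact: pt_zip false false _ _ ps ptt].
Qed.

Lemma pt_undup X (eX : Enc X) (s : X -> seq (seq bool)) : PT s -> PT (fun x => undup (s x)).
Proof.
move=> ps; apply: (pt_ext (f := fun x => foldl (fun acc a => if has (fun b => b == a) acc then acc else a :: acc) [::] (rev (s x)))).
  move=> x; elim: (s x) => //= a l IH; rewrite rev_cons -cats1 foldl_cat IH /=.
  by rewrite has_pred1 mem_undup.
apply: (@pt_foldl_add _ _ _ _ _ _ (fun _ acc a => if has (fun b => b == a) acc then acc else a :: acc) (fun _ => [::]) _ (fun _ _ => True) 1 1) => //.
- exact: pt_rev.
- pt.
- by apply: pt_if; pt; apply: pt_has; pt; apply: pt_eq_bits; pt.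
- by move=> x acc a _; split=> //; case: ifP => _; rewrite ?tsize_cons expn1; lia.
Qed.

Ltac pt_extra ::= first
  [ simple eapply pt_rev | simple eapply pt_map | simple eapply pt_filter | simple eapply pt_has | simple eapply pt_all
  | simple eapply pt_orb | simple eapply pt_andb | simple eapply pt_negb | simple eapply pt_implb | simple eapply pt_addb
  | simple eapply pt_eqb | simple eapply pt_size_seq | simple eapply pt_cat | simple eapply pt_flatten | simple eapply pt_behead
  | simple eapply pt_head | simple eapply pt_nilp | simple eapply pt_drop | simple eapply pt_nth | simple eapply pt_pred
  | simple eapply pt_sub | simple eapply pt_add | simple eapply pt_double | simple eapply pt_is0 | simple eapply pt_leq
  | simple eapply pt_eqn | simple eapply pt_min | simple eapply pt_max | simple eapply pt_iota | simple eapply pt_mkseq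
  | simple eapply pt_mem_nat | simple eapply pt_eq_bits | simple eapply pt_undup ].
End Pt2.

(** * Programs for binary numbers *)

Module Pt3.
From Corelib Require Import BinNums.
Require Import Defs.
From mathcomp Require Import all_boot zify.
Import Pt Pt2.
Local Open Scope nat_scope.

(** The same type under another name, opaque to instance resolution, so that [Enc] selects the
    binary encoding. *)
Definition bin := nat.
#[global] Instance enc_inst_bin : Enc bin := enc_nat.
#[global] Typeclasses Opaque bin.

Definition bval (s : seq bool) : bin := foldr (fun (b : bool) v => b + v.*2) 0 s.
(** Drops the leading zeros. The tree of a normalised list of bits is literally that of the binary
    number, so passing between the two costs nothing. *)
Definition norm (s : seq bool) := foldr (fun b l => if b || ~~ nilp l then b :: l else [::]) [::] s.

Lemma bin_of_nat_double v p : bin_of_nat v = Npos p ->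
  bin_of_nat v.*2 = Npos (xO p) /\ bin_of_nat v.*2.+1 = Npos (xI p).
Proof.
move=> e; have ep : v = nat_of_pos p by rewrite -(bin_of_natK v) e.
by split; apply: (can_inj nat_of_binK); rewrite bin_of_natK /= ep NatTrec.doubleE.
Qed.

Lemma enc_nat_bit (b : bool) v : enc_nat (b + v.*2) = if b || (v != 0) then Node (enc_bool b) (enc_nat v) else Leaf.
Proof.
case: v => [|v]; first by case: b.
rewrite orbT /enc_nat; case E : (bin_of_nat v.+1) => [|p].
  by have := bin_of_natK v.+1; rewrite E.
by have [e0 e1] := bin_of_nat_double E; case: b; rewrite ?add0n ?add1n ?e0 ?e1.
Qed.

Lemma enc_bval s : enc (bval s) = enc (norm s).
Proof.
have H l : (bval l != 0) = ~~ nilp (norm l).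
  elim: l => //= b l IH; rewrite -IH /bval /= -/(bval l); case: b; case: (bval l) => //=.
elim: s => //= b s IH; rewrite /bval /= -/(bval s) [LHS]enc_nat_bit H; case: ifP => // _.
by rewrite -[enc_nat _]/(enc (bval s)) IH.
Qed.

Lemma bval_norm s : bval (norm s) = bval s.
Proof.
elim: s => //= b s IH; case: ifP => [_|]; first by rewrite /bval /= -/(bval _) IH.
by case: b => //= /negbFE/nilP e; rewrite e in IH; rewrite /bval /= -/(bval s) -IH.
Qed.

Fixpoint bits_rec k n : seq bool := if k is k'.+1 then odd n :: bits_rec k' n./2 else [::].
Definition bits (n : bin) : seq bool := norm (bits_rec n n).

Lemma bitsK n : bval (bits n) = n.
Proof.
rewrite /bits bval_norm; suff H k m : m <= k -> bval (bits_rec k m) = m by exact: H.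
elim: k m => [|k IH] m; first by rewrite leqn0 => /eqP.
by move=> mk; rewrite /bval /= -/(bval _) IH ?odd_double_half //; have := odd_double_half m; lia.
Qed.

Lemma enc_bits (n : bin) : enc n = enc (bits n).
Proof.
have nn s : norm (norm s) = norm s by elim: s => //= b s IH; case: ifP => //= e; rewrite IH e.
by rewrite -{1}(bitsK n) enc_bval /bits nn.
Qed.

Section Bin.
Context {X : Type} {eX : Enc X}.

Lemma pt_bits (n : X -> bin) : PT n -> PT (fun x => bits (n x)).
Proof. by move=> pn; apply: (pt_enc _ pn) => x; exact: enc_bits. Qed.

Lemma pt_norm (s : X -> seq bool) : PT s -> PT (fun x => norm (s x)).
Proof.
move=> ps; apply: (pt_ext (f := fun x => foldl (fun l b => if b || ~~ nilp l then b :: l else [::]) [::] (rev (s x)))).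
  by move=> x; rewrite foldl_rev.
apply: (@pt_foldl_add _ _ _ _ _ _ (fun _ l b => if b || ~~ nilp l then b :: l else [::]) (fun _ => [::]) _ (fun _ _ => True) 1 1) => //.
- pt.
- pt.
- pt.
by move=> x acc a _; split=> //; case: ifP => _; rewrite ?tsize_cons expn1 ?tsize_nil; lia.
Qed.

Lemma pt_bval (s : X -> seq bool) : PT s -> PT (fun x => bval (s x)).
Proof. by move=> ps; apply: (pt_enc _ (pt_norm ps)) => x; rewrite enc_bval. Qed.

(* Subtraction with borrow, least significant bits first; a borrow left at the end means a negative result. *)
Definition sub_step (cs : bool * seq bool) (ab : bool * bool) :=
  (if ab.1 then ab.2 && cs.1 else ab.2 || cs.1, (ab.1 (+) ab.2 (+) cs.1) :: cs.2).
Definition sub_run (s t : seq bool) :=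
  foldl sub_step (false, [::]) [seq (nth false s i, nth false t i) | i <- iota 0 (maxn (size s) (size t))].
Definition sub_bits s t := let r := sub_run s t in if r.1 then [::] else rev r.2.

Lemma bval_rcons s b : bval (rcons s b) = bval s + b * 2 ^ size s.
Proof.
elim: s => [|a s IH] /=; first by rewrite /bval /= muln1 addn0.
by rewrite /bval /= -!/(bval _) IH expnS; lia.
Qed.

Lemma sub_run_spec s t : let r := sub_run s t in let k := maxn (size s) (size t) in
  bval s + r.1 * 2 ^ k = bval (rev r.2) + bval t /\ bval (rev r.2) < 2 ^ k.
Proof.
rewrite /sub_run /=; set k := maxn _ _.
pose F j := foldl sub_step (false, [::]) [seq (nth false s i, nth false t i) | i <- iota 0 j].
have FS j : F j.+1 = sub_step (F j) (nth false s j, nth false t j).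
  by rewrite /F -[in LHS]addn1 iotaD map_cat foldl_cat add0n.
have H j : bval (mkseq (nth false s) j) + (F j).1 * 2 ^ j = bval (rev (F j).2) + bval (mkseq (nth false t) j) /\ size (F j).2 = j.
  elim: j => [|j [IH1 IH2]] //; rewrite FS !mkseqS !bval_rcons !size_mkseq; move: IH1 IH2.
  case: (F j) => c l; rewrite /sub_step [(_, l).1]/= [(_, l).2]/= => IH1 IH2; split; last by rewrite /= IH2.
  rewrite [(_, _ :: l).1]/= [(_, _ :: l).2]/= rev_cons bval_rcons size_rev IH2 expnS; move: IH1.
  by clear; case: c; case: (nth false s j); case: (nth false t j) => /=; lia.
rewrite -/(F k).
have pad l j : size l <= j -> bval (mkseq (nth false l) j) = bval l.
  move=> lj; have -> : mkseq (nth false l) j = l ++ nseq (j - size l) false.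
    apply: (@eq_from_nth _ false); rewrite ?size_mkseq ?size_cat ?size_nseq ?subnKC // => i ij.
    by rewrite nth_mkseq // nth_cat; case: ltnP => // le; rewrite nth_default // nth_nseq if_same.
  by move: (j - size l) => z; elim: l {lj} => [|b l IH] /=; [elim: z => //= i; rewrite /bval /= => -> | rewrite /bval /= -!/(bval _) IH].
have [e1 e2] := H k; rewrite !pad ?leq_maxl ?leq_maxr // in e1; split=> //.
rewrite -{2}e2 -(size_rev _.2); elim: (rev _) => //= b l IH; rewrite /bval /= -/(bval l) expnS; case: b; lia.
Qed.

Lemma sub_bits_val s t : bval (sub_bits s t) = bval s - bval t.
Proof.
by have := sub_run_spec s t; rewrite /sub_bits /=; case: ifP => /= _ [e l]; rewrite ?bval0 /=; lia.
Qed.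

Lemma sub_run_leq s t : (bval t <= bval s) = ~~ (sub_run s t).1.
Proof.
have := sub_run_spec s t; rewrite /=; case: (sub_run s t) => c l /= []; move: (bval s) (bval t) (bval _) (2 ^ _) => a b d e.
by case: c => /=; rewrite ?mul1n ?mul0n; clear; lia.
Qed.

Lemma pt_sub_run (s t : X -> seq bool) : PT s -> PT t -> PT (fun x => sub_run (s x) (t x)).
Proof.
move=> ps ptt; rewrite /sub_run.
apply: (@pt_foldl_add _ _ _ _ _ _ (fun _ => sub_step) (fun _ => (false, [::])) _ (fun _ _ => True) 10 1) => //.
- pt; [exact: (pt_comp (pt_fst (pt_id _)) ps) | exact: (pt_comp (pt_fst (pt_id _)) ptt)].
- pt.
- rewrite /sub_step; pt.
move=> x acc a _; split=> //; rewrite /sub_step !tsize_pair tsize_cons /= expn1.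
have h (b : bool) : tsize b <= 3 by exact: tsize_bool.
have := h (if a.1 then a.2 && acc.1 else a.2 || acc.1); have := h (a.1 (+) a.2 (+) acc.1).
pose proof (tsize_gt0 _ x) as g; move: g; move: (tsize _) (tsize _) (tsize _) (tsize _) (tsize _) => p q r u v; clear; lia.
Qed.

Lemma pt_bsub (m n : X -> bin) : PT m -> PT n -> PT ((fun x => m x - n x) : X -> bin).
Proof.
move=> pm pn; apply: (pt_ext (f := fun x => bval (sub_bits (bits (m x)) (bits (n x))))).
  by move=> x; rewrite sub_bits_val !bitsK.
have pr : PT (fun x => sub_run (bits (m x)) (bits (n x))) by apply: pt_sub_run; exact: pt_bits.
by apply: pt_bval; rewrite /sub_bits; pt.
Qed.

Lemma pt_bleq (m n : X -> bin) : PT m -> PT n -> PT (fun x => leq (m x) (n x)).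
Proof.
move=> pm pn; apply: (pt_ext (f := fun x => ~~ (sub_run (bits (n x)) (bits (m x))).1)).
  by move=> x; rewrite -sub_run_leq !bitsK.
by apply: pt_negb; apply: pt_fst; apply: pt_sub_run; exact: pt_bits.
Qed.

Lemma pt_beq0 (m : X -> bin) : PT m -> PT (fun x => eq_op (m x : nat) 0).
Proof.
move=> pm; apply: (pt_ext (f := fun x => leq (m x) 0)); first by move=> x; rewrite leqn0.
by apply: pt_bleq => //; exact: pt_const.
Qed.

Lemma pt_bmin (m n : X -> bin) : PT m -> PT n -> PT ((fun x => minn (m x) (n x)) : X -> bin).
Proof.
move=> pm pn; rewrite /minn; apply: pt_if => //.
apply: (pt_ext (f := fun x => ~~ leq (n x) (m x))); first by move=> x; rewrite -ltnNge.
by apply: pt_negb; exact: pt_bleq.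
Qed.

Lemma pt_bodd (m : X -> bin) : PT m -> PT (fun x => odd (m x)).
Proof.
move=> pm; apply: (pt_ext (f := fun x => head false (bits (m x)))).
  by move=> x; rewrite -{2}(bitsK (m x)); case: (bits _) => //= b s; rewrite /bval /= oddD odd_double addbF oddb.
have := pt_bits pm => pb; pt.
Qed.

Lemma pt_bhalf (m : X -> bin) : PT m -> PT ((fun x => (m x)./2) : X -> bin).
Proof.
move=> pm; apply: (pt_ext (f := fun x => bval (behead (bits (m x))))).
  by move=> x; rewrite -{2}(bitsK (m x)); case: (bits _) => //= b s; rewrite {2}/bval /= -/(bval s) half_bit_double.
by have pb := pt_bits pm; apply: pt_bval; pt.
Qed.

Lemma pt_bdouble (m : X -> bin) : PT m -> PT ((fun x => (m x).*2) : X -> bin).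
Proof.
move=> pm; apply: (pt_ext (f := fun x => bval (false :: bits (m x)))).
  by move=> x; rewrite /bval /= -/(bval _) bitsK.
by have pb := pt_bits pm; apply: pt_bval; pt.
Qed.

End Bin.

(** The digit 1 has a larger tree than the digit 0, so the size is not monotone: the tree of 7 is
    larger than that of 8. The factor 2 repairs this. *)
Lemma tsize_bin_leq (m n : bin) : m <= n -> @tsize bin _ m <= 2 * @tsize bin _ n.
Proof.
have H k (a b : nat) : b <= k -> a <= b -> tree_size (enc_nat a) <= 2 * tree_size (enc_nat b); last exact: H (leqnn _).
elim: k a b => [|k IH] a b; first by rewrite leqn0 => /eqP ->; rewrite leqn0 => /eqP ->.
move=> bk ab; rewrite -(odd_double_half a) -(odd_double_half b) !enc_nat_bit.
have h2 : a./2 <= b./2 by exact: half_leq.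
case: ifP => [ea|_]; last by have := tree_size_gt0 (if odd b || (b./2 != 0) then Node (enc_bool (odd b)) (enc_nat b./2) else Leaf); rewrite /=; lia.
have nb : b != 0 by apply: contraTneq ea => b0; move: ab; rewrite b0 leqn0 => /eqP ->.
have -> : odd b || (b./2 != 0) by move: nb; rewrite -{1}(odd_double_half b); case: (odd b) => //=; case: (b./2).
have b2 : b./2 <= k by move: bk nb; have := odd_double_half b; lia.
have sz (c : bool) : tree_size (enc_bool c) = c.*2.+1 by case: c.
by rewrite /= !sz; have := IH _ _ b2 h2; case: (odd a); case: (odd b); lia.
Qed.
End Pt3.

(** * Depth-first search in the subdivided graph *)

Module Dfs.
From mathcomp Require Import all_boot zify.
Import Palm.

Section Search.
Variable nbs : seq (seq nat).

Definition nb x := nth [::] nbs x.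
Definition fresh (seen : seq nat) x := [seq y <- nb x | y \notin seen].
(** The list is newest first and pairs each node with the discovery number of its parent. The search
    continues from the newest node with an unseen neighbour; position [j] in the list has discovery
    number [size t - j.+1]. *)
Definition dfs_step (t : seq (nat * nat)) : seq (nat * nat) :=
  let seen := unzip1 t in
  if [seq j <- iota 0 (size t) | ~~ nilp (fresh seen (nth 0 seen j))] is j :: _
  then (head 0 (fresh seen (nth 0 seen j)), size t - j.+1) :: t else t.
Definition dfs r := iter (size nbs) dfs_step [:: (r, 0)].
Definition order (t : seq (nat * nat)) := rev (unzip1 t).
Definition parents (t : seq (nat * nat)) := rev (unzip2 t).

Variable r : nat.
Hypothesis r_in : r < size nbs.
Hypothesis nb_in : forall x y, y \in nb x -> y < size nbs.

(** The last clause is the depth-first property: whatever was discovered between the parent of [k]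
    and [k] itself has been exhausted by then. *)
Definition dfs_ok (o p : seq nat) := [/\ uniq o, head 0 o = r & size p = size o] /\
  forall k, 0 < k < size o -> [/\ nth 0 p k < k, nth 0 o k \in nb (nth 0 o (nth 0 p k)) &
    forall x, nth 0 p k < x < k -> {subset nb (nth 0 o x) <= take k o}].

Lemma dfs_step_ok t : t != [::] -> dfs_ok (order t) (parents t) -> dfs_ok (order (dfs_step t)) (parents (dfs_step t)).
Proof.
move=> tn ok; rewrite /dfs_step; set js := [seq j <- _ | _]; case E : js => [//|j js'].
have so : size (order t) = size t by rewrite size_rev size_map.
have : j \in js by rewrite E mem_head.
rewrite mem_filter mem_iota add0n => /andP[nj jt].
set seen := unzip1 t in js E nj *; set x := nth 0 seen j in nj *; set y := head 0 _.
have yf : y \in fresh seen x by rewrite /y; case: (fresh seen x) nj => // a l _; rewrite mem_head.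
move: yf; rewrite mem_filter => /andP[yn yx].
have ssz : size seen = size t by rewrite size_map.
have before j' : j' < j -> fresh seen (nth 0 seen j') = [::].
  move=> j'j; apply/eqP/negPn/negP => ne; have : j' \in js by rewrite mem_filter mem_iota /nilp size_eq0 ne /=; lia.
  have : sorted ltn js by apply: sorted_filter (iota_ltn_sorted _ _); exact: ltn_trans.
  rewrite E inE => /= so'; case/orP => [/eqP|]; first by lia.
  by move/(order_path_min ltn_trans): so' => /allP h /h; lia.
have oE i : i < size t -> nth 0 (order t) i = nth 0 seen (size t - i.+1) by move=> it; rewrite nth_rev ssz.
case: ok => [[u h sp] st]; split.
  rewrite /order /parents /= !rev_cons !size_rcons rcons_uniq u mem_rev yn sp; split=> //.
  rewrite -h; have : 0 < size (order t) by rewrite so (leq_ltn_trans (leq0n j)). 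
  by rewrite /order; case: (rev _).
move=> k; rewrite /order /parents /= !rev_cons size_rcons !nth_rcons -/(order t) -/(parents t) sp so => /andP[k0 ks].
have sub i : i < size t -> take i (rcons (order t) y) = take i (order t).
  by move=> it; rewrite -cats1 takel_cat // so ltnW.
move: ks; rewrite ltnS leq_eqVlt => /orP[/eqP kE|kt].
  rewrite kE ltnn eqxx; have lt : size t - j.+1 < size t by lia.
  rewrite lt; split=> //.
    have ar a c : c < a -> a - (a - c.+1).+1 = c by clear; lia.
    rewrite oE // (ar _ _ jt).
    by [].
  move=> x' /andP[jx xt]; rewrite nth_rcons so xt oE // -cats1 takel_cat ?so // take_oversize ?so // => z zx.
  have lj : size t - x'.+1 < j by move: jx xt jt; move: (size t) => N0; clear; lia.
  have := before _ lj; rewrite mem_rev; case zs : (z \in seen) => // f0.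
  suff : z \in fresh seen (nth 0 seen (size t - x'.+1)) by rewrite f0.
  by rewrite mem_filter zs.
have k0t : 0 < k < size (order t) by rewrite so k0.
have [a b c] := st k k0t; rewrite kt (ltn_trans a kt) sub //; split=> // x' /andP[px xk].
by rewrite nth_rcons so (ltn_trans xk kt); apply: c; rewrite px.
Qed.

Lemma dfs_step_nil t : t != [::] -> dfs_step t != [::].
Proof. by rewrite /dfs_step; case: [seq j <- _ | _]. Qed.

Lemma dfs_ok_dfs : dfs_ok (order (dfs r)) (parents (dfs r)).
Proof.
have h k : iter k dfs_step [:: (r, 0)] != [::] by elim: k => //= k; exact: dfs_step_nil.
rewrite /dfs; elim: (size nbs) => [|k IH]; last exact: (dfs_step_ok (h k) IH).
by split=> // -[|k] //= /andP[].
Qed.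

Lemma dfs_root : r \in order (dfs r).
Proof.
have [[u h sp] st] := dfs_ok_dfs; have dn : dfs r != [::].
  by rewrite /dfs; elim: (size nbs) => //= k; exact: dfs_step_nil.
have : 0 < size (order (dfs r)) by rewrite size_rev size_map lt0n size_eq0.
by move: h; case: (order _) => //= a s -> _; rewrite mem_head.
Qed.

Lemma dfs_par0 : nth 0 (parents (dfs r)) 0 = 0.
Proof.
have [s ->] : exists s, dfs r = rcons s (r, 0).
  rewrite /dfs; elim: (size nbs) => [|k [s IH]]; first by exists [::].
  by rewrite iterS IH /dfs_step; case: [seq j <- _ | _] => [|j js]; [exists s | eexists; rewrite -rcons_cons].
by rewrite /parents /unzip2 map_rcons rev_rcons.
Qed.

(** Every step that changes the list discovers a node. After [size nbs] steps the search has
    therefore stopped; otherwise it would hold one node too many. *)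
Lemma dfs_closed x y : x \in order (dfs r) -> y \in nb x -> y \in order (dfs r).
Proof.
pose full (t : seq (nat * nat)) := nilp [seq j <- iota 0 (size t) | ~~ nilp (fresh (unzip1 t) (nth 0 (unzip1 t) j))].
have stay t : full t -> dfs_step t = t by move/nilP; rewrite /dfs_step => ->.
have step_size t : ~~ full t -> size (dfs_step t) = (size t).+1.
  by rewrite /full /dfs_step; case: [seq j <- _ | _].
have bound t : dfs_ok (order t) (parents t) -> size t <= size nbs.
  move=> [[u h sp] st]; have -> : size t = size (order t) by rewrite size_rev size_map.
  rewrite -[size nbs](size_iota 0); apply: uniq_leq_size => // z /(nthP 0)[i i_s <-]; rewrite mem_iota /=.
  have [->|i0] := posnP i; first by rewrite nth0 h.
  have i0s : 0 < i < size (order t) by rewrite i0.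
  by have [_ b _] := st i i0s; exact: nb_in b.
have ok k : dfs_ok (order (iter k dfs_step [:: (r, 0)])) (parents (iter k dfs_step [:: (r, 0)])).
  have h j : iter j dfs_step [:: (r, 0)] != [::] by elim: j => //= j; exact: dfs_step_nil.
  elim: k => [|k IH]; last exact: (dfs_step_ok (h k) IH).
  by split=> // -[|k] //= /andP[].
have grow k : full (iter k dfs_step [:: (r, 0)]) \/ size (iter k dfs_step [:: (r, 0)]) = k.+1.
  elim: k => [|k [IH|IH]]; [by right | by left; rewrite iterS (stay _ IH) |].
  have [f|nf] := boolP (full (iter k dfs_step [:: (r, 0)])); first by left; rewrite iterS (stay _ f).
  by right; rewrite iterS step_size // IH.
rewrite /dfs; case: (grow (size nbs)) => [f|e]; last by have := bound _ (ok (size nbs)); rewrite e ltnn.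
move: f; set t := iter _ _ _ => /nilP f; rewrite !mem_rev => xt yx.
apply/negPn/negP => ny; have xi : index x (unzip1 t) < size t by rewrite -(size_map fst) index_mem.
have : index x (unzip1 t) \in [seq j <- iota 0 (size t) | ~~ nilp (fresh (unzip1 t) (nth 0 (unzip1 t) j))].
  rewrite mem_filter mem_iota xi nth_index // andbT.
  have : y \in fresh (unzip1 t) x by rewrite mem_filter ny.
  by case: (fresh _ _).
by rewrite f.
Qed.

Lemma dfs_in x : x \in order (dfs r) -> x < size nbs.
Proof.
have [[u h sp] st] := dfs_ok_dfs; move=> /(nthP 0)[i i_s <-]; have [->|i0] := posnP i; first by rewrite nth0 h.
have i0s : 0 < i < size (order (dfs r)) by rewrite i0.
by have [_ b _] := st i i0s; exact: nb_in b.
Qed.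

End Search.

(* The search runs in the graph obtained by subdividing every edge: node 0 is a virtual root, v + 1 stands for the
   vertex v and n + 1 + k for the k-th edge. Every back edge then starts at the leaf that subdivides it. *)
Definition simple_pairs n (us : seq (nat * nat)) := all (fun e => (e.1 < e.2) && (e.2 < n)) us.

Section Subdivided.
Variables (n : nat) (us : seq (nat * nat)).
Let m := size us.
Let edge k := nth (0, 0) us k.
Hypothesis us_lt : simple_pairs n us.

Definition sub_nbs : seq (seq nat) :=
  iota 1 n :: [seq [seq n.+1 + k | k <- iota 0 m & ((edge k).1 == v) || ((edge k).2 == v)] | v <- iota 0 n]
  ++ [seq [:: e.1.+1; e.2.+1] | e <- us].
Definition tree := dfs sub_nbs 0.
Definition ord := order tree.
Definition par k := nth 0 (parents tree) k.
Definition id_of x := index x ord.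
Definition tail_id k := id_of (edge k).1.+1.
Definition head_id k := id_of (edge k).2.+1.
Definition edge_id k := id_of (n.+1 + k).
Definition backs := [seq edge_id k | k <- iota 0 m & maxn (tail_id k) (head_id k) < edge_id k].
(** The ends of a back edge are the parent of its leaf and a proper ancestor of that parent; the
    latter has the smaller number. *)
Definition tgt b := let k := nth 0 ord b - n.+1 in minn (tail_id k) (head_id k).
Definition is_edge i := n < nth 0 ord i.

Let size_nbs : size sub_nbs = (n + m).+1.
Proof. by rewrite /= size_cat !size_map size_iota. Qed.

Lemma edge_lt k : k < m -> (edge k).1 < (edge k).2 < n.
Proof. by move=> km; exact: (allP us_lt _ (mem_nth _ km)). Qed.

Lemma nb_root : nb sub_nbs 0 = iota 1 n. Proof. by []. Qed.

Lemma nb_vertex v : v < n ->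
  nb sub_nbs v.+1 = [seq n.+1 + k | k <- iota 0 m & ((edge k).1 == v) || ((edge k).2 == v)].
Proof.
by move=> vn; rewrite /nb /= nth_cat size_map size_iota vn (nth_map 0) ?size_iota // nth_iota.
Qed.

Lemma nb_edge k : k < m -> nb sub_nbs (n.+1 + k) = [:: (edge k).1.+1; (edge k).2.+1].
Proof.
move=> km; rewrite /nb /= nth_cat size_map size_iota ltnNge leq_addr /= addKn.
by rewrite (nth_map (0, 0)).
Qed.

Lemma nodeP x : x < size sub_nbs -> [\/ x = 0, exists2 v, v < n & x = v.+1 | exists2 k, k < m & x = n.+1 + k].
Proof.
rewrite size_nbs; case: x => [|x]; first by constructor 1.
rewrite ltnS => xs; case: (ltnP x n) => xn; [constructor 2; by exists x | constructor 3; exists (x - n); lia].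
Qed.

Let nb_in x y : y \in nb sub_nbs x -> y < size sub_nbs.
Proof.
case: (ltnP x (size sub_nbs)) => [/nodeP[->|[v vn ->]|[k km ->]]|xs]; last by rewrite /nb nth_default.
- by rewrite nb_root mem_iota size_nbs; lia.
- by rewrite nb_vertex // => /mapP[k]; rewrite mem_filter mem_iota size_nbs => /and3P[_ _ km] ->; move: km; lia.
- by rewrite nb_edge // size_nbs !inE; have := edge_lt km; case/andP=> a b /orP[]/eqP ->; lia.
Qed.

Let r_in : 0 < size sub_nbs. Proof. by []. Qed.
Let T := n + m.

Lemma ord_ok : dfs_ok sub_nbs 0 ord (parents tree).
Proof. exact: dfs_ok_dfs. Qed.

Lemma ord_mem x : (x \in ord) = (x < T.+1).
Proof.
apply/idP/idP => [/(dfs_in r_in nb_in)|]; first by rewrite size_nbs.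
have cl := @dfs_closed sub_nbs 0 r_in nb_in; rewrite -size_nbs.
have o0 : 0 \in ord := dfs_root r_in.
have ov v : v < n -> v.+1 \in ord by move=> vn; apply: (cl 0) => //; rewrite nb_root mem_iota; lia.
case/nodeP => [->//|[v vn ->]|[k km ->]]; first exact: ov.
have /andP[a b] := edge_lt km; apply: (cl (edge k).2.+1); first exact: ov.
by rewrite nb_vertex // map_f // mem_filter eqxx orbT mem_iota.
Qed.

Lemma ord_uniq : uniq ord. Proof. by case: ord_ok => -[]. Qed.
Lemma ord_size : size ord = T.+1.
Proof.
rewrite -(size_iota 0 T.+1); apply/perm_size/uniq_perm; rewrite ?iota_uniq ?ord_uniq // => x.
by rewrite ord_mem mem_iota.
Qed.
Lemma ord0 : nth 0 ord 0 = 0. Proof. by case: ord_ok => -[_ h _] _; rewrite nth0. Qed.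
Lemma nth_id x : x <= T -> nth 0 ord (id_of x) = x.
Proof. by move=> xT; rewrite nth_index // ord_mem ltnS. Qed.
Lemma id_nth i : i <= T -> id_of (nth 0 ord i) = i.
Proof. by move=> iT; rewrite /id_of index_uniq ?ord_uniq // ord_size ltnS. Qed.
Lemma id_le x : x <= T -> id_of x <= T.
Proof. by move=> xT; rewrite -ltnS -ord_size index_mem ord_mem ltnS. Qed.
Lemma id_gt0 x : 0 < x <= T -> 0 < id_of x.
Proof. by move=> /andP[x0 xT]; rewrite lt0n; apply: contraTneq x0 => e; rewrite -(nth_id xT) e ord0. Qed.
Lemma par_lt k : 0 < k -> par k < k.
Proof.
move=> k0; case: (ltnP k (size ord)) => ks; last by rewrite /par nth_default //; case: ord_ok => -[_ _ ->].
by have [_ /(_ k)] := ord_ok; rewrite k0 ks => /(_ isT)[].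
Qed.
Lemma par0 : par 0 = 0. Proof. exact: dfs_par0. Qed.
Lemma par_nb k : 0 < k <= T -> nth 0 ord k \in nb sub_nbs (nth 0 ord (par k)).
Proof. by move=> kT; have [_ /(_ k)] := ord_ok; rewrite ord_size ltnS kT => /(_ isT)[]. Qed.
Lemma par_done k x : 0 < k <= T -> par k < x < k -> {subset nb sub_nbs (nth 0 ord x) <= take k ord}.
Proof. by move=> kT xk; have [_ /(_ k)] := ord_ok; rewrite ord_size ltnS kT => /(_ isT)[_ _]; apply. Qed.

Lemma tail_in k : k < m -> 0 < (edge k).1.+1 <= T. Proof. by move=> km; have /andP[a b] := edge_lt km; rewrite /T; lia. Qed.
Lemma head_in k : k < m -> 0 < (edge k).2.+1 <= T. Proof. by move=> km; have /andP[a b] := edge_lt km; rewrite /T; lia. Qed.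
Lemma edge_in k : k < m -> 0 < n.+1 + k <= T. Proof. by rewrite /T; lia. Qed.

Lemma mem_nb_edge k y : k < m -> y \in nb sub_nbs (n.+1 + k) -> y = (edge k).1.+1 \/ y = (edge k).2.+1.
Proof. by move=> km; rewrite nb_edge // !inE => /orP[] /eqP; [left|right]. Qed.

Lemma par_par k : 0 < k <= T -> 0 < par k -> is_edge k = ~~ is_edge (par k).
Proof.
move=> kT p0; have pT : par k <= T by have := par_lt (k := k); lia.
have := par_nb kT; rewrite /is_edge.
have : nth 0 ord (par k) < size sub_nbs by rewrite size_nbs ltnS -ltnS -ord_mem mem_nth // ord_size ltnS.
case/nodeP => [e|[v vn ->]|[j jm ->]].
- by have := id_nth pT; rewrite e => h; move: p0; rewrite -h -ord0 id_nth.
- by rewrite nb_vertex // => /mapP[j _ ->]; lia.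
- by have /andP[a b] := edge_lt jm; move/(mem_nb_edge jm) => [] ->; lia.
Qed.

Lemma root_kid k : 0 < k <= T -> par k = 0 -> is_edge k = false.
Proof. by move=> kT p0; have := par_nb kT; rewrite p0 ord0 nb_root mem_iota /is_edge; lia. Qed.

Lemma tail_vertex k : k < m -> is_edge (tail_id k) = false.
Proof. by move=> km; have /andP[a b] := edge_lt km; rewrite /is_edge nth_id; move: (tail_in km); lia. Qed.
Lemma head_vertex k : k < m -> is_edge (head_id k) = false.
Proof. by move=> km; have /andP[a b] := edge_lt km; rewrite /is_edge nth_id; move: (head_in km); lia. Qed.
Lemma edge_is_edge k : k < m -> is_edge (edge_id k).
Proof. by move=> km; rewrite /is_edge nth_id; move: (edge_in km); lia. Qed.

Lemma is_edgeP i : i <= T -> is_edge i -> exists2 k, k < m & i = edge_id k.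
Proof.
move=> iT ie; exists (nth 0 ord i - n.+1); last by rewrite /edge_id subnKC // id_nth.
have : nth 0 ord i \in ord by rewrite mem_nth // ord_size.
by rewrite ord_mem; move: ie; rewrite /is_edge /T; lia.
Qed.

Lemma edge_id_inj k k' : k < m -> k' < m -> edge_id k = edge_id k' -> k = k'.
Proof.
move=> /edge_in/andP[_ km] /edge_in/andP[_ k'm] e; have := nth_id km; rewrite -/(edge_id k) e nth_id //; lia.
Qed.

Lemma par_edge k : k < m -> par (edge_id k) = tail_id k \/ par (edge_id k) = head_id k.
Proof.
move=> km; have /andP[e0 eT] := edge_in km; have i0 := id_gt0 (edge_in km).
have iT := id_le eT; have kT : 0 < edge_id k <= T by rewrite i0.
have p0 : 0 < par (edge_id k) by rewrite lt0n; apply: contraTneq (edge_is_edge km) => /(root_kid kT) ->.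
have pT : par (edge_id k) <= T := leq_trans (ltnW (par_lt i0)) iT.
have := par_par kT p0; rewrite edge_is_edge // => /esym/negbTE nE.
have := par_nb kT; rewrite nth_id //.
have : nth 0 ord (par (edge_id k)) < size sub_nbs by rewrite size_nbs ltnS -ltnS -ord_mem mem_nth // ord_size ltnS.
case/nodeP => [e|[v vn ev]|[j jm ej]]; last by move: nE; rewrite /is_edge ej; lia.
  by have := id_nth pT; rewrite e => h; move: p0; rewrite -h -ord0 id_nth.
rewrite ev nb_vertex // => /mapP[j]; rewrite mem_filter => /andP[h _] /addnI kj; rewrite -kj in h.
by rewrite -(id_nth pT) ev /tail_id /head_id; case/orP: h => /eqP ->; [left|right].
Qed.

Definition other k := if par (edge_id k) == tail_id k then head_id k else tail_id k.

Lemma ends_swap k : k < m -> (par (edge_id k) = tail_id k /\ other k = head_id k) \/ (par (edge_id k) = head_id k /\ other k = tail_id k).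
Proof.
move=> km; rewrite /other; case: eqP => [->|ne]; first by left.
by right; split=> //; case: (par_edge km).
Qed.

Lemma tail_neq_head k : k < m -> tail_id k <> head_id k.
Proof.
move=> km e; have /andP[_ a] := tail_in km; have /andP[_ b] := head_in km; have := nth_id a.
by rewrite -/(tail_id k) e nth_id //; have /andP[] := edge_lt km; lia.
Qed.

Lemma other_neq k : k < m -> other k <> par (edge_id k).
Proof. by move=> km; have := tail_neq_head km; case: (ends_swap km) => -[-> ->] // h e; apply: h. Qed.

Lemma other_in k : k < m -> 0 < other k <= T /\ is_edge (other k) = false.
Proof.
move=> km; have a := tail_in km; have b := head_in km; have /andP[_ a2] := a; have /andP[_ b2] := b.
by case: (ends_swap km) => -[_ ->]; rewrite ?tail_vertex ?head_vertex // ?id_gt0 ?id_le.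
Qed.

Lemma par_edge_gt0 k : k < m -> 0 < par (edge_id k).
Proof.
move=> km; have a := tail_in km; have b := head_in km; have /andP[_ a2] := a; have /andP[_ b2] := b.
by case: (ends_swap km) => -[-> _]; rewrite id_gt0.
Qed.

Lemma other_nb k : k < m -> nth 0 ord (other k) \in nb sub_nbs (n.+1 + k) /\ n.+1 + k \in nb sub_nbs (nth 0 ord (other k)).
Proof.
move=> km; have /andP[_ a2] := tail_in km; have /andP[_ b2] := head_in km; have /andP[a b] := edge_lt km.
have h v : v < n -> ((edge k).1 == v) || ((edge k).2 == v) -> n.+1 + k \in nb sub_nbs v.+1.
  by move=> vn hv; rewrite nb_vertex // map_f // mem_filter hv mem_iota.
case: (ends_swap km) => -[_ ->]; rewrite nth_id // nb_edge // !inE eqxx ?orbT; split=> //; apply: h; rewrite ?eqxx ?orbT //.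
exact: ltn_trans b.
Qed.

(* A visited node that is not an ancestor of a later one has no unvisited neighbour left. *)
Lemma finished x y : x < y -> y <= T -> ~~ anc par x y -> {subset nb sub_nbs (nth 0 ord x) <= take y ord}.
Proof.
elim/ltn_ind: y => y IH xy yT nxy; have y0 : 0 < y by case: (y) xy.
have py := par_lt y0; case: (ltngtP x (par y)) => [xp|px|e].
- have np : ~~ anc par x (par y) by apply: contra nxy => h; rewrite ancE // ?h ?orbT //; exact: par_lt.
  move=> z /(IH _ py xp (leq_trans (ltnW py) yT) np); move=> h.
  by have : z \in take (par y + (y - par y)) ord; [rewrite takeD mem_cat h | rewrite subnKC // ltnW].
- by apply: par_done; rewrite ?y0 ?px.
- by rewrite e ancE ?anc_refl ?orbT // in nxy; exact: par_lt.
Qed.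

Lemma take_ord x y : x <= T -> y <= T -> (nth 0 ord x \in take y ord) = (x < y).
Proof.
move=> xT yT; apply/idP/idP => [|xy].
  case/(nthP 0) => i; rewrite size_take ord_size ltnS yT => iy; rewrite nth_take // => e.
  by rewrite -(id_nth xT) -e id_nth // (leq_trans (ltnW iy)).
by rewrite -(nth_take 0 xy) mem_nth // size_take ord_size ltnS yT.
Qed.

(** If the other end of the edge was visited before the subdividing node, it is an ancestor, as
    [finished] would otherwise have the node visited too early. If not, it is the only unvisited
    neighbour of this node and comes next. *)
Lemma other_cases k : k < m ->
  (other k < par (edge_id k) /\ anc par (other k) (edge_id k)) \/ (other k = (edge_id k).+1 /\ par (other k) = edge_id k).
Proof.
move=> km; have [/andP[o0 oT] oE] := other_in km; have /andP[e0 eT] := edge_in km; have i0 := id_gt0 (edge_in km).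
have iT : edge_id k <= T := id_le eT; have [nb1 nb2] := other_nb km.
have ne : other k <> edge_id k by move=> e; move: oE; rewrite e edge_is_edge.
case: (ltngtP (other k) (edge_id k)) => [lt|gt|//]; [left | right].
  have an : anc par (other k) (edge_id k).
    apply/negPn/negP => /(finished lt iT)/(_ _ nb2); rewrite -{1}(nth_id eT) take_ord // -/(edge_id k) ltnn //.
  split=> //; have : anc par (other k) (par (edge_id k)) by rewrite anc_par // ?an ?(introN eqP ne) //; exact: par_lt.
  by move/(anc_leq par_lt); rewrite leq_eqVlt => /orP[/eqP/(other_neq km)|].
have kT : 0 < (edge_id k).+1 <= T by apply: leq_trans gt oT.
have pe : par (edge_id k).+1 = edge_id k.
  have := par_lt (ltn0Sn (edge_id k)); rewrite ltnS leq_eqVlt => /orP[/eqP //|lt].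
  have := par_done kT (x := edge_id k); rewrite lt ltnSn => /(_ isT); rewrite nth_id // => /(_ _ nb1).
  by rewrite take_ord // ltnS leqNgt gt.
have := par_nb kT; rewrite pe nth_id // => /(mem_nb_edge km) h.
have kT2 : (edge_id k).+1 <= T by case/andP: kT.
suff e : other k = (edge_id k).+1 by rewrite e pe.
have h' : (edge_id k).+1 = tail_id k \/ (edge_id k).+1 = head_id k.
  by case: h => h; [left|right]; rewrite -(id_nth kT2) h.
by have := par_lt i0; case: (ends_swap km) => -[-> ->]; case: h' => <- //; rewrite ltnNge leqnSn.
Qed.

End Subdivided.
End Dfs.

(** * Solving the left-right constraints, and the cycle space *)

Module Lr.
From mathcomp Require Import all_boot zify.
Import Kampen Palm Wgmv Dfs.

Section Colour.
Variables (par : nat -> nat) (T : nat) (B : seq nat) (tgt : nat -> nat).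
Local Notation ret := (Palm.ret par B tgt).
Local Notation anc := (Palm.anc par).

Definition same_con b1 b2 :=
  has (fun c => has (fun c' => [&& par c == par c', c != c', ret c b1, ret c b2 &
    has (fun b0 => [&& ret c' b0, tgt b0 < tgt b1 & tgt b0 < tgt b2]) B]) (iota 1 T)) (iota 1 T).
Definition differ_con b b' :=
  has (fun c => has (fun c' => [&& par c == par c', c != c', ret c b, ret c' b',
    has (fun b0 => ret c b0 && (tgt b0 < tgt b')) B & has (fun b0' => ret c' b0' && (tgt b0' < tgt b)) B])
    (iota 1 T)) (iota 1 T).
Definition align_con b1 b2 :=
  has (fun u => [&& anc u b1, anc u b2, tgt b1 == tgt b2, tgt b1 < u &
    all (fun b => anc u b ==> (tgt b1 <= tgt b)) B]) (iota 0 T.+1).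

(* The nodes 2b and 2b + 1 of the constraint graph stand for the two colours of b. *)
Definition con_edges b1 b2 :=
  (if same_con b1 b2 || align_con b1 b2 then [:: (b1.*2, b2.*2); (b1.*2.+1, b2.*2.+1)] else [::]) ++
  (if differ_con b1 b2 then [:: (b1.*2, b2.*2.+1); (b1.*2.+1, b2.*2)] else [::]).
Definition constraints := flatten [seq flatten [seq con_edges b1 b2 | b2 <- B] | b1 <- B].
Definition labels := merge T.+1.*2 constraints.
(** The two copies of [b] carry different labels, and each constraint merges both pairs of copies
    alike; so comparing the labels of the copies is a consistent choice of sides. *)
Definition colour b := nth 0 labels b.*2 < nth 0 labels b.*2.+1.

Hypothesis par_lt : forall k, 0 < k -> par k < k.
Hypothesis B_in : forall b, b \in B -> b <= T.
Hypothesis solvable : exists lam, [/\ same_rule par B tgt lam, differ_rule par B tgt lam & align_rule par B tgt lam].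

Lemma mem_constraints e b1 b2 : b1 \in B -> b2 \in B -> e \in con_edges b1 b2 -> e \in constraints.
Proof.
by move=> h1 h2 he; apply/flattenP; exists (flatten [seq con_edges b1 b | b <- B]); [exact: (map_f (fun b => _)) | apply/flattenP; exists (con_edges b1 b2); [exact: map_f|]].
Qed.

Lemma constraintsP e : e \in constraints -> exists b1 b2, [/\ b1 \in B, b2 \in B & e \in con_edges b1 b2].
Proof. by case/flattenP => s /mapP[b1 h1 ->] /flattenP[s' /mapP[b2 h2 ->]]; exists b1, b2. Qed.

Lemma constraints_in : inrange T.+1.*2 constraints.
Proof.
apply/allP => e /constraintsP[b1 [b2 [/B_in h1 /B_in h2]]].
by rewrite mem_cat => /orP[]; case: ifP => // _; rewrite !inE => /orP[] /eqP -> /=; lia.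
Qed.

Lemma ret_le c b : ret c b -> 0 < c <= T.
Proof. by case/and4P => bB /(anc_leq par_lt) cb -> _; exact: leq_trans cb (B_in bB). Qed.

(** A solution [mu] yields a set [S] of coloured nodes that respects every merge and contains
    exactly one of the two copies of [b]. *)
Lemma labels_differ b : b \in B -> nth 0 labels b.*2 != nth 0 labels b.*2.+1.
Proof.
move=> bB; have [mu [sr dr ar]] := solvable; apply/eqP => e.
pose S x := mu x./2 (+) odd x.
have S2 x : S x.*2 = mu x by rewrite /S doubleK odd_double addbF.
have S21 x : S x.*2.+1 = ~~ mu x by rewrite /S /= uphalf_double odd_double addbT.
have cl : closed constraints S.
  apply/allP => f /constraintsP[b1 [b2 [h1 h2]]]; rewrite mem_cat /cut => /orP[].
    case: ifP => // c; have eq12 : mu b1 = mu b2.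
      case/orP: c.
        case/hasP => c _ /hasP[c' _ /and5P[/eqP pc /eqP nc r1 r2 /hasP[b0 _ /and3P[r0 t1 t2]]]].
        exact: (sr c c' b1 b2 b0).
      case/hasP => u _ /and5P[a1 a2 /eqP t12 tu /allP all]; apply: (ar u) => // b' b'B ab'.
      by have := all b' b'B; rewrite ab'.
    by rewrite !inE => /orP[] /eqP -> /=; rewrite ?S2 ?S21 eq12 eqxx.
  case: ifP => // /hasP[c _ /hasP[c' _ /and5P[/eqP pc /eqP nc r1 r2 /andP[/hasP[b0 _ /andP[r0 t0]] /hasP[b0' _ /andP[r0' t0']]]]]].
  have eq12 := dr c c' b1 b2 b0 b0' pc nc r1 r2 r0 r0' t0' t0.
  by rewrite !inE => /orP[] /eqP -> /=; rewrite ?S2 ?S21 eq12 ?negbK eqxx.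
have bT := B_in bB; have := merge_closed constraints_in cl _ _ e; rewrite S2 S21; case: (mu b) => h; have := h _ _; lia.
Qed.

Lemma colour_same b1 b2 : b1 \in B -> b2 \in B -> same_con b1 b2 || align_con b1 b2 -> colour b1 = colour b2.
Proof.
move=> h1 h2 c; have e f : f \in con_edges b1 b2 -> nth 0 labels f.1 = nth 0 labels f.2.
  by move=> fc; apply: merge_edge constraints_in (mem_constraints h1 h2 fc).
have := e (b1.*2, b2.*2); have := e (b1.*2.+1, b2.*2.+1).
by rewrite /con_edges c !mem_cat !inE !eqxx orbT /colour => /(_ isT) /= -> /(_ isT) /= ->.
Qed.

Lemma colour_differ b1 b2 : b1 \in B -> b2 \in B -> differ_con b1 b2 -> colour b1 = ~~ colour b2.
Proof.
move=> h1 h2 c; have e f : f \in con_edges b1 b2 -> nth 0 labels f.1 = nth 0 labels f.2.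
  by move=> fc; apply: merge_edge constraints_in (mem_constraints h1 h2 fc).
have := e (b1.*2, b2.*2.+1); have := e (b1.*2.+1, b2.*2).
rewrite /con_edges c !mem_cat !inE !eqxx !orbT /colour => /(_ isT) /= -> /(_ isT) /= ->.
by have := labels_differ h2; case: ltngtP.
Qed.

Lemma colour_rules : [/\ same_rule par B tgt colour, differ_rule par B tgt colour & align_rule par B tgt colour].
Proof.
have I c b : ret c b -> c \in iota 1 T by move/ret_le; rewrite mem_iota; lia.
have inB c b : ret c b -> b \in B by case/and4P.
split.
- move=> c c' b1 b2 b0 pc nc r1 r2 r0 t1 t2; apply: (colour_same (inB _ _ r1) (inB _ _ r2)); apply/orP; left.
  apply/hasP; exists c; [exact: I r1 | apply/hasP; exists c'; [exact: I r0 |]].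
  by rewrite pc r1 r2 eqxx (introN eqP nc) /=; apply/hasP; exists b0; [exact: inB r0 | rewrite r0 t1].
- move=> c c' b b' b0 b0' pc nc r1 r2 r0 r0' t1 t2; apply: (colour_differ (inB _ _ r1) (inB _ _ r2)).
  apply/hasP; exists c; [exact: I r1 | apply/hasP; exists c'; [exact: I r2 |]].
  rewrite pc r1 r2 eqxx (introN eqP nc) /=; apply/andP; split; apply/hasP.
    by exists b0; [exact: inB r0 | rewrite r0].
  by exists b0'; [exact: inB r0' | rewrite r0'].
- move=> u b1 b2 h1 h2 a1 a2 t12 tu all; apply: (colour_same h1 h2); apply/orP; right.
  apply/hasP; exists u; first by rewrite mem_iota /= ltnS; apply: leq_trans (anc_leq par_lt a1) (B_in h1).
  rewrite a1 a2 t12 eqxx -t12 tu /=; apply/allP => b bB; apply/implyP; exact: all.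
Qed.

End Colour.

Section Embed.
Variables (n : nat) (us : seq (nat * nat)).
Let m := size us.
Let T := n + m.
Let edge k := nth (0, 0) us k.
Hypothesis us_lt : simple_pairs n us.
Local Notation ord := (ord n us).
Local Notation par := (par n us).
Local Notation edge_id := (edge_id n us).
Local Notation other := (other n us).
Local Notation tail_id := (tail_id n us).
Local Notation head_id := (head_id n us).
Local Notation backs := (backs n us).
Local Notation tgt := (tgt n us).
Local Notation is_edge := (is_edge n us).
Local Notation anc := (Palm.anc par).
Local Notation sub_nbs := (sub_nbs n us).

Let plt := @par_lt n us.

Lemma edge_id_in k : k < m -> 0 < edge_id k <= T.
Proof. by move=> km; have e := edge_in us_lt km; rewrite id_gt0 // id_le //; case/andP: e. Qed.

Lemma backP b : b \in backs -> exists k, [/\ k < m, b = edge_id k, tgt b = other k, other k < par b & anc (other k) b].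
Proof.
case/mapP => k; rewrite mem_filter mem_iota => /andP[lt /andP[_ km]] ->; exists k; rewrite add0n in km.
have ol : other k < edge_id k by case: (ends_swap us_lt km) => -[_ ->]; move: lt; lia.
case: (other_cases us_lt km) => [[op oa]|[e _]]; last by rewrite e ltnNge leqnSn in ol.
split=> //; rewrite /Dfs.tgt nth_id //; last by case/andP: (edge_in us_lt km).
by rewrite addKn; case: (ends_swap us_lt km) op => -[-> ->]; lia.
Qed.

Lemma back_edge k : k < m -> (edge_id k \in backs) = (other k < edge_id k).
Proof.
move=> km; apply/idP/idP => [/backP[k' [k'm e _ lt _]]|lt].
  have kk := edge_id_inj us_lt km k'm e; rewrite -kk in lt; apply: ltn_trans lt _; apply: plt.
  by case/andP: (edge_id_in km).
apply/mapP; exists k => //; rewrite mem_filter mem_iota km andbT.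
have pl : par (edge_id k) < edge_id k by apply: plt; case/andP: (edge_id_in km).
by case: (ends_swap us_lt km) => -[a b]; rewrite a b in lt pl; rewrite gtn_max; lia.
Qed.

Lemma tree_edge k : k < m -> edge_id k \notin backs -> other k = (edge_id k).+1 /\ par (other k) = edge_id k.
Proof.
move=> km; rewrite back_edge // => nl; case: (other_cases us_lt km) => // -[op _]; case/negP: nl.
by apply: ltn_trans op _; apply: plt; case/andP: (edge_id_in km).
Qed.

Lemma kid_edge c k : k < m -> 0 < c <= T -> par c = edge_id k -> c = other k.
Proof.
move=> km cT pc; have /andP[c0 cl] := cT; have eT := andP (edge_in us_lt km).
have := par_nb us_lt cT; rewrite pc nth_id //; last by case: eT.
move=> /(mem_nb_edge km) h.
have h' : c = tail_id k \/ c = head_id k by case: h => h; [left|right]; rewrite -(id_nth us_lt cl) h.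
have pl : par (edge_id k) < edge_id k by apply: plt; case/andP: (edge_id_in km).
have cp : edge_id k < c by rewrite -pc; exact: plt.
by case: (ends_swap us_lt km) => -[a b]; rewrite a b in pl *; case: h' => h'; move: pl cp; rewrite h' //; lia.
Qed.

Lemma back_leaf b k : b \in backs -> 0 < k -> par k <> b.
Proof.
move=> bB k0 pk; have [j [jm e _ lt _]] := backP bB; have kT : 0 < k <= T.
  (* Outside the range of the search [par] returns the default 0, which is not the number of an edge
     node. *)
  rewrite k0 leqNgt; apply/negP => kT; have : par k = 0.
    by rewrite /Dfs.par nth_default //; have [[_ _ ->] _] := ord_ok n us; rewrite ord_size.
  by rewrite pk e => z; have := edge_id_in jm; rewrite z.
have := kid_edge jm kT; rewrite -e => /(_ pk) ko; have := plt k0; rewrite pk ko => bo.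
have bp : par b < b by apply: plt; rewrite e; case/andP: (edge_id_in jm).
lia.
Qed.

Lemma back_tgt b : b \in backs -> [/\ 0 < tgt b, tgt b < par b & anc (tgt b) b].
Proof. by move=> /backP[k [km e -> lt an]]; split=> //; have [/andP[]] := other_in us_lt km. Qed.

Lemma back_in b : b \in backs -> 0 < b <= T.
Proof. by move=> /backP[k [km -> _ _ _]]; exact: edge_id_in. Qed.

Lemma backs_uniq : uniq backs.
Proof.
rewrite map_inj_in_uniq ?filter_uniq ?iota_uniq // => k k'; rewrite !mem_filter !mem_iota => /andP[_ km] /andP[_ k'm].
by apply: edge_id_inj.
Qed.

(** Incidence read off from the lists of the vertices. The virtual root has no point in the drawing,
    and its list is left out. *)
Definition node_adj x y := ((0 < x <= n) && (y \in nb sub_nbs x)) || ((0 < y <= n) && (x \in nb sub_nbs y)).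
Variables (lt : rel nat) (w : nat -> nat -> nat -> bool).
Hypothesis vk : van_kampen (fun x => 0 < x <= T) node_adj lt w.

Lemma vertex_node i : 0 < i <= T -> is_edge i = false -> 0 < nth 0 ord i <= n.
Proof.
move=> /andP[i0 iT]; rewrite /Dfs.is_edge => /negbT; rewrite -leqNgt => ->; rewrite andbT lt0n.
by apply: contraTneq i0 => e; rewrite -(id_nth us_lt iT) e -(ord0 n us) id_nth.
Qed.

(** The winding numbers refer to nodes and [lr_sides_exist] to discovery numbers; [ord] translates
    between the two. *)
Lemma sides_exist : exists lam, [/\ same_rule par backs tgt lam, differ_rule par backs tgt lam & align_rule par backs tgt lam].
Proof.
pose dom i := 0 < i <= T.
have ordT i : dom i -> 0 < nth 0 ord i <= T.
  move=> /andP[i0 iT]; have : nth 0 ord i \in ord by rewrite mem_nth // ord_size.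
  rewrite ord_mem // ltnS => ->; rewrite andbT lt0n; apply: contraTneq i0 => e.
  by rewrite -(id_nth us_lt iT) e -(ord0 n us) id_nth.
have par_out k : T < k -> par k = 0.
  by move=> kT; rewrite /Dfs.par nth_default //; have [[_ _ ->] _] := ord_ok n us; rewrite ord_size.
have inT k : 0 < par k -> 0 < k <= T.
  move=> p0; case: (leqP k T) => [kT|/par_out e]; last by rewrite e in p0.
  by rewrite andbT lt0n; apply: contraTneq p0 => ->; rewrite par0.
have parT k : 0 < k <= T -> 0 < par k -> 0 < par k <= T.
  by move=> /andP[k0 kT] ->; have := plt k0; lia.
have adjC x y : node_adj x y = node_adj y x by rewrite /node_adj orbC.
have inj i j : dom i -> dom j -> nth 0 ord i = nth 0 ord j -> i = j.
  by move=> /andP[_ iT] /andP[_ jT] e; rewrite -(id_nth us_lt iT) e id_nth.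
have vn i j : dom i -> dom j -> is_edge i = false -> nth 0 ord j \in nb sub_nbs (nth 0 ord i) -> node_adj (nth 0 ord j) (nth 0 ord i).
  by move=> di dj ei h; rewrite /node_adj (vertex_node di ei) h orbT.
have adj_nb i j : dom i -> dom j -> is_edge j = ~~ is_edge i -> nth 0 ord j \in nb sub_nbs (nth 0 ord i) -> node_adj (nth 0 ord j) (nth 0 ord i).
  move=> di dj e h; case ei : (is_edge i); last exact: vn.
  have /andP[_ iT] := di; have [k km ik] := is_edgeP us_lt iT ei.
  have ej : is_edge j = false by rewrite e ei.
  rewrite adjC; apply: vn => //; move: h; rewrite ik (nth_id us_lt); last by case/andP: (edge_in us_lt km).
  move=> h; have /andP[a b] := edge_lt us_lt km.
  by case: (mem_nb_edge km h) => ->; rewrite (nb_vertex us) ?(ltn_trans a b) //; apply/mapP; exists k; rewrite ?mem_filter ?eqxx ?orbT //= mem_iota.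
have pE k : 0 < par k -> is_edge k = ~~ is_edge (par k) by move=> p0; apply: (par_par us_lt) => //; exact: inT.
have dtgt b : b \in backs -> dom (tgt b).
  by move=> bB; have [t0 tp _] := back_tgt bB; have /andP[b0 bT] := back_in bB; rewrite /dom t0; have := plt b0; lia.
apply: (@lr_sides_exist par plt backs tgt is_edge dom (fun i j => [&& dom i, dom j & node_adj (nth 0 ord i) (nth 0 ord j)])
  (fun i j => lt (nth 0 ord i) (nth 0 ord j)) (fun c a b => w (nth 0 ord c) (nth 0 ord a) (nth 0 ord b))).
- case: vk => v1 v2 v3; split.
  + by move=> x y dx dy xy; apply: v1; [exact: ordT | exact: ordT | move/(inj _ _ dx dy)].
  + by move=> c a b; exact: v2.
  + move=> a b c d /and3P[da db ab] /and3P[dc dd cd] ac ad bc bd.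
    by apply: v3 => //; [move/(inj _ _ da dc)|move/(inj _ _ da dd)|move/(inj _ _ db dc)|move/(inj _ _ db dd)].
- move=> k p0; have kT := inT k p0; have pT := parT _ kT p0; apply/and3P; split=> //.
  exact: (adj_nb _ _ pT kT (pE _ p0) (par_nb us_lt kT)).
- by move=> k l; rewrite andbCA adjC.
- move=> b bB; rewrite /dom back_in //= -/(dom _) dtgt //=; have [k [km e te _ _]] := backP bB.
  have [/andP[o0 oT] oE] := other_in us_lt km; rewrite te e.
  have de : dom (edge_id k) := edge_id_in km; have dO : dom (other k) by rewrite /dom o0.
  have eo : is_edge (edge_id k) = ~~ is_edge (other k) by rewrite oE edge_is_edge.
  by apply: (adj_nb _ _ dO de eo); have [_] := other_nb us_lt km; rewrite (nth_id us_lt) //; case/andP: (edge_in us_lt km).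
- exact: pE.
- exact: back_tgt.
- by move=> b /backP[k [km e -> _ _]]; case: (other_in us_lt km).
- move=> c c' c0 c'0 pc nc p0; apply/negbTE/negP => eE; have cT := inT c p0; rewrite pc in p0; have c'T := inT c' p0.
  have /andP[_ pT] := parT _ c'T p0; rewrite pc in eE; have [k km ke] := is_edgeP us_lt pT eE.
  by apply: nc; rewrite (kid_edge km cT) ?pc // (kid_edge km c'T).
- by move=> b x bB /(anc_leq plt) xb x0; have /andP[_ bT] := back_in bB; rewrite /dom x0; lia.
Qed.

Definition sides := colour par T backs tgt.

Lemma sides_rules : [/\ same_rule par backs tgt sides, differ_rule par backs tgt sides & align_rule par backs tgt sides].
Proof. by apply: colour_rules => // [b /back_in/andP[]|]; [| exact: sides_exist]. Qed.

End Embed.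

Lemma xor_sumD1 m k (P F : pred nat) : k < m ->
  \big[addb/false]_(i <- iota 0 m | P i) F i =
  (P k && F k) (+) \big[addb/false]_(i <- iota 0 m | P i && (i != k)) F i.
Proof.
move=> km; have kI : k \in iota 0 m by rewrite mem_iota.
rewrite big_mkcond (bigD1_seq k kI (iota_uniq _ _)) /=; congr (_ (+) _).
by rewrite -big_mkcondr; apply: eq_bigl => i; rewrite andbC.
Qed.

Section Cycles.
Variables (n : nat) (us : seq (nat * nat)).
Let m := size us.
Let T := n + m.
Let edge k := nth (0, 0) us k.
Hypothesis us_lt : simple_pairs n us.
Local Notation ord := (ord n us).
Local Notation par := (par n us).
Local Notation id_of := (id_of n us).
Local Notation edge_id := (edge_id n us).
Local Notation other := (other n us).
Local Notation backs := (backs n us).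
Local Notation tgt := (tgt n us).
Local Notation is_edge := (is_edge n us).
Local Notation anc := (Palm.anc par).
Let plt := @par_lt n us.

(** The edge [k] belongs to the fundamental cycle of [b], detected at its subdividing node, which
    the tree path from [b] to [tgt b] passes. *)
Definition on_cycle k b := anc (edge_id k) b && (tgt b < edge_id k).
Definition crosses (Q : pred nat) k := Q (edge k).1 (+) Q (edge k).2.
Definition even_set (Z : pred nat) := forall Q, \big[addb/false]_(k <- iota 0 m | Z k) crosses Q k = false.

Lemma crosses_id Q k : k < m ->
  let Q' i := Q (nth 0 ord i).-1 in crosses Q k = Q' (par (edge_id k)) (+) Q' (other k).
Proof.
move=> km; have a := tail_in us_lt km; have b := head_in us_lt km; rewrite /crosses.
by case: (ends_swap us_lt km) => -[-> ->]; rewrite /tail_id /head_id !nth_id; try (by case/andP: a); try (by case/andP: b); rewrite // addbC.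
Qed.

Lemma par_inner k : k < m -> 0 < edge_id k. Proof. by move=> km; case/andP: (edge_id_in us_lt km). Qed.

(** Both ends are vertices, so the tree path consists of whole edges and the sum telescopes. One
    induction step passes from [x] over the edge node [par x] to the next vertex [y]. *)
Lemma path_cross Q t x : 0 < t -> is_edge t = false -> is_edge x = false -> x <= T -> anc t x ->
  let Q' i := Q (nth 0 ord i).-1 in
  \big[addb/false]_(k <- iota 0 m | anc (edge_id k) x && (t < edge_id k)) crosses Q k = Q' x (+) Q' t.
Proof.
move=> t0 tE + + + Q'; elim/ltn_ind: x => x IH xE xT tx.
have [e|ne] := eqVneq t x.
  rewrite -e addbb big1_seq // => k /andP[/andP[/(anc_leq plt)]]; lia.
have x0 : 0 < x by have := anc_leq plt tx; lia.
have tp : anc t (par x) by rewrite (anc_par plt) // tx.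
have p0 : 0 < par x by have := anc_leq plt tp; lia.
have xT' : 0 < x <= T by rewrite x0.
have pE : is_edge (par x) by have := par_par us_lt xT' p0; rewrite xE; case: (is_edge _).
have pT : par x <= T by have := plt x0; lia.
have [k0 k0m pk] := is_edgeP us_lt pT pE; have xo := kid_edge us_lt k0m xT' pk.
set y := par (edge_id k0).
have yp := par_edge_gt0 us_lt k0m; rewrite -/y in yp; have ylt : y < edge_id k0 by apply: plt; exact: par_inner.
have yE : is_edge y = false.
  by have := par_par us_lt (edge_id_in us_lt k0m) yp; rewrite edge_is_edge // -/y; case: (is_edge y).
have te : t != edge_id k0 by apply: contraFneq tE => ->; exact: edge_is_edge.
have ty : anc t y by rewrite /y (anc_par plt) ?par_inner // te andbT -pk.
have px := plt x0; have yx : y < x by rewrite pk in px; lia.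
have yT : y <= T by lia.
have tle : t < edge_id k0.
  by have := anc_leq plt tp; rewrite pk leq_eqVlt (negbTE te).
have split_at k : k < m -> k != k0 -> anc (edge_id k) x = anc (edge_id k) y.
  move=> km nk; have n1 : edge_id k != x by apply: contraFneq xE => <-; exact: edge_is_edge.
  have n2 : edge_id k != edge_id k0 by apply: contraNneq nk => /(edge_id_inj us_lt km k0m) ->.
  by rewrite (ancE plt) // (negbTE n1) /= pk (ancE plt) ?par_inner // (negbTE n2).
have k0I : k0 \in iota 0 m by rewrite mem_iota.
have a0 : anc (edge_id k0) x by rewrite (ancE plt) // pk (anc_refl plt) orbT.
have ay : anc (edge_id k0) y = false by apply/negbTE/negP => /(anc_leq plt); rewrite leqNgt ylt.
rewrite (xor_sumD1 _ _ k0m) /= a0 tle /=.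
have := IH y yx yE yT ty.
rewrite [LHS](xor_sumD1 _ _ k0m) /= ay /= => IHy.
have -> : \big[addb/false]_(k <- iota 0 m | (anc (edge_id k) x && (t < edge_id k)) && (k != k0)) crosses Q k =
   \big[addb/false]_(k <- iota 0 m | (anc (edge_id k) y && (t < edge_id k)) && (k != k0)) crosses Q k.
  rewrite big_seq_cond [RHS]big_seq_cond; apply: eq_bigl => k; rewrite mem_iota add0n /=.
  by case km : (k < m) => //=; case nk : (k != k0); rewrite ?andbF // split_at.
move: IHy; rewrite crosses_id // -xo -/y /Q' => ->.
by case: (Q _); case: (Q _); case: (Q _).
Qed.

Lemma cycle_even b : b \in backs -> even_set (fun k => on_cycle k b).
Proof.
move=> bB Q; have [k0 [k0m e te lt an]] := backP us_lt bB; have bT := back_in us_lt bB.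
have b0 : 0 < b by case/andP: bT.
set y := par b; have yp : 0 < y by rewrite /y e; exact: par_edge_gt0.
have yb : y < b := plt b0.
have yE : is_edge y = false.
  by have := par_par us_lt bT yp; rewrite e edge_is_edge // -e -/y; case: (is_edge y).
have [/andP[t0 tT] tE] := other_in us_lt k0m.
have ty : anc (tgt b) y by rewrite /y (anc_par plt) // te an; apply/eqP => h; move: lt; rewrite h -/y; lia.
have yT : y <= T by case/andP: bT; lia.
rewrite te in ty; have := path_cross Q t0 tE yE yT ty; rewrite /= => P.
have k0I : k0 \in iota 0 m by rewrite mem_iota.
have tb : other k0 < b := ltn_trans lt yb.
have oc : on_cycle k0 b by rewrite /on_cycle -e (anc_refl plt) te tb.
rewrite (xor_sumD1 _ _ k0m) oc.
have <- : \big[addb/false]_(k <- iota 0 m | anc (edge_id k) y && (other k0 < edge_id k)) crosses Q k =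
   \big[addb/false]_(k <- iota 0 m | on_cycle k b && (k != k0)) crosses Q k.
  rewrite big_seq_cond [RHS]big_seq_cond; apply: eq_bigl => k; rewrite mem_iota add0n /on_cycle te.
  case km : (k < m) => //=; rewrite [anc _ b](ancE plt) // -/y e.
  have [->|nk] := eqVneq k k0.
    by rewrite andbF; apply/negbTE; rewrite negb_and; apply/orP; left; apply/negP => /(anc_leq plt); rewrite -e leqNgt yb.
  have n2 : edge_id k != edge_id k0 by apply: contraNneq nk => /(edge_id_inj us_lt km k0m) ->.
  by rewrite (negbTE n2) andbT.
by rewrite P crosses_id // -e -/y; case: (Q _); case: (Q _).
Qed.

(** Fundamental cycles form a basis of the cycle space. For a tree edge, test [Z] on the set [Q] of
    vertices below it: besides [k] itself, only the back edges whose cycles contain [k] leave this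
    set. For a back edge, no other fundamental cycle contains it. *)
Lemma even_cycles Z k : even_set Z -> k < m ->
  Z k = \big[addb/false]_(k' <- iota 0 m | edge_id k' \in backs) (Z k' && on_cycle k (edge_id k')).
Proof.
move=> ev km; have kI : k \in iota 0 m by rewrite mem_iota.
have ek0 := par_inner km.
have [eB|nB] := boolP (edge_id k \in backs).
  rewrite (xor_sumD1 _ _ km) eB big1_seq ?addbF.
    have [t0 tp _] := back_tgt us_lt eB; have := plt ek0 => pe.
    by rewrite /on_cycle (anc_refl plt) (ltn_trans tp pe) /= andbT.
  move=> k' /andP[/andP[bB ne]]; rewrite mem_iota add0n => /= k'm.
  rewrite /on_cycle; case an : (anc _ _); rewrite ?andbF //=.
  have ne' : edge_id k != edge_id k' by apply: contraNneq ne => /(edge_id_inj us_lt km k'm) ->.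
  have [c [c0 pc _]] := anc_child plt an ne'.
  by case: (back_leaf us_lt eB c0 pc).
have [ox px] := tree_edge us_lt km nB; set x := other k in ox px.
have [/andP[x0 xT] xE] := other_in us_lt km; rewrite -/x in x0 xT xE.
pose Q v := anc x (id_of v.+1).
have Q'E i : 0 < i <= T -> is_edge i = false -> Q (nth 0 ord i).-1 = anc x i.
  move=> iT iE; have /andP[o0 _] := vertex_node us_lt iT iE; rewrite /Q prednK // id_nth //; by case/andP: iT.
have cr k' : k' < m -> crosses Q k' = (k' == k) (+) ((edge_id k' \in backs) && on_cycle k (edge_id k')).
  move=> k'm; have e0 := par_inner k'm; have eT := edge_id_in us_lt k'm.
  have pp := par_edge_gt0 us_lt k'm; have pe := plt e0.
  have pT : 0 < par (edge_id k') <= T by rewrite pp; case/andP: eT; lia.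
  have pE : is_edge (par (edge_id k')) = false.
    by have := par_par us_lt eT pp; rewrite edge_is_edge //; case: (is_edge _).
  have [oT oE] := other_in us_lt k'm.
  have nxe : x != edge_id k' by apply: contraFneq xE => ->; exact: edge_is_edge.
  rewrite crosses_id // !Q'E // (anc_par plt) // nxe andbT.
  have [eB|nB'] := boolP (edge_id k' \in backs).
    have kk : (k' == k) = false by apply: contraNF nB => /eqP <-.
    have [j [jm ej tj _ anj]] := backP us_lt eB; have kj := edge_id_inj us_lt k'm jm ej; rewrite -kj in tj anj.
    rewrite kk addFb andTb /on_cycle tj; have oE' := oE.
    have ae : anc (edge_id k) (edge_id k') = anc x (edge_id k').
      apply/idP/idP => h; last by apply: (anc_trans plt) h; rewrite (ancE plt) // px (anc_refl plt) orbT.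
      have ne : edge_id k != edge_id k' by apply: contraNneq nB => ->.
      have [c [c0 pc ac]] := anc_child plt h ne; have cT : 0 < c <= T by rewrite c0; exact: leq_trans (anc_leq plt ac) (proj2 (andP eT)).
      by rewrite /x -(kid_edge us_lt km cT pc).
    rewrite ae; case xa : (anc x (edge_id k')) => /=; last first.
      by apply/negbTE/negP => h; move: xa; rewrite (anc_trans plt h anj).
    case: (ltnP (other k') (edge_id k)) => lt.
      by apply/negP => /(anc_leq plt); rewrite ox ltnNge (ltnW lt).
    apply/negbF; apply: (anc_total plt xa anj); rewrite ox ltn_neqAle lt andbT.
    by apply: contraFneq oE => <-; exact: edge_is_edge.
  have [oe pe'] := tree_edge us_lt k'm nB'.
  rewrite andFb addbF; have [->|nk] := eqVneq k' k.
    rewrite -/x (anc_refl plt) addbT; apply/negP => /(anc_leq plt); rewrite ox; lia.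
  have o0 : 0 < other k' by case/andP: oT.
  rewrite (ancE plt _ o0) pe' // .
  have nxo : x != other k'.
    by apply: contraNneq nk => h; apply/eqP; apply: (edge_id_inj us_lt k'm km); rewrite -pe' -px h.
  by rewrite (negbTE nxo) /= addbb.
have E := ev Q.
have {E} : \big[addb/false]_(k' <- iota 0 m) ((Z k' && (k' == k)) (+) ((edge_id k' \in backs) && (Z k' && on_cycle k (edge_id k')))) = false.
  transitivity (\big[addb/false]_(k' <- iota 0 m | Z k') crosses Q k'); last exact: E.
  rewrite [RHS]big_mkcond big_seq [RHS]big_seq; apply: eq_bigr => k'; rewrite mem_iota add0n => /= k'm.
  by rewrite cr //; case: (Z k'); case: (_ == _); case: (_ \in _); case: (on_cycle _ _).
rewrite big_split /= (bigD1_seq k kI) ?iota_uniq //= eqxx andbT big1 ?addbF; last by move=> i /negbTE ->; rewrite andbF.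
have -> : \big[addb/false]_(k' <- iota 0 m | edge_id k' \in backs) (Z k' && on_cycle k (edge_id k')) =
    \big[addb/false]_(i <- iota 0 m) [&& edge_id i \in backs, Z i & on_cycle k (edge_id i)].
  by rewrite big_mkcond; apply: eq_bigr => i _; case: (_ \in _).
by case: (Z k); case: (\big[_/_]_(i <- _) _).
Qed.

End Cycles.
End Lr.

(** * The dual graph built from the word *)

Module Dual.
From mathcomp Require Import all_boot zify.
Import Kampen Palm Word Wgmv Wtree Wstep Dfs Lr.

Definition first_pos (s : seq (bool * nat)) l := index l s.
Definition last_pos (s : seq (bool * nat)) l := (size s).-1 - index l (rev s).

Lemma two_positions X Y Z (l : bool * nat) : count_mem l (X ++ l :: Y ++ l :: Z) = 2 ->
  first_pos (X ++ l :: Y ++ l :: Z) l = size X /\ last_pos (X ++ l :: Y ++ l :: Z) l = (size X + size Y).+1.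
Proof.
rewrite count_cat /= count_cat /= eqxx /= => c2.
have n0 s : count_mem l s = 0 -> l \notin s by move=> h; rewrite -has_pred1 has_count h.
have [x0 z0] : l \notin X /\ l \notin Z by split; apply: n0; move: c2; move: (count_mem l X) (count_mem l Y) (count_mem l Z); clear; lia.
rewrite /first_pos /last_pos index_cat (negbTE x0) /= eqxx addn0; split=> //.
rewrite rev_cat rev_cons rev_cat rev_cons -!cats1 -!catA index_cat mem_rev (negbTE z0) /= eqxx addn0.
rewrite size_rev !size_cat /= size_cat /=; lia.
Qed.

Section Dual.
Variables (n : nat) (us : seq (nat * nat)) (isd : pred nat).
Let m := size us.
Let T := n + m.
Let edge k := nth (0, 0) us k.
Hypothesis us_lt : simple_pairs n us.
Local Notation par := (par n us).
Local Notation edge_id := (edge_id n us).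
Local Notation backs := (backs n us).
Local Notation tgt := (tgt n us).
Local Notation anc := (Palm.anc par).
Local Notation on_cycle := (on_cycle n us).
Local Notation crosses := (crosses us).
Local Notation even_set := (even_set us).

Definition dword := word par T backs tgt (sides n us) 0.
Let wl := size dword.
(** Nodes [0] to [wl] are the gaps of the word, gap [i] standing before letter [i]. The extra node
    of an edge sits between its link and its second face. *)
Definition edge_node k := wl.+1 + k.
Definition face1 k := first_pos dword (false, edge_id k).
Definition face2 k := last_pos dword (false, edge_id k).
Definition back1 b := first_pos dword (true, b).
Definition back2 b := last_pos dword (true, b).
(** At the mark of a tree edge the contour crosses nothing, so the two gaps are identified. At a
    back edge, the gap before one occurrence lies on the same side as the gap after the other. *)
Definition dfree :=
  [seq (i, i.+1) | i <- iota 0 wl & ~~ (nth (false, 0) dword i).1] ++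
  flatten [seq [:: (back1 b, (back2 b).+1); ((back1 b).+1, back2 b)] | b <- backs] ++
  [seq (edge_node k, face2 k) | k <- iota 0 m & ~~ isd k].
Definition ddem := [seq (edge_node k, face2 k) | k <- iota 0 m & isd k].
Definition dlinks := [seq (face1 k, edge_node k) | k <- iota 0 m].
Definition dsize := wl.+1 + m.

Variables (lt : rel nat) (wd : nat -> nat -> nat -> bool).
Hypothesis vk : van_kampen (fun x => 0 < x <= T) (node_adj n us) lt wd.

Let plt := @par_lt n us.
Let rules := sides_rules us_lt vk.
Let Bin b (bB : b \in backs) : 0 < b <= T := back_in us_lt bB.
Let leaf b k (bB : b \in backs) (h : 0 < k <= T) : par k <> b := back_leaf us_lt bB (proj1 (andP h)).
Let btgt b (bB : b \in backs) := back_tgt us_lt bB.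

Let sp : spec par T backs tgt 0 dword.
Proof.
by have [] := word_spec (sides n us) plt Bin (backs_uniq us_lt) btgt (leq0n T).
Qed.

Let spec_back b : b \in backs -> count_mem (true, b) dword = 2.
Proof. by move=> bB; rewrite sp.1 bB (anc_root plt). Qed.

Let spec_letter b : (true, b) \in dword -> b \in backs.
Proof.
apply: contraTT => nb; rewrite -has_pred1 has_count -leqNgt leqn0; apply/eqP.
by have := sp.1 b; rewrite (negbTE nb).
Qed.

Let spec_edge k : k < m -> count_mem (false, edge_id k) dword = 2.
Proof. by move=> km; have /andP[a b] := edge_id_in us_lt km; rewrite sp.2 a b (anc_root plt) eq_sym -lt0n a. Qed.

Lemma face_split k : k < m -> exists X Y Z, [/\ dword = X ++ (false, edge_id k) :: Y ++ (false, edge_id k) :: Z,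
  face1 k = size X, face2 k = (size X + size Y).+1 & forall b, b \in backs -> odd (count_mem (true, b) Y) = on_cycle k b].
Proof.
move=> km; have eT := edge_id_in us_lt km.
have [X [Y [Z [e h]]]] := word0_mark (sides n us) plt Bin (backs_uniq us_lt) btgt eT.
have := spec_edge km; rewrite /dword e => c2; have [f1 f2] := two_positions c2.
exists X, Y, Z; split=> //; first by rewrite /face1 /dword e.
by rewrite /face2 /dword e.
Qed.

Lemma back_split b : b \in backs -> exists X Y Z, [/\ dword = X ++ (true, b) :: Y ++ (true, b) :: Z,
  back1 b = size X, back2 b = (size X + size Y).+1 & forall b', b' \in backs -> b' != b -> ~~ odd (count_mem (true, b') Y)].
Proof.
move=> bB; have c2 := spec_back bB; case: rules => r1 r2 r3.
have [X [Y [Z e]]] : exists X Y Z, dword = X ++ (true, b) :: Y ++ (true, b) :: Z.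
  have ls : (true, b) \in dword by rewrite -has_pred1 has_count c2.
  case/splitPr: ls c2 => X s'; rewrite count_cat /= eqxx /= => c2.
  have [xX|nX] := boolP ((true, b) \in X).
    by case/splitPr: xX => X1 X2; exists X1, X2, s'; rewrite -catA.
  have : (true, b) \in s'.
    have := nX; rewrite -!has_pred1 !has_count -leqNgt leqn0 => /eqP x0; move: c2; rewrite x0; move: (count_mem _ s'); clear; lia.
  by case/splitPr => Y Z; exists X, Y, Z.
have := c2; rewrite e => c2'; have [f1 f2] := two_positions c2'.
exists X, Y, Z; split=> //; rewrite ?/back1 ?/back2 ?e // => b' b'B nb.
by apply: (word0_noncrossing plt Bin (backs_uniq us_lt) leaf btgt r1 r2 r3 bB b'B _ e); apply/eqP; rewrite eq_sym.
Qed.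

Lemma dfree_in : inrange dsize dfree.
Proof.
have f2 k : k < m -> face2 k < dsize.
  by move=> km; have [X [Y [Z [e _ -> _]]]] := face_split km; rewrite /dsize /wl e size_cat /= size_cat /=; lia.
rewrite /inrange !all_cat; apply/and3P; split; apply/allP => f.
- by case/mapP => i; rewrite mem_filter mem_iota /dsize => /andP[_ iw] -> /=; lia.
- case/flattenP => s /mapP[b bB ->]; have [X [Y [Z [e b1 b2 _]]]] := back_split bB.
  have : (size X + size Y).+1 < wl by rewrite /wl e size_cat /= size_cat /=; lia.
  by rewrite /dsize !inE => h /orP[] /eqP -> /=; rewrite b1 b2; lia.
- case/mapP => k; rewrite mem_filter mem_iota => /andP[_ km] ->; have := f2 k km.
  by rewrite /= /edge_node /dsize => ->; move: km; rewrite /=; lia.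
Qed.

Lemma ddem_in : inrange dsize ddem.
Proof.
apply/allP => f /mapP[k]; rewrite mem_filter mem_iota => /andP[_ km] ->.
have [X [Y [Z [e _ e2 _]]]] := face_split km; rewrite /= e2 /edge_node /dsize.
by move: km; rewrite /= /wl e size_cat /= size_cat /=; lia.
Qed.

Lemma dlinks_in : inrange dsize dlinks.
Proof.
apply/allP => f /mapP[k]; rewrite mem_iota => km ->.
have [X [Y [Z [e e1 _ _]]]] := face_split km; rewrite /= e1 /edge_node /dsize.
by move: km; rewrite /= /wl e size_cat /= size_cat /=; lia.
Qed.

Lemma ddem_uniq : uniq ddem.
Proof.
rewrite map_inj_uniq ?filter_uniq ?iota_uniq // => k k' [] /eqP; by rewrite /edge_node eqn_add2l => /eqP.
Qed.

Lemma dlink_ends k : k < m -> ends dlinks k = (face1 k, edge_node k).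
Proof. by move=> km; rewrite /ends (nth_map 0) ?size_iota // nth_iota. Qed.

Lemma big_letters (F : pred nat) (s : seq (bool * nat)) : {subset s <= dword} ->
  \big[addb/false]_(l <- s) (l.1 && F l.2) = \big[addb/false]_(b <- backs) (F b && odd (count_mem (true, b) s)).
Proof.
elim: s => [|[t x] s IH] sub; first by rewrite big_nil big1 // => b _; rewrite andbF.
rewrite big_cons IH /=; last by move=> l ls; apply: sub; rewrite inE ls orbT.
case: t sub => sub /=; last first.
  by apply: eq_bigr.
have xB : x \in backs by apply: spec_letter; apply: sub; rewrite mem_head.
under [RHS]eq_bigr => b _ do rewrite oddD andb_addr.
rewrite big_split /=; congr (_ (+) _); rewrite (bigD1_seq x xB (backs_uniq us_lt)) /= eqxx andbT big1 ?addbF // => b.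
by rewrite xpair_eqE /= eq_sym => /negbTE ->; rewrite andbF.
Qed.

Lemma big_backs (F : pred nat) : \big[addb/false]_(b <- backs) F b =
  \big[addb/false]_(k <- iota 0 m | edge_id k \in backs) F (edge_id k).
Proof.
rewrite /Dfs.backs big_map big_filter -/m big_seq_cond [RHS]big_seq_cond; apply: eq_bigl => k.
rewrite mem_iota add0n /=; case km : (k < m) => //=; apply/idP/mapP => [h|[k']].
  by exists k; rewrite // mem_filter h mem_iota.
by rewrite mem_filter mem_iota => /andP[h /andP[_ k'm]] /(edge_id_inj us_lt km k'm) ->.
Qed.

Section Closed.
Variable S : pred nat.
Hypothesis cS : closed dfree S.
Definition flip b := S (back1 b) (+) S (back1 b).+1.

Lemma closed_mark i : i < wl -> ~~ (nth (false, 0) dword i).1 -> S i = S i.+1.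
Proof.
move=> iw ni; have := allP cS (i, i.+1); rewrite mem_cat => /(_ _); rewrite /cut negbK => h; apply/eqP/h.
by apply/orP; left; apply/mapP; exists i; rewrite // mem_filter ni mem_iota.
Qed.

Lemma closed_back b : b \in backs -> S (back1 b) = S (back2 b).+1 /\ S (back1 b).+1 = S (back2 b).
Proof.
move=> bB; have h f : f \in [:: (back1 b, (back2 b).+1); ((back1 b).+1, back2 b)] -> S f.1 = S f.2.
  move=> fi; have := allP cS f; rewrite /cut negbK => H; apply/eqP/H; rewrite !mem_cat; apply/orP; right; apply/orP; left.
  by apply/flattenP; exists [:: (back1 b, (back2 b).+1); ((back1 b).+1, back2 b)] => //; apply: (map_f (fun b => [:: (back1 b, (back2 b).+1); ((back1 b).+1, back2 b)])).
by split; [apply: (h (back1 b, (back2 b).+1)) | apply: (h ((back1 b).+1, back2 b))]; rewrite !inE eqxx ?orbT.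
Qed.

Lemma closed_step X l Z : dword = X ++ l :: Z -> S (size X) (+) S (size X).+1 = l.1 && flip l.2.
Proof.
move=> e; have xw : size X < wl by rewrite /wl e size_cat /=; lia.
have nl : nth (false, 0) dword (size X) = l by rewrite e nth_cat ltnn subnn.
case: l e nl => [[] b] e nl /=; last by rewrite (closed_mark xw) ?nl // addbb.
have bB : b \in backs by apply: spec_letter; rewrite e mem_cat mem_head orbT.
have [X' [Y [Z' [e' b1 b2 _]]]] := back_split bB; have [h1 h2] := closed_back bB; rewrite /flip.
have [->|n1] := eqVneq (size X) (back1 b); first by [].
suff -> : size X = back2 b by rewrite -h2 -h1 addbC.
have := spec_back bB; rewrite e' b2.
move: nl xw; rewrite /wl e' nth_cat; case: ltnP => lt1.
  move=> nX _; rewrite count_cat /= count_cat /= eqxx /= => c2.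
  have : (true, b) \in X' by rewrite -nX mem_nth.
  by rewrite -has_pred1 has_count; move: c2; move: (count_mem _ _) (count_mem _ _) (count_mem _ _); clear; lia.
rewrite b1 in n1; case E : (size X - size X') => [|j] /=; first by move: n1 lt1 E; move: (size X) (size X') => p q; clear; lia.
rewrite nth_cat; case: ltnP => lt2.
  move=> nY _; rewrite count_cat /= count_cat /= eqxx /= => c2.
  have : (true, b) \in Y by rewrite -nY mem_nth.
  by rewrite -has_pred1 has_count; move: c2; move: (count_mem _ _) (count_mem _ _) (count_mem _ _); clear; lia.
case E2 : (j - size Y) => [|i] /=; first by move: E E2 lt1 lt2; move: (size X) (size X') (size Y) => p q y; clear; lia.
move=> nZ; rewrite !size_cat /= size_cat /= => xw; rewrite count_cat /= count_cat /= eqxx /= => c2.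
have : (true, b) \in Z' by rewrite -nZ mem_nth //; move: xw E E2 lt1 lt2; move: (size X) (size X') (size Y) (size Z') => p q y z; clear; lia.
by rewrite -has_pred1 has_count; move: c2; move: (count_mem _ _) (count_mem _ _) (count_mem _ _); clear; lia.
Qed.

Lemma closed_walk X Y Z : dword = X ++ Y ++ Z ->
  S (size X) (+) S (size X + size Y) = \big[addb/false]_(l <- Y) (l.1 && flip l.2).
Proof.
elim: Y X => [|l Y IH] X e; first by rewrite big_nil addn0 addbb.
have e' : dword = rcons X l ++ Y ++ Z by rewrite cat_rcons.
rewrite big_cons -(closed_step e) -(IH _ e') size_rcons /= addnS addSn.
by case: (S (size X)); case: (S _); case: (S _).
Qed.

Definition face_cut k := S (face1 k) (+) S (face2 k).

(** Walking from one mark of [k] to the other meets an odd number of times exactly those back edges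
    whose fundamental cycles contain [k]. *)
Lemma face_cutE k : k < m -> face_cut k = \big[addb/false]_(b <- backs) (flip b && on_cycle k b).
Proof.
move=> km; have [X [Y [Z [e f1 f2 h]]]] := face_split km; rewrite /face_cut f1 f2.
have := @closed_walk X ((false, edge_id k) :: Y) ((false, edge_id k) :: Z) e; rewrite /= addnS => ->.
rewrite big_cons /= big_letters; last by move=> l lY; rewrite e mem_cat inE mem_cat lY !orbT.
by rewrite !big_seq; apply: eq_bigr => b bB; rewrite h.
Qed.

Lemma face_cut_even : even_set face_cut.
Proof.
move=> Q; rewrite big_mkcond /=.
transitivity (\big[addb/false]_(k <- iota 0 m) \big[addb/false]_(b <- backs) (flip b && (on_cycle k b && crosses Q k))).
  rewrite !big_seq; apply: eq_bigr => k; rewrite mem_iota => km; rewrite face_cutE //.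
  have -> (c d : bool) : (if c then d else false) = c && d by case: c.
  by rewrite big_distrl; apply: eq_bigr => b _; rewrite /= andbA.
rewrite exchange_big /= big1_seq // => b /andP[_ bB]; rewrite -big_distrr /=.
have := cycle_even us_lt bB Q; rewrite big_mkcond /= => h.
have -> : \big[addb/false]_(k <- iota 0 m) (on_cycle k b && crosses Q k) = false; last by rewrite andbF.
by rewrite -[RHS]h; apply: eq_bigr => k _; case: (on_cycle k b).
Qed.

Lemma closed_nondemand k : k < m -> ~~ isd k -> S (edge_node k) = S (face2 k).
Proof.
move=> km nd; have := allP cS (edge_node k, face2 k); rewrite /cut negbK => h; apply/eqP/h.
rewrite !mem_cat; apply/orP; right; apply/orP; right; apply/mapP; exists k => //.
by rewrite mem_filter nd mem_iota.
Qed.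

Variable d : nat.
Hypothesis dm : d < m.
Hypothesis d_cut : cut S (edge_node d, face2 d).
Hypothesis d_only : forall k, k < m -> isd k -> cut S (edge_node k, face2 k) -> k = d.

Lemma face_cut_link k : k < m -> face_cut k = cut S (ends dlinks k) (+) (k == d).
Proof.
move=> km; rewrite dlink_ends // /face_cut /cut /=.
have -> : (k == d) = (S (edge_node k) != S (face2 k)).
  apply/eqP/idP => [->|c]; first exact: d_cut.
  case dk : (isd k); first exact: d_only.
  by rewrite (closed_nondemand km) ?dk ?eqxx // in c.
by case: (S _); case: (S _); case: (S _).
Qed.

(** The links cut by [S] form, after toggling [d], an even set. Hence every vertex set that
    separates the ends of [d] is left by a cut link, which means that the cut links connect these
    ends. *)
Lemma link_crosses (Q : pred nat) : Q (edge d).1 != Q (edge d).2 ->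
  exists k, [/\ k < m, cut S (ends dlinks k) & crosses Q k].
Proof.
move=> Qd; have cd : crosses Q d by move: Qd; rewrite /Lr.crosses -/(edge d); case: (Q _); case: (Q _).
have [/hasP[k]|/hasPn no] := boolP (has (fun k => cut S (ends dlinks k) && crosses Q k) (iota 0 m)).
  by rewrite mem_iota => km /andP[a b]; exists k.
have := face_cut_even Q; rewrite (xor_sumD1 _ _ dm) cd andbT face_cut_link // eqxx.
have := no d; rewrite mem_iota => /(_ dm); rewrite cd andbT => /negbTE ->.
rewrite big1_seq // => k /andP[/andP[fk kd]]; rewrite mem_iota => km.
have := no k; rewrite mem_iota => /(_ km); move: fk; rewrite face_cut_link // (negbTE kd) addbF => ->.
by move/negbTE.
Qed.

End Closed.

Lemma viol_demand X S : viol dfree ddem dlinks X S -> exists d,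
  [/\ d < m, isd d, cut S (edge_node d, face2 d) & forall k, k < m -> isd k -> cut S (edge_node k, face2 k) -> k = d].
Proof.
move=> v; have [e [/mapP[d]]] := viol_cut v; rewrite mem_filter mem_iota => /andP[dd dm] -> cd u; exists d; split=> //.
move=> k km dk ck; have : (edge_node k, face2 k) \in ddem by apply/mapP; exists k; rewrite // mem_filter dk mem_iota.
by move/u => /(_ ck) [] /eqP; rewrite /edge_node eqn_add2l => /eqP.
Qed.

Lemma edge_neq k : k < m -> (edge k).1 != (edge k).2.
Proof. by move=> km; have /andP[a _] := edge_lt us_lt km; rewrite neq_ltn a. Qed.

Lemma dall_feas S : ~~ viol dfree ddem dlinks (iota 0 (size dlinks)) S.
Proof.
apply/negP => v; have [d [dm dd cd u]] := viol_demand v; have /and3P[cf /allP cl _] := v.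
have Qd : pred1 (edge d).1 (edge d).1 != pred1 (edge d).1 (edge d).2 by rewrite /= eqxx [_.2 == _]eq_sym (negbTE (edge_neq dm)).
have [k [km ck _]] := link_crosses cf dm cd u Qd.
have kin : ends dlinks k \in pick dlinks (iota 0 (size dlinks)) by apply: map_f; rewrite mem_iota size_map size_iota.
by have := cl _ kin; rewrite ck.
Qed.

(* The set of faces inside an even set of edges. *)
Lemma even_closed Z d : even_set Z -> d < m -> isd d -> exists S, [/\ closed dfree S,
  forall k, k < m -> cut S (ends dlinks k) = Z k (+) (k == d) &
  forall k, k < m -> cut S (edge_node k, face2 k) = (k == d)].
Proof.
move=> ev dm dd; pose zb b := has (fun k => Z k && (edge_id k == b)) (iota 0 m).
have zbE k : k < m -> zb (edge_id k) = Z k.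
  move=> km; apply/hasP/idP => [[k']|zk]; last by exists k; rewrite ?mem_iota // zk eqxx.
  by rewrite mem_iota => k'm /andP[zk /eqP /(edge_id_inj us_lt k'm km) <-].
pose P i := \big[addb/false]_(l <- take i dword) (l.1 && zb l.2).
(* [P] counts mod 2 the edges of [Z] crossed by the contour up to a gap. An edge node copies its
   second face, except at [d], where the demand has to be cut. *)
pose S i := if i < wl.+1 then P i else P (face2 (i - wl.+1)) (+) (i - wl.+1 == d).
have walk X Y Z' : dword = X ++ Y ++ Z' -> P (size X) (+) P (size X + size Y) = \big[addb/false]_(l <- Y) (l.1 && zb l.2).
  move=> e; rewrite /P e take_size_cat // catA -size_cat take_size_cat // big_cat /=.
  by rewrite addbA addbb addFb.
have Sp i : i <= wl -> S i = P i by rewrite /S ltnS => ->.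
have Sx k : S (edge_node k) = P (face2 k) (+) (k == d).
  by rewrite /S /edge_node ltnNge leq_addr /= addKn.
have fw k : k < m -> face1 k <= wl /\ face2 k <= wl.
  move=> km; have [X [Y [Z' [e -> -> _]]]] := face_split km; rewrite /wl e size_cat /= size_cat /=; lia.
have fc k : k < m -> P (face1 k) (+) P (face2 k) = Z k.
  move=> km; have [X [Y [Z' [e f1 f2 h]]]] := face_split km; rewrite f1 f2.
  have := @walk X ((false, edge_id k) :: Y) ((false, edge_id k) :: Z') e; rewrite /= addnS => ->.
  rewrite big_cons /= big_letters; last by move=> l lY; rewrite e mem_cat inE mem_cat lY !orbT.
  rewrite (even_cycles us_lt ev km) -/m big_backs big_seq_cond [RHS]big_seq_cond; apply: eq_bigr => k'.
  by rewrite mem_iota => /andP[k'm eB]; rewrite zbE // h.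
exists S; split.
- rewrite /closed !all_cat; apply/and3P; split; apply/allP => f.
  + case/mapP => i; rewrite mem_filter mem_iota => /andP[ni iw] ->; rewrite /cut negbK !Sp ?(ltnW iw) //.
    have e : dword = take i dword ++ [:: nth (false, 0) dword i] ++ drop i.+1 dword.
      by rewrite -[LHS](cat_take_drop i) (drop_nth (false, 0) iw).
    have := walk _ _ _ e; rewrite big_seq1 (negbTE ni) /= size_takel ?(ltnW iw) // addn1.
    by case: (P i); case: (P i.+1).
  + case/flattenP => s /mapP[b bB ->]; have [X [Y [Z' [e b1 b2 h]]]] := back_split bB.
    have yw : (size X + size Y).+1 < wl by rewrite /wl e size_cat /= size_cat /=; lia.
    have bY : \big[addb/false]_(l <- Y) (l.1 && zb l.2) = zb b && odd (count_mem (true, b) Y).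
      rewrite big_letters; last by move=> l lY; rewrite e mem_cat inE mem_cat lY !orbT.
      rewrite (bigD1_seq b bB (backs_uniq us_lt)) /= big1_seq ?addbF // => b' /andP[nb b'B].
      by rewrite (negbTE (h b' b'B nb)) andbF.
    have y0 : count_mem (true, b) Y = 0.
      have := spec_back bB; have [f1 f2] := (b1, b2).
      have cX := spec_back bB; rewrite e count_cat /= count_cat /= eqxx /= in cX.
      by move: cX; clear; move: (count_mem _ X) (count_mem _ Y) (count_mem _ Z'); lia.
    rewrite y0 andbF in bY.
    have [l1 l2 l3] : [/\ size X <= wl, (size X).+1 <= wl & (size X + size Y).+1 <= wl].
      by split; move: yw; clear; move: (size X) (size Y) (wl) => p q r; lia.
    rewrite !inE => /orP[] /eqP ->; rewrite /cut negbK b1 b2 /= !Sp //.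
      have e' : dword = X ++ ((true, b) :: Y ++ [:: (true, b)]) ++ Z' by rewrite e /= -catA.
      have := walk _ _ _ e'; rewrite big_cons big_cat big_seq1 /= bY addFb addbb size_cat /= addn1 !addnS.
      by case: (P _); case: (P _).
    have e' : dword = (rcons X (true, b)) ++ Y ++ ((true, b) :: Z') by rewrite e cat_rcons.
    have := walk _ _ _ e'; rewrite bY size_rcons addSn; by case: (P _); case: (P _).
  + case/mapP => k; rewrite mem_filter mem_iota => /andP[nd km] ->; rewrite /cut negbK Sx Sp; last by case: (fw k km).
    by have -> : (k == d) = false; [apply: contraNF nd => /eqP -> | rewrite addbF].
- move=> k km; rewrite dlink_ends // /cut Sx Sp; last by case: (fw k km).
  by rewrite /= -(fc k km); case: (P (face1 k)); case: (P (face2 k)); case: (k == d).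
- move=> k km; rewrite /cut Sx Sp; last by case: (fw k km).
  by rewrite /=; case: (P (face2 k)); case: (k == d).
Qed.

(** [P] with [d] toggled is even, hence bounds a set of faces that cuts the links of [P] and only
    the demand [d]. As [F] leaves no set violated, it contains one of these links. *)
Lemma cut_separates F (P : pred nat) d : valid dlinks F -> (forall S, ~~ viol dfree ddem dlinks F S) -> d < m -> isd d ->
  (forall Q, \big[addb/false]_(k <- iota 0 m | P k) crosses Q k = crosses Q d) ->
  exists2 k, k \in F & P k.
Proof.
move=> vF nv dm dd wP; pose Z k := P k (+) (k == d).
have ev : even_set Z.
  move=> Q; have -> : \big[addb/false]_(k <- iota 0 m | Z k) crosses Q k =
      \big[addb/false]_(k <- iota 0 m) ((P k && crosses Q k) (+) ((k == d) && crosses Q k)).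
    rewrite big_mkcond; apply: eq_bigr => k _; rewrite /Z; case: (P k); case: (k == d); case: (crosses Q k) => //.
  rewrite big_split /=.
  have -> : \big[addb/false]_(k <- iota 0 m) (P k && crosses Q k) = crosses Q d.
    by rewrite -wP [RHS]big_mkcond; apply: eq_bigr => k _; case: (P k).
  have dI : d \in iota 0 m by rewrite mem_iota.
  rewrite (bigD1_seq d dI (iota_uniq _ _)) /= eqxx andTb big1 ?addbF ?addbb // => k /negbTE -> //.
have [S [cS cl cd]] := even_closed ev dm dd.
have [/hasP[k kF Pk]|/hasPn no] := boolP (has P F); first by exists k.
case/negP: (nv S); apply/and3P; split=> //.
  apply/allP => e /mapP[k kF ->]; have km : k < m by have := allP vF k kF; rewrite size_map size_iota.
  by rewrite cl // /Z -addbA addbb addbF; exact: no.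
have dI : (edge_node d, face2 d) \in ddem by apply/mapP; exists d; rewrite // mem_filter dd mem_iota.
apply/eqP; apply: (cut1 ddem_uniq dI); first by rewrite cd // eqxx.
move=> e /mapP[k]; rewrite mem_filter mem_iota => /andP[_ km] ->; rewrite cd // => /eqP -> //.
Qed.

End Dual.
End Dual.

(** * The primal-dual step and the searches as programs *)

Module PtAlg.
Require Import Defs.
From mathcomp Require Import all_boot zify.
Import Pt Pt2 Pt3 Palm Wgmv Wstep Dfs.
Local Open Scope nat_scope.

Lemma pt_eq_pair X (eX : Enc X) (f g : X -> nat * nat) : PT f -> PT g -> PT (fun x => f x == g x).
Proof.
move=> pf pg; apply: (pt_ext (f := fun x => ((f x).1 == (g x).1) && ((f x).2 == (g x).2))); first by move=> x; case: (f x) => a b; case: (g x).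
by pt.
Qed.

Lemma pt_zip_bits X (eX : Enc X) (s t : X -> seq bool) : PT s -> PT t -> PT (fun x => zip (s x) (t x)).
Proof. by move=> ps pt'; exact: (pt_zip false false ps pt'). Qed.

Lemma tsize_all_nat (s : seq nat) b : all (fun a => a <= b) s -> tsize s <= size s * b.*2.+2 + 1.
Proof. by elim: s => //= a s IH /andP[ab /IH]; rewrite tsize_cons tsize_nat; nia. Qed.

Lemma pt_merge_base : PT (fun p : nat * seq (nat * nat) => merge p.1 p.2).
Proof.
rewrite /merge; apply: (@pt_foldl_add _ _ _ _ _ _ (fun _ => merge_step) (fun p : nat * seq (nat * nat) => iota 0 p.1) (fun p => p.2)
  (fun p lab => size lab <= p.1 /\ all (fun l => l <= p.1) lab) 4 2).
- pt.
- pt.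
- by rewrite /merge_step; pt.
- by move=> p; rewrite size_iota; split=> //; apply/allP => l; rewrite mem_iota; lia.
move=> p lab e [sl al].
have nl i : nth 0 lab i <= p.1.
  by case: (ltnP i (size lab)) => h; [apply: (allP al); rewrite mem_nth | rewrite nth_default].
have al' : all (fun l => l <= p.1) (merge_step lab e).
  by apply/allP => l /mapP[l' l'l ->]; case: ifP => _; [exact: nl | exact: (allP al)].
split; first by rewrite size_map.
have h := tsize_all_nat al'; rewrite size_map in h.
have h2 : p.1 < tsize p by rewrite tsize_pair tsize_nat; lia.
apply: leq_trans h _; apply: leq_trans (leq_addl _ _); move: sl h2; move: (tsize p) (tsize e) (size lab) p.1 => a b c d; clear; nia.
Qed.
Lemma pt_merge X (eX : Enc X) (N : X -> nat) (es : X -> seq (nat * nat)) : PT N -> PT es -> PT (fun x => merge (N x) (es x)).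
Proof. exact: pt_app2 pt_merge_base. Qed.

Ltac pt_extra2 := first [ simple eapply pt_eq_pair | simple eapply pt_merge | simple eapply pt_zip_bits ].
Ltac pt_more := fail.
Ltac pt2 := cbv beta zeta; repeat (first [ pt_more; cbv beta | pt_extra2; cbv beta | pt1 ]).

Definition graph_env : Type := nat * (seq (nat * nat) * (seq (nat * nat) * seq (nat * nat))).

Lemma pt_cand : PT (fun p : graph_env * seq nat => cand p.1.1 p.1.2.1 p.1.2.2.1 p.1.2.2.2 p.2).
Proof. by rewrite /cand /cand_of /others /pick /comp /ends; pt2. Qed.

Lemma pt_act : PT (fun p : graph_env * seq nat => act p.1.1 p.1.2.1 p.1.2.2.1 p.1.2.2.2 p.2).
Proof.
rewrite /act /minimal_in /subset_of; have pc := pt_cand.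
have pc' : PT (fun q : (graph_env * seq nat) * seq bool => cand q.1.1.1 q.1.1.2.1 q.1.1.2.2.1 q.1.1.2.2.2 q.1.2).
  exact: (pt_comp (f := fst) (pt_fst (pt_id _)) pc).
by pt2.
Qed.

Lemma pt_half X (eX : Enc X) (links : X -> seq (nat * nat)) A h : PT links -> PT A -> PT h -> PT (fun x => half (links x) (A x) (h x)).
Proof.
move=> pl pA ph.
have base : PT (fun p : seq (nat * nat) * (seq (seq bool) * (nat * bool)) => half p.1 p.2.1 p.2.2) by rewrite /half /end_of /ends; pt2.
exact: (pt_app3 base).
Qed.
Lemma pt_crossing X (eX : Enc X) (links : X -> seq (nat * nat)) A : PT links -> PT A -> PT (fun x => crossing (links x) (A x)).
Proof.
move=> pl pA; have base : PT (fun p : seq (nat * nat) * seq (seq bool) => crossing p.1 p.2).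
  by rewrite /crossing; pt2; apply: pt_half; pt2.
exact: (pt_app2 base).
Qed.

Notation blink := (bin * (bool * bool))%type.
Ltac pt_more ::= first [simple eapply pt_half | simple eapply pt_crossing].
Notation bstate := ((seq blink * seq nat) * (bool * (seq (seq bool) * seq (seq bool * bin))))%type.

Lemma pt_nth_link X (eX : Enc X) (dyn : X -> seq blink) (i : X -> nat) : PT dyn -> PT i -> PT ((fun x => nth link0 (dyn x) (i x)) : X -> blink).
Proof. by move=> pd pi; apply: (@pt_nth _ _ blink _ (fun _ => link0)) => //; apply: pt_const. Qed.

Lemma pt_adjust : PT ((fun p : seq (nat * nat) * (seq (seq bool) * (bool * (nat * blink))) =>
  adjust p.1 p.2.1 p.2.2.1 p.2.2.2.1 p.2.2.2.2) : _ -> blink).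
Proof.
pose E : Type := seq (nat * nat) * (seq (seq bool) * (bool * (nat * blink))).
have one : PT ((fun _ => 1) : E -> bin) by exact: pt_const.
have zero : PT ((fun _ => 0) : E -> bin) by exact: pt_const.
have b2n (c : E -> bool) : PT c -> PT ((fun p : E => nat_of_bool (c p)) : E -> bin).
  move=> pc; apply: (pt_ext (f := (fun p => if c p then 1 else 0) : E -> bin)); first by move=> p; case: (c p).
  exact: pt_if.
have pu : PT (fun p : E => half p.1 p.2.1 (p.2.2.2.1, false) && (p.2.2.2.2.2.1 != p.2.2.1)) by pt2.
have pv : PT (fun p : E => half p.1 p.2.1 (p.2.2.2.1, true) && (p.2.2.2.2.2.2 != p.2.2.1)) by pt2.
have pd : PT ((fun p : E => p.2.2.2.2.1) : E -> bin) by pt2.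
have p1 : PT (fun p : E => p.2.2.2.2.2.1) by pt2.
have p2 : PT (fun p : E => p.2.2.2.2.2.2) by pt2.
exact: (@pt_pair _ _ bin _ _ _ _ _ (pt_bsub (pt_bsub pd (b2n _ pu)) (b2n _ pv)) (pt_pair (pt_addb p1 pu) (pt_addb p2 pv))).
Qed.

Lemma pt_room : PT ((fun p : seq (nat * nat) * (seq (seq bool) * (nat * blink)) => room p.1 p.2.1 p.2.2.1 p.2.2.2) : _ -> bin).
Proof.
by rewrite /room; apply: pt_if; [pt2; apply: pt_half; pt2 | apply: pt_bhalf; pt2 | pt2].
Qed.

Lemma pt_grow : PT ((fun p : seq (nat * nat) * (seq (seq bool) * (bin * (nat * blink))) =>
  grow p.1 p.2.1 p.2.2.1 p.2.2.2.1 p.2.2.2.2) : _ -> blink).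
Proof.
have zero : PT ((fun _ => 0) : seq (nat * nat) * (seq (seq bool) * (bin * (nat * blink))) -> bin) by exact: pt_const.
have du s : PT ((fun p : seq (nat * nat) * (seq (seq bool) * (bin * (nat * blink))) =>
   if half p.1 p.2.1 (p.2.2.2.1, s) then p.2.2.1 else 0) : _ -> bin).
  by apply: pt_if => //; [apply: pt_half; pt2 | pt2].
rewrite /grow; apply: (@pt_pair _ _ bin).
  by apply: pt_bsub; [apply: pt_bsub; [pt2 | exact: du] | exact: du].
have pf := du false; have ptr := du true.
have p1 : PT (fun p : seq (nat * nat) * (seq (seq bool) * (bin * (nat * blink))) => p.2.2.2.2.2.1) by pt2.
have p2 : PT (fun p : seq (nat * nat) * (seq (seq bool) * (bin * (nat * blink))) => p.2.2.2.2.2.2) by pt2.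
exact: (pt_pair (pt_addb p1 (pt_bodd pf)) (pt_addb p2 (pt_bodd ptr))).
Qed.

Lemma pt_map_links E (eE : Enc E) (f : E -> nat -> blink -> blink) (links : E -> seq (nat * nat)) (dyn : E -> seq blink) :
  PT ((fun p : E * (nat * blink) => f p.1 p.2.1 p.2.2) : _ -> blink) -> PT links -> PT dyn ->
  PT ((fun p => map_links (links p) (f p) (dyn p)) : E -> seq blink).
Proof.
move=> pf pl pd; rewrite /map_links; apply: pt_mkseq; last by pt2.
have pn : PT ((fun p : E * nat => nth link0 (dyn p.1) p.2) : _ -> blink).
  by apply: pt_nth_link; [exact: (pt_comp (pt_fst (pt_id _)) pd) | pt2].
have pp : PT ((fun p : E * nat => (p.1, (p.2, nth link0 (dyn p.1) p.2))) : _ -> E * (nat * blink)) by pt2.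
exact: (pt_comp pp pf).
Qed.

Lemma pt_minl : PT ((fun s : seq bin => minl s) : _ -> bin).
Proof.
have zero : PT ((fun _ => 0) : seq bin -> bin) by exact: pt_const.
have ph : PT ((fun s : seq bin => head 0 s) : seq bin -> bin) by apply: (@pt_head _ _ bin); pt2.
rewrite /minl; apply: (@pt_foldl _ _ bin bin _ _ (fun _ => minn) (fun s : seq bin => head 0 s) (fun s : seq bin => behead s)) => //.
- by apply: pt_behead; pt2.
- by apply: pt_bmin; pt2.
(* The running minimum never exceeds the head of the list; the factor 2 is that of
   [tsize_bin_leq]. *)
exists (fun n => 2 * n); first by apply: (@pbound_mul (fun=> 2) id); [exact: pbound_const | exact: pbound_id].
move=> s k.
have h0 : @tsize bin _ (head 0 s) <= tsize s by case: s => //= a s; rewrite tsize_cons; lia.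
apply: leq_trans (leq_mul (leqnn 2) h0); apply: tsize_bin_leq.
elim: (take k _) (head 0 s) => //= a t IH b; apply: leq_trans (IH _) _; exact: geq_minl.
Qed.

Lemma pt_tight : PT (fun p : seq (nat * nat) * (seq (seq bool) * seq blink) => tight p.1 p.2.1 p.2.2).
Proof.
rewrite /tight /slack; apply: pt_filter; last by apply: pt_crossing; pt2.
by apply: pt_beq0; apply: (@pt_fst _ _ bin); apply: pt_nth_link; pt2.
Qed.

Lemma pt_grow_all : PT ((fun p : seq (nat * nat) * (seq (seq bool) * (seq blink * bstate)) =>
  grow_all p.1 p.2.1 p.2.2.1 p.2.2.2) : _ -> bstate).
Proof.
pose E : Type := seq (nat * nat) * (seq (seq bool) * (seq blink * bstate)).
pose rooms (p : E) : seq bin := [seq room p.1 p.2.1 i (nth link0 p.2.2.1 i) | i <- crossing p.1 p.2.1].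
have pr : PT rooms.
  apply: pt_map; last by apply: pt_crossing; pt2.
  have pn : PT ((fun q : E * nat => nth link0 q.1.2.2.1 q.2) : _ -> blink) by apply: pt_nth_link; pt2.
  have pp : PT ((fun q : E * nat => (q.1.1, (q.1.2.1, (q.2, nth link0 q.1.2.2.1 q.2)))) : _ -> seq (nat * nat) * (seq (seq bool) * (nat * blink))) by pt2.
  exact: (pt_comp pp pt_room).
have pD : PT ((fun p : E => minl (rooms p)) : E -> bin) := pt_comp pr pt_minl.
rewrite /grow_all -/E; apply: pt_if; first exact: pt_beq0 pD.
  have h : PT ((fun p : E => ((p.2.2.1, p.2.2.2.1.2), p.2.2.2.2)) : E -> bstate) by pt2.
  exact: h.
have pg : PT ((fun p : E => map_links p.1 (grow p.1 p.2.1 (minl (rooms p))) p.2.2.1) : E -> seq blink).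
  apply: (@pt_map_links E _ (fun p => grow p.1 p.2.1 (minl (rooms p))) (fun p => p.1) (fun p => p.2.2.1)); [|pt2|pt2].
  have pD' : PT ((fun q : E * (nat * blink) => minl (rooms q.1)) : _ -> bin) by exact: (pt_comp (pt_fst (pt_id _)) pD).
  have pp : PT ((fun q : E * (nat * blink) => (q.1.1, (q.1.2.1, (minl (rooms q.1), q.2)))) : _ -> seq (nat * nat) * (seq (seq bool) * (bin * (nat * blink)))) by pt2.
  exact: (pt_comp pp pt_grow).
have pm : PT ((fun p : E => [seq (B, minl (rooms p) : bin) | B <- p.2.1]) : E -> seq (seq bool * bin)).
  apply: (@pt_map _ _ _ (seq bool * bin)); last by pt2.
  by apply: (@pt_pair _ _ _ bin); [pt2 | exact: (pt_comp (pt_fst (pt_id _)) pD)].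
have po : PT (fun p : E => odd (minl (rooms p))) by exact: pt_bodd pD.
have h : PT ((fun p : E => ((map_links p.1 (grow p.1 p.2.1 (minl (rooms p))) p.2.2.1, p.2.2.2.1.2),
   (p.2.2.2.2.1 (+) odd (minl (rooms p)), (p.2.1, [seq (B, minl (rooms p) : bin) | B <- p.2.1] ++ p.2.2.2.2.2.2)))) : E -> bstate).
  apply: pt_pair; first by apply: pt_pair; [exact: pg | pt2].
  apply: pt_pair; first by apply: pt_addb; [pt2 | exact: po].
  by apply: pt_pair; [pt2 | apply: pt_cat; [exact: pm | pt2]].
exact: h.
Qed.

Lemma pt_wstep : PT ((fun p : graph_env * bstate => wstep p.1.1 p.1.2.1 p.1.2.2.1 p.1.2.2.2 p.2) : _ -> bstate).
Proof.
pose E : Type := graph_env * bstate.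
pose A (p : E) := act p.1.1 p.1.2.1 p.1.2.2.1 p.1.2.2.2 p.2.1.2.
have pA : PT A.
  have pp : PT (fun p : E => (p.1, p.2.1.2)) by pt2.
  exact: (pt_comp pp pt_act).
have ptt : PT (fun p : E => tight p.1.2.2.2 (A p) p.2.1.1).
  have pp : PT ((fun p : E => (p.1.2.2.2, (A p, p.2.1.1))) : E -> seq (nat * nat) * (seq (seq bool) * seq blink)) by pt2.
  exact: (pt_comp pp pt_tight).
have pd : PT ((fun p : E => map_links p.1.2.2.2 (adjust p.1.2.2.2 (A p) p.2.2.1) p.2.1.1) : E -> seq blink).
  apply: (@pt_map_links E _ (fun p => adjust p.1.2.2.2 (A p) p.2.2.1) (fun p => p.1.2.2.2) (fun p => p.2.1.1)); [|pt2|pt2].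
  have pA' : PT (fun q : E * (nat * blink) => A q.1) by exact: (pt_comp (pt_fst (pt_id _)) pA).
  have pp : PT ((fun q : E * (nat * blink) => (q.1.1.2.2.2, (A q.1, (q.1.2.2.1, q.2)))) : _ -> seq (nat * nat) * (seq (seq bool) * (bool * (nat * blink)))) by pt2.
  exact: (pt_comp pp pt_adjust).
have pp : PT ((fun p : E => (p.1.2.2.2, (A p, (map_links p.1.2.2.2 (adjust p.1.2.2.2 (A p) p.2.2.1) p.2.1.1, p.2)))) : E -> seq (nat * nat) * (seq (seq bool) * (seq blink * bstate))) by pt2.
have pgr := pt_comp pp pt_grow_all.
have h : PT ((fun p : E => if nilp (A p) then p.2 else if tight p.1.2.2.2 (A p) p.2.1.1 is i :: _ then ((p.2.1.1, i :: p.2.1.2), p.2.2) else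
    (grow_all p.1.2.2.2 (A p) (map_links p.1.2.2.2 (adjust p.1.2.2.2 (A p) p.2.2.1) p.2.1.1) p.2 : bstate)) : E -> bstate).
  apply: pt_if; [exact: pt_nilp pA | by pt2 |].
  by apply: (pt_case_seq (g := (fun p i _ => ((p.2.1.1, i :: p.2.1.2), p.2.2)) : E -> nat -> seq nat -> bstate)) => //; pt2.
exact: h.
Qed.

Lemma pt_feas : PT (fun p : graph_env * seq nat => feas p.1.1 p.1.2.1 p.1.2.2.1 p.1.2.2.2 p.2).
Proof. by rewrite /feas; apply: pt_nilp; exact: pt_cand. Qed.

Lemma pt_prune : PT (fun p : graph_env * seq nat => prune p.1.1 p.1.2.1 p.1.2.2.1 p.1.2.2.2 [::] p.2).
Proof.
rewrite /prune; apply: pt_fst.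
apply: (@pt_foldl_add _ _ nat (seq nat * seq nat) _ _ (fun p : graph_env * seq nat => prune_step p.1.1 p.1.2.1 p.1.2.2.1 p.1.2.2.2) _ _ (fun _ _ => True) 2 1) => //.
- pt2.
- pt2.
- rewrite /prune_step; have pf : PT (fun q : (graph_env * seq nat) * ((seq nat * seq nat) * nat) =>
     feas q.1.1.1 q.1.1.2.1 q.1.1.2.2.1 q.1.1.2.2.2 (q.2.1.1 ++ behead q.2.1.2)).
    have pp : PT (fun q : (graph_env * seq nat) * ((seq nat * seq nat) * nat) => (q.1.1, q.2.1.1 ++ behead q.2.1.2)) by pt2.
    exact: (pt_comp pp pt_feas).
  by pt2.
move=> p [K R] i _; split=> //; rewrite /prune_step /= !tsize_pair /= expn1.
have hb : tsize (behead R) <= tsize R by case: R => //= a R; rewrite tsize_cons; lia.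
by case: ifP => _; rewrite ?tsize_cons; move: hb; move: (tsize _) (tsize _) (tsize _) (tsize _) (tsize _) => a b c d e; clear; lia.
Qed.

Lemma pt_dfs_step : PT (fun p : seq (seq nat) * seq (nat * nat) => dfs_step p.1 p.2).
Proof.
rewrite /dfs_step /fresh /nb /unzip1.
apply: (@pt_case_seq _ _ _ nat _ _ _ _ (fun p j _ => (head 0 [seq y <- nth [::] p.1 (nth 0 [seq i.1 | i <- p.2] j) | y \notin [seq i.1 | i <- p.2]], size p.2 - j.+1) :: p.2)); by pt2.
Qed.

(** The invariant knows the number of rounds made, for iterations where only this number bounds the
    length of the state. *)
Lemma pt_iter_n X (eX : Enc X) B (eB : Enc B) (f : X -> B -> B) (b : X -> B) (n : X -> nat) (inv : X -> nat -> B -> Prop) q :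
  PT n -> PT b -> PT (fun p : X * B => f p.1 p.2) -> (forall x, inv x 0 (b x)) ->
  (forall x j acc, j < n x -> inv x j acc -> inv x j.+1 (f x acc)) ->
  pbound q -> (forall x j acc, j <= n x -> inv x j acc -> tsize acc <= q (tsize x)) ->
  PT (fun x => iter (n x) (f x) (b x)).
Proof.
move=> pn pb pf i0 iS qb Q; apply: (pt_ext (f := fun x => foldl (fun acc (_ : unit) => f x acc) (b x) (nseq (n x) tt))).
  by move=> x; rewrite -iter_foldl.
apply: (pt_foldl (pt_units pn) pb); first by apply: (pt_comp (f := fun p : X * (B * unit) => (p.1, p.2.1)) _ pf); pt.
exists q => // x k; have [j jn ->] : exists2 j, j <= n x & take k (nseq (n x) tt) = nseq j tt.
  by exists (minn k (n x)); [exact: geq_minr | elim: k (n x) => [|k IH] [|m] //=; rewrite ?min0n // minnSS /= -IH].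
rewrite -iter_foldl; apply: (Q x j) => //; elim: j jn => [|j IH] jn //=; apply: iS => //; apply: IH; exact: ltnW.
Qed.

Lemma tsize_all X (eX : Enc X) (s : seq X) b : all (fun a => tsize a <= b) s -> tsize s <= size s * b.+1 + 1.
Proof. by elim: s => //= a s IH /andP[ab /IH]; rewrite tsize_cons mulSn; lia. Qed.

Lemma tsize_nth X (eX : Enc X) (d : X) (s : seq X) i : tsize (nth d s i) <= tsize d + tsize s.
Proof. by elim: s i => [|a s IH] [|i] /=; rewrite ?tsize_cons; try lia; apply: leq_trans (IH i) _; lia. Qed.

Lemma tsize_in (X : eqType) (eX : Enc X) (x : X) s : x \in s -> tsize x < tsize s.
Proof. by case/splitPr => s1 s2; exact: tsize_mem. Qed.

Ltac pbd := repeat first [ exact: pbound_id | exact: pbound_const | assumption | apply: pbound_add | apply: pbound_mul ].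

Lemma pt_dfs_base : PT (fun p : seq (seq nat) * nat => dfs p.1 p.2).
Proof.
rewrite /dfs; apply: (@pt_iter_n _ _ _ _ (fun p : seq (seq nat) * nat => dfs_step p.1) (fun p => [:: (p.2, 0)]) (fun p => size p.1)
  (fun p j t => size t <= j.+1 /\ all (fun e => (e.1 <= tsize p) && (e.2 <= tsize p)) t) (fun n => (n + 1) * (4 * n + 4) + 1)).
- by pt2.
- by pt2.
- have pp : PT (fun q : (seq (seq nat) * nat) * seq (nat * nat) => (q.1.1, q.2)) by pt2.
  exact: (pt_comp pp pt_dfs_step).
- by move=> p; split=> //=; rewrite !andbT tsize_pair !tsize_nat; lia.
- move=> p j t jn [st at_]; rewrite /dfs_step; case: [seq _ <- _ | _] => [|i l] /=; first by split=> //; lia.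
  split; first by [].
  rewrite at_ andbT; have sp : size p.1 < tsize p.1 by exact: size_tsize.
  apply/andP; split; last by move: sp st jn; rewrite tsize_pair; move: (size t) (size p.1) (tsize p.1) => a b d; clear; lia.
  have := mem_nth 0; rewrite /fresh /nb; set s := [seq y <- _ | _]; move=> _.
  case E : s => [|y s'] //=; have : y \in s by rewrite E mem_head.
  rewrite mem_filter => /andP[_ yn]; have h1 : tsize y < tsize (nth [::] p.1 (nth 0 (unzip1 t) i)) by exact: tsize_in yn.
  have h2 : tsize (nth [::] p.1 (nth 0 (unzip1 t) i)) <= tsize ([::] : seq nat) + tsize p.1 by exact: tsize_nth.
  have key (a : nat) N : tsize a < N -> N <= 1 + tsize p.1 -> a <= tsize p by rewrite tsize_pair tsize_nat; clear; lia.
  exact: (key y _ h1 h2).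
- by pbd.
move=> p j t jn [st at_]; apply: leq_trans (tsize_all (b := 4 * tsize p + 3) _) _.
  apply: sub_all at_ => e /andP[a b]; rewrite tsize_pair !tsize_nat; lia.
have sp : size p.1 < tsize p.1 by exact: size_tsize.
have : size t <= tsize p + 1 by move: sp st jn; rewrite tsize_pair; move: (size t) (size p.1) (tsize p.1) (tsize p.2) => a b d e; clear; lia.
by move=> h; rewrite leq_add2r -addnS leq_mul.
Qed.
Lemma pt_dfs X (eX : Enc X) (nbs : X -> seq (seq nat)) (r : X -> nat) : PT nbs -> PT r -> PT (fun x => dfs (nbs x) (r x)).
Proof. exact: pt_app2 pt_dfs_base. Qed.

(** The climb becomes an iteration on the reversed list, which stays put once its head is 0. *)
Lemma pt_climb_base : PT (fun p : seq nat * (nat * nat) => climb (fun i => nth 0 p.1 i) p.2.1 p.2.2).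
Proof.
pose st (P s : seq nat) := if head 0 s == 0 then s else nth 0 P (head 0 s) :: s.
have E (P : seq nat) f k acc : rev (iter f (st P) (k :: acc)) = rev acc ++ climb (fun i => nth 0 P i) f.+1 k.
  elim: f k acc => [|f IH] k acc; first by rewrite /= rev_cons -cats1; case: (k == 0).
  rewrite iterSr {2}/st /=; case: ifP => k0; last by rewrite IH rev_cons cat_rcons.
  have -> : iter f (st P) (k :: acc) = k :: acc by elim: f {IH} => //= f ->; rewrite /st /= k0.
  by rewrite rev_cons -cats1.
apply: (pt_ext (f := fun p : seq nat * (nat * nat) => if p.2.1 is f.+1 then rev (iter f (st p.1) [:: p.2.2]) else [::])).
  by move=> [P [[|f] k]] //=; rewrite E.
apply: pt_case_nat; [by pt2 | by pt2 |]; apply: pt_rev.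
apply: (@pt_iter_n _ _ _ _ (fun p : (seq nat * (nat * nat)) * nat => st p.1.1) (fun p => [:: p.1.2.2]) (fun p => p.2)
  (fun p j t => size t <= j.+1 /\ all (fun e => e <= tsize p) t) (fun n => (n + 1) * (2 * n + 2) + 1)).
- by pt2.
- by pt2.
- by rewrite /st; pt2.
- by move=> p; split=> //=; rewrite andbT !tsize_pair !tsize_nat; lia.
- move=> p j t jn [s1 s2]; rewrite /st; case: ifP => _; first by split=> //; lia.
  split=> //=; rewrite s2 andbT; have h1 : tsize p.1.1 < tsize p by rewrite !tsize_pair; lia.
  have h2 : tsize (nth 0 p.1.1 (head 0 t)) <= tsize 0 + tsize p.1.1 by exact: tsize_nth.
  move: h1 h2; rewrite !tsize_nat; clear; lia.
- by pbd.
move=> p j t jn [s1 s2]; apply: leq_trans (tsize_all (b := 2 * tsize p + 1) _) _.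
  by apply: sub_all s2 => e a; rewrite tsize_nat; lia.
have : size t <= tsize p + 1 by rewrite tsize_pair !tsize_nat; lia.
by move=> h; rewrite leq_add2r -addnS leq_mul.
Qed.
Lemma pt_climb X (eX : Enc X) (P : X -> seq nat) (f k : X -> nat) : PT P -> PT f -> PT k ->
  PT (fun x => climb (fun i => nth 0 (P x) i) (f x) (k x)).
Proof. by move=> pP pf pk; exact: (pt_comp (pt_pair pP (pt_pair pf pk)) pt_climb_base). Qed.

Lemma findE T (x0 : T) a s : find a s = head (size s) [seq i <- iota 0 (size s) | a (nth x0 s i)].
Proof.
elim: s => //= b s IH; case: (a b) => //=; rewrite IH (iotaDl 1 0) filter_map -[RHS]/(head (size s).+1 _).
by rewrite (eq_filter (a2 := fun i => a (nth x0 s i))) //; case: [seq _ <- _ | _].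
Qed.
Lemma pt_index_nat X (eX : Enc X) (k : X -> nat) s : PT k -> PT s -> PT (fun x => index (k x) (s x)).
Proof.
move=> pk ps; apply: (pt_ext (f := fun x => head (size (s x)) [seq i <- iota 0 (size (s x)) | nth 0 (s x) i == k x])).
  by move=> x; rewrite /index (findE 0).
have pk' : PT (fun p : X * nat => k p.1) by exact: (pt_comp (pt_fst (pt_id _)) pk).
have ps' : PT (fun p : X * nat => s p.1) by exact: (pt_comp (pt_fst (pt_id _)) ps).
by pt2.
Qed.
Lemma pt_index_letter X (eX : Enc X) (b : X -> bool) (k : X -> nat) (s : X -> seq (bool * nat)) : PT b -> PT k -> PT s ->
  PT (fun x => index (b x, k x) (s x)).
Proof.
move=> pb pk ps; apply: (pt_ext (f := fun x => head (size (s x)) [seq i <- iota 0 (size (s x)) | ((nth (false, 0) (s x) i).1 == b x) && ((nth (false, 0) (s x) i).2 == k x)])).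
  by move=> x; rewrite /index (findE (false, 0)).
have pb' : PT (fun p : X * nat => b p.1) by exact: (pt_comp (pt_fst (pt_id _)) pb).
have pk' : PT (fun p : X * nat => k p.1) by exact: (pt_comp (pt_fst (pt_id _)) pk).
have ps' : PT (fun p : X * nat => s p.1) by exact: (pt_comp (pt_fst (pt_id _)) ps).
by pt2.
Qed.
Lemma pt_foldl_max X (eX : Enc X) (s : X -> seq nat) : PT s -> PT (fun x => foldl maxn 0 (s x)).
Proof.
move=> ps; apply: (@pt_foldl_add _ _ nat nat _ _ (fun _ => maxn) (fun _ => 0) s (fun _ _ => True) 1 1) => //; [by pt2 | by pt2 |].
by move=> x acc a _; split=> //; rewrite expn1 !tsize_nat; lia.
Qed.
Lemma pt_foldl_min X (eX : Enc X) (m : X -> nat) (s : X -> seq nat) : PT m -> PT s -> PT (fun x => foldl minn (m x) (s x)).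
Proof.
move=> pm ps; apply: (@pt_foldl_add _ _ nat nat _ _ (fun _ => minn) m s (fun _ _ => True) 1 1) => //; first by pt2.
by move=> x acc a _; split=> //; rewrite expn1 !tsize_nat; lia.
Qed.
End PtAlg.

(** * The word and the dual graph as programs *)

Module PtTree.
Require Import Defs.
From mathcomp Require Import all_boot zify.
Import Pt Pt2 Pt3 Kampen Palm Word Wgmv Wstep Dfs Lr Dual PtAlg.
Local Open Scope nat_scope.

Lemma pt_take X (eX : Enc X) A (eA : Enc A) (k : X -> nat) (s : X -> seq A) : PT k -> PT s -> PT (fun x => take (k x) (s x)).
Proof.
move=> pk ps; apply: (pt_ext (f := fun x => rev (drop (size (s x) - k x) (rev (s x))))); last by pt2.
move=> x; rewrite drop_rev revK; case: (leqP (k x) (size (s x))) => h; first by rewrite subKn.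
by rewrite (eqP (ltnW h : size (s x) - k x == 0)) subn0 take_size take_oversize // ltnW.
Qed.
Lemma pt_mul4 X (eX : Enc X) (k : X -> nat) : PT k -> PT (fun x => 4 * k x).
Proof. by move=> pk; apply: (pt_ext (f := fun x => (k x).*2.*2)); [move=> x; lia | pt2]. Qed.
Lemma pt_nat_of_bool X (eX : Enc X) (b : X -> bool) : PT b -> PT (fun x => nat_of_bool (b x)).
Proof. by move=> pb; apply: (pt_ext (f := fun x => if b x then 1 else 0)); [move=> x; case: (b x) | pt2]. Qed.
Notation arcs := (seq (nat * nat)).
Notation genv := (nat * arcs)%type.

Ltac pt_more0 := first [simple eapply pt_nat_of_bool | simple eapply pt_half | simple eapply pt_crossing | simple eapply pt_take | simple eapply pt_mul4 | simple eapply pt_dfs | simple eapply pt_climb | simple eapply pt_index_nat | simple eapply pt_index_letter | simple eapply pt_foldl_max | simple eapply pt_foldl_min].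
Ltac pt_more ::= pt_more0.

Lemma ptb_sub_nbs : PT (fun p : genv => Dfs.sub_nbs p.1 p.2).
Proof. by rewrite /Dfs.sub_nbs; pt2. Qed.

Lemma pt_sub_nbs X (eX : Enc X) (n : X -> nat) (us : X -> arcs) : PT n -> PT us -> PT (fun x => Dfs.sub_nbs (n x) (us x)).
Proof. by move=> pn pu; exact: (pt_comp (pt_pair pn pu) ptb_sub_nbs). Qed.

Ltac pt_more1 := first [simple eapply pt_sub_nbs | pt_more0].
Ltac pt_more ::= pt_more1.

Lemma ptb_tree : PT (fun p : genv => Dfs.tree p.1 p.2).
Proof. by rewrite /Dfs.tree; pt2. Qed.

Lemma pt_tree X (eX : Enc X) (n : X -> nat) (us : X -> arcs) : PT n -> PT us -> PT (fun x => Dfs.tree (n x) (us x)).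
Proof. by move=> pn pu; exact: (pt_comp (pt_pair pn pu) ptb_tree). Qed.

Ltac pt_more2 := first [simple eapply pt_tree | pt_more1].
Ltac pt_more ::= pt_more2.

Lemma ptb_ord : PT (fun p : genv => Dfs.ord p.1 p.2).
Proof. by rewrite /Dfs.ord /order /unzip1; pt2. Qed.

Lemma pt_ord X (eX : Enc X) (n : X -> nat) (us : X -> arcs) : PT n -> PT us -> PT (fun x => Dfs.ord (n x) (us x)).
Proof. by move=> pn pu; exact: (pt_comp (pt_pair pn pu) ptb_ord). Qed.

Lemma ptb_parents : PT (fun p : genv => parents (Dfs.tree p.1 p.2)).
Proof. by rewrite /parents /unzip2; pt2. Qed.

Lemma pt_parents X (eX : Enc X) (n : X -> nat) (us : X -> arcs) : PT n -> PT us -> PT (fun x => parents (Dfs.tree (n x) (us x))).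
Proof. by move=> pn pu; exact: (pt_comp (pt_pair pn pu) ptb_parents). Qed.

Ltac pt_more3 := first [simple eapply pt_ord | simple eapply pt_parents | pt_more2].
Ltac pt_more ::= pt_more3.

Lemma ptb_par : PT (fun p : genv * nat => Dfs.par p.1.1 p.1.2 p.2).
Proof. by rewrite /Dfs.par; pt2. Qed.

Lemma pt_par X (eX : Enc X) (n : X -> nat) (us : X -> arcs) (a : X -> nat) : PT n -> PT us -> PT a -> PT (fun x => Dfs.par (n x) (us x) (a x)).
Proof. by move=> pn pu p1; exact: (pt_comp (pt_pair (pt_pair pn pu) p1) ptb_par). Qed.

Lemma ptb_id_of : PT (fun p : genv * nat => Dfs.id_of p.1.1 p.1.2 p.2).
Proof. by rewrite /Dfs.id_of; pt2. Qed.

Lemma pt_id_of X (eX : Enc X) (n : X -> nat) (us : X -> arcs) (a : X -> nat) : PT n -> PT us -> PT a -> PT (fun x => Dfs.id_of (n x) (us x) (a x)).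
Proof. by move=> pn pu p1; exact: (pt_comp (pt_pair (pt_pair pn pu) p1) ptb_id_of). Qed.

Ltac pt_more4 := first [simple eapply pt_par | simple eapply pt_id_of | pt_more3].
Ltac pt_more ::= pt_more4.

Lemma ptb_tail_id : PT (fun p : genv * nat => Dfs.tail_id p.1.1 p.1.2 p.2).
Proof. by rewrite /Dfs.tail_id; pt2. Qed.

Lemma pt_tail_id X (eX : Enc X) (n : X -> nat) (us : X -> arcs) (a : X -> nat) : PT n -> PT us -> PT a -> PT (fun x => Dfs.tail_id (n x) (us x) (a x)).
Proof. by move=> pn pu p1; exact: (pt_comp (pt_pair (pt_pair pn pu) p1) ptb_tail_id). Qed.

Lemma ptb_head_id : PT (fun p : genv * nat => Dfs.head_id p.1.1 p.1.2 p.2).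
Proof. by rewrite /Dfs.head_id; pt2. Qed.

Lemma pt_head_id X (eX : Enc X) (n : X -> nat) (us : X -> arcs) (a : X -> nat) : PT n -> PT us -> PT a -> PT (fun x => Dfs.head_id (n x) (us x) (a x)).
Proof. by move=> pn pu p1; exact: (pt_comp (pt_pair (pt_pair pn pu) p1) ptb_head_id). Qed.

Lemma ptb_edge_id : PT (fun p : genv * nat => Dfs.edge_id p.1.1 p.1.2 p.2).
Proof. by rewrite /Dfs.edge_id; pt2. Qed.

Lemma pt_edge_id X (eX : Enc X) (n : X -> nat) (us : X -> arcs) (a : X -> nat) : PT n -> PT us -> PT a -> PT (fun x => Dfs.edge_id (n x) (us x) (a x)).
Proof. by move=> pn pu p1; exact: (pt_comp (pt_pair (pt_pair pn pu) p1) ptb_edge_id). Qed.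

Ltac pt_more5 := first [simple eapply pt_tail_id | simple eapply pt_head_id | simple eapply pt_edge_id | pt_more4].
Ltac pt_more ::= pt_more5.

Lemma ptb_backs : PT (fun p : genv => Dfs.backs p.1 p.2).
Proof. by rewrite /Dfs.backs; pt2. Qed.

Lemma pt_backs X (eX : Enc X) (n : X -> nat) (us : X -> arcs) : PT n -> PT us -> PT (fun x => Dfs.backs (n x) (us x)).
Proof. by move=> pn pu; exact: (pt_comp (pt_pair pn pu) ptb_backs). Qed.

Lemma ptb_tgt : PT (fun p : genv * nat => Dfs.tgt p.1.1 p.1.2 p.2).
Proof. by rewrite /Dfs.tgt /=; pt2. Qed.

Lemma pt_tgt X (eX : Enc X) (n : X -> nat) (us : X -> arcs) (a : X -> nat) : PT n -> PT us -> PT a -> PT (fun x => Dfs.tgt (n x) (us x) (a x)).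
Proof. by move=> pn pu p1; exact: (pt_comp (pt_pair (pt_pair pn pu) p1) ptb_tgt). Qed.

Ltac pt_more6 := first [simple eapply pt_backs | simple eapply pt_tgt | pt_more5].
Ltac pt_more ::= pt_more6.

Lemma ptb_chain : PT (fun p : genv * nat => Palm.chain (Dfs.par p.1.1 p.1.2) p.2).
Proof. by rewrite /Palm.chain /Dfs.par; pt2. Qed.

Lemma pt_chain X (eX : Enc X) (n : X -> nat) (us : X -> arcs) (a : X -> nat) : PT n -> PT us -> PT a -> PT (fun x => Palm.chain (Dfs.par (n x) (us x)) (a x)).
Proof. by move=> pn pu p1; exact: (pt_comp (pt_pair (pt_pair pn pu) p1) ptb_chain). Qed.

Ltac pt_more7 := first [simple eapply pt_chain | pt_more6].
Ltac pt_more ::= pt_more7.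

Lemma ptb_anc : PT (fun p : genv * (nat * nat) => Palm.anc (Dfs.par p.1.1 p.1.2) p.2.1 p.2.2).
Proof. by rewrite /Palm.anc; pt2. Qed.

Lemma pt_anc X (eX : Enc X) (n : X -> nat) (us : X -> arcs) (a : X -> nat) (b : X -> nat) : PT n -> PT us -> PT a -> PT b -> PT (fun x => Palm.anc (Dfs.par (n x) (us x)) (a x) (b x)).
Proof. by move=> pn pu p1 p2; exact: (pt_comp (pt_pair (pt_pair pn pu) (pt_pair p1 p2)) ptb_anc). Qed.

Ltac pt_more8 := first [simple eapply pt_anc | pt_more7].
Ltac pt_more ::= pt_more8.

Lemma ptb_ret : PT (fun p : genv * (nat * nat) => Palm.ret (Dfs.par p.1.1 p.1.2) (Dfs.backs p.1.1 p.1.2) (Dfs.tgt p.1.1 p.1.2) p.2.1 p.2.2).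
Proof. by rewrite /Palm.ret; pt2. Qed.

Lemma pt_ret X (eX : Enc X) (n : X -> nat) (us : X -> arcs) (a : X -> nat) (b : X -> nat) : PT n -> PT us -> PT a -> PT b -> PT (fun x => Palm.ret (Dfs.par (n x) (us x)) (Dfs.backs (n x) (us x)) (Dfs.tgt (n x) (us x)) (a x) (b x)).
Proof. by move=> pn pu p1 p2; exact: (pt_comp (pt_pair (pt_pair pn pu) (pt_pair p1 p2)) ptb_ret). Qed.

Ltac pt_more9 := first [simple eapply pt_ret | pt_more8].
Ltac pt_more ::= pt_more9.

Lemma ptb_same_con : PT (fun p : genv * (nat * nat) => Lr.same_con (Dfs.par p.1.1 p.1.2) (p.1.1 + size p.1.2) (Dfs.backs p.1.1 p.1.2) (Dfs.tgt p.1.1 p.1.2) p.2.1 p.2.2).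
Proof. by rewrite /Lr.same_con; pt2. Qed.

Lemma pt_same_con X (eX : Enc X) (n : X -> nat) (us : X -> arcs) (a : X -> nat) (b : X -> nat) : PT n -> PT us -> PT a -> PT b -> PT (fun x => Lr.same_con (Dfs.par (n x) (us x)) ((n x) + size (us x)) (Dfs.backs (n x) (us x)) (Dfs.tgt (n x) (us x)) (a x) (b x)).
Proof. by move=> pn pu p1 p2; exact: (pt_comp (pt_pair (pt_pair pn pu) (pt_pair p1 p2)) ptb_same_con). Qed.

Lemma ptb_differ_con : PT (fun p : genv * (nat * nat) => Lr.differ_con (Dfs.par p.1.1 p.1.2) (p.1.1 + size p.1.2) (Dfs.backs p.1.1 p.1.2) (Dfs.tgt p.1.1 p.1.2) p.2.1 p.2.2).
Proof. by rewrite /Lr.differ_con; pt2. Qed.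

Lemma pt_differ_con X (eX : Enc X) (n : X -> nat) (us : X -> arcs) (a : X -> nat) (b : X -> nat) : PT n -> PT us -> PT a -> PT b -> PT (fun x => Lr.differ_con (Dfs.par (n x) (us x)) ((n x) + size (us x)) (Dfs.backs (n x) (us x)) (Dfs.tgt (n x) (us x)) (a x) (b x)).
Proof. by move=> pn pu p1 p2; exact: (pt_comp (pt_pair (pt_pair pn pu) (pt_pair p1 p2)) ptb_differ_con). Qed.

Lemma ptb_align_con : PT (fun p : genv * (nat * nat) => Lr.align_con (Dfs.par p.1.1 p.1.2) (p.1.1 + size p.1.2) (Dfs.backs p.1.1 p.1.2) (Dfs.tgt p.1.1 p.1.2) p.2.1 p.2.2).
Proof. by rewrite /Lr.align_con; pt2. Qed.

Lemma pt_align_con X (eX : Enc X) (n : X -> nat) (us : X -> arcs) (a : X -> nat) (b : X -> nat) : PT n -> PT us -> PT a -> PT b -> PT (fun x => Lr.align_con (Dfs.par (n x) (us x)) ((n x) + size (us x)) (Dfs.backs (n x) (us x)) (Dfs.tgt (n x) (us x)) (a x) (b x)).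
Proof. by move=> pn pu p1 p2; exact: (pt_comp (pt_pair (pt_pair pn pu) (pt_pair p1 p2)) ptb_align_con). Qed.

Ltac pt_more10 := first [simple eapply pt_same_con | simple eapply pt_differ_con | simple eapply pt_align_con | pt_more9].
Ltac pt_more ::= pt_more10.

Lemma ptb_labels : PT (fun p : genv => Lr.labels (Dfs.par p.1 p.2) (p.1 + size p.2) (Dfs.backs p.1 p.2) (Dfs.tgt p.1 p.2)).
Proof. by rewrite /Lr.labels /Lr.constraints /Lr.con_edges; pt2. Qed.

Lemma pt_labels X (eX : Enc X) (n : X -> nat) (us : X -> arcs) : PT n -> PT us -> PT (fun x => Lr.labels (Dfs.par (n x) (us x)) ((n x) + size (us x)) (Dfs.backs (n x) (us x)) (Dfs.tgt (n x) (us x))).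
Proof. by move=> pn pu; exact: (pt_comp (pt_pair pn pu) ptb_labels). Qed.

Ltac pt_more11 := first [simple eapply pt_labels | pt_more10].
Ltac pt_more ::= pt_more11.

Lemma ptb_sides : PT (fun p : genv * nat => Lr.sides p.1.1 p.1.2 p.2).
Proof. by rewrite /Lr.sides /Lr.colour; pt2. Qed.

Lemma pt_sides X (eX : Enc X) (n : X -> nat) (us : X -> arcs) (a : X -> nat) : PT n -> PT us -> PT a -> PT (fun x => Lr.sides (n x) (us x) (a x)).
Proof. by move=> pn pu p1; exact: (pt_comp (pt_pair (pt_pair pn pu) p1) ptb_sides). Qed.

Ltac pt_more12 := first [simple eapply pt_sides | pt_more11].
Ltac pt_more ::= pt_more12.

Lemma ptb_returns : PT (fun p : genv * nat => Word.returns (Dfs.par p.1.1 p.1.2) (Dfs.backs p.1.1 p.1.2) (Dfs.tgt p.1.1 p.1.2) p.2).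
Proof. by rewrite /Word.returns; pt2. Qed.

Lemma pt_returns X (eX : Enc X) (n : X -> nat) (us : X -> arcs) (a : X -> nat) : PT n -> PT us -> PT a -> PT (fun x => Word.returns (Dfs.par (n x) (us x)) (Dfs.backs (n x) (us x)) (Dfs.tgt (n x) (us x)) (a x)).
Proof. by move=> pn pu p1; exact: (pt_comp (pt_pair (pt_pair pn pu) p1) ptb_returns). Qed.

Ltac pt_more13 := first [simple eapply pt_returns | pt_more12].
Ltac pt_more ::= pt_more13.

Lemma ptb_low : PT (fun p : genv * nat => Word.low (Dfs.par p.1.1 p.1.2) (p.1.1 + size p.1.2) (Dfs.backs p.1.1 p.1.2) (Dfs.tgt p.1.1 p.1.2) p.2).
Proof. by rewrite /Word.low; pt2. Qed.

Lemma pt_low X (eX : Enc X) (n : X -> nat) (us : X -> arcs) (a : X -> nat) : PT n -> PT us -> PT a -> PT (fun x => Word.low (Dfs.par (n x) (us x)) ((n x) + size (us x)) (Dfs.backs (n x) (us x)) (Dfs.tgt (n x) (us x)) (a x)).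
Proof. by move=> pn pu p1; exact: (pt_comp (pt_pair (pt_pair pn pu) p1) ptb_low). Qed.

Lemma ptb_high : PT (fun p : genv * nat => Word.high (Dfs.par p.1.1 p.1.2) (Dfs.backs p.1.1 p.1.2) (Dfs.tgt p.1.1 p.1.2) p.2).
Proof. by rewrite /Word.high; pt2. Qed.

Lemma pt_high X (eX : Enc X) (n : X -> nat) (us : X -> arcs) (a : X -> nat) : PT n -> PT us -> PT a -> PT (fun x => Word.high (Dfs.par (n x) (us x)) (Dfs.backs (n x) (us x)) (Dfs.tgt (n x) (us x)) (a x)).
Proof. by move=> pn pu p1; exact: (pt_comp (pt_pair (pt_pair pn pu) p1) ptb_high). Qed.

Ltac pt_more14 := first [simple eapply pt_low | simple eapply pt_high | pt_more13].
Ltac pt_more ::= pt_more14.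

Lemma ptb_side : PT (fun p : genv * nat => Word.side (Dfs.par p.1.1 p.1.2) (Dfs.backs p.1.1 p.1.2) (Dfs.tgt p.1.1 p.1.2) (Lr.sides p.1.1 p.1.2) p.2).
Proof. by rewrite /Word.side; pt2. Qed.

Lemma pt_side X (eX : Enc X) (n : X -> nat) (us : X -> arcs) (a : X -> nat) : PT n -> PT us -> PT a -> PT (fun x => Word.side (Dfs.par (n x) (us x)) (Dfs.backs (n x) (us x)) (Dfs.tgt (n x) (us x)) (Lr.sides (n x) (us x)) (a x)).
Proof. by move=> pn pu p1; exact: (pt_comp (pt_pair (pt_pair pn pu) p1) ptb_side). Qed.

Ltac pt_more15 := first [simple eapply pt_side | pt_more14].
Ltac pt_more ::= pt_more15.

Lemma ptb_key : PT (fun p : genv * nat => Word.key (Dfs.par p.1.1 p.1.2) (p.1.1 + size p.1.2) (Dfs.backs p.1.1 p.1.2) (Dfs.tgt p.1.1 p.1.2) (Lr.sides p.1.1 p.1.2) p.2).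
Proof. by rewrite /Word.key /Word.nest; pt2. Qed.

Lemma pt_key X (eX : Enc X) (n : X -> nat) (us : X -> arcs) (a : X -> nat) : PT n -> PT us -> PT a -> PT (fun x => Word.key (Dfs.par (n x) (us x)) ((n x) + size (us x)) (Dfs.backs (n x) (us x)) (Dfs.tgt (n x) (us x)) (Lr.sides (n x) (us x)) (a x)).
Proof. by move=> pn pu p1; exact: (pt_comp (pt_pair (pt_pair pn pu) p1) ptb_key). Qed.

Lemma ptb_kids : PT (fun p : genv * nat => Word.kids (Dfs.par p.1.1 p.1.2) (p.1.1 + size p.1.2) p.2).
Proof. by rewrite /Word.kids; pt2. Qed.

Lemma pt_kids X (eX : Enc X) (n : X -> nat) (us : X -> arcs) (a : X -> nat) : PT n -> PT us -> PT a -> PT (fun x => Word.kids (Dfs.par (n x) (us x)) ((n x) + size (us x)) (a x)).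
Proof. by move=> pn pu p1; exact: (pt_comp (pt_pair (pt_pair pn pu) p1) ptb_kids). Qed.

Ltac pt_more16 := first [simple eapply pt_key | simple eapply pt_kids | pt_more15].
Ltac pt_more ::= pt_more16.

Lemma ptb_sorted_kids : PT (fun p : genv * nat => Word.sorted_kids (Dfs.par p.1.1 p.1.2) (p.1.1 + size p.1.2) (Dfs.backs p.1.1 p.1.2) (Dfs.tgt p.1.1 p.1.2) (Lr.sides p.1.1 p.1.2) p.2).
Proof. by rewrite /Word.sorted_kids; pt2. Qed.

Lemma pt_sorted_kids X (eX : Enc X) (n : X -> nat) (us : X -> arcs) (a : X -> nat) : PT n -> PT us -> PT a -> PT (fun x => Word.sorted_kids (Dfs.par (n x) (us x)) ((n x) + size (us x)) (Dfs.backs (n x) (us x)) (Dfs.tgt (n x) (us x)) (Lr.sides (n x) (us x)) (a x)).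
Proof. by move=> pn pu p1; exact: (pt_comp (pt_pair (pt_pair pn pu) p1) ptb_sorted_kids). Qed.

Ltac pt_more17 := first [simple eapply pt_sorted_kids | pt_more16].
Ltac pt_more ::= pt_more17.

Notation letters := (seq (seq (bool * nat))).
(** One round of [Word.words]; the number of rounds already made is the length of the
    accumulator. *)
Definition word_step n us (acc : letters) : letters :=
  take (4 * (n + size us)).+4 (Word.step_word (Dfs.par n us) (n + size us) (Dfs.backs n us) (Dfs.tgt n us) (Lr.sides n us)
    (fun c => nth [::] acc (c - (n + size us - size acc).+1)) (n + size us - size acc)) :: acc.

Lemma wordsE n us k : iter k (word_step n us) [::] =
  Word.words (Dfs.par n us) (n + size us) (Dfs.backs n us) (Dfs.tgt n us) (Lr.sides n us) k.
Proof.
have sz k' : size (Word.words (Dfs.par n us) (n + size us) (Dfs.backs n us) (Dfs.tgt n us) (Lr.sides n us) k') = k' by elim: k' => //= k' ->.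
by elim: k => //= k ->; rewrite /word_step sz.
Qed.

Lemma pt_word_step : PT (fun p : genv * letters => word_step p.1.1 p.1.2 p.2).
Proof. by rewrite /word_step /Word.step_word /Word.block /Word.attached; pt2. Qed.

Lemma ptb_dword : PT (fun p : genv => dword p.1 p.2).
Proof.
apply: (pt_ext (f := fun p : genv => nth [::] (iter (p.1 + size p.2).+1 (word_step p.1 p.2) [::]) 0)).
  by move=> p; rewrite wordsE.
apply: pt_nth; [by pt2 | | by pt2].
pose ok (p : genv) (w : seq (bool * nat)) := (size w <= (4 * (p.1 + size p.2)).+4) && all (fun l => l.2 <= p.1 + size p.2 + \max_(b <- Dfs.backs p.1 p.2) b) w.
have [g gb gs] := pt_size (pt_backs (pt_fst (pt_id _)) (pt_snd (pt_id _)) : PT (fun p : genv => Dfs.backs p.1 p.2)).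
apply: (@pt_iter_n _ _ _ _ (fun p : genv => word_step p.1 p.2) (fun p => [::]) (fun p => (p.1 + size p.2).+1)
  (fun p j t => size t <= j /\ all (ok p) t) (fun n => (2 * n + 1) * ((4 * (2 * n) + 4) * (2 * (2 * n + g n) + 6) + 2) + 1)).
- by pt2.
- by pt2.
- exact: pt_word_step.
- by [].
- move=> p j t jn [s1 s2]; split; first by [].
  rewrite /word_step /= s2 andbT /ok size_take_min geq_minl /=; apply/allP => l /mem_take.
  have nb a : all (fun l => l.2 <= p.1 + size p.2 + \max_(b <- Dfs.backs p.1 p.2) b) (nth [::] t a).
    case: (ltnP a (size t)) => h; last by rewrite nth_default.
    by have /andP[_] := allP s2 _ (mem_nth [::] h).
  rewrite /Word.step_word mem_cat => /orP[|/flattenP[w /mapP[c cin ->]]].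
    by case: ifP => //; rewrite inE => _ /eqP -> /=; rewrite -addnA leq_subLR; lia.
  have cT : c <= p.1 + size p.2.
    by move: cin; rewrite /Word.sorted_kids => /flattenP[w' /mapP[k _ ->]]; rewrite !mem_filter mem_iota => /and3P[_ _]; lia.
  have cl (b : bool) : (b, c).2 <= p.1 + size p.2 + \max_(b <- Dfs.backs p.1 p.2) b by apply: leq_trans cT _; exact: leq_addr.
  rewrite /Word.block /Word.attached !(mem_cat, inE) !mem_filter !mem_rev => /orP[/andP[_]|/orP[/eqP ->|/orP[|/orP[/eqP ->|/andP[_]]]]];
    try (by move/(allP (nb _))); exact: cl.
- by pbd.
move=> p j t jn [s1 s2]; have h1 : p.1 + size p.2 <= 2 * tsize p.
  have : size p.2 < tsize p.2 by exact: size_tsize.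
  by rewrite tsize_pair tsize_nat; lia.
have h2 : \max_(b <- Dfs.backs p.1 p.2) b <= g (tsize p).
  apply/bigmax_leqP_seq => b bB _; apply: leq_trans (gs p).
  have : tsize b < tsize (Dfs.backs p.1 p.2) by exact: tsize_in.
  by rewrite tsize_nat; move: (tsize _) => q; clear; lia.
apply: leq_trans (tsize_all (b := (4 * (2 * tsize p) + 4) * (2 * (2 * tsize p + g (tsize p)) + 6) + 1) _) _; last first.
  rewrite leq_add2r -addnS leq_mul //; move: s1 jn h1; move: (size t) (p.1 + size p.2) (tsize p) => a b d; clear; lia.
apply: sub_all s2 => w /andP[w1 w2]; apply: leq_trans (tsize_all (b := 2 * (2 * tsize p + g (tsize p)) + 5) _) _.
  apply: sub_all w2 => l h; rewrite tsize_pair tsize_nat; have := tsize_bool l.1.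
  by move: h h1 h2; move: (tsize l.1) (l.2) (p.1 + size p.2) (\max_(_ <- _) _) (tsize p) (g _) => q1 q2 q3 q4 q5 q6; clear; lia.
rewrite leq_add2r -addnS leq_mul //; move: w1 h1; move: (size w) (p.1 + size p.2) (tsize p) => a b d; clear; lia.
Qed.
Lemma pt_dword X (eX : Enc X) (n : X -> nat) (us : X -> arcs) : PT n -> PT us -> PT (fun x => dword (n x) (us x)).
Proof. by move=> pn pu; exact: (pt_comp (pt_pair pn pu) ptb_dword). Qed.

Ltac pt_more18 := first [simple eapply pt_dword | pt_more17].
Ltac pt_more ::= pt_more18.

Lemma ptb_edge_node : PT (fun p : genv * nat => edge_node p.1.1 p.1.2 p.2).
Proof. by rewrite /edge_node; pt2. Qed.

Lemma pt_edge_node X (eX : Enc X) (n : X -> nat) (us : X -> arcs) (a : X -> nat) : PT n -> PT us -> PT a -> PT (fun x => edge_node (n x) (us x) (a x)).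
Proof. by move=> pn pu p1; exact: (pt_comp (pt_pair (pt_pair pn pu) p1) ptb_edge_node). Qed.

Lemma ptb_face1 : PT (fun p : genv * nat => face1 p.1.1 p.1.2 p.2).
Proof. by rewrite /face1 /first_pos; pt2. Qed.

Lemma pt_face1 X (eX : Enc X) (n : X -> nat) (us : X -> arcs) (a : X -> nat) : PT n -> PT us -> PT a -> PT (fun x => face1 (n x) (us x) (a x)).
Proof. by move=> pn pu p1; exact: (pt_comp (pt_pair (pt_pair pn pu) p1) ptb_face1). Qed.

Lemma ptb_face2 : PT (fun p : genv * nat => face2 p.1.1 p.1.2 p.2).
Proof. by rewrite /face2 /last_pos; pt2. Qed.

Lemma pt_face2 X (eX : Enc X) (n : X -> nat) (us : X -> arcs) (a : X -> nat) : PT n -> PT us -> PT a -> PT (fun x => face2 (n x) (us x) (a x)).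
Proof. by move=> pn pu p1; exact: (pt_comp (pt_pair (pt_pair pn pu) p1) ptb_face2). Qed.

Lemma ptb_back1 : PT (fun p : genv * nat => back1 p.1.1 p.1.2 p.2).
Proof. by rewrite /back1 /first_pos; pt2. Qed.

Lemma pt_back1 X (eX : Enc X) (n : X -> nat) (us : X -> arcs) (a : X -> nat) : PT n -> PT us -> PT a -> PT (fun x => back1 (n x) (us x) (a x)).
Proof. by move=> pn pu p1; exact: (pt_comp (pt_pair (pt_pair pn pu) p1) ptb_back1). Qed.

Lemma ptb_back2 : PT (fun p : genv * nat => back2 p.1.1 p.1.2 p.2).
Proof. by rewrite /back2 /last_pos; pt2. Qed.

Lemma pt_back2 X (eX : Enc X) (n : X -> nat) (us : X -> arcs) (a : X -> nat) : PT n -> PT us -> PT a -> PT (fun x => back2 (n x) (us x) (a x)).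
Proof. by move=> pn pu p1; exact: (pt_comp (pt_pair (pt_pair pn pu) p1) ptb_back2). Qed.

Lemma ptb_dsize : PT (fun p : genv => dsize p.1 p.2).
Proof. by rewrite /dsize; pt2. Qed.

Lemma pt_dsize X (eX : Enc X) (n : X -> nat) (us : X -> arcs) : PT n -> PT us -> PT (fun x => dsize (n x) (us x)).
Proof. by move=> pn pu; exact: (pt_comp (pt_pair pn pu) ptb_dsize). Qed.

Ltac pt_more19 := first [simple eapply pt_edge_node | simple eapply pt_face1 | simple eapply pt_face2 | simple eapply pt_back1 | simple eapply pt_back2 | simple eapply pt_dsize | pt_more18].
Ltac pt_more ::= pt_more19.

Lemma ptb_dlinks : PT (fun p : genv => dlinks p.1 p.2).
Proof. by rewrite /dlinks; pt2. Qed.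

Lemma pt_dlinks X (eX : Enc X) (n : X -> nat) (us : X -> arcs) : PT n -> PT us -> PT (fun x => dlinks (n x) (us x)).
Proof. by move=> pn pu; exact: (pt_comp (pt_pair pn pu) ptb_dlinks). Qed.

Ltac pt_more20 := first [simple eapply pt_dlinks | pt_more19].
Ltac pt_more ::= pt_more20.
End PtTree.

(** * Size bounds for the whole run *)

Module PtRun.
Require Import Defs.
From mathcomp Require Import all_boot zify.
Import Pt Pt2 Pt3 Wgmv Wstep PtAlg.
Local Open Scope nat_scope.

Lemma minl_head s : minl s <= head 0 s.
Proof. rewrite /minl; elim: (behead s) (head 0 s) => //= a l IH b; apply: leq_trans (IH _) _; exact: geq_minl. Qed.

Definition slack_le M (dyn : seq link_state) := all (fun d => d.1 <= M) dyn.

Lemma slack_nth M dyn i : slack_le M dyn -> (nth link0 dyn i).1 <= M.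
Proof. by move=> h; case: (ltnP i (size dyn)) => il; [exact: (allP h) (mem_nth _ il) | rewrite nth_default]. Qed.

Lemma slack_map_links links f M dyn : (forall i d, (f i d).1 <= d.1) -> slack_le M dyn ->
  slack_le M (map_links links f dyn) /\ size (map_links links f dyn) = size links.
Proof.
move=> fl h; split; last by rewrite size_mkseq.
by apply/allP => d /mapP[i _ ->]; apply: leq_trans (fl _ _) (slack_nth _ h).
Qed.

Section Bounds.
Variables (N : nat) (free dem links : seq (nat * nat)) (w : seq nat) (M L AB : nat).
Hypothesis actB : forall K, size K <= (size links).*2.+1 -> all (fun i => i < size links) K ->
  @tsize (seq (seq bool)) _ (act N free dem links K) <= AB.
Hypothesis LB : size links <= L.

(** Holds without any assumption on the graph: slacks only decrease, [D] never exceeds a slack, and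
    a round records at most as many sets as the encoding of the active sets is large. *)
Definition bounded j (st : wstate) := [/\ size st.1.2 <= j /\ all (fun i => i < size links) st.1.2,
  size st.1.1 <= L /\ slack_le M st.1.1, @tsize (seq (seq bool)) _ st.2.2.1 <= AB
  & size st.2.2.2 <= j * AB /\ all (fun r => (@tsize (seq bool) _ r.1 <= AB) && (r.2 <= M)) st.2.2.2].

Lemma bounded_step j st : j < (size links).*2.+1 -> bounded j st -> bounded j.+1 (wstep N free dem links st).
Proof.
move=> jn [[k1 k2] [d1 d2] a [r1 r2]]; have aB := actB (leq_trans k1 (ltnW jn)) k2.
have mono : bounded j.+1 st by split=> //; split=> //; [exact: leqW | apply: leq_trans r1 _; rewrite leq_mul2r leqnSn orbT].
rewrite /wstep; case: ifP => // _; set A := act _ _ _ _ _ in aB *.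
case E : (tight _ _ _) => [|i l].
  have [m1 m2] := slack_map_links (M := M) (dyn := st.1.1) (f := adjust links A st.2.1) links
    (fun i d => leq_trans (leq_subr _ _) (leq_subr _ _)) d2.
  rewrite /grow_all; set D := minl _; set dyn1 := map_links _ _ _ in m1 m2 D *.
  have DM : D <= M.
    apply: leq_trans (minl_head _) _; case: (crossing _ _) => //= c s; rewrite /room.
    apply: leq_trans (slack_nth c m1); case: ifP => // _; rewrite -divn2; exact: leq_div.
  case: eqP => _; first by split=> //=; [split=> //; exact: leqW | rewrite m2 | split=> //; apply: leq_trans r1 _; rewrite leq_mul2r leqnSn orbT].
  have [m3 m4] := slack_map_links (f := grow links A D) links (fun i d => leq_trans (leq_subr _ _) (leq_subr _ _)) m1.
  split=> //=; [split=> //; exact: leqW | by rewrite m4 |].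
  rewrite size_cat size_map mulSn; split; first by apply: leq_add r1; apply: leq_trans aB; exact: ltnW (size_tsize _ _).
  rewrite all_cat r2 andbT; apply/allP => r /mapP[B BA ->] /=; rewrite DM andbT.
  apply: leq_trans aB; apply: ltnW; exact: tsize_in.
split=> //=; last by split=> //; apply: leq_trans r1 _; rewrite leq_mul2r leqnSn orbT.
rewrite k2 andbT; split=> //; have : i \in tight links A st.1.1 by rewrite E mem_head.
by rewrite mem_filter mem_filter mem_iota => /and3P[_ _].
Qed.
End Bounds.

Lemma pt_nseq_true X (eX : Enc X) (n : X -> nat) : PT n -> PT (fun x => nseq (n x) true).
Proof.
move=> pn; apply: (pt_ext (f := fun x => [seq true | _ <- iota 0 (n x)])); last by pt2.
by move=> x; rewrite -{2}(size_iota 0 (n x)); elim: (iota _ _) => //= a s ->.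
Qed.

Lemma pt_winit : PT ((fun p : nat * seq bin => winit p.1 p.2) : _ -> bstate).
Proof.
have zero X (eX : Enc X) : PT ((fun _ : X => ((0 : bin), (false, false))) : X -> blink) by exact: pt_const.
have pd : PT ((fun p : nat * seq bin => [seq (c, (false, false)) | c <- p.2]) : _ -> seq blink).
  apply: (@pt_map _ _ bin blink _ _ (fun _ c => (c, (false, false)))); last by pt2.
  by apply: (@pt_pair _ _ bin); [pt2 | exact: pt_const].
have pr X (eX : Enc X) : PT ((fun _ => [::]) : X -> seq (seq bool * bin)) by exact: pt_const.
have pn : PT (fun p : nat * seq bin => nseq p.1 true) by apply: pt_nseq_true; pt2.
have h : PT ((fun p : nat * seq bin => (([seq (c, (false, false)) | c <- p.2], [::]), (false, ([:: nseq p.1 true], [::])))) : _ -> bstate).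
  apply: pt_pair; first by apply: pt_pair; [exact: pd | exact: pt_const].
  apply: pt_pair; first exact: pt_const.
  by apply: pt_pair; [apply: pt_cons; [exact: pn | exact: pt_const] | exact: pr].
exact: h.
Qed.

Notation run_env := (graph_env * seq bin)%type.
Lemma pt_wrun : PT ((fun p : run_env => wrun p.1.1 p.1.2.1 p.1.2.2.1 p.1.2.2.2 p.2) : _ -> bstate).
Proof.
have [g [a [k gb]] gs] := pt_size pt_act.
(* [KB] bounds the encoding of the list of picked links. [AB] bounds that of the active sets, its
   first part being for the initial family, which consists of the whole ground set. *)
pose KB n := (2 * n + 1) * (2 * n + 2) + 1.
pose AB n := 4 * n + 3 + a * (n + KB n + 2).+1 ^ k.
have pAB : pbound AB.
  rewrite /AB /KB; apply: pbound_add; first by pbd.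
  by apply: (@pbound_comp (fun n => a * n.+1 ^ k)); [exists a, k | pbd].
pose M (p : run_env) := foldr maxn 0 p.2.
have MB p v : v <= M p -> @tsize bin _ v <= 2 * tsize p.
  move=> vM; apply: leq_trans (tsize_bin_leq vM) _; rewrite leq_mul2l /=.
  have : @tsize bin _ (M p) <= tsize p.2.
    rewrite /M; elim: (p.2 : seq nat) => [|b s IH] //=.
    have -> : @tsize (seq bin) _ (b :: s) = (@tsize bin _ b + @tsize (seq bin) _ s).+1 by [].
    by rewrite /maxn; case: ifP => _; [apply: leq_trans IH _ |]; rewrite -addSn; [exact: leq_addl | rewrite addSn; apply: leqW; exact: leq_addr].
  by move/leq_trans; apply; rewrite tsize_pair; exact: leqW (leq_addl _ _).
have lk (p : run_env) : size p.1.2.2.2 < tsize p /\ size p.2 < tsize p.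
  have h1 : size p.1.2.2.2 < tsize p.1.2.2.2 by exact: size_tsize.
  have h2 : size p.2 < tsize p.2 by exact: size_tsize.
  have -> : tsize p = (tsize p.1 + tsize p.2).+1 by [].
  have -> : tsize p.1 = (tsize p.1.1 + (tsize p.1.2.1 + (tsize p.1.2.2.1 + tsize p.1.2.2.2).+1).+1).+1 by [].
  by move: h1 h2; clear; lia.
rewrite /wrun; apply: (@pt_iter_n _ _ bstate _ ((fun p : run_env => wstep p.1.1 p.1.2.1 p.1.2.2.1 p.1.2.2.2) : run_env -> bstate -> bstate)
  ((fun p => winit p.1.1 p.2) : run_env -> bstate) (fun p => (size p.1.2.2.2).*2.+1)
  (fun p j st => bounded p.1.2.2.2 (M p) (tsize p) (AB (tsize p)) j st)
  (fun n => ((n * (2 * n + 10) + 1) + KB n + 1) + (3 + (AB n + ((2 * n + 1) * AB n * (AB n + 2 * n + 2) + 1) + 1) + 1) + 1)).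
- by pt2.
- have pp : PT (fun p : run_env => (p.1.1, p.2)) by pt2.
  exact: (pt_comp pp pt_winit).
- have pp : PT (fun q : run_env * bstate => (q.1.1, q.2)) by pt2.
  exact: (pt_comp pp pt_wstep).
- move=> p; have [l1 l2] := lk p; split=> //=.
  + rewrite size_map; split; first exact: ltnW.
    rewrite /slack_le all_map; apply/allP => v /= vin; rewrite /M; elim: (p.2 : seq nat) vin => //= b s IH.
    by rewrite inE => /orP[/eqP ->|/IH h]; rewrite leq_max ?leqnn ?h ?orbT.
  + have h : @tsize (seq bool) _ (nseq p.1.1 true) = 4 * p.1.1 + 1.
      elim: (p.1.1) => //= q; rewrite tsize_cons => ->; rewrite /tsize /=; lia.
    have -> : @tsize (seq (seq bool)) _ [:: nseq p.1.1 true] = (4 * p.1.1 + 1 + 1).+1 by rewrite -h.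
    have h2 : tsize p.1.1 <= tsize p.
      by have -> : tsize p = ((tsize p.1.1 + tsize p.1.2).+1 + tsize p.2).+1 by []; clear; lia.
    by move: h2; rewrite tsize_nat /AB; move: (a * _); clear; lia.
- move=> p j st jn bd; have [l1 l2] := lk p; apply: (bounded_step _ (ltnW l1) jn bd) => K sK vK.
  apply: leq_trans (gs (p.1, K)) _; apply: leq_trans (gb _) _; apply: leq_trans (leq_addl _ _).
  have hK : tsize K <= KB (tsize p).
    apply: leq_trans (tsize_all (b := 2 * tsize p + 1) _) _.
      by apply: sub_all vK => i il; rewrite tsize_nat; move: il l1; clear; lia.
    by rewrite /KB leq_add2r -addnS leq_mul //; move: sK l1; clear; lia.
  rewrite leq_mul2l; apply/orP; right.
  have h3 : (tsize (p.1, K)).+1 <= (tsize p + KB (tsize p) + 2).+1.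
    rewrite tsize_pair /= [tsize p]tsize_pair; move: hK; rewrite [tsize p]tsize_pair; move: (KB _) => q; clear; lia.
  by case: (k) => // k0; rewrite leq_exp2r.
- rewrite /KB; pbd.
move=> p j st jn [[k1 k2] [d1 d2] aa [r1 r2]]; have [l1 l2] := lk p.
have -> : @tsize bstate _ st = ((@tsize (seq blink) _ st.1.1 + tsize st.1.2).+1 + (tsize st.2.1 + (tsize st.2.2.1 + @tsize (seq (seq bool * bin)) _ st.2.2.2).+1).+1).+1 by [].
have j2 : j <= 2 * tsize p + 1 by move: jn l1; clear; lia.
have e1 : @tsize (seq blink) _ st.1.1 <= tsize p * (2 * tsize p + 10) + 1.
  apply: leq_trans (@tsize_all blink _ st.1.1 (2 * tsize p + 9) _) _.
    apply: sub_all d2 => d dM; have := MB p d.1 dM.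
    have -> : @tsize blink _ d = (@tsize bin _ d.1 + (tsize d.2.1 + tsize d.2.2).+1).+1 by [].
    by have := tsize_bool d.2.1; have := tsize_bool d.2.2; clear; lia.
  by rewrite leq_add2r -addnS leq_mul.
have e2 : tsize st.1.2 <= KB (tsize p).
  apply: leq_trans (tsize_all (b := 2 * tsize p + 1) _) _.
    by apply: sub_all k2 => i il; rewrite tsize_nat; move: il l1; clear; lia.
  by rewrite /KB leq_add2r -addnS leq_mul //; exact: leq_trans k1 j2.
have e3 : @tsize (seq (seq bool * bin)) _ st.2.2.2 <= (2 * tsize p + 1) * AB (tsize p) * (AB (tsize p) + 2 * tsize p + 2) + 1.
  apply: leq_trans (@tsize_all (seq bool * bin)%type _ st.2.2.2 (AB (tsize p) + 2 * tsize p + 1) _) _.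
    apply: sub_all r2 => r /andP[ra rm]; have := MB p r.2 rm.
    have -> : @tsize (seq bool * bin)%type _ r = (tsize r.1 + @tsize bin _ r.2).+1 by [].
    by move: ra; move: (AB _) => q; clear; lia.
  rewrite leq_add2r -addnS leq_mul //; apply: leq_trans r1 _; by rewrite leq_mul2r j2 orbT.
have e4 := tsize_bool st.2.1.
have fin (a1 a2 a3 a4 a5 q1 q2 q3 q4 : nat) : a1 <= q1 -> a2 <= q2 -> a3 <= q3 -> a4 <= 3 -> a5 <= q4 ->
  ((a1 + a2).+1 + (a4 + (a5 + a3).+1).+1).+1 <= q1 + q2 + 1 + (3 + (q4 + q3 + 1) + 1) + 1 by clear; lia.
exact: (fin _ _ _ _ _ _ _ _ _ e1 e2 e3 e4 aa).
Qed.

Lemma pt_duals : PT ((fun p : run_env => duals p.1.1 p.1.2.1 p.1.2.2.1 p.1.2.2.2 p.2) : _ -> seq (seq bool * bin)).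
Proof.
have h : PT ((fun p : bstate => p.2.2.2) : _ -> seq (seq bool * bin)) by pt2.
exact: (pt_comp pt_wrun h).
Qed.

Lemma pt_kept : PT (fun p : run_env => kept p.1.1 p.1.2.1 p.1.2.2.1 p.1.2.2.2 p.2).
Proof.
have h : PT (fun p : bstate => p.1.2) by pt2.
have pp : PT (fun p : run_env => p.1) by pt2.
exact: (pt_comp (pt_pair pp (pt_comp pt_wrun h)) pt_prune).
Qed.
End PtRun.

(** * From the input matrix to the answer *)

Module Solve.
From mathcomp Require Import all_boot zify.
Import Kampen Palm Word Wgmv Wtree Wstep Dfs Lr Dual.

Section Solve.
Variable mat : seq (seq (option nat * bool)).
Local Notation n := (size mat).
Definition cell i j : option nat * bool := nth (None, false) (nth [::] mat i) j.
Definition supplied i j := if (cell i j).1 is Some _ then true else false.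
Definition pairs := [seq e <- [seq (i, j) | i <- iota 0 n, j <- iota 0 n] |
  (e.1 < e.2) && (supplied e.1 e.2 || (cell e.1 e.2).2)].
Definition pair_at k := nth (0, 0) pairs k.
(** A demand edge without supply gets capacity 0: its link is free of cost, and no set of positive
    dual value can cut it. *)
Definition cap (e : nat * nat) : nat := if (cell e.1 e.2).1 is Some c then c else 0.
Definition weights := [seq (cap e).*2 | e <- pairs].
Definition isd k := (cell (pair_at k).1 (pair_at k).2).2.
Definition gsize := dsize n pairs.
Definition gfree := dfree n pairs isd.
Definition gdem := ddem n pairs isd.
Definition glinks := dlinks n pairs.
Definition dual_sets := [seq r <- duals gsize gfree gdem glinks weights | r.2 != 0].
Definition cut_links := kept gsize gfree gdem glinks weights.
Definition cuts_edge (S : seq bool) (e : nat * nat) := cut (mem_map S) e.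
Definition used S := [seq k <- iota 0 (size pairs) | cuts_edge S (ends glinks k)].
Definition dem_of S := head 0 [seq k <- iota 0 (size pairs) | isd k && cuts_edge S (edge_node n pairs k, face2 n pairs k)].
(** Adjacency lists of the edges whose links [S] cuts; a search among them yields the flow path of
    [S]. *)
Definition flow_nbs S := [seq [seq (if e.1 == v then e.2 else e.1) | e <- [seq pair_at k | k <- used S] &
  (e.1 == v) || (e.2 == v)] | v <- iota 0 n].
Definition flow_tree S := dfs (flow_nbs S) (pair_at (dem_of S)).1.
Definition flow_start S := index (pair_at (dem_of S)).2 (order (flow_tree S)).
Definition flow_path S := [seq nth 0 (order (flow_tree S)) i |
  i <- climb (fun i => nth 0 (parents (flow_tree S)) i) (flow_start S).+1 (flow_start S)].
Definition joins (e : nat * nat) i j := ((e.1 == i) && (e.2 == j)) || ((e.1 == j) && (e.2 == i)).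
(** [x / 2] in lowest terms, as signed numerator and denominator in the layout of [enc_rat]. *)
Definition half_rat (x : nat) : (bool * nat) * (bool * nat) :=
  ((false, if odd x then x else x./2), (false, if odd x then 2 else 1)).
Definition flow_at i j := [seq (flow_path r.1, half_rat r.2) | r <- dual_sets & joins (pair_at (dem_of r.1)) i j].
Definition cut_at i j := supplied i j && has (fun k => joins (pair_at k) i j) cut_links.
Definition solution := (mkseq (fun i => mkseq (fun j => flow_at i j) n) n, mkseq (fun i => mkseq (fun j => cut_at i j) n) n).
End Solve.
End Solve.

(** * The answer as the output of one program *)

Module PtSolve.
Require Import Defs.
From mathcomp Require Import all_boot zify.
Import Pt Pt2 Pt3 Kampen Palm Word Wgmv Wstep Dfs Lr Dual PtAlg PtTree PtRun Solve.
Local Open Scope nat_scope.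

Lemma half_size k : size [seq i <- iota 0 k | i.*2.+1 < k] = k./2.
Proof.
have h2 : k./2 <= k by rewrite -divn2 leq_div.
have -> : iota 0 k = iota 0 k./2 ++ iota k./2 (k - k./2) by rewrite -{1}(subnKC h2) iotaD.
rewrite filter_cat size_cat.
have -> : [seq i <- iota 0 k./2 | i.*2.+1 < k] = iota 0 k./2.
  by apply/all_filterP/allP => i; rewrite mem_iota; have := odd_double_half k; lia.
have -> : [seq i <- iota k./2 (k - k./2) | i.*2.+1 < k] = [::].
  by apply/eqP; rewrite -size_eq0 size_filter -leqn0 leqNgt -has_count; apply/hasPn => i; rewrite mem_iota; have := odd_double_half k; case: (odd k) => /=; lia.
by rewrite size_iota addn0.
Qed.

Lemma pt_uhalf X (eX : Enc X) (k : X -> nat) : PT k -> PT (fun x => (k x)./2).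
Proof.
move=> pk; apply: (pt_ext (f := fun x => size [seq i <- iota 0 (k x) | i.*2.+1 < k x])); first by move=> x; rewrite half_size.
have pk' : PT (fun p : X * nat => k p.1) by exact: (pt_comp (pt_fst (pt_id _)) pk).
by pt2.
Qed.

(** Conversion from unary to binary: the digit of index [a] is the parity after [a] halvings. *)
Lemma pt_ubin X (eX : Enc X) (k : X -> nat) : PT k -> PT ((fun x => k x) : X -> bin).
Proof.
move=> pk; apply: (pt_comp (g := (fun i => i) : nat -> bin) pk).
have E j i : bits_rec j i = [seq odd (iter a ssrnat.half i) | a <- iota 0 j].
  elim: j i => //= j IH i; rewrite IH (iotaDl 1 0) -map_comp; congr (_ :: _).
  by apply: eq_map => a /=; rewrite -iterSr.
have V j i : i <= j -> bval (bits_rec j i) = i.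
  elim: j i => [|j IH] i; first by rewrite leqn0 => /eqP.
  by move=> mk; rewrite /bval /= -/(bval _) IH ?odd_double_half //; have := odd_double_half i; lia.
apply: (pt_ext (f := fun i : nat => bval [seq odd (iter a ssrnat.half i) | a <- iota 0 i])); first by move=> i; rewrite -E V.
apply: pt_bval; apply: pt_map; last by pt2.
have pi : PT (fun p : nat * nat => iter p.2 ssrnat.half p.1).
  apply: (@pt_iter _ _ nat _ (fun _ : nat * nat => ssrnat.half) fst snd (fun _ _ => True) 1 1) => //; try by pt2.
    by apply: pt_uhalf; pt2.
  by move=> x a _; split=> //; rewrite !tsize_nat expn1; have := odd_double_half a; lia.
apply: (pt_ext (f := fun p : nat * nat => ~~ (iter p.2 ssrnat.half p.1 == ((iter p.2 ssrnat.half p.1)./2).*2))).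
  by move=> p; have := odd_double_half (iter p.2 ssrnat.half p.1); case: (odd _) => /= h; apply/eqP; lia.
by apply: pt_negb; apply: pt_eqn => //; apply: pt_double; exact: pt_uhalf.
Qed.

Notation cells := (seq (seq (option bin * bool))).

Section Cells.
Context {X : Type} {eX : Enc X}.
Variable (mat : X -> cells).
Hypothesis pm : PT mat.

Lemma pt_size_mat : PT (fun x => @size (seq (option nat * bool)) (mat x)).
Proof. exact: (pt_size_seq pm). Qed.

Lemma pt_cell (i j : X -> nat) : PT i -> PT j -> PT ((fun x => cell (mat x) (i x) (j x)) : X -> option bin * bool).
Proof.
move=> pi pj; have r : PT ((fun x => nth [::] (mat x) (i x)) : X -> seq (option bin * bool)).
  exact: (pt_nth (pt_const _ _ ([::] : seq (option bin * bool))) pm pi).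
exact: (pt_nth (pt_const _ _ ((None, false) : option bin * bool)) r pj).
Qed.

Lemma pt_cell2 (i j : X -> nat) : PT i -> PT j -> PT (fun x => (cell (mat x) (i x) (j x)).2).
Proof. by move=> pi pj; exact: (pt_snd (pt_cell pi pj)). Qed.

Lemma pt_supplied (i j : X -> nat) : PT i -> PT j -> PT (fun x => supplied (mat x) (i x) (j x)).
Proof.
move=> pi pj; have pc : PT ((fun x => (cell (mat x) (i x) (j x)).1) : X -> option bin) by exact: (pt_fst (pt_cell pi pj)).
exact: (pt_case_option (g := fun _ _ => true) pc (pt_const _ _ false) (pt_const _ _ true)).
Qed.

Lemma pt_cap (e : X -> nat * nat) : PT e -> PT ((fun x => cap (mat x) (e x)) : X -> bin).
Proof.
move=> pe; have pc : PT ((fun x => (cell (mat x) (e x).1 (e x).2).1) : X -> option bin).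
  by exact: (pt_fst (pt_cell (pt_fst pe) (pt_snd pe))).
exact: (pt_case_option (g := (fun _ b => b) : X -> bin -> bin) pc (pt_const _ _ (0 : bin)) (pt_snd (pt_id _))).
Qed.
End Cells.

Ltac pt_mats0 := first [simple eapply pt_size_mat | simple eapply pt_cell2 | simple eapply pt_supplied].
Ltac pt_mats := pt_mats0.
Ltac pt3 := cbv beta zeta; repeat (first [ pt_mats; cbv beta | pt_more; cbv beta | pt_extra2; cbv beta | pt1 ]).

Lemma ptb_pairs : PT (fun mat : cells => pairs mat).
Proof. by rewrite /pairs; pt3. Qed.
Lemma pt_pairs X (eX : Enc X) (mat : X -> cells) : PT mat -> PT (fun x => pairs (mat x)).
Proof. by move=> pm; exact: (pt_comp pm ptb_pairs). Qed.
Ltac pt_mats1 := first [simple eapply pt_pairs | pt_mats0].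
Ltac pt_mats ::= pt_mats1.

Lemma pt_pair_at X (eX : Enc X) (mat : X -> cells) (k : X -> nat) : PT mat -> PT k -> PT (fun x => pair_at (mat x) (k x)).
Proof. by move=> pm pk; rewrite /pair_at; pt3. Qed.
Ltac pt_mats2 := first [simple eapply pt_pair_at | pt_mats1].
Ltac pt_mats ::= pt_mats2.

Lemma pt_weights : PT ((fun mat : cells => weights mat) : cells -> seq bin).
Proof.
have h : PT ((fun p : cells * (nat * nat) => (cap p.1 p.2).*2) : _ -> bin).
  exact: (pt_bdouble (pt_cap (pt_fst (pt_id _)) (pt_snd (pt_id _)))).
exact: (@pt_map cells _ _ bin _ _ (fun mat e => (cap mat e).*2) _ h ptb_pairs).
Qed.

Lemma pt_isd X (eX : Enc X) (mat : X -> cells) (k : X -> nat) : PT mat -> PT k -> PT (fun x => isd (mat x) (k x)).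
Proof. by move=> pm pk; rewrite /isd; pt3. Qed.
Ltac pt_mats3 := first [simple eapply pt_isd | pt_mats2].
Ltac pt_mats ::= pt_mats3.

Lemma pt_gfree : PT (fun mat : cells => gfree mat). Proof. by rewrite /gfree /dfree; pt3. Qed.
Lemma pt_gdem : PT (fun mat : cells => gdem mat). Proof. by rewrite /gdem /ddem; pt3. Qed.
Lemma pt_glinks : PT (fun mat : cells => glinks mat). Proof. by rewrite /glinks; pt3. Qed.
Lemma pt_gsize : PT (fun mat : cells => gsize mat). Proof. by rewrite /gsize; pt3. Qed.

Lemma pt_input : PT ((fun mat : cells => ((gsize mat, (gfree mat, (gdem mat, glinks mat))), weights mat)) : cells -> run_env).
Proof. exact: (pt_pair (pt_pair pt_gsize (pt_pair pt_gfree (pt_pair pt_gdem pt_glinks))) pt_weights). Qed.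

Lemma pt_dual_sets X (eX : Enc X) (mat : X -> cells) : PT mat -> PT ((fun x => dual_sets (mat x)) : X -> seq (seq bool * bin)).
Proof.
move=> pm; apply: (pt_comp (g := (fun mat => dual_sets mat) : cells -> seq (seq bool * bin)) pm).
apply: (@pt_filter _ _ (seq bool * bin)%type _ (fun _ r => r.2 != 0)); last exact: (pt_comp pt_input pt_duals).
by apply: pt_negb; apply: pt_beq0; apply: (@pt_snd _ _ _ bin); pt3.
Qed.

Lemma pt_cut_links X (eX : Enc X) (mat : X -> cells) : PT mat -> PT (fun x => cut_links (mat x)).
Proof. by move=> pm; exact: (pt_comp (pt_comp pm pt_input) pt_kept). Qed.

Section Paths.
Context {X : Type} {eX : Enc X}.
Variables (mat : X -> cells) (S : X -> seq bool).
Hypotheses (pm : PT mat) (pS : PT S).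
Let lift Y (eY : Enc Y) (f : cells -> seq bool -> Y) : PT (fun p : cells * seq bool => f p.1 p.2) -> PT (fun x => f (mat x) (S x)).
Proof. by move=> pf; exact: (pt_comp (pt_pair pm pS) pf). Qed.

Lemma pt_used : PT (fun x => used (mat x) (S x)).
Proof. by apply: lift; rewrite /used /cuts_edge /cut /mem_map /ends /glinks; pt3. Qed.
Lemma pt_dem_of : PT (fun x => dem_of (mat x) (S x)).
Proof. by apply: lift; rewrite /dem_of /cuts_edge /cut /mem_map; pt3. Qed.
End Paths.
Ltac pt_mats4 := first [simple eapply pt_used | simple eapply pt_dem_of | pt_mats3].
Ltac pt_mats ::= pt_mats4.

Lemma ptb_flow_tree : PT (fun p : cells * seq bool => flow_tree p.1 p.2).
Proof. by rewrite /flow_tree /flow_nbs; pt3. Qed.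
Lemma pt_flow_tree X (eX : Enc X) (mat : X -> cells) (S : X -> seq bool) : PT mat -> PT S -> PT (fun x => flow_tree (mat x) (S x)).
Proof. by move=> pm pS; exact: (pt_comp (pt_pair pm pS) ptb_flow_tree). Qed.
Ltac pt_mats5 := first [simple eapply pt_flow_tree | pt_mats4].
Ltac pt_mats ::= pt_mats5.

Lemma pt_flow_path : PT ((fun p : cells * seq bool => flow_path p.1 p.2) : _ -> seq bin).
Proof.
have h : PT (fun p : cells * seq bool => flow_path p.1 p.2) by rewrite /flow_path /flow_start /order /parents /unzip1 /unzip2; pt3.
apply: (pt_ext (f := (fun p : cells * seq bool => [seq (v : bin) | v <- flow_path p.1 p.2]) : _ -> seq bin)); first by move=> p; exact: map_id.
apply: (@pt_map _ _ nat bin _ _ (fun _ v => v)) => //.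
by apply: pt_ubin; pt3.
Qed.

Notation rat_code := ((bool * bin) * (bool * bin))%type.
Lemma pt_half_rat : PT ((fun b : bin => half_rat b) : bin -> rat_code).
Proof.
have po : PT (fun b : bin => odd b) by exact: pt_bodd (pt_id _).
have ph : PT ((fun b => if odd b then b else b./2) : bin -> bin) by apply: pt_if => //; [exact: pt_id | exact: pt_bhalf (pt_id _)].
have p2 : PT ((fun b => if odd b then 2 else 1) : bin -> bin) by apply: pt_if => //; exact: pt_const.
have pf : PT (fun b : bin => false) by exact: pt_const.
exact: (pt_pair (pt_pair pf ph) (pt_pair pf p2)).
Qed.

Notation answer := (seq (seq (seq (seq bin * rat_code))) * seq (seq bool))%type.
Lemma pt_solution : PT ((fun mat : cells => solution mat) : cells -> answer).
Proof.
pose E : Type := (cells * nat) * nat.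
have pE : PT (fun p : E => p.1.1) by pt3.
have pfl : PT ((fun p : E => flow_at p.1.1 p.1.2 p.2) : E -> seq (seq bin * rat_code)).
  apply: (@pt_map _ _ (seq bool * bin)%type (seq bin * rat_code)%type _ _ (fun p r => (flow_path p.1.1 r.1, half_rat r.2))).
    have pr : PT ((fun q : E * (seq bool * bin) => q.2.2) : _ -> bin) by pt3.
    have pp : PT (fun q : E * (seq bool * bin) => (q.1.1.1, q.2.1)) by pt3.
    exact: (pt_pair (pt_comp pp pt_flow_path) (pt_comp pr pt_half_rat)).
  apply: (@pt_filter _ _ (seq bool * bin)%type _ (fun p r => joins (pair_at p.1.1 (dem_of p.1.1 r.1)) p.1.2 p.2)); last exact: pt_dual_sets.
  have h1 : PT (fun q : E * (seq bool * bin) => pair_at q.1.1.1 (dem_of q.1.1.1 q.2.1)) by pt3.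
  have h2 : PT (fun q : E * (seq bool * bin) => q.1.1.2) by pt3.
  have h3 : PT (fun q : E * (seq bool * bin) => q.1.2) by pt3.
  by rewrite /joins; apply: pt_orb; apply: pt_andb; apply: pt_eqn; try exact: pt_fst h1; try exact: pt_snd h1.
have pcl : PT (fun p : E => cut_links p.1.1) by exact: pt_cut_links.
have pct : PT (fun p : E => cut_at p.1.1 p.1.2 p.2) by rewrite /cut_at /joins; pt3.
have ps : PT (fun mat : cells => @size (seq (option nat * bool)) mat) by exact: pt_size_mat (pt_id _).
have row Y (eY : Enc Y) (f : cells -> nat -> nat -> Y) : PT (fun p : E => f p.1.1 p.1.2 p.2) ->
    PT (fun mat : cells => mkseq (fun i => mkseq (fun j => f mat i j) (size mat)) (size mat)).
  move=> pf; apply: (pt_mkseq (f := fun mat i => mkseq (fun j => f mat i j) (size mat))) => //.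
  apply: (pt_mkseq (f := fun (p : cells * nat) j => f p.1 p.2 j)) => //; exact: (pt_comp (pt_fst (pt_id _)) ps).
exact: (pt_pair (row _ _ (fun mat i j => flow_at mat i j : seq (seq bin * rat_code)) pfl) (row _ _ (fun mat i j => cut_at mat i j) pct)).
Qed.
End PtSolve.

(** * Correctness of the computed flow and multicut *)

Module Correct.
Require Import Defs.
From mathcomp Require Import all_boot all_order all_algebra.
From mathcomp Require Import reals zify.
Import Kampen Palm Word Wgmv Wtree Wstep Wpot Dfs Lr Dual Solve.
Local Open Scope nat_scope.

Lemma set2_eq (T : finType) (a b x y : T) : [set a; b] = [set x; y] -> (a = x /\ b = y) \/ (a = y /\ b = x).
Proof.
move=> e; have h1 : a \in [set x; y] by rewrite -e set21.
have h2 : b \in [set x; y] by rewrite -e set22.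
have h3 : x \in [set a; b] by rewrite e set21.
have h4 : y \in [set a; b] by rewrite e set22.
by move: h1 h2 h3 h4; rewrite !inE => /orP[] /eqP h1 /orP[] /eqP h2 /orP[] /eqP h3 /orP[] /eqP h4;
  first [left; split; congruence | right; split; congruence].
Qed.

Lemma climb_path (par : nat -> nat) f i : i < f -> (forall k, 0 < k <= i -> par k < k) ->
  exists s, [/\ climb par f i = i :: s, path (fun a b => (0 < a) && (b == par a)) i s, last i s = 0 & path gtn i s].
Proof.
elim: f i => // f IH i if_ lt /=; case: eqP => [->|/eqP i0]; first by exists [::].
have pi : par i < i by apply: lt; lia.
have [|k kp|s [e1 e2 e3 e4]] := IH (par i); first by lia.
  by apply: lt; lia.
by exists (par i :: s); split; rewrite /= ?e1 ?e2 ?e3 ?e4 ?eqxx ?andbT /= ?lt0n.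
Qed.

Lemma path_edges_sub (V : finType) (P : pred {set V}) x s : path (fun a b => P [set a; b]) x s ->
  forall e, e \in path_edges (x :: s) -> P e.
Proof.
elim: s x => [|y s IH] x /=; first by move=> _ e; rewrite /path_edges /= in_nil.
by move=> /andP[xy p] e; rewrite /path_edges /= inE => /orP[/eqP -> //|]; exact: IH.
Qed.

Lemma path_mapE (A B : Type) (f : A -> B) (e : rel B) x s : path e (f x) [seq f y | y <- s] = path (fun a b => e (f a) (f b)) x s.
Proof. by elim: s x => //= y s IH x; rewrite IH. Qed.

Lemma last_mapE (A B : Type) (f : A -> B) x s : last (f x) [seq f y | y <- s] = f (last x s).
Proof. exact: last_map. Qed.

Lemma leq_sum_sub (T : eqType) (s : seq T) (P Q : pred T) (f : T -> nat) : {in s, forall x, P x -> Q x} ->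
  \sum_(x <- s | P x) f x <= \sum_(x <- s | Q x) f x.
Proof.
elim: s => [|a s IH] h; first by rewrite !big_nil.
have {}IH : \sum_(x <- s | P x) f x <= \sum_(x <- s | Q x) f x by apply: IH => x xs; apply: h; rewrite inE xs orbT.
rewrite !big_cons; case Pa : (P a); first by rewrite (h a (mem_head _ _) Pa) leq_add2l.
by case: (Q a) => //; apply: leq_trans IH (leq_addl _ _).
Qed.

Lemma path_in (T : eqType) (e e' : rel T) x s : (forall a b, a \in x :: s -> b \in x :: s -> e a b -> e' a b) ->
  path e x s -> path e' x s.
Proof.
elim: s x => //= y s IH x h /andP[xy p]; rewrite h ?inE ?eqxx ?orbT //=; apply: IH => // a b a1 b1.
by apply: h; rewrite inE ?a1 ?b1 orbT.
Qed.

Section Correct.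
Variables (R : realType) (V : finType) (E D : {set {set V}}) (c : {set V} -> nat) (v0 : V).
Hypotheses (sE : simple_graph E) (sD : simple_graph D) (pl : planar R (E :|: D)).
Definition matrix_of (W : finType) (E' D' : {set {set W}}) (c' : {set W} -> nat) : seq (seq (option nat * bool)) :=
  [seq [seq (if [set x; y] \in E' then Some (c' [set x; y]) else None, [set x; y] \in D') | y <- enum W] | x <- enum W].
Local Notation mt := (matrix_of E D c).
Local Notation n := #|V|.
Definition vx i := nth v0 (enum V) i.
Definition ix v := index v (enum V).
Local Notation us := (pairs mt).
Local Notation m := (size us).
Definition eset (e : nat * nat) : {set V} := [set vx e.1; vx e.2].

Lemma vxK v : vx (ix v) = v. Proof. by rewrite /vx nth_index // mem_enum. Qed.
Lemma ix_lt v : ix v < n. Proof. by rewrite cardE index_mem mem_enum. Qed.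
Lemma ixK i : i < n -> ix (vx i) = i. Proof. by move=> h; rewrite /ix index_uniq ?enum_uniq // -cardE. Qed.
Lemma size_mt : size mt = n. Proof. by rewrite size_map cardE. Qed.

Lemma cellE i j : i < n -> j < n ->
  cell mt i j = (if [set vx i; vx j] \in E then Some (c [set vx i; vx j]) else None, [set vx i; vx j] \in D).
Proof. by rewrite cardE => i_n j_n; rewrite /cell (nth_map v0) // (nth_map v0). Qed.

Lemma suppliedE i j : i < n -> j < n -> supplied mt i j = ([set vx i; vx j] \in E).
Proof. by move=> h1 h2; rewrite /supplied cellE //; case: ifP. Qed.

Lemma mem_pairs e : (e \in us) = [&& e.1 < e.2, e.2 < n & eset e \in E :|: D].
Proof.
case: e => i j; rewrite mem_filter size_mt /=; case: ltnP => //= ij; case: (ltnP j n) => jn /=; last first.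
  by apply/negbTE/negP => /andP[_ /allpairsP[[a b] /= [_ bn [_ eb]]]]; move: bn; rewrite mem_iota -eb add0n /= ltnNge jn.
have i_n := ltn_trans ij jn; rewrite suppliedE // cellE // in_setU /eset /=.
have -> : (i, j) \in [seq (i, j) | i <- iota 0 n, j <- iota 0 n]; last by rewrite andbT.
by apply/allpairsP; exists (i, j); rewrite /= !mem_iota.
Qed.

Lemma us_uniq : uniq us.
Proof. by apply: filter_uniq; apply: allpairs_uniq; rewrite ?iota_uniq // => -[a b] [a' b'] _ _ [-> ->]. Qed.

Lemma us_lt : simple_pairs n us.
Proof. by apply/allP => e; rewrite mem_pairs => /and3P[-> ->]. Qed.

Lemma pair_in k : k < m -> pair_at mt k \in us. Proof. exact: mem_nth. Qed.
Lemma pair_lt k : k < m -> (pair_at mt k).1 < (pair_at mt k).2 < n.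
Proof. by move/pair_in; rewrite mem_pairs => /and3P[-> ->]. Qed.

Lemma edge_exists x y : [set x; y] \in E :|: D ->
  exists2 k, k < m & eset (pair_at mt k) = [set x; y] /\ (pair_at mt k = (ix x, ix y) \/ pair_at mt k = (ix y, ix x)).
Proof.
move=> xyU; have xy : x != y.
  have : #|[set x; y]| = 2 by move: xyU; rewrite in_setU => /orP[/sE|/sD].
  by rewrite cards2; case: (x != y).
have nth_k e : e \in us -> exists2 k, k < m & pair_at mt k = e by move/(nthP (0, 0)) => [k km <-]; exists k.
case: (ltngtP (ix x) (ix y)) => h; last by case/eqP: xy; rewrite -(vxK x) h vxK.
- have [|k km ek] := nth_k (ix x, ix y); first by rewrite mem_pairs /eset /= h ix_lt !vxK.
  by exists k; rewrite // ek /eset /= !vxK; split; [|left].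
- have [|k km ek] := nth_k (ix y, ix x); first by rewrite mem_pairs /eset /= h ix_lt !vxK setUC.
  by exists k; rewrite // ek /eset /= !vxK setUC; split; [|right].
Qed.

Lemma eset_inj e e' : e \in us -> e' \in us -> eset e = eset e' -> e = e'.
Proof.
case: e e' => [a b] [a' b']; rewrite !mem_pairs /= => /and3P[ab bn _] /and3P[ab' bn' _].
have [an an'] := (ltn_trans ab bn, ltn_trans ab' bn').
case/set2_eq => /= -[/(congr1 ix) + /(congr1 ix)]; rewrite !ixK // => e1 e2; first by rewrite e1 e2.
by move: ab ab'; rewrite e1 e2 => h1 h2; have := ltn_trans h1 h2; rewrite ltnn.
Qed.

Lemma eset_at_inj k k' : k < m -> k' < m -> eset (pair_at mt k) = eset (pair_at mt k') -> k = k'.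
Proof.
move=> km k'm /(eset_inj (pair_in km) (pair_in k'm)) e; apply/eqP; rewrite -(nth_uniq (0, 0) km k'm us_uniq); exact/eqP.
Qed.

(** A node up to [n] is a vertex shifted by one, and a later node [x] is the edge with index
    [x - n.+1]; the relations of the drawing are transported along this renaming. *)
Lemma planar_nodes : exists lt w, van_kampen (fun x => 0 < x <= n + m) (node_adj n us) lt w.
Proof.
have [lt [w [h1 h2 h3]]] := Topo.planar_van_kampen pl.
pose h x : V + {set V} := if x <= n then inl (vx x.-1) else inr (eset (pair_at mt (x - n.+1))).
exists (fun x y => lt (h x) (h y)), (fun a b d => w (h a) (h b) (h d)).
have hi x y : 0 < x <= n + m -> 0 < y <= n + m -> x <> y -> h x <> h y.
  rewrite /h => xd yd ne; case: (leqP x n) => xn; case: (leqP y n) => yn // [].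
    move/(congr1 ix); rewrite !ixK; lia.
  have a1 : x - #|V|.+1 < m by lia.
  have a2 : y - #|V|.+1 < m by lia.
  move/(eset_at_inj a1 a2) => e'; apply: ne; lia.
have dm (x : nat) : 0 < x <= n + m -> Topo.sub_dom (E :|: D) (h x).
  move=> /andP[_ xm]; rewrite /h; case: (leqP x #|V|) => //= xn.
  have a1 : x - #|V|.+1 < m by rewrite ltn_subLR // addSn ltnS.
  by move/pair_in: a1; rewrite mem_pairs => /and3P[].
have adj_dom a b : node_adj n us a b -> [/\ 0 < a <= n + m, 0 < b <= n + m & Topo.sub_adj (E :|: D) (h a) (h b)].
  have key x y : 0 < x <= n -> y \in nb (sub_nbs n us) x -> [/\ 0 < y <= n + m, h x = inl (vx x.-1) &
      exists2 k, k < m & h y = inr (eset (pair_at mt k)) /\ vx x.-1 \in eset (pair_at mt k)].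
    move=> /andP[x0 xn]; case: x x0 xn => // x _ xn; rewrite nb_vertex // => /mapP[k]; rewrite mem_filter mem_iota => /and3P[hx _ km] ->.
    split; [move: km; lia | by rewrite /h xn |]; exists k => //; split; first by rewrite /h leqNgt leq_addr /= addKn.
    by rewrite /eset !inE; case/orP: hx => /eqP <-; rewrite eqxx ?orbT.
  by case/orP => /andP[x0 /(key _ _ x0)[y0 hx [k km [hy xe]]]]; rewrite hx hy /=; have := pair_in km; rewrite mem_pairs => /and3P[_ _ ->]; rewrite xe; split=> //; case/andP: x0 => -> h0; rewrite (leq_trans h0 (leq_addr _ _)).
split=> [x y xd yd ne|a b d|a b d e].
- exact: h1 (dm _ xd) (dm _ yd) (hi _ _ xd yd ne).
- exact: h2.
by move=> /adj_dom[ad bd s1] /adj_dom[dd ed s2] n1 n2 n3 n4; apply: h3 => //; exact: hi.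
Qed.

Lemma size_weights : size (weights mt) = size (glinks mt).
Proof. by rewrite !size_map size_iota. Qed.

Lemma weights_at k : k < m -> nth 0 (weights mt) k = if eset (pair_at mt k) \in E then (c (eset (pair_at mt k))).*2 else 0.
Proof.
move=> km; have /andP[a b] := pair_lt km; rewrite (nth_map (0, 0)) // -/(pair_at mt k) /cap cellE //; last exact: ltn_trans b.
by rewrite /= -/(eset _); case: ifP.
Qed.

Lemma isdE k : k < m -> isd mt k = (eset (pair_at mt k) \in D).
Proof. by move=> km; have /andP[a b] := pair_lt km; rewrite /isd cellE //; exact: ltn_trans b. Qed.

Lemma solver_spec :
  [/\ valid (glinks mt) (cut_links mt), forall S, ~~ viol (gfree mt) (gdem mt) (glinks mt) (cut_links mt) S,
   \sum_(g <- cut_links mt) nth 0 (weights mt) g <= (\sum_(r <- dual_sets mt) r.2).*2,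
   forall k, k < m -> \sum_(r <- dual_sets mt | cuts_edge r.1 (ends (glinks mt) k)) r.2 <= nth 0 (weights mt) k
   & forall r, r \in dual_sets mt -> 0 < r.2 /\ viol (gfree mt) (gdem mt) (glinks mt) [::] (mem_map r.1)].
Proof.
have [lt [w vk]] := planar_nodes; have ul := us_lt.
have fN : inrange (gsize mt) (gfree mt) by rewrite /gsize /gfree size_mt; exact: dfree_in vk.
have dN : inrange (gsize mt) (gdem mt) by rewrite /gsize /gdem size_mt; first [exact: ddem_in vk | exact: ddem_in ul].
have lN : inrange (gsize mt) (glinks mt) by rewrite /gsize /glinks size_mt; first [exact: dlinks_in vk | exact: dlinks_in ul].
have af S : ~~ viol (gfree mt) (gdem mt) (glinks mt) (iota 0 (size (glinks mt))) S.
  by rewrite /gfree /gdem /glinks size_mt; exact: dall_feas vk _.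
have ew i : odd (nth 0 (weights mt) i) = false.
  by case: (ltnP i m) => h; [rewrite weights_at //; case: ifP; rewrite ?odd_double | rewrite nth_default // size_map].
have du : uniq (gdem mt) by rewrite /gdem; exact: ddem_uniq.
have [vK nv b ld rc] := wgmv fN dN lN du size_weights ew isT af.
have sF (P : pred (seq bool * nat)) : \sum_(r <- dual_sets mt | P r) r.2 = \sum_(r <- duals (gsize mt) (gfree mt) (gdem mt) (glinks mt) (weights mt) | P r) r.2.
  rewrite big_filter_cond [LHS]big_mkcond [RHS]big_mkcond; apply: eq_bigr => r _.
  by case: eqP => //= ->; case: (P r).
split=> //.
- by apply: leq_trans b _; rewrite leq_double (sF predT) /total sumnE big_map.
- move=> k km; rewrite (sF (fun r => cuts_edge r.1 (ends (glinks mt) k))) big_mkcond.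
  have := ld k; rewrite size_map size_iota => /(_ km); rewrite /load sumnE big_map; exact: leq_trans.
- by move=> r; rewrite mem_filter lt0n => /andP[-> /rc[]].
Qed.

Lemma demand_spec r : r \in dual_sets mt -> exists d, [/\ dem_of mt r.1 = d, d < m, eset (pair_at mt d) \in D &
  forall Q : pred nat, Q (pair_at mt d).1 != Q (pair_at mt d).2 -> exists2 k, k \in used mt r.1 & crosses us Q k].
Proof.
move=> rin; have [lt [w vk]] := planar_nodes; have ul := us_lt.
have [_ _ _ _ /(_ r rin)[_ v]] := solver_spec; have := v; rewrite /gfree /gdem /glinks size_mt => v'.
have [d [dm dd cd u]] := viol_demand v'; exists d.
have dE : dem_of mt r.1 = d.
  rewrite /dem_of; set s := [seq k <- _ | _].
  have ds : d \in s by rewrite mem_filter mem_iota dd dm /cuts_edge size_mt cd.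
  have : head 0 s \in s by case: (s) ds => //= a s' _; rewrite mem_head.
  by rewrite {2}/s mem_filter mem_iota /cuts_edge size_mt => /and3P[/andP[a b] _ h]; exact: u.
split=> //; first by rewrite -isdE.
move=> Q qd; have /and3P[cf _ _] := v'.
have [k [km ck xk]] := link_crosses ul vk cf dm cd u qd.
by exists k => //; rewrite mem_filter mem_iota km /cuts_edge /glinks size_mt ck.
Qed.

Definition dset (r : seq bool * nat) := eset (pair_at mt (dem_of mt r.1)).
Definition flow_verts (S : seq bool) := [seq vx i | i <- flow_path mt S].

Lemma nb_flow S x y : x < n -> y \in nb (flow_nbs mt S) x ->
  y < n /\ exists2 k, k \in used mt S & eset (pair_at mt k) = [set vx x; vx y].
Proof.
move=> xn; rewrite /nb /flow_nbs size_mt (nth_map 0) ?size_iota // nth_iota // => /mapP[e].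
rewrite mem_filter => /andP[ex /mapP[k ku ek]] ->; rewrite ek in ex *; have km : k < m by move: ku; rewrite mem_filter mem_iota => /andP[].
have /andP[a b] := pair_lt km; move: ex; rewrite /eset add0n; case: eqP => [e1|_] /=.
  by move=> _; split=> //; exists k => //; rewrite /eset e1.
by move=> /eqP e2; split; [exact: ltn_trans a b | exists k => //; rewrite /eset e2 setUC].
Qed.

(** If the search from one end of the demand missed the other, the set of visited vertices would
    separate the two ends without being left by a used edge, against [demand_spec]. Parents have
    smaller discovery numbers, so the climb back is a simple path. *)
Lemma flow_path_spec r : r \in dual_sets mt -> exists x s, [/\ flow_verts r.1 = x :: s,
  path (fun a b => has (fun k => eset (pair_at mt k) == [set a; b]) (used mt r.1)) x s, uniq (x :: s),
  dset r = [set x; last x s] & all (fun i => i < n) (flow_path mt r.1)].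
Proof.
move=> rin; have [d [dE dm dD xr]] := demand_spec rin; have /andP[d12 d2n] := pair_lt dm; have d1n := ltn_trans d12 d2n.
pose nbs := flow_nbs mt r.1; have sn : size nbs = n by rewrite size_map size_iota size_mt.
have u_in : (pair_at mt d).1 < size nbs by rewrite sn.
have nbi x y : y \in nb nbs x -> y < size nbs.
  case: (ltnP x n) => xn; last by rewrite /nb nth_default // sn.
  by move/(nb_flow xn) => [yn _]; rewrite sn.
pose t := flow_tree mt r.1; have tE : t = dfs nbs (pair_at mt d).1 by rewrite /t /flow_tree dE.
pose o := order t; pose p := parents t.
have [[uo ho sp] st] : dfs_ok nbs (pair_at mt d).1 o p by rewrite /o /p tE; exact: dfs_ok_dfs.
have o_lt x : x \in o -> x < n by rewrite /o tE => /(dfs_in u_in nbi); rewrite sn.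
have vo : (pair_at mt d).2 \in o.
  apply/negPn/negP => nv; have uo' : (pair_at mt d).1 \in o by rewrite /o tE; exact: dfs_root.
  have [|k ku] := xr (mem o); first by rewrite /= uo' (negbTE nv).
  have km : k < m by move: ku; rewrite mem_filter mem_iota => /andP[].
  have /andP[a b] := pair_lt km; have kn := ltn_trans a b.
  have cl x y : x \in o -> y \in nb nbs x -> y \in o by rewrite /o tE; exact: dfs_closed.
  have n1 : (pair_at mt k).2 \in nb nbs (pair_at mt k).1.
    rewrite /nb /nbs /flow_nbs size_mt (nth_map 0) ?size_iota // nth_iota //; apply/mapP; exists (pair_at mt k); last by rewrite eqxx.
    by rewrite mem_filter eqxx map_f.
  have n2 : (pair_at mt k).1 \in nb nbs (pair_at mt k).2.
    rewrite /nb /nbs /flow_nbs size_mt (nth_map 0) ?size_iota // nth_iota //; apply/mapP; exists (pair_at mt k).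
      by rewrite mem_filter eqxx orbT map_f.
    by rewrite add0n ltn_eqF.
  rewrite /crosses -/(pair_at mt k); case o1 : (mem o (pair_at mt k).1); case o2 : (mem o (pair_at mt k).2) => // _.
    by move: (cl _ _ o1 n1) => h; rewrite /= h in o2.
  by move: (cl _ _ o2 n2) => h; rewrite /= h in o1.
pose i := index (pair_at mt d).2 o; have io : i < size o by rewrite index_mem.
have [|s [e1 e2 e3 e4]] := @climb_path (fun k => nth 0 p k) i.+1 i (ltnSn i).
  by move=> k /andP[k0 ki]; have [|] := st k; rewrite ?k0 ?(leq_ltn_trans ki io).
have sub : {in i :: s, forall j, j <= i}.
  by move=> j; rewrite inE => /orP[/eqP -> //|js]; have := order_path_min (fun a b c h1 h2 => ltn_trans h2 h1) e4 => /allP/(_ j js)/ltnW.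
have us_ : uniq (i :: s) by apply: (@sorted_uniq _ gtn) => //; [move=> a b e h1 h2; exact: ltn_trans h1 | move=> a; exact: ltnn].
exists (vx (nth 0 o i)), [seq vx (nth 0 o j) | j <- s]; split.
- by rewrite /flow_verts /flow_path /flow_start dE -/t -/o -/p -/i e1 /= -map_comp.
- rewrite (@path_mapE _ _ (fun j => vx (nth 0 o j)) _ i s); apply: path_in e2 => a b ai bi /andP[a0 /eqP ->]; have ao : 0 < a < size o by rewrite a0 (leq_ltn_trans (sub a ai) io).
  have [pa hb _] := st a ao; have pn : nth 0 o (nth 0 p a) < n by apply: o_lt; rewrite mem_nth // (ltn_trans pa) //; case/andP: ao.
  have [_ [k ku ek]] := nb_flow pn hb; apply/hasP; exists k => //; by rewrite ek setUC.
- rewrite -[_ :: _]/(map (fun j => vx (nth 0 o j)) (i :: s)) map_inj_in_uniq // => a b ai bi /(congr1 ix).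
  have [ao bo] := (leq_ltn_trans (sub a ai) io, leq_ltn_trans (sub b bi) io).
  by rewrite !ixK ?o_lt ?mem_nth // => /eqP; rewrite nth_uniq // => /eqP.
- have e5 : nth 0 o i = (pair_at mt d).2 by exact: nth_index.
  have e6 : nth 0 o 0 = (pair_at mt d).1 by rewrite nth0.
  by rewrite (@last_mapE _ _ (fun j => vx (nth 0 o j)) i s) e3 /= e5 e6 /dset dE /eset setUC.
- rewrite /flow_path /flow_start dE -/t -/o -/p -/i e1; apply/allP => _ /mapP[j js ->].
  by apply: o_lt; rewrite mem_nth // (leq_ltn_trans (sub j js)).
Qed.

Lemma joinsE e i j : e.1 < n -> e.2 < n -> i < n -> j < n -> (eset e == [set vx i; vx j]) = joins e i j.
Proof.
case: e => a b /= an bn i_n j_n; rewrite /eset /joins /=; apply/eqP/orP => [/set2_eq[]|[]].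
- by move=> [/(congr1 ix) + /(congr1 ix)]; rewrite !ixK // => -> ->; left; rewrite !eqxx.
- by move=> [/(congr1 ix) + /(congr1 ix)]; rewrite !ixK // => -> ->; right; rewrite !eqxx.
- by move=> /andP[/eqP -> /eqP ->].
- by move=> /andP[/eqP -> /eqP ->]; rewrite setUC.
Qed.

Definition half (x : nat) : rat := (x%:R / 2%:R)%R.
Definition flow : multiflow V := fun d => [seq (flow_verts r.1, half r.2) | r <- dual_sets mt & d == dset r].
Definition multicut : {set {set V}} := [set e in E | has (fun k => eset (pair_at mt k) == e) (cut_links mt)].

Lemma dset_in r : r \in dual_sets mt -> dset r \in D.
Proof. by move=> rin; have [d [dE _ dD _]] := demand_spec rin; rewrite /dset dE. Qed.

Lemma sum_by (T : eqType) (s : seq T) (f : T -> {set V}) (P : pred T) (q : T -> rat) : {in s, forall r, f r \in D} ->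
  (\sum_(d in D) \sum_(r <- s | (d == f r) && P r) q r = \sum_(r <- s | P r) q r)%R.
Proof.
move=> fD; rewrite (exchange_big_dep P) /=; last by move=> d r _ /andP[].
rewrite big_seq_cond [RHS]big_seq_cond; apply: eq_bigr => r /andP[rs Pr].
by rewrite (big_pred1 (f r)) // => d /=; rewrite Pr andbT; case: eqP => [->|]; rewrite ?andbF ?fD.
Qed.

Lemma flow_valueE : flow_value D flow = half (\sum_(r <- dual_sets mt) r.2).
Proof.
rewrite /flow_value; have -> : half (\sum_(r <- dual_sets mt) r.2) = (\sum_(r <- dual_sets mt | predT r) half r.2)%R.
  by rewrite /half GRing.natr_sum GRing.mulr_suml.
rewrite -(sum_by predT (fun r => half r.2) dset_in); apply: eq_bigr => d _.
by rewrite /flow big_map big_filter; apply: eq_bigl => r; rewrite andbT.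
Qed.

Lemma used_through r e k : r \in dual_sets mt -> k < m -> e = eset (pair_at mt k) -> e \in path_edges (flow_verts r.1) ->
  cuts_edge r.1 (ends (glinks mt) k).
Proof.
move=> rin km ->; have [x [s [-> ps _ _ _]]] := flow_path_spec rin.
move/(path_edges_sub (P := fun e => has (fun k => eset (pair_at mt k) == e) (used mt r.1)) ps) => /hasP[k'].
by rewrite mem_filter mem_iota => /and3P[ck _ k'm] /eqP /(eset_at_inj k'm km) <-.
Qed.

(** A path through [e] comes from a set that cuts the link of [e]. The load of this link is at most
    twice the capacity, and path values are halved duals. *)
Lemma flow_throughE e : e \in E -> (flow_through D flow e <= (c e)%:R)%R.
Proof.
move=> eE; have [x [y [xy ee]]] : exists x y, x != y /\ e = [set x; y].
  have : #|e| == 2 by apply/eqP; exact: sE.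
  first [by case/cards2P => x [y h]; exists x, y; case: h | by case/cards2P => x [y h1 h2]; exists x, y].
have [|k km [ek _]] := @edge_exists x y; first by rewrite -ee inE eE.
rewrite -ee in ek; have [_ _ _ ld _] := solver_spec.
rewrite /flow_through (eq_bigr (fun d => \sum_(r <- dual_sets mt | (d == dset r) && (e \in path_edges (flow_verts r.1))) half r.2)%R); last first.
  by move=> d _; rewrite /flow big_map big_filter_cond.
rewrite (sum_by (fun r => e \in path_edges (flow_verts r.1)) (fun r => half r.2) dset_in).
have -> : (\sum_(r <- dual_sets mt | e \in path_edges (flow_verts r.1)) half r.2)%R = half (\sum_(r <- dual_sets mt | e \in path_edges (flow_verts r.1)) r.2).
  by rewrite /half GRing.natr_sum GRing.mulr_suml.
rewrite /half Num.Theory.ler_pdivrMr ?Num.Theory.ltr0n // -GRing.natrM Num.Theory.ler_nat muln2.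
have := ld k km; rewrite weights_at // ek eE; apply: leq_trans.
by apply: leq_sum_sub => r rin h; exact: used_through rin km (esym ek) h.
Qed.

(** Counting traversals mod 2 covers arbitrary walks, whose repeated edges cancel. *)
Definition step_parity x p k := \big[addb/false]_(u <- zip (x :: p) p) (eset (pair_at mt k) == [set u.1; u.2]).

Lemma step_parity_crosses x p : path (adj (E :|: D)) x p -> forall Q : pred nat,
  \big[addb/false]_(k <- iota 0 m | step_parity x p k) crosses us Q k = Q (ix x) (+) Q (ix (last x p)).
Proof.
move=> + Q; elim: p x => [|y p IH] x /=.
  by move=> _; rewrite addbb big1 // => k; rewrite /step_parity big_nil.
move=> /andP[xy pp]; have [k km [ek ek']] := edge_exists xy.
transitivity (\big[addb/false]_(i <- iota 0 m) (((i == k) && crosses us Q i) (+) (step_parity y p i && crosses us Q i))).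
  rewrite big_mkcond big_seq [RHS]big_seq; apply: eq_bigr => i; rewrite mem_iota => im.
  rewrite /step_parity big_cons /= -ek -/(step_parity y p i).
  have -> : (eset (pair_at mt i) == eset (pair_at mt k)) = (i == k) by apply/eqP/eqP => [/eset_at_inj h|->//]; exact: h.
  by case: (i == k); case: (step_parity y p i); case: (crosses us Q i).
rewrite big_split /=.
have kI : k \in iota 0 m by rewrite mem_iota.
rewrite (bigD1_seq k kI (iota_uniq _ _)) /= eqxx big1 ?addbF; last by move=> i /negbTE ->.
have -> : \big[addb/false]_(i <- iota 0 m) (step_parity y p i && crosses us Q i) = Q (ix y) (+) Q (ix (last y p)).
  by rewrite -(IH y pp) [RHS]big_mkcond; apply: eq_bigr => i _; case: (step_parity y p i).
rewrite andTb /crosses -/(pair_at mt k); case: ek' => -> /=; by case: (Q (ix x)); case: (Q (ix y)); case: (Q _).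
Qed.

(** By [cut_separates], a walk joining the ends of a demand traverses some kept link an odd number
    of times. Every step of the assumed walk lies in [E], so this edge belongs to the multicut that
    the walk avoids. *)
Lemma multicut_separates s t : [set s; t] \in D -> ~~ connect (adj (E :\: multicut)) s t.
Proof.
move=> stD; apply/negP => /connectP[p pp pt]; have [lt [w vk]] := planar_nodes; have ul := us_lt.
have [vK nv _ _ _] := solver_spec.
have [|d dm [ed ed']] := @edge_exists s t; first by rewrite inE stD orbT.
have dd : isd mt d by rewrite isdE // ed.
have pU : path (adj (E :|: D)) s p by apply: sub_path pp => a b; rewrite /adj !inE => /andP[_ ->].
have vK' : valid (dlinks n us) (cut_links mt) by move: vK; rewrite /glinks size_mt.
have nv' S : ~~ viol (dfree n us (isd mt)) (ddem n us (isd mt)) (dlinks n us) (cut_links mt) S.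
  by have := nv S; rewrite /gfree /gdem /glinks size_mt.
have [|k kK Pk] := cut_separates ul vk vK' nv' dm dd (P := step_parity s p).
  move=> Q; rewrite (step_parity_crosses pU) -pt /crosses -/(pair_at mt d); case: ed' => -> //=; by rewrite addbC.
have [u uin /eqP ek] : exists2 u, u \in zip (s :: p) p & eset (pair_at mt k) == [set u.1; u.2].
  apply/hasP; apply: contraTT Pk => /hasPn h; rewrite /step_parity big1_seq // => u /andP[_ /h]; exact: negbTE.
have : [set u.1; u.2] \in E :\: multicut.
  elim: (p) (s) pp uin => [|b q IH] a //=; rewrite inE => /andP[ab pq] /orP[/eqP -> //|]; exact: IH.
rewrite in_setD => /andP[/negP nm eE]; case: nm; rewrite /multicut in_set eE -ek /=; apply/hasP; by exists k.
Qed.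

(** Kept links of edges outside [E] have weight 0 and are left out of the multicut; the others weigh
    twice their capacity, hence the comparison after doubling. *)
Lemma cut_valueE : cut_value c multicut <= \sum_(r <- dual_sets mt) r.2.
Proof.
have [vK _ b _ _] := solver_spec; rewrite -leq_double; apply: leq_trans b.
rewrite /cut_value -muln2 big_distrl /=.
apply: (@leq_trans (\sum_(e in multicut) \sum_(k <- cut_links mt | eset (pair_at mt k) == e) c e * 2)).
  apply: leq_sum => e; rewrite inE => /andP[_ /hasP[k kK ke]].
  by rewrite (big_rem k kK) /= ke leq_addr.
rewrite (exchange_big_dep predT) //= big_seq [X in _ <= X]big_seq; apply: leq_sum => k kK.
have km : k < m by have := allP vK k kK; rewrite size_map size_iota.
rewrite weights_at //; case: ifP => eE.
  case mM : (eset (pair_at mt k) \in multicut).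
    by rewrite (big_pred1 (eset (pair_at mt k))) ?muln2 // => e /=; rewrite [RHS]eq_sym; case: eqP => [<-|]; rewrite ?mM ?andbF.
  by rewrite big1 // => e /andP[+ /eqP ee]; rewrite -ee mM.
by rewrite big1 // => e /andP[+ /eqP ee]; rewrite -ee inE eE.
Qed.

Lemma flow_cut : flow_cut_pair E D c flow multicut.
Proof.
have pos r : (0 <= half r.2)%R by rewrite /half Num.Theory.divr_ge0 // Num.Theory.ler0n.
split; first split.
- move=> d dD pq /mapP[r]; rewrite mem_filter => /andP[/eqP dr rin] ->; split; last by rewrite /=; exact: pos.
  have [x [s [e ps u de _]]] := flow_path_spec rin; change (path_for E d (flow_verts r.1)); rewrite e /path_for u dr de eqxx !andbT.
  apply: sub_path ps => a b /hasP[k]; rewrite mem_filter mem_iota => /and3P[ck _ km] /eqP ek.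
  (* Were the edge not in [E], its weight would be 0, and a set of positive dual value could not cut
     its link. *)
  have [_ _ _ /(_ k km) ld /(_ r rin)[rp _]] := solver_spec; rewrite /adj -ek; case eE : (_ \in E) => //.
  move: ld; rewrite weights_at // eE leqn0 (big_rem r rin) /= ck addn_eq0 => /andP[/eqP r0 _]; by rewrite r0 in rp.
- exact: flow_throughE.
- move=> d dD pq /mapP[r _ ->]; exists (Posz r.2); by [].
- by split; [apply/fintype.subsetP => e; rewrite inE => /andP[] | exact: multicut_separates].
rewrite flow_valueE /half GRing.mulrC GRing.divfK ?Num.Theory.pnatr_eq0 // Num.Theory.ler_nat; exact: cut_valueE.
Qed.
End Correct.
End Correct.

(* Matching the encodings, and the theorem *)
Require Import Defs.
From mathcomp Require Import all_boot all_order all_algebra.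
From mathcomp Require Import all_classical all_reals all_analysis.
From mathcomp Require Import zify.
Import Pt Pt2 Pt3 Wgmv Wstep Dfs Solve PtSolve Correct.
Local Open Scope nat_scope.

Lemma flow_cut_empty (V : finType) (E D : {set {set V}}) (c : {set V} -> nat) : simple_graph D -> (V -> False) ->
  flow_cut_pair E D c (fun=> [::]) finset.set0.
Proof.
move=> sD no; split; first split.
- by move=> d _ pq; rewrite in_nil.
- move=> e _; rewrite /flow_through big1 ?Num.Theory.ler0n // => d _; by rewrite big_nil.
- by move=> d _ pq; rewrite in_nil.
- by split; [exact: finset.sub0set | move=> s; case: (no s)].
rewrite /cut_value /flow_value big_set0 big1 ?GRing.mulr0 // => d _; by rewrite big_nil.
Qed.

Lemma enc_rat_half x : enc_rat (half x) = @enc ((bool * bin) * (bool * bin)) _ (half_rat x).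
Proof.
have cE (a b : nat) : 0 < b -> coprime a b -> enc_rat (a%:R / b%:R)%R = @enc ((bool * bin) * (bool * bin)) _ ((false, a), (false, b)).
  move=> b0 ab; have e : ((a%:R / b%:R)%R : rat) = (a%:~R / b%:~R)%R by [].
  have cab : coprime `|Posz a| `|Posz b| by [].
  rewrite /enc_rat e (coprimeq_num cab) (coprimeq_den cab).
  have -> : (Num.sg (Posz b) * Posz a = Posz a :> int)%R by case: (b) b0 => // b' _; rewrite Num.Theory.gtr0_sg // GRing.mul1r.
  have -> : ((if Posz b == 0 then 1 else `|Posz b|) = Posz b :> int)%R by case: (b) b0.
  by [].
rewrite /half_rat /half; case ox : (odd x); first by apply: cE; rewrite // coprimen2.
rewrite -(cE x./2 1) ?coprimen1 // GRing.divr1; congr enc_rat.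
have xE : x = x./2 * 2 by have := odd_double_half x; rewrite ox; lia.
by rewrite {1}xE GRing.natrM GRing.mulfK.
Qed.

Lemma enc_seq_map (A B : Type) (e : B -> Defs.tree) (f : A -> B) s : enc_seq e [seq f a | a <- s] = enc_seq (e \o f) s.
Proof. by elim: s => //= a s <-. Qed.

Lemma eq_in_enc_seq (A : eqType) (e e' : A -> Defs.tree) s : {in s, e =1 e'} -> enc_seq e s = enc_seq e' s.
Proof.
elim: s => //= a s IH h; rewrite h ?mem_head // IH // => b bs; by apply: h; rewrite inE bs orbT.
Qed.

Lemma enc_square T (eT : Enc T) k (entry : 'I_k -> 'I_k -> Defs.tree) (f : nat -> nat -> T) :
  (forall i j : 'I_k, entry i j = enc (f i j)) ->
  enc_matrix entry = enc (mkseq (fun i => mkseq (fun j => f i j) k) k).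
Proof.
move=> h; have E U (g : nat -> U) (eU : U -> Defs.tree) : enc_seq eU (mkseq g k) = enc_seq (fun i : 'I_k => eU (g i)) (enum 'I_k).
  by rewrite /mkseq -(val_enum_ord k) -map_comp enc_seq_map.
transitivity (enc_seq (@enc (seq T) _) (mkseq (fun i => mkseq (fun j => f i j) k) k)); last by [].
rewrite E; apply: eq_in_enc_seq => i _; transitivity (enc_seq (@enc T _) (mkseq (fun j => f i j) k)); last by [].
by rewrite E; apply: eq_in_enc_seq => j _; exact: h.
Qed.

Lemma enc_instanceE I : enc_instance I = @enc cells _ (matrix_of (supply I) (demand I) (capacity I)).
Proof.
transitivity (enc_seq (@enc (seq (option bin * bool)) _) (matrix_of (supply I) (demand I) (capacity I))); last by [].
rewrite /matrix_of enc_seq_map; apply: eq_in_enc_seq => i _.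
transitivity (enc_seq (@enc (option bin * bool)%type _) [seq (if [set i; y] \in supply I then Some (capacity I [set i; y]) else None,
  [set i; y] \in demand I) | y <- enum 'I_(num_vertices I)]); last by [].
by rewrite [RHS]enc_seq_map; apply: eq_in_enc_seq => j _; rewrite /=; case: ifP.
Qed.

Section Instance.
Variables (R : realType) (I : instance).
Hypothesis pl : planar R (supply I :|: demand I).
Variable v0 : 'I_(num_vertices I).
Local Notation k := (num_vertices I).
Local Notation mt := (matrix_of (supply I) (demand I) (capacity I)).

Lemma vx_ord (i : 'I_k) : vx v0 i = i.
Proof. by apply: val_inj; rewrite /vx /= nth_enum_ord. Qed.

(** The mathematical flow selects the dual sets by their demand as a set of two vertices, the
    program by [joins] on indices; both filters pick the same sublist for every pair. *)
Lemma enc_solutionE : @enc_solution I (flow (supply I) (demand I) (capacity I) v0, multicut (supply I) (demand I) (capacity I) v0) =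
  @enc answer _ (solution mt).
Proof.
have sm : size mt = k by rewrite size_mt card_ord.
have hk (i : 'I_k) : i < #|'I_k| by rewrite card_ord.
have plt g : g < size (pairs mt) -> (pair_at mt g).1 < (pair_at mt g).2 < #|'I_k| by apply: pair_lt.
have jE e (i j : 'I_k) : e.1 < #|'I_k| -> e.2 < #|'I_k| -> (eset v0 e == [set i; j]) = joins e i j.
  by move=> e1 e2; rewrite -{1}(vx_ord i) -{1}(vx_ord j); apply: joinsE.
have su (i j : 'I_k) : supplied mt i j = ([set i; j] \in supply I).
  by rewrite -{2}(vx_ord i) -{2}(vx_ord j); apply: suppliedE.
have fl (i j : 'I_k) : enc_seq (fun pq : seq 'I_k * rat => Node (enc_seq (fun v : 'I_k => enc_nat v) pq.1) (enc_rat pq.2))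
    (flow (supply I) (demand I) (capacity I) v0 [set i; j]) =
    @enc (seq (seq bin * ((bool * bin) * (bool * bin)))) _ (flow_at mt i j).
  transitivity (enc_seq (@enc (seq bin * ((bool * bin) * (bool * bin)))%type _)
    [seq (flow_path mt r.1, half_rat r.2) | r <- dual_sets mt & joins (pair_at mt (dem_of mt r.1)) i j]); last by [].
  rewrite /flow !enc_seq_map.
  have -> : [seq r <- dual_sets mt | [set i; j] == dset (supply I) (demand I) (capacity I) v0 r] =
            [seq r <- dual_sets mt | joins (pair_at mt (dem_of mt r.1)) i j].
    apply: eq_in_filter => r rin; have [d [dE dm _ _]] := @demand_spec R _ (supply I) (demand I) (capacity I) v0 pl r rin.
    have /andP[a b] := plt d dm; rewrite /dset dE.
    by rewrite -(jE _ i j (ltn_trans a b) b) eq_sym.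
  apply: eq_in_enc_seq => r; rewrite mem_filter => /andP[_ rin].
  have [x [s [_ _ _ _ al]]] := @flow_path_spec R _ (supply I) (demand I) (capacity I) v0 pl r rin.
  change (Node (enc_seq (fun v : 'I_k => enc_nat v) (flow_verts (supply I) (demand I) (capacity I) v0 r.1)) (enc_rat (half r.2)) =
    Node (enc_seq enc_nat (flow_path mt r.1)) (@enc ((bool * bin) * (bool * bin)) _ (half_rat r.2))).
  rewrite enc_rat_half; congr Node; rewrite /flow_verts enc_seq_map; apply: eq_in_enc_seq => i' i'in.
  change (enc_nat (vx v0 i') = enc_nat i'); congr enc_nat; apply: nth_enum_ord.
  by have := allP al i' i'in; rewrite card_ord.
have cu (i j : 'I_k) : enc_bool ([set i; j] \in multicut (supply I) (demand I) (capacity I) v0) = @enc bool _ (cut_at mt i j).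
  change (enc_bool ([set i; j] \in multicut (supply I) (demand I) (capacity I) v0) = enc_bool (cut_at mt i j)); congr enc_bool.
  rewrite /multicut finset.in_set /cut_at su; congr (_ && _).
  have [vK _ _ _ _] := @solver_spec R _ (supply I) (demand I) (capacity I) v0 pl.
  apply: eq_in_has => g gK; have gm : g < size (pairs mt) by have := allP vK g gK; rewrite size_map size_iota.
  have /andP[a b] := plt g gm.
  by rewrite -(jE _ i j (ltn_trans a b) b).
transitivity (Node (@enc (seq (seq (seq (seq bin * ((bool * bin) * (bool * bin)))))) _ (mkseq (fun i => mkseq (fun j => flow_at mt i j) k) k))
  (@enc (seq (seq bool)) _ (mkseq (fun i => mkseq (fun j => cut_at mt i j) k) k))); last by rewrite /solution sm.
rewrite /enc_solution; congr Node; [exact: (@enc_square _ _ k _ (flow_at mt) fl) | exact: (@enc_square _ _ k _ (cut_at mt) cu)].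
Qed.
End Instance.

Theorem theorem2 (R : realType) :
  (forall (V : finType) (E D : {set {set V}}) (c : {set V} -> nat),
      simple_graph E -> simple_graph D -> planar R (E :|: D) ->
      exists (F : multiflow V) (M : {set {set V}}), flow_cut_pair E D c F M)
  /\
  poly_time_search enc_instance enc_solution
    (fun I => [/\ simple_graph (supply I), simple_graph (demand I)
                & planar R (supply I :|: demand I)])
    (fun I y => flow_cut_pair (supply I) (demand I) (capacity I) y.1 y.2).
Proof.
split=> [V E D c sE sD pl|].
  case: (pickP (fun _ : V => true)) => [v0 _|no].
    by exists (flow E D c v0), (multicut E D c v0); exact: (flow_cut c v0 sE sD pl).
  by exists (fun=> [::]), finset.set0; apply: flow_cut_empty => // v; have := no v.
have [P [a [k H]]] := pt_solution; exists (P 0), (a * 2 ^ k), k => I [sE sD pl].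
have [s [t [e E _ le]]] := H 0 (init (enc_instance I)) (matrix_of (supply I) (demand I) (capacity I)) (enc_instanceE I).
(* The bound of [PT] is in the successor of the size; sizes are positive, so [2 ^ k] absorbs the
   difference. *)
have bt : t <= a * 2 ^ k * tree_size (enc_instance I) ^ k.
  apply: leq_trans le _; rewrite -mulnA -expnMn leq_mul2l; apply/orP; right.
  have -> : @tsize cells _ (matrix_of (supply I) (demand I) (capacity I)) = tree_size (enc_instance I) by rewrite enc_instanceE.
  case: (k) => // k'; rewrite leq_exp2r //; have := tree_size_gt0 (enc_instance I); lia.
case: (pickP (fun _ : 'I_(num_vertices I) => true)) => [v0 _|no].
  exists (flow (supply I) (demand I) (capacity I) v0, multicut (supply I) (demand I) (capacity I) v0), s, t.
  split=> //; last exact: (flow_cut (capacity I) v0 sE sD pl).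
  by rewrite E (enc_solutionE pl v0).
(* Without vertices there is no default [v0]; the program still halts, with two empty matrices,
   which encode the empty flow and the empty cut. *)
have k0 : num_vertices I = 0 by case: (posnP (num_vertices I)) => // kp; have := no (Ordinal kp).
exists ((fun=> [::]), finset.set0), s, t; split=> //; last by apply: flow_cut_empty => // v; have := no v.
have sm : size (matrix_of (supply I) (demand I) (capacity I)) = 0 by rewrite size_map size_enum_ord.
have en : enum 'I_(num_vertices I) = [::] by apply/size0nil; rewrite size_enum_ord.
by rewrite E /solution sm /enc_solution /enc_multiflow /enc_edge_set /enc_matrix en.
Qed.
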